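(* For $\mu>0$ let $\varphi_\mu:=f_1+\mu f_2$ and $\gamma(\mu):=\operatorname{arg\,min}_{x\in\mathcal{M}}\varphi_\mu(x)$. Assume that: $\mathcal{M}$ is a smooth and compact Riemannian manifold; $f_1,f_2:\mathcal{M}\to\mathbb{R}$ are twice continuously differentiable; for every $\mu>0$, $\gamma(\mu)$ is a singleton; for every $\mu>0$, the Riemannian Hessian $\operatorname{Hess}\varphi_\mu(\gamma(\mu))$ is invertible on $T_{\gamma(\mu)}\mathcal{M}$; and $f_1,f_2$ are Lipschitz continuous with Lipschitz constants $L_{f_1},L_{f_2}>0$ (with respect to the Riemannian distance). Let $0<\mu_{\min}<\mu_{\max}$. Then there exist $\delta>0$, $\eta_0>0$ and a constant $C>0$ such that the following holds for every partition $\mu_{\min}=\mu_0<\mu_1<\cdots<\mu_N=\mu_{\max}$ with $\Delta_{\max}:=\max_{0\le i\le N-1}(\mu_{i+1}-\mu_i)\le\delta$ and every $\eta\in[0,\eta_0]$ (so $C$ is independent of the partition, of $\Delta_{\max}$ and of $\eta$). For each $i\in\{0,\dots,N-1\}$ let $I_i:=[\mu_i,\mu_{i+1}]$, $q_i:=\gamma(\mu_{i+1})$ and $\Gamma_i(\mu):=\operatorname{Log}_{q_i}(\gamma(\mu))$, $\mu\in I_i$. Let $\widehat v_i^L,\widehat v_i^R\in T_{q_i}\mathcal{M}$ satisfy $$\|\widehat v_i^L-\dot\Gamma_i(\mu_i)\|_{q_i}\le\eta,\qquad \|\widehat v_i^R-\dot\Gamma_i(\mu_{i+1})\|_{q_i}\le\eta,$$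 let $\tilde\Gamma_i:I_i\to T_{q_i}\mathcal{M}$ be the cubic Hermite interpolant with endpoint values $\Gamma_i(\mu_i)$, $\Gamma_i(\mu_{i+1})=0$ and endpoint derivatives $\widehat v_i^L$, $\widehat v_i^R$, let $\tilde\gamma_i(\mu):=\operatorname{Exp}_{q_i}(\tilde\Gamma_i(\mu))$, and let $\tilde\gamma:[\mu_{\min},\mu_{\max}]\to\mathcal{M}$ be the concatenation of the $\tilde\gamma_i$. Define $$\omega(t):=\max_{0\le i\le N-1}\ \sup_{\substack{\mu,\nu\in I_i\\ |\mu-\nu|\le t}}\|\dot\Gamma_i(\mu)-\dot\Gamma_i(\nu)\|_{q_i}.$$ Then $$\sup_{\mu\in[\mu_{\min},\mu_{\max}]}\bigl\|(f_1(\gamma(\mu)),f_2(\gamma(\mu)))-(f_1(\tilde\gamma(\mu)),f_2(\tilde\gamma(\mu)))\bigr\|\le\sqrt{L_{f_1}^2+L_{f_2}^2}\;C\bigl(\Delta_{\max}\,\omega(\Delta_{\max})+\eta\,\Delta_{\max}\bigr).$$ In particular, as $\Delta_{\max}\to0$, the approximate front $(f_1(\tilde\gamma(\mu)),f_2(\tilde\gamma(\mu)))$ converges to the front $(f_1(\gamma(\mu)),f_2(\gamma(\mu)))$, in the sense that $$\lim_{\Delta_{\max}\to0}\ \sup_{\mu\in[\mu_{\min},\mu_{\max}]}\bigl\|(f_1(\gamma(\mu)),f_2(\gamma(\mu)))-(f_1(\tilde\gamma(\mu)),f_2(\tilde\gamma(\mu)))\bigr\|=0.$$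
   Context: When the set of global minimizers $\gamma(\mu)$ is a singleton, it is identified with its unique element. $\|\cdot\|$ on $\mathbb{R}^2$ is the Euclidean norm, $\|\cdot\|_q$ the norm on $T_q\mathcal{M}$ induced by the metric, and $\operatorname{Hess}$ the Riemannian Hessian, a linear operator on the tangent space. $\operatorname{Exp}_q:T_q\mathcal{M}\to\mathcal{M}$ is the Riemannian exponential map; $\mathcal{I}_q$ denotes the interior set of $q$ (the complement of the cut locus of $q$) and $\mathcal{I}_q^T\subset T_q\mathcal{M}$ the corresponding tangent interior set (the open star-shaped domain bounded by the tangent cut locus), which $\operatorname{Exp}_q$ maps diffeomorphically onto $\mathcal{I}_q$. For $y\in\mathcal{I}_q$, $\operatorname{Log}_q(y)$ is the unique $\xi\in\mathcal{I}_q^T$ with $\operatorname{Exp}_q(\xi)=y$. Under the stated hypotheses $\gamma$ is $C^1$ and, for all sufficiently fine partitions (which is part of the meaning of $\Delta_{\max}\le\delta$), $\gamma(I_i)\subset\mathcal{I}_{q_i}$ and $\Gamma_i\in C^1(I_i,T_{q_i}\mathcal{M})$ for every $i$, so all the objects are well defined. The cubic Hermite interpolant on $[a,b]$ with $h=b-a$, endpoint values $y_a,y_b$ and endpoint derivatives $v_a,v_b$ in a vector space is $\mu\mapsto h_{00}(\theta)y_a+h\,h_{10}(\theta)v_a+h_{01}(\theta)y_b+h\,h_{11}(\theta)v_b$ with $\theta=(\mu-a)/h$, $h_{00}(\theta)=2\theta^3-3\theta^2+1$, $h_{10}(\theta)=\theta^3-2\theta^2+\theta$, $h_{01}(\theta)=-2\theta^3+3\theta^2$,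 $h_{11}(\theta)=\theta^3-\theta^2$. At each node $\mu_i$ the adjacent pieces $\tilde\gamma_{i-1},\tilde\gamma_i$ both take the value $\gamma(\mu_i)$, so the concatenation $\tilde\gamma$ (equal to $\tilde\gamma_i$ on $I_i$) is well defined. The limit $\Delta_{\max}\to0$ is meant as follows: for every $\varepsilon>0$ there is $\delta'>0$ such that the supremum is at most $\varepsilon$ for every partition $\mu_{\min}=\mu_0<\mu_1<\cdots<\mu_N=\mu_{\max}$ with $\Delta_{\max}\le\delta'$, every $\eta\in[0,\eta_0]$ and every choice of endpoint tangent data $\widehat v_i^L,\widehat v_i^R\in T_{q_i}\mathcal{M}$, $i\in\{0,\dots,N-1\}$, satisfying $\|\widehat v_i^L-\dot\Gamma_i(\mu_i)\|_{q_i}\le\eta$ and $\|\widehat v_i^R-\dot\Gamma_i(\mu_{i+1})\|_{q_i}\le\eta$. *)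

(* Defs.v *)
From HB Require Import structures.
From mathcomp Require Import all_boot all_order all_algebra.
From mathcomp Require Import all_classical all_reals all_analysis.
Set Implicit Arguments.
Unset Strict Implicit.
Unset Printing Implicit Defensive.
Import Order.TTheory GRing.Theory Num.Theory.
Import numFieldNormedType.Exports.
Local Open Scope classical_set_scope.
Local Open Scope ring_scope.

(* C^k regularity on an open set U: the iterated directional derivatives exist
   up to order k at every point of U, those of order k being continuous. *)
Fixpoint Ck (R : realType) (n : nat) (W : normedModType R) (k : nat)
    (U : set 'rV[R]_n) (f : 'rV[R]_n -> W) : Prop :=
  if k is k'.+1 then
    (forall x v, U x -> derivable f x v) /\
    (forall v, Ck k' U (fun x => 'D_v f x))
  else forall x, U x -> {for x, continuous f}.

Definition smooth (R : realType) (n : nat) (W : normedModType R)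
    (U : set 'rV[R]_n) (f : 'rV[R]_n -> W) : Prop := forall k, Ck k U f.

(* The bilinear form with Gram matrix G, on row vectors. *)
Definition gram (R : realType) (n : nat) (G : 'M[R]_n) (u v : 'rV[R]_n) : R :=
  (u *m G *m v^T) ord0 ord0.

(* A smooth Riemannian manifold of dimension n, without boundary and not
   assumed connected, given by a smooth atlas.  A chart is a pair of total
   maps, meaningful on the domain dom i and on its image only.  The tangent
   space at x is 'rV[R]_n: a tangent vector is represented by its coordinates
   in the chart chart_at x selected around x.  The metric is given by its Gram
   matrices in the charts. *)
Record riemannianManifold (R : realType) (n : nat) := RiemannianManifold {
  carrier :> topologicalType ;
  carrier_hausdorff : hausdorff_space carrier ;
  carrier_second_countable : @second_countable carrier ;
  atlas : Type ;
  dom : atlas -> set carrier ;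
  chart : atlas -> carrier -> 'rV[R]_n ;
  unchart : atlas -> 'rV[R]_n -> carrier ;
  chart_at : carrier -> atlas ;
  mem_chart_at : forall x, dom (chart_at x) x ;
  dom_open : forall i, open (dom i) ;
  image_open : forall i, open (chart i @` dom i) ;
  chartK : forall i x, dom i x -> unchart i (chart i x) = x ;
  chart_continuous : forall i x, dom i x -> {for x, continuous (chart i)} ;
  unchart_continuous : forall i p, (chart i @` dom i) p ->
    {for p, continuous (unchart i)} ;
  transition_smooth : forall i j,
    smooth (chart i @` (dom i `&` dom j)) (chart j \o unchart i) ;
  metric : atlas -> 'rV[R]_n -> 'M[R]_n ;
  metric_smooth : forall i, smooth (chart i @` dom i) (metric i) ;
  metric_sym : forall i p, (chart i @` dom i) p ->
    (metric i p)^T = metric i p ;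
  metric_pos : forall i p u, (chart i @` dom i) p -> u != 0 ->
    0 < gram (metric i p) u u ;
  metric_compat : forall i j p u v, (chart i @` (dom i `&` dom j)) p ->
    let tau := chart j \o unchart i in
    gram (metric j (tau p)) ('D_u tau p) ('D_v tau p) = gram (metric i p) u v
}.

Section Riemannian.
Context {R : realType} {n : nat} (M : riemannianManifold R n).

Definition tnorm (q : M) (v : 'rV[R]_n) : R :=
  Num.sqrt (gram (metric (chart_at q) (chart (chart_at q) q)) v v).

Definition velocity (c : R -> M) (t : R) : 'rV[R]_n :=
  derive1 (chart (chart_at (c t)) \o c) t.

Definition C1_curve (c : R -> M) : Prop :=
  continuous c /\
  forall i t, dom i (c t) ->
    derivable (chart i \o c) t 1 /\ {for t, continuous (derive1 (chart i \o c))}.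

Definition curve_length (c : R -> M) : \bar R :=
  (\int[lebesgue_measure]_(t in `[0%R, 1%R]) (tnorm (c t) (velocity c t))%:E)%E.

(* Every C^1 curve on [0, 1], with one-sided derivatives at the ends, is the
   restriction of a C^1 curve on the whole line.  The distance between points
   of different connected components is +oo. *)
Definition rdist (x y : M) : \bar R :=
  ereal_inf [set curve_length c | c in
    [set c | C1_curve c /\ c 0 = x /\ c 1 = y]].

Definition riemannian_lipschitz (L : R) (f : M -> R) : Prop :=
  forall x y, (`|f x - f y|%:E <= L%:E * rdist x y)%E.

Definition C2_function (f : M -> R) : Prop :=
  forall i, Ck 2 (chart i @` dom i) (f \o unchart i : 'rV[R]_n -> R^o).

(* christoffel i p u v is the vector with components Gamma^k_(ab) u^a v^b; it
   is obtained from the Koszul formula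
   2 g(Gamma(u, v), w) = (D_u g)(v, w) + (D_v g)(u, w) - (D_w g)(u, v). *)
Definition christoffel (i : atlas M) (p u v : 'rV[R]_n) : 'rV[R]_n :=
  (\row_k (2^-1 * (gram ('D_u (metric i) p) v (delta_mx ord0 k)
                 + gram ('D_v (metric i) p) u (delta_mx ord0 k)
                 - gram ('D_(delta_mx ord0 k) (metric i) p) u v)))
  *m invmx (metric i p).

(* The components in the chart i of the Riemannian gradient of f. *)
Definition gradient (f : M -> R) (i : atlas M) (p : 'rV[R]_n) : 'rV[R]_n :=
  (\row_k ('D_(delta_mx ord0 k) (f \o unchart i : 'rV[R]_n -> R^o) p))
  *m invmx (metric i p).

(* u |-> nabla_u (grad f), for the Levi-Civita connection nabla. *)
Definition hessian (f : M -> R) (x : M) (u : 'rV[R]_n) : 'rV[R]_n :=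
  let i := chart_at x in let p := chart i x in
  'D_u (gradient f i) p + christoffel i p u (gradient f i p).

Definition geodesic_on (J : set R) (c : R -> M) : Prop :=
  forall t, J t -> {for t, continuous c} /\
    forall i, dom i (c t) ->
      let x := chart i \o c in
      [/\ derivable x t 1, derivable (derive1 x) t 1 &
          derive1 (derive1 x) t
          = - christoffel i (x t) (derive1 x t) (derive1 x t)].

(* Exp q v = c(1) for the geodesic c with c(0) = q and c'(0) = v; the default
   value q is taken when this geodesic does not reach time 1, which never
   happens on a complete manifold. *)
Definition Exp (q : M) (v : 'rV[R]_n) : M :=
  xget q [set y | exists (J : set R) (c : R -> M),
    [/\ open J, is_interval J, `[0, 1] `<=` J & geodesic_on J c] /\
    [/\ c 0 = q, velocity c 0 = v & c 1 = y]].

(* The supremum of the times up to which the geodesic t |-> Exp q (t xi) is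
   minimizing; xi is not normalized, so that for xi <> 0 this is the usual cut
   time of the unit vector xi / |xi|, divided by |xi|, and it is +oo for
   xi = 0. *)
Definition cut_time (q : M) (xi : 'rV[R]_n) : \bar R :=
  ereal_sup [set t%:E | t in
    [set t : R | 0 <= t /\ rdist q (Exp q (t *: xi)) = (t * tnorm q xi)%:E]].

Definition tangent_cut_locus (q : M) : set 'rV[R]_n :=
  [set xi | cut_time q xi = 1%:E].

Definition cut_locus (q : M) : set M := Exp q @` tangent_cut_locus q.

Definition interior_set (q : M) : set M := ~` cut_locus q.

Definition tangent_interior_set (q : M) : set 'rV[R]_n :=
  [set xi | (1%:E < cut_time q xi)%E].

Definition Log (q y : M) : 'rV[R]_n :=
  xget 0 [set xi | tangent_interior_set q xi /\ Exp q xi = y].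

Definition argmin (phi : M -> R) : set M :=
  [set x | forall y, phi x <= phi y].

Definition scalarization (f1 f2 : M -> R) (mu : R) : M -> R :=
  fun x => f1 x + mu * f2 x.

End Riemannian.

Definition is_partition (R : realType) (a b : R) (N : nat) (mu : nat -> R) :=
  [/\ mu 0%N = a, mu N = b & forall i, (i < N)%N -> mu i < mu i.+1].

Definition mesh (R : realType) (N : nat) (mu : nat -> R) : R :=
  \big[Num.max/0]_(i < N) (mu i.+1 - mu i).

Definition hermite (R : realType) (V : lmodType R) (a b : R)
    (ya yb va vb : V) (x : R) : V :=
  let h := b - a in
  let th := (x - a) / h in
  (2 * th ^+ 3 - 3 * th ^+ 2 + 1) *: ya
  + (h * (th ^+ 3 - 2 * th ^+ 2 + th)) *: va
  + (- 2 * th ^+ 3 + 3 * th ^+ 2) *: yb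
  + (h * (th ^+ 3 - th ^+ 2)) *: vb.

Section Interpolation.
Context {R : realType} {n : nat} (M : riemannianManifold R n).
Variables (gamma : R -> M) (N : nat) (mu : nat -> R).

Definition base (i : nat) : M := gamma (mu i.+1).

(* Used on [mu i, mu i.+1]; it is a total function of x, so that its
   derivatives at the end points of that interval are two-sided. *)
Definition lift_curve (i : nat) (x : R) : 'rV[R]_n := Log (base i) (gamma x).

(* gamma stays in the interior sets, so that the lifted pieces are genuine
   logarithms, and these pieces are of class C^1. *)
Definition well_lifted : Prop :=
  forall i, (i < N)%N ->
    [/\ forall x, x \in `[mu i, mu i.+1] ->
          interior_set (base i) (gamma x) /\
          exists! xi, tangent_interior_set (base i) xi /\
                      Exp (base i) xi = gamma x,
        forall x, x \in `[mu i, mu i.+1] -> derivable (lift_curve i) x 1 &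
        {within `[mu i, mu i.+1], continuous (derive1 (lift_curve i))}].

Definition velocity_data (eta : R) (vL vR : nat -> 'rV[R]_n) : Prop :=
  forall i, (i < N)%N ->
    tnorm (base i) (vL i - derive1 (lift_curve i) (mu i)) <= eta /\
    tnorm (base i) (vR i - derive1 (lift_curve i) (mu i.+1)) <= eta.

Definition omega (t : R) : R :=
  \big[Num.max/0]_(i < N)
    sup [set r | exists x y,
      [/\ x \in `[mu i, mu i.+1], y \in `[mu i, mu i.+1], `|x - y| <= t &
          r = tnorm (base i) (derive1 (lift_curve i) x
                              - derive1 (lift_curve i) y)]].

Variables vL vR : nat -> 'rV[R]_n.

Definition interpolant_piece (i : nat) (x : R) : M :=
  Exp (base i) (hermite (mu i) (mu i.+1)
    (lift_curve i (mu i)) (lift_curve i (mu i.+1)) (vL i) (vR i) x).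

(* The piece number i is the first one such that x <= mu i.+1. *)
Definition interpolant (x : R) : M :=
  interpolant_piece (find (fun i => x <= mu i.+1) (iota 0 N)) x.

Definition well_concatenated : Prop :=
  forall i x, (i < N)%N -> x \in `[mu i, mu i.+1] ->
    interpolant x = interpolant_piece i x.

End Interpolation.

Definition front_error (R : realType) (M : Type) (f1 f2 : M -> R)
    (c d : R -> M) (a b : R) : \bar R :=
  ereal_sup [set (Num.sqrt ((f1 (c x) - f1 (d x)) ^+ 2
                          + (f2 (c x) - f2 (d x)) ^+ 2))%:E | x in `[a, b]].

(* Main.v *)
Require Import Defs.
From HB Require Import structures.
From mathcomp Require Import all_boot all_order all_algebra.
From mathcomp Require Import all_classical all_reals all_analysis.
From mathcomp Require Import ring lra.
Set Implicit Arguments.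
Unset Strict Implicit.
Unset Printing Implicit Defensive.
Import Order.TTheory GRing.Theory Num.Theory.
Import numFieldNormedType.Exports.
Local Open Scope classical_set_scope.
Local Open Scope ring_scope.

(** The interpolation error is measured in the tangent spaces.  On a piece
    [a, b] with base point q = gamma b, subtract from Gamma x = Log q (gamma x)
    its affine part Gamma a + (x - a) Gamma'(a), which cubic Hermite
    interpolation reproduces: what is left has values at most h omega(h) and end
    slopes at most omega(h) + eta, so the interpolant is within 3 h (omega(h) +
    eta) of Gamma (hermite_close).  Exp q is Lipschitz near 0, so the same bound,
    up to a constant, holds for the Riemannian distance, and the Lipschitz
    constants of f1 and f2 turn it into the bound on the fronts (front_point).
    The constants must be uniform, and Gamma must be a C^1 curve; this is
    log_good_uniform, which the rest of the file prepares.

    Regularity of gamma.  Compactness of M and uniqueness of the minimizer make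
    gamma continuous.  In a chart, gamma mu solves df1 + mu df2 = 0, and the
    derivative of this equation in the space variable is invertible because the
    Hessian is; so gamma has a strict derivative, hence is C^1 (gamma_sder).

    Regularity of Exp.  Geodesics in a chart are the integral curves of the
    spray, a vector field with Lipschitz derivative.  Over a short time the
    flow, its first differences and its second differences are controlled by a
    Gronwall estimate (flow_exists, flow_diff, flow_diff2).  In a chart, Exp is
    thus a perturbation of the translation by at most one eighth of the
    displacement, uniformly in the base point: it is a local bijection, and the
    difference quotients of the preimage of a C^1 curve are Cauchy (log_sder).

    Cut times.  Log is defined through the cut time, so short geodesics must be
    shown to minimize.  Instead of the Gauss lemma, the proof exhibits along a
    short geodesic x an explicit subsolution of the Hamilton-Jacobi equation,
      F t p = E t + g(x t)(x' t, p - x t) - (m t / 2) g(p0)(p - x t, p - x t),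
    and integrates it along a competing curve (calibration); a curve which
    leaves the chart ball is too long anyway (rdist_lower).  Conversely the
    triangle inequality along a geodesic bounds by the distance to the end point
    every tangent vector of cut time at least 1 (cut_time_bound), so that all
    logarithms of a nearby point are small, and injectivity of Exp on small
    vectors gives uniqueness.  Exp takes a default value when a geodesic stops
    too early, and this is excluded by compactness (geodesic_complete). *)

(** * Norms, derivatives and primitives of vector-valued curves *)

Section Coord.
Context {R : realType}.

Lemma coord_le_norm m n (x : 'M[R]_(m, n)) i j : `|x i j| <= `|x|.
Proof.
rewrite [leRHS]/Num.Def.normr/= mx_normrE.
exact: (le_bigmax _ (fun ij : 'I_m * 'I_n => `|x ij.1 ij.2|) (i, j)).
Qed.

Lemma norm_le_coord m n (x : 'M[R]_(m, n)) K :
  0 <= K -> (forall i j, `|x i j| <= K) -> `|x| <= K.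
Proof.
move=> K0 H; rewrite [leLHS]/Num.Def.normr/= mx_normrE.
by apply: bigmax_le => // -[i j] _; exact: H.
Qed.

Lemma norm_le_row n (x : 'rV[R]_n) K :
  0 <= K -> (forall j, `|x ord0 j| <= K) -> `|x| <= K.
Proof. by move=> K0 H; apply: norm_le_coord => // i j; rewrite (ord1 i). Qed.

Lemma norm_lt_row n (x : 'rV[R]_n) K :
  0 < K -> (forall j, `|x ord0 j| < K) -> `|x| < K.
Proof.
move=> K0 H; rewrite [ltLHS]/Num.Def.normr/= mx_normrE.
by apply: bigmax_lt => // -[i j] _; rewrite (ord1 i); exact: H.
Qed.

Lemma row_sum_delta n (v : 'rV[R]_n) : v = \sum_j v ord0 j *: delta_mx ord0 j.
Proof. by rewrite [LHS]row_sum_delta. Qed.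

Lemma is_derive_coord (V : normedModType R) m n (x : V -> 'M[R]_(m, n)) t v d i j :
  is_derive t v x d -> is_derive t v (fun s => x s i j) (d i j).
Proof.
move=> [dx <-]; split; first exact: (derivable_mxP _ _ _).1.
by rewrite derive_mx// mxE.
Qed.

Lemma is_derive_mx (V : normedModType R) m n (x : V -> 'M[R]_(m, n)) t v (d : 'M[R]_(m, n)) :
  (forall i j, is_derive t v (fun s => x s i j) (d i j)) -> is_derive t v x d.
Proof.
move=> H; have dx : derivable x t v by apply/derivable_mxP => i j; case: (H i j).
split=> //; rewrite derive_mx//; apply/matrixP => i j; rewrite mxE.
by case: (H i j).
Qed.

Lemma is_derive_continuous (V : normedModType R) (x : R -> V) (t : R) (d : V) :
  is_derive t 1 x d -> {for t, continuous x}.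
Proof. by move=> [dx _]; exact/differentiable_continuous/derivable1_diffP. Qed.

Lemma is_derive1E (V : normedModType R) (x : R -> V) (t : R) (d : V) :
  is_derive t 1 x d -> derive1 x t = d.
Proof. by move=> [_ <-]; rewrite derive1E. Qed.

Lemma derivable_is_derive1 (V : normedModType R) (x : R -> V) (t : R) :
  derivable x t 1 -> is_derive t 1 x (derive1 x t).
Proof. by move=> dx; split=> //; rewrite derive1E. Qed.

Lemma le_of_derive_le (f df g dg : R -> R) (a b : R) : a <= b ->
  (forall t, a <= t <= b -> is_derive t 1 f (df t)) ->
  (forall t, a <= t <= b -> is_derive t 1 g (dg t)) ->
  (forall t, a <= t <= b -> df t <= dg t) -> f b - f a <= g b - g a.
Proof.
move=> ab Hf Hg Hle.
have Hd t : a <= t <= b -> is_derive t 1 (g - f) (dg t - df t).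
  by move=> tab; have := Hf _ tab; have := Hg _ tab => h1 h2; exact: is_deriveB.
have [||c] := @MVT_segment R (g - f) (fun t => dg t - df t) a b ab.
- by move=> x; rewrite in_itv/= => /andP[/ltW ax /ltW xb]; apply: Hd; rewrite ax.
- apply: derivable_within_continuous => x; rewrite in_itv/= => xab.
  by case: (Hd _ xab).
rewrite in_itv/= => cab; rewrite !fctE => e.
have : 0 <= (dg c - df c) * (b - a).
  by apply: mulr_ge0; rewrite subr_ge0 //; exact: Hle.
rewrite -e; lra.
Qed.

(** In the sup norm the scalar mean value inequality applies to each coordinate. *)
Lemma vec_le_of_derive_le m (f df : R -> 'rV[R]_m) (g dg : R -> R) (a b : R) : a <= b ->
  (forall t, a <= t <= b -> is_derive t 1 f (df t)) ->
  (forall t, a <= t <= b -> is_derive t 1 g (dg t)) ->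
  (forall t, a <= t <= b -> `|df t| <= dg t) -> `|f b - f a| <= g b - g a.
Proof.
move=> ab Hf Hg Hle.
have Hfj j t : a <= t <= b -> is_derive t 1 (fun s => f s ord0 j) (df t ord0 j).
  by move=> tab; exact/is_derive_coord/Hf.
apply: norm_le_row => [|j].
  rewrite -(subrr (0 : R)); apply: (@le_of_derive_le (cst 0) (fun=> 0) g dg a b ab _ Hg).
  by move=> t tab; exact: le_trans (Hle _ tab).
have le1 t : a <= t <= b -> `|df t ord0 j| <= dg t.
  by move=> tab; exact: le_trans (coord_le_norm _ _ _) (Hle _ tab).
rewrite !mxE ler_norml; apply/andP; split; last first.
  apply: (le_of_derive_le ab (Hfj j) Hg) => t tab.
  by have := le1 _ tab; rewrite ler_norml => /andP[].
have Hfn t : a <= t <= b ->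
    is_derive t 1 (fun s => - f s ord0 j) (- df t ord0 j).
  by move=> tab; have := Hfj j _ tab => h; exact: is_deriveN.
rewrite lerNl opprB; have := le_of_derive_le ab Hfn Hg; rewrite opprK addrC; apply.
move=> t tab; have := le1 _ tab; rewrite ler_norml => /andP[].
lra.
Qed.

Lemma vec_le_const m (f df : R -> 'rV[R]_m) (K a b : R) : a <= b ->
  (forall t, a <= t <= b -> is_derive t 1 f (df t)) ->
  (forall t, a <= t <= b -> `|df t| <= K) -> `|f b - f a| <= K * (b - a).
Proof.
move=> ab Hf HK; rewrite mulrBr.
apply: (@vec_le_of_derive_le _ f df (fun t => K * t) (fun=> K)) => // t tab.
have h : is_derive t 1 (K *: (@id R)) (K *: 1) by exact: is_deriveZ.
by rewrite -[X in is_derive _ _ _ X]mulr1; exact: h.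
Qed.

(** The form used for flows, which run in both directions of time. *)
Lemma vec_le_const_sym m (f df : R -> 'rV[R]_m) (K a b A : R) :
  `|a| <= A -> `|b| <= A ->
  (forall t : R, `|t| <= A -> is_derive t 1 f (df t)) ->
  (forall t : R, `|t| <= A -> `|df t| <= K) -> `|f b - f a| <= K * `|b - a|.
Proof.
move=> aA bA Hf HK.
have H c d : `|c| <= A -> `|d| <= A -> c <= d -> `|f d - f c| <= K * (d - c).
  rewrite !ler_norml => /andP[? ?] /andP[? ?] cd.
  by apply: (vec_le_const cd) => t /andP[? ?]; [apply: Hf|apply: HK]; rewrite ler_norml; lra.
case: (leP a b) => ab.
  by rewrite [in leRHS]ger0_norm ?subr_ge0//; exact: H.
rewrite distrC [in leRHS]distrC [in leRHS]ger0_norm ?subr_ge0 ?(ltW ab)//.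
by apply: H => //; exact: ltW.
Qed.

(** The fundamental theorem of calculus gives primitives on bounded intervals
    only; primitive_scalar patches them together. *)
Lemma primitive_local (f : R -> R) (A : R) : continuous f -> 0 < A ->
  exists F : R -> R, F 0 = 0 /\ forall t : R, `|t| < A -> is_derive t 1 F (f t).
Proof.
move=> cf A0.
pose F x := (\int[lebesgue_measure]_(t in `[- A, x]) f t)%R.
exists (fun x => F x - F 0); split; first by rewrite subrr.
move=> t; rewrite ltr_norml => /andP[lt gt].
have ifu : lebesgue_measure.-integrable `[- A, A] (EFin \o f).
  apply: continuous_compact_integrable; first exact: segment_compact.
  exact: continuous_subspaceT.
have [d1 d2] := @continuous_FTC1_closed R f (- A) t A gt ifu lt (cf t).
have dF : is_derive t 1 F (f t) 
  by apply: DeriveDef; [exact: d1|rewrite -derive1E; exact: d2].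
have := @is_deriveB _ _ _ F (cst (F 0)) t 1 _ _ dF (is_derive_cst _ _ _).
by rewrite subr0.
Qed.

Lemma derive_eq_cst0 (f g : R -> R) (d : R -> R) (A : R) : f 0 = g 0 ->
  (forall t : R, `|t| < A -> is_derive t 1 f (d t)) ->
  (forall t : R, `|t| < A -> is_derive t 1 g (d t)) ->
  forall t : R, `|t| < A -> f t = g t.
Proof.
move=> e0 df dg t tA.
have Ht s : Num.min 0 t <= s <= Num.max 0 t -> `|s| < A.
  move: tA; rewrite !ltr_norml => /andP[? ?]; case: (lerP 0 t) => ? /andP[? ?]; lra.
have le0t : Num.min 0 t <= Num.max 0 t by case: (lerP 0 t) => ?; lra.
have h1 := @le_of_derive_le f d g d _ _ le0t (fun s hs => df s (Ht s hs))
   (fun s hs => dg s (Ht s hs)) (fun s hs => lexx _).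
have h2 := @le_of_derive_le g d f d _ _ le0t (fun s hs => dg s (Ht s hs))
   (fun s hs => df s (Ht s hs)) (fun s hs => lexx _).
by case: (lerP 0 t) h1 h2 => ?; lra.
Qed.

Lemma primitive_scalar (f : R -> R) : continuous f ->
  exists F : R -> R, F 0 = 0 /\ forall t : R, is_derive t 1 F (f t).
Proof.
move=> cf.
have /choice[G HG] : forall k : nat, exists F : R -> R,
    F 0 = 0 /\ forall t : R, `|t| < k.+1%:R -> is_derive t 1 F (f t).
  by move=> k; apply: primitive_local.
pose b (t : R) := Num.truncn `|t|.
exists (fun t => G (b t) t); split; first by case: (HG (b 0)).
have bt t : `|t| < (b t).+1%:R by rewrite /b truncnS_gt.
move=> t.
have lt1 : `|t| < (b t).+2%:R by rewrite (lt_trans (bt t))// ltr_nat.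
apply: (@near_eq_is_derive _ _ _ (G (b t).+1)); last by apply: (HG _).2.
have : \forall s \near t, `|s| < (b t).+2%:R.
  near=> s.
  suff : `|s - t| < (b t).+2%:R - `|t|.
    have := ler_normD t (s - t); rewrite addrC subrK; lra.
  near: s; apply/nbhs_ballP; exists ((b t).+2%:R - `|t|); first by rewrite /= subr_gt0.
  by move=> s; rewrite /ball/= distrC.
move=> H; near=> s.
have sl : `|s| < (b t).+2%:R by near: s.
case: (leqP (b s) (b t).+1) => h.
  apply: (@derive_eq_cst0 (G (b t).+1) (G (b s)) f (b s).+1%:R) => //.
  - by rewrite (HG _).1 (HG _).1.
  - move=> r rb; apply: (HG _).2; apply: lt_le_trans rb _.
    by rewrite ler_nat.
  - by move=> r rb; apply: (HG _).2.
apply: (@derive_eq_cst0 (G (b t).+1) (G (b s)) f (b t).+2%:R) => //.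
- by rewrite (HG _).1 (HG _).1.
- by move=> r rb; apply: (HG _).2.
- by move=> r rb; apply: (HG _).2; apply: lt_trans rb _; rewrite ltr_nat.
Unshelve. all: by end_near. Qed.

Lemma continuous_coord m n (x : R -> 'M[R]_(m, n)) (t : R) i j :
  {for t, continuous x} -> {for t, continuous (fun s => x s i j)}.
Proof.
move=> cx; apply: (@continuous_comp _ _ _ x (fun M : 'M[R]_(m, n) => M i j)) => //.
exact: coord_continuous.
Qed.

Lemma primitive_vec m (f : R -> 'rV[R]_m) : continuous f ->
  exists F : R -> 'rV[R]_m, F 0 = 0 /\ forall t : R, is_derive t 1 F (f t).
Proof.
move=> cf.
have /choice[G HG] : forall j : 'I_m, exists F : R -> R,
    F 0 = 0 /\ forall t : R, is_derive t 1 F (f t ord0 j).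
  by move=> j; apply: primitive_scalar => t; exact/continuous_coord/cf.
exists (fun t => \row_j G j t); split.
  by apply/rowP => j; rewrite !mxE (HG j).1.
move=> t; apply: is_derive_mx => i j; rewrite (ord1 i).
have -> : (fun s => (\row_j0 G j0 s) ord0 j) = G j by apply/funext => s; rewrite mxE.
by apply: (HG j).2.
Qed.

End Coord.

(** * Directional derivatives of C^k functions *)

Section Ck.
Context {R : realType}.

Lemma open_ball_ex (V : normedModType R) (U : set V) p : open U -> U p ->
  exists r : R, 0 < r /\ forall x, `|x - p| < r -> U x.
Proof.
move=> oU Up; have /nbhs_ballP[r r0 H] : nbhs p U by exact: open_nbhs_nbhs.
by exists r; split => // x xr; apply: H; rewrite -ball_normE/= distrC.
Qed.

Lemma cont_ex (V W : normedModType R) (f : V -> W) p (e : R) :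
  {for p, continuous f} -> 0 < e ->
  exists r : R, 0 < r /\ forall x, `|x - p| < r -> `|f x - f p| < e.
Proof.
move=> cf e0; have /cvgrPdist_lt/(_ _ e0) := cf.
rewrite near_simpl => /nbhs_ballP[r r0 H].
by exists r; split => // x xr; rewrite distrC; apply: H; rewrite -ball_normE/= distrC.
Qed.

Lemma ex_cont (V W : normedModType R) (f : V -> W) p :
  (forall e : R, 0 < e ->
    exists r : R, 0 < r /\ forall x, `|x - p| < r -> `|f x - f p| <= e) ->
  {for p, continuous f}.
Proof.
move=> H; apply/cvgrPdist_le => e e0; have [r [r0 Hr]] := H _ e0.
apply/nbhs_ballP; exists r => // x; rewrite -ball_normE/= distrC => xr.
by rewrite distrC; exact: Hr.
Qed.

Lemma near_ex (V : normedModType R) (P : set V) p :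
  (\forall x \near p, P x) <-> exists r : R, 0 < r /\ forall x, `|x - p| < r -> P x.
Proof.
split=> [/nbhs_ballP[r r0 H]|[r [r0 H]]].
  by exists r; split => // x xr; apply: H; rewrite -ball_normE/= distrC.
by apply/nbhs_ballP; exists r => // x; rewrite -ball_normE/= distrC => /H.
Qed.

Lemma dnbhs0_ex (P : set R) :
  (\forall h \near 0^', P h) <->
  exists r : R, 0 < r /\ forall h, `|h| < r -> h != 0 -> P h.
Proof.
split=> [H|[r [r0 H]]].
  have [r [r0 Hr]] := (@near_ex R (fun h => h != 0 -> P h) 0).1 H.
  by exists r; split => // h hr; apply: Hr; rewrite subr0.
apply: (@near_ex R (fun h => h != 0 -> P h) 0).2.
by exists r; split => // h; rewrite subr0 => hr; exact: H.
Qed.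

Lemma radius_forall (V : normedModType R) (I : finType) (P : I -> V -> Prop) p :
  (forall j, exists r : R, 0 < r /\ forall x, `|x - p| < r -> P j x) ->
  exists r : R, 0 < r /\ forall x, `|x - p| < r -> forall j, P j x.
Proof.
move=> /choice[g Hg]; exists (\big[Num.min/1]_j g j); split.
  by apply: lt_bigmin => // j _; exact: (Hg j).1.
move=> x xr j; apply: (Hg j).2; apply: lt_le_trans xr _.
exact: bigmin_le.
Qed.

Lemma term_le_sum (I : finType) (F : I -> R) j :
  (forall i, 0 <= F i) -> F j <= \sum_i F i.
Proof. by move=> F0; rewrite (bigD1 j)//= lerDl sumr_ge0. Qed.

Lemma bounded_family (I : finType) (F : I -> R) :
  exists S, 0 <= S /\ forall j, `|F j| <= S.
Proof.
exists (\sum_i `|F i|); split; first exact: sumr_ge0.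
by move=> j; apply: (@term_le_sum _ (fun i => `|F i|)).
Qed.

Lemma le_sum3 (a b c : R) : 0 <= a -> 0 <= b -> 0 <= c ->
  [/\ a <= a + b + c, b <= a + b + c & 0 <= a + b + c].
Proof. by move=> *; split; lra. Qed.

Lemma norm_le_split (a b c d : R) : `|a - b| <= c -> `|b| <= d -> `|a| <= c + d.
Proof. by move=> h1 h2; rewrite -(subrK b a) (le_trans (ler_normD _ _))// lerD. Qed.

Lemma sum_cst_ord n (c : R) : \sum_(j < n) c = n%:R * c.
Proof. by rewrite sumr_const card_ord mulr_natl. Qed.

Lemma Ck_eq n (W : normedModType R) k (U : set 'rV[R]_n) (f g : 'rV[R]_n -> W) :
  open U -> (forall x, U x -> f x = g x) -> Ck k U f -> Ck k U g.
Proof.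
move=> oU; elim: k f g => [|k IH] f g fg.
  move=> cf x Ux; have fgx : \forall y \near x, f y = g y.
    by have := open_nbhs_nbhs (conj oU Ux); apply: filterS => y; exact: fg.
  suff : g y @[y --> x] --> g x by [].
  rewrite -(fg _ Ux); exact: (cvg_trans (near_eq_cvg fgx) (cf x Ux)).
move=> [df Cf]; have fgx x : U x -> \forall y \near x, f y = g y.
  by move=> Ux; have := open_nbhs_nbhs (conj oU Ux); apply: filterS => y; exact: fg.
split=> [x v Ux|v]; first exact: (near_eq_derivable (fgx x Ux) (df x v Ux)).
apply: IH (Cf v) => x Ux; exact/near_eq_derive/fgx.
Qed.

Lemma Ck_coord n a b k (U : set 'rV[R]_n) (f : 'rV[R]_n -> 'M[R]_(a, b)) i j :
  open U -> Ck k U f -> Ck k U (fun x => f x i j : R^o).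
Proof.
move=> oU; elim: k f => [|k IH] f.
  move=> cf x Ux; apply: (@continuous_comp _ _ _ f (fun M : 'M[R]_(a, b) => M i j)).
    exact: cf.
  exact: coord_continuous.
move=> [df Cf]; split=> [x v Ux|v]; first exact: (derivable_mxP _ _ _).1 (df x v Ux) i j.
apply: (Ck_eq oU _ (IH _ (Cf v))) => x Ux.
by rewrite derive_mx ?mxE//; exact: df.
Qed.

Lemma is_derive_line (V W : normedModType R) (f : V -> W) (y d : V) (s : R) :
  derivable f (y + s *: d) d ->
  is_derive s 1 (fun r : R => f (y + r *: d)) ('D_d f (y + s *: d)).
Proof.
move=> df.
have E : (fun h : R => h^-1 *: (((fun r : R => f (y + r *: d)) \o shift s) (h *: 1)
      - f (y + s *: d))) =
    (fun h => h^-1 *: ((f \o shift (y + s *: d)) (h *: d) - f (y + s *: d))).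
  apply/funext => h /=; congr (_ *: (f _ - _)).
  by rewrite [h%:A]mulr1 scalerDl addrCA.
by split; rewrite /derivable /derive /= E.
Qed.

Section Scalar.
Context {n : nat}.
Implicit Types (U : set 'rV[R]_n) (f : 'rV[R]_n -> R^o).

Lemma line_mvt f (y d : 'rV[R]_n) :
  (forall s : R, 0 <= s <= 1 -> derivable f (y + s *: d) d) ->
  exists s : R, 0 <= s <= 1 /\ f (y + d) - f y = 'D_d f (y + s *: d).
Proof.
move=> df.
have dl (s : R) : 0 <= s <= 1 -> is_derive s 1 (fun r : R => f (y + r *: d)) ('D_d f (y + s *: d)).
  by move=> s01; exact/is_derive_line/df.
have [||s] := @MVT_segment R (fun r : R => f (y + r *: d))
   (fun s => 'D_d f (y + s *: d)) 0 1 ler01.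
- by move=> s; rewrite in_itv/= => /andP[/ltW s0 /ltW s1]; apply: dl; rewrite s0.
- apply: derivable_within_continuous => s; rewrite in_itv/= => s01.
  by case: (dl s s01).
rewrite in_itv/= => s01; rewrite scale1r scale0r addr0 subr0 mulr1 => e.
by exists s.
Qed.

Lemma derive_dirZ U f p (c : R) v : Ck 1 U f -> U p -> 'D_(c *: v) f p = c * 'D_v f p.
Proof.
move=> [df _] Up.
have h1 : is_derive (c * 0 : R) 1 (fun r : R => f (p + r *: v)) ('D_v f (p + (c * 0) *: v)).
  by apply: is_derive_line; rewrite mulr0 scale0r addr0; exact: df.
have h2 : is_derive (0 : R) 1 (fun r : R => c * r) c.
  have h : is_derive (0 : R) 1 (c *: (@id R)) (c *: 1) by exact: is_deriveZ.
  by rewrite -[X in is_derive _ _ _ X]mulr1; exact: h.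
have h3 := @is_derive1_comp R (fun r : R => f (p + r *: v)) (fun r => c * r) 0 _ _ h1 h2.
have h4 : is_derive (0 : R) 1 (fun r : R => f (p + r *: (c *: v)))
    ('D_(c *: v) f (p + (0 : R) *: (c *: v))).
  by apply: is_derive_line; rewrite scale0r addr0; exact: df.
have := is_derive1E h4; rewrite scale0r addr0 => <-.
have := is_derive1E h3; rewrite mulr0 scale0r addr0 mulrC => <-.
congr (derive1 _ 0); apply/funext => r /=; by rewrite scalerA mulrC.
Qed.

(** Derivatives are defined direction by direction; additivity in the direction
    is where their continuity is used. *)
Lemma derive_dirD U f p u w : open U -> Ck 1 U f -> U p ->
  'D_(u + w) f p = 'D_u f p + 'D_w f p.
Proof.
move=> oU Cf Up; have [df cf] := Cf.
have [r0 [r0p Hr0]] := open_ball_ex oU Up.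
apply/cvg_lim => //; apply/cvgrPdist_le => e e0.
have e20 : 0 < e / 2 by rewrite divr_gt0.
have [r1 [r1p Hr1]] := cont_ex (cf w p Up) e20.
have := df p u Up; rewrite /derivable => /cvgrPdist_le/(_ _ e20).
set A := fun h : R => _.
move=> /dnbhs0_ex[r2 [r2p Hr2]]; apply/dnbhs0_ex.
pose B := `|u| + `|w| + 1.
have B0 : 0 < B by rewrite /B; have := normr_ge0 u; have := normr_ge0 w; lra.
exists (Num.min r2 (Num.min r0 r1 / B)).
split; first by rewrite !lt_min r2p/= divr_gt0// lt_min r0p.
move=> h; rewrite lt_min => /andP[hr2]; rewrite ltr_pdivlMr// => hB h0.
have small (s : R) : 0 <= s <= 1 -> `|(p + h *: u) + s *: (h *: w) - p| < Num.min r0 r1.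
  move=> /andP[s0 s1]; apply: le_lt_trans hB.
  rewrite addrAC (addrC p) addrK scalerA mulrC -scalerA -scalerDr normrZ.
  rewrite ler_wpM2l// (le_trans (ler_normD _ _))// normrZ (ger0_norm s0) /B.
  have : s * `|w| <= 1 * `|w| by rewrite ler_wpM2r.
  lra.
have [|s [s01 Es]] := @line_mvt f (p + h *: u) (h *: w).
  move=> s /small; rewrite lt_min => /andP[/Hr0 ? _]; exact: df.
have := small s s01; rewrite lt_min => /andP[/Hr0 Uxi /Hr1 Dxi].
move: Es; rewrite (derive_dirZ _ _ Cf Uxi) => Es.
have HA := Hr2 h hr2 h0.
have -> : (f \o shift p) (h *: (u + w)) = f (p + h *: u + h *: w).
  by rewrite /= scalerDr addrC addrA.
rewrite (_ : f _ - f p = (f (p + h *: u + h *: w) - f (p + h *: u)) + (f (p + h *: u) - f p)); last first.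
  by rewrite addrA subrK.
rewrite Es; move: HA Dxi; rewrite /A /= (addrC _ p) -/('D_u f p).
set X := 'D_w f _; set Y := f _ - f p; set Du := 'D_u f p; set Dw := 'D_w f p.
rewrite /GRing.scale/= => HA Dxi.
rewrite mulrDr mulrA mulVf// mul1r (_ : _ - _ = (Du - h^-1 * Y) - (X - Dw)); last by ring.
by rewrite (le_trans (ler_normB _ _))// [leRHS](splitr e) lerD// ltW.
Qed.

Lemma derive_dir_linear U f p (c : R) u w : open U -> Ck 1 U f -> U p ->
  'D_(c *: u + w) f p = c * 'D_u f p + 'D_w f p.
Proof. by move=> oU Cf Up; rewrite (derive_dirD _ _ oU Cf Up) (derive_dirZ _ _ Cf Up). Qed.

Lemma derive_dir_sum U f p v : open U -> Ck 1 U f -> U p ->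
  'D_v f p = \sum_j v ord0 j * 'D_(delta_mx ord0 j) f p.
Proof.
move=> oU Cf Up; rewrite {1}(row_sum_delta v).
elim/big_ind2 : _ => [|x1 x2 y1 y2 <- <-|i _]; first exact: derive0.
  by rewrite (derive_dirD _ _ oU Cf Up).
by rewrite (derive_dirZ _ _ Cf Up).
Qed.

Lemma derive_dir_diff_le U f p q v (e : R) : open U -> Ck 1 U f -> U p -> U q ->
  0 <= e ->
  (forall j, `|'D_(delta_mx ord0 j) f p - 'D_(delta_mx ord0 j) f q| <= e) ->
  `|'D_v f p - 'D_v f q| <= n%:R * e * `|v|.
Proof.
move=> oU Cf Up Uq e0 H.
rewrite (derive_dir_sum _ oU Cf Up) (derive_dir_sum _ oU Cf Uq) -sumrB.
apply: (le_trans (ler_norm_sum _ _ _)).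
apply: (@le_trans _ _ (\sum_(j < n) e * `|v|)); last first.
  by rewrite sum_cst_ord mulrA.
apply: ler_sum => j _; rewrite -mulrBr normrM mulrC ler_pM//; exact: coord_le_norm.
Qed.

Lemma ball_convex (p x y : 'rV[R]_n) (r s : R) : `|x - p| < r -> `|y - p| < r ->
  0 <= s <= 1 -> `|y + s *: (x - y) - p| < r.
Proof.
move=> xr yr /andP[s0 s1].
have -> : y + s *: (x - y) - p = s *: (x - p) + (1 - s) *: (y - p).
  by rewrite !scalerBr !scalerBl !scale1r; apply/rowP => j; rewrite !mxE; ring.
apply: (le_lt_trans (ler_normD _ _)).
rewrite !normrZ (ger0_norm s0) (@ger0_norm _ (1 - s)) ?subr_ge0//.
have [s12|s12] := lerP s (1/2).
  have : s * `|x - p| <= s * r by apply: ler_wpM2l => //; exact: ltW.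
  have : (1 - s) * `|y - p| < (1 - s) * r by rewrite ltr_pM2l; lra.
  lra.
have : s * `|x - p| < s * r by rewrite ltr_pM2l; lra.
have : (1 - s) * `|y - p| <= (1 - s) * r by apply: ler_wpM2l; [lra|exact: ltW].
lra.
Qed.

Lemma seg_dist (q x y : 'rV[R]_n) (s : R) : 0 <= s <= 1 ->
  `|y + s *: (x - y) - q| <= `|x - q| + `|y - q|.
Proof.
move=> /andP[s0 s1].
have -> : y + s *: (x - y) - q = s *: (x - q) + (1 - s) *: (y - q).
  by rewrite !scalerBr !scalerBl !scale1r; apply/rowP => j; rewrite !mxE; ring.
apply: (le_trans (ler_normD _ _)); rewrite !normrZ (ger0_norm s0) (@ger0_norm _ (1 - s)) ?subr_ge0//.
by rewrite lerD// ler_piMl//; lra.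
Qed.

Lemma mvt_ball U f p (r : R) x y : Ck 1 U f -> (forall x, `|x - p| < r -> U x) ->
  `|x - p| < r -> `|y - p| < r ->
  exists s : R, 0 <= s <= 1 /\ f x - f y = 'D_(x - y) f (y + s *: (x - y)).
Proof.
move=> [df _] HU xr yr.
have [|s [s01 E]] := @line_mvt f y (x - y).
  by move=> s s01; apply: df; apply: HU; exact: ball_convex.
by exists s; split => //; rewrite -E addrCA subrr addr0.
Qed.

(** Mean value theorem on a segment: continuity of the partial derivatives makes
    the derivative strict, that is, uniform over pairs of nearby points. *)
Lemma Ck1_strict U f p (e : R) : open U -> Ck 1 U f -> U p -> 0 < e ->
  exists r : R, 0 < r /\ forall x y, `|x - p| < r -> `|y - p| < r ->
    `|f x - f y - 'D_(x - y) f p| <= e * `|x - y|.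
Proof.
move=> oU Cf Up e0; have [df cf] := Cf.
have [r0 [r0p Hr0]] := open_ball_ex oU Up.
pose e' := e / n.+1%:R.
have e'0 : 0 < e' by rewrite divr_gt0.
have [|r1 [r1p Hr1]] := @radius_forall _ _ (fun j x => `|'D_(delta_mx ord0 j) f x - 'D_(delta_mx ord0 j) f p| <= e') p.
  move=> j.
  have [r1 [r1p Hr1]] := cont_ex (cf (delta_mx ord0 j) p Up) e'0.
  by exists r1; split => // x /Hr1/ltW.
exists (Num.min r0 r1); split; first by rewrite lt_min r0p.
move=> x y xr yr.
have lt0 z : `|z - p| < Num.min r0 r1 -> `|z - p| < r0 by rewrite lt_min => /andP[].
have [s [s01 ->]] := mvt_ball Cf Hr0 (lt0 _ xr) (lt0 _ yr).
have xir := ball_convex xr yr s01.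
have xi1 : `|y + s *: (x - y) - p| < r1 by move: xir; rewrite lt_min => /andP[].
apply: le_trans (derive_dir_diff_le _ oU Cf (Hr0 _ (lt0 _ xir)) Up (ltW e'0) (Hr1 _ xi1)) _.
rewrite ler_wpM2r// /e' mulrCA ler_piMr ?(ltW e0)// ler_pdivrMr// mul1r ler_nat.
exact: leqnSn.
Qed.

(** A bound on the second derivatives on a ball bounds the second-order Taylor
    remainder between any two of its points, with the derivative taken at a third. *)
Lemma Ck2_C11 U f p : open U -> Ck 2 U f -> U p ->
  exists r K : R, [/\ 0 < r, 0 <= K, forall x, `|x - p| < r -> U x &
   [/\ forall x, `|x - p| < r -> `|f x| <= K,
       forall x v, `|x - p| < r -> `|'D_v f x| <= K * `|v|,
       forall x y, `|x - p| < r -> `|y - p| < r -> `|f x - f y| <= K * `|x - y| &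
       forall x y q, `|x - p| < r -> `|y - p| < r -> `|q - p| < r ->
         `|f x - f y - 'D_(x - y) f q| <= K * (`|x - q| + `|y - q|) * `|x - y|]].
Proof.
move=> oU Cf Up; have [df cf] := Cf.
have [r0 [r0p Hr0]] := open_ball_ex oU Up.
have [|r1 [r1p Hr1]] := @radius_forall _ _ (fun (jk : 'I_n * 'I_n) x =>
   `|'D_(delta_mx ord0 jk.2) ('D_(delta_mx ord0 jk.1) f) x -
     'D_(delta_mx ord0 jk.2) ('D_(delta_mx ord0 jk.1) f) p| <= 1) p.
  move=> [j k] /=.
  have [r1 [r1p Hr1]] := cont_ex ((cf (delta_mx ord0 j)).2 (delta_mx ord0 k) p Up) ltr01.
  by exists r1; split => // x /Hr1/ltW.
pose r := Num.min (Num.min r0 r1) 1.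
have rp : 0 < r by rewrite !lt_min r0p r1p/=.
have ltr0 z : `|z - p| < r -> `|z - p| < r0 by rewrite !lt_min => /andP[/andP[]].
have ltr1 z : `|z - p| < r -> `|z - p| < r1 by rewrite !lt_min => /andP[/andP[]].
have ltr11 z : `|z - p| < r -> `|z - p| < 1 by rewrite !lt_min => /andP[].
have HrU z : `|z - p| < r -> U z by move/ltr0/Hr0.
have [S2 [S20 HS2]] := @bounded_family _ (fun jk : 'I_n * 'I_n =>
  'D_(delta_mx ord0 jk.2) ('D_(delta_mx ord0 jk.1) f) p).
pose K2 := 1 + S2.
have K20 : 0 <= K2 by rewrite /K2; lra.
have D2 x j k : `|x - p| < r -> `|'D_(delta_mx ord0 k) ('D_(delta_mx ord0 j) f) x| <= K2.
  move=> xr; exact: norm_le_split (Hr1 _ (ltr1 _ xr) (j, k)) (HS2 (j, k)).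
have D2v x j v : `|x - p| < r -> `|'D_v ('D_(delta_mx ord0 j) f) x| <= n%:R * K2 * `|v|.
  move=> xr; rewrite (derive_dir_sum _ oU (cf (delta_mx ord0 j)) (HrU _ xr)).
  apply: (le_trans (ler_norm_sum _ _ _)).
  apply: (@le_trans _ _ (\sum_(j < n) K2 * `|v|)); last first.
    by rewrite sum_cst_ord mulrA.
  by apply: ler_sum => k _; rewrite normrM mulrC ler_pM//; [exact: D2|exact: coord_le_norm].
have Lip1 x y j : `|x - p| < r -> `|y - p| < r ->
   `|'D_(delta_mx ord0 j) f x - 'D_(delta_mx ord0 j) f y| <= n%:R * K2 * `|x - y|.
  move=> xr yr; have [s [s01 ->]] := mvt_ball (cf (delta_mx ord0 j)) HrU xr yr.
  exact: D2v (ball_convex xr yr s01).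
have Cf1 : Ck 1 U f.
  split=> // v x Ux; apply: ex_cont => e e0.
  have [r2 [r2p Hr2]] := @Ck1_strict U ('D_v f) x 1 oU (cf v) Ux ltr01.
  pose B := (1 + \sum_j `|'D_(delta_mx ord0 j) ('D_v f) x|).
  have sB : 0 <= \sum_j `|'D_(delta_mx ord0 j) ('D_v f) x| by apply: sumr_ge0.
  have B0 : 0 < B by rewrite /B; lra.
  exists (Num.min r2 (e / B)); split; first by rewrite lt_min r2p divr_gt0.
  move=> y; rewrite lt_min => /andP[yr]; rewrite ltr_pdivlMr// => ye.
  have := Hr2 y x yr; rewrite subrr normr0 => /(_ r2p) H.
  have Hb : `|'D_(y - x) ('D_v f) x| <= (\sum_j `|'D_(delta_mx ord0 j) ('D_v f) x|) * `|y - x|.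
    rewrite (derive_dir_sum _ oU (cf v) Ux) mulr_suml.
    apply: (le_trans (ler_norm_sum _ _ _)); apply: ler_sum => k _.
    by rewrite normrM mulrC ler_wpM2l// coord_le_norm.
  move: H Hb ye; rewrite /B; set S := \sum_j _; set a := 'D_v f y - _; set b := 'D_ _ _ x.
  move=> H Hb ye; have := ler_normD (a - b) b; rewrite subrK; lra.
have [S1 [S10 HS1]] := @bounded_family _ (fun j : 'I_n => 'D_(delta_mx ord0 j) f p).
pose K1 := n%:R * K2 + S1.
have nK2 : 0 <= n%:R * K2 by rewrite mulr_ge0.
have K10 : 0 <= K1 by rewrite /K1; lra.
have D1 x j : `|x - p| < r -> `|'D_(delta_mx ord0 j) f x| <= K1.
  move=> xr; have h := Lip1 x p j xr; rewrite subrr normr0 in h.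
  apply: norm_le_split (le_trans (h rp) _) (HS1 j).
  by rewrite ler_piMr// ltW// ltr11.
have D1v x v : `|x - p| < r -> `|'D_v f x| <= n%:R * K1 * `|v|.
  move=> xr; rewrite (derive_dir_sum _ oU Cf1 (HrU _ xr)).
  apply: (le_trans (ler_norm_sum _ _ _)).
  apply: (@le_trans _ _ (\sum_(j < n) K1 * `|v|)); last first.
    by rewrite sum_cst_ord mulrA.
  by apply: ler_sum => k _; rewrite normrM mulrC ler_pM//; [exact: D1|exact: coord_le_norm].
have Lip0 x y : `|x - p| < r -> `|y - p| < r -> `|f x - f y| <= n%:R * K1 * `|x - y|.
  move=> xr yr; have [s [s01 ->]] := mvt_ball Cf1 HrU xr yr.
  exact: D1v (ball_convex xr yr s01).
have nK1 : 0 <= n%:R * K1 by rewrite mulr_ge0.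
have K11 x y q : `|x - p| < r -> `|y - p| < r -> `|q - p| < r ->
    `|f x - f y - 'D_(x - y) f q| <= n%:R * (n%:R * K2) * (`|x - q| + `|y - q|) * `|x - y|.
  move=> xr yr qr; have [s [s01 ->]] := mvt_ball Cf1 HrU xr yr.
  have xir := ball_convex xr yr s01.
  rewrite -[n%:R * (n%:R * K2) * _]mulrA.
  apply: (derive_dir_diff_le _ oU Cf1 (HrU _ xir) (HrU _ qr)).
    by rewrite !mulr_ge0// addr_ge0.
  move=> j; apply: (le_trans (Lip1 _ _ j xir qr)).
  by rewrite ler_wpM2l//; exact: seg_dist.
have nnK2 : 0 <= n%:R * (n%:R * K2) by rewrite mulr_ge0.
pose K := n%:R * (n%:R * K2) + n%:R * K1 + `|f p|.
have f0 := normr_ge0 (f p).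

have [KK2 KK1 K0] := le_sum3 nnK2 nK1 f0.
exists r, K; split; [by []|exact: K0|exact: HrU|].
split => [x xr|x v xr|x y xr yr|x y q xr yr qr].
- have := Lip0 x p xr; rewrite subrr normr0 => /(_ rp).
  move=> h; apply: le_trans (norm_le_split h (lexx _)) _.
  rewrite /K lerD// (@le_trans _ _ (n%:R * K1))// ?lerDr// ler_piMr// ltW// ltr11//.
- by apply: le_trans (D1v x v xr) _; rewrite ler_wpM2r.
- by apply: le_trans (Lip0 x y xr yr) _; rewrite ler_wpM2r.
- by apply: le_trans (K11 x y q xr yr qr) _; rewrite ler_wpM2r// ler_wpM2r// addr_ge0.
Qed.

End Scalar.
End Ck.

(** * Functions with Lipschitz derivative, with constants *)

Section C11.
Context {R : realType}.

Definition nball (V : normedModType R) (p : V) (r : R) : set V := [set x | `|x - p| < r].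

(** The derivative is part of the data, and the last clause compares increments
    of f with the derivative at an arbitrary third point: this is what second
    differences of flows require, and it is stable under products and inverses. *)
Record c11 (V : normedModType R) (S : set V) (f : V -> R) (df : V -> V -> R) (K : R)
  : Prop := C11Data {
  c11_K : 0 <= K ;
  c11_lin : forall p, S p -> forall a u v, df p (a *: u + v) = a * df p u + df p v ;
  c11_bd : forall p, S p -> `|f p| <= K ;
  c11_dbd : forall p v, S p -> `|df p v| <= K * `|v| ;
  c11_lip : forall x y, S x -> S y -> `|f x - f y| <= K * `|x - y| ;
  c11_est : forall x y p, S x -> S y -> S p ->
    `|f x - f y - df p (x - y)| <= K * (`|x - p| + `|y - p|) * `|x - y| }.

Definition C11 (V : normedModType R) (S : set V) (f : V -> R) :=
  exists df K, c11 S f df K.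

Section Closure.
Context {V : normedModType R}.
Implicit Types (S : set V) (f g : V -> R).

Lemma c11_weaken S f df (K L : R) : K <= L -> c11 S f df K -> c11 S f df L.
Proof.
move=> KL [K0 l b d lp e]; split => //; first exact: le_trans KL.
- by move=> p Sp; exact: le_trans (b p Sp) KL.
- by move=> p v Sp; apply: le_trans (d p v Sp) _; rewrite ler_wpM2r.
- by move=> x y Sx Sy; apply: le_trans (lp x y Sx Sy) _; rewrite ler_wpM2r.
- move=> x y p Sx Sy Sp; apply: le_trans (e x y p Sx Sy Sp) _.
  by rewrite ler_wpM2r// ler_wpM2r// addr_ge0.
Qed.

Lemma C11_sub S S' f : S' `<=` S -> C11 S f -> C11 S' f.
Proof.
move=> sub [df [K [K0 l b d lp e]]]; exists df, K; split => //.
- by move=> p /sub; exact: l.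
- by move=> p /sub; exact: b.
- by move=> p v /sub; exact: d.
- by move=> x y /sub ? /sub; exact: lp.
- by move=> x y p /sub ? /sub ? /sub; exact: e.
Qed.

Lemma C11_ext S f g : (forall x, S x -> f x = g x) -> C11 S f -> C11 S g.
Proof.
move=> fg [df [K [K0 l b d lp e]]]; exists df, K; split => //.
- by move=> p Sp; rewrite -fg//; exact: b.
- by move=> x y Sx Sy; rewrite -!fg//; exact: lp.
- by move=> x y p Sx Sy Sp; rewrite -!fg//; exact: e.
Qed.

Lemma C11_cst S (c : R) : C11 S (fun=> c).
Proof.
exists (fun _ _ => 0), `|c|; split => //.
- by move=> *; rewrite mulr0 addr0.
- by move=> *; rewrite normr0 mulr_ge0.
- by move=> *; rewrite subrr normr0 mulr_ge0.
- by move=> *; rewrite subrr subr0 normr0 !mulr_ge0// addr_ge0.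
Qed.

Lemma C11_linear S (l : V -> R) (B : R) :
  (forall a u v, l (a *: u + v) = a * l u + l v) -> (forall v, `|l v| <= `|v|) ->
  (forall x, S x -> `|x| <= B) -> C11 S l.
Proof.
move=> ll lb SB; exists (fun _ => l), (`|B| + 1).
have lB x y : l (x - y) = l x - l y by rewrite -scaleN1r addrC ll; lra.
have B1 := normr_ge0 B; have BB := ler_norm B.
have K0 : 0 <= `|B| + 1 by lra.
split => //.
- by move=> p Sp; apply: (le_trans (lb p)); have := SB p Sp; lra.
- by move=> p v _; apply: (le_trans (lb v)); rewrite ler_peMl//; lra.
- by move=> x y _ _; rewrite -lB; apply: (le_trans (lb _)); rewrite ler_peMl//; lra.
- by move=> x y p _ _ _; rewrite lB subrr normr0 !mulr_ge0// ?addr_ge0.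
Qed.

Lemma C11_add S f g : C11 S f -> C11 S g -> C11 S (fun x => f x + g x).
Proof.
move=> [df [K [K0 l b d lp e]]] [dg [L [L0 l' b' d' lp' e']]].
exists (fun p v => df p v + dg p v), (K + L); split; first exact: addr_ge0.
- by move=> p Sp a u v; rewrite l// l'//; ring.
- by move=> p Sp; rewrite (le_trans (ler_normD _ _))// lerD ?b ?b'.
- by move=> p v Sp; rewrite (le_trans (ler_normD _ _))// mulrDl lerD ?d ?d'.
- move=> x y Sx Sy; rewrite opprD addrACA (le_trans (ler_normD _ _))// mulrDl.
  by rewrite lerD ?lp ?lp'.
- move=> x y p Sx Sy Sp.
  rewrite (_ : _ - _ = (f x - f y - df p (x - y)) + (g x - g y - dg p (x - y))); last by ring.
  by rewrite (le_trans (ler_normD _ _))// !mulrDl -!mulrDl mulrDl mulrDl lerD// ?e ?e'.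
Qed.

Lemma C11_mul S f g : C11 S f -> C11 S g -> C11 S (fun x => f x * g x).
Proof.
move=> [df [K [K0 l b d lp e]]] [dg [L [L0 l' b' d' lp' e']]].
exists (fun p v => df p v * g p + f p * dg p v), (3 * (K * L)).
have KL0 : 0 <= K * L by exact: mulr_ge0.
split.
- by rewrite mulr_ge0.
- by move=> p Sp a u v; rewrite l// l'//; ring.
- move=> p Sp; rewrite normrM.
  apply: (@le_trans _ _ (K * L)); last by lra.
  by rewrite ler_pM// ?b ?b'.
- move=> p v Sp; apply: (le_trans (ler_normD _ _)); rewrite !normrM.
  have h1 : `|df p v| * `|g p| <= K * `|v| * L by rewrite ler_pM// ?d ?b'.
  have h2 : `|f p| * `|dg p v| <= K * (L * `|v|) by rewrite ler_pM// ?d' ?b.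
  have : 0 <= K * L * `|v| by rewrite mulr_ge0.
  lra.
- move=> x y Sx Sy.
  rewrite (_ : _ - _ = (f x - f y) * g x + f y * (g x - g y)); last by ring.
  apply: (le_trans (ler_normD _ _)); rewrite !normrM.
  have h1 : `|f x - f y| * `|g x| <= K * `|x - y| * L by rewrite ler_pM// ?lp ?b'.
  have h2 : `|f y| * `|g x - g y| <= K * (L * `|x - y|) by rewrite ler_pM// ?lp' ?b.
  have : 0 <= K * L * `|x - y| by rewrite mulr_ge0.
  lra.
- move=> x y p Sx Sy Sp; set D := x - y.
  rewrite (_ : _ - _ = (f x - f y - df p D) * g x + df p D * (g x - g p) +
     f y * (g x - g y - dg p D) + (f y - f p) * dg p D); last by ring.
  set A := `|x - p| + `|y - p|.
  have A0 : 0 <= A by exact: addr_ge0.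
  have h1 : `|f x - f y - df p D| * `|g x| <= (K * A * `|D|) * L.
    by rewrite ler_pM// ?e ?b'.
  have h2 : `|df p D| * `|g x - g p| <= (K * `|D|) * (L * `|x - p|).
    by rewrite ler_pM// ?d ?lp'.
  have h3 : `|f y| * `|g x - g y - dg p D| <= K * (L * A * `|D|).
    by rewrite ler_pM// ?b ?e'.
  have h4 : `|f y - f p| * `|dg p D| <= (K * `|y - p|) * (L * `|D|).
    by rewrite ler_pM// ?lp ?d'.
  have n1 := ler_normD ((f x - f y - df p D) * g x + df p D * (g x - g p) +
     f y * (g x - g y - dg p D)) ((f y - f p) * dg p D).
  have n2 := ler_normD ((f x - f y - df p D) * g x + df p D * (g x - g p))
     (f y * (g x - g y - dg p D)).
  have n3 := ler_normD ((f x - f y - df p D) * g x) (df p D * (g x - g p)).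
  rewrite (normrM (f y - f p)) (normrM (f y)) in n1 n2.
  rewrite (normrM (f x - _ - _)) (normrM (df _ _)) in n3.
  have -> : 3 * (K * L) * A * `|D| = (K * A * `|D|) * L + (K * `|D|) * (L * `|x - p|) +
     K * (L * A * `|D|) + (K * `|y - p|) * (L * `|D|) by rewrite /A; ring.
  apply: le_trans n1 _; apply: le_trans (lerD n2 (lexx _)) _.
  apply: le_trans (lerD (lerD n3 (lexx _)) (lexx _)) _.
  exact: lerD (lerD (lerD h1 h2) h3) h4.
Qed.

Lemma C11_opp S f : C11 S f -> C11 S (fun x => - f x).
Proof.
move=> h; apply: (@C11_ext _ (fun x => -1 * f x)) => [x _|]; first by rewrite mulN1r.
exact: C11_mul (C11_cst _ _) h.
Qed.

Lemma C11_sub_fun S f g : C11 S f -> C11 S g -> C11 S (fun x => f x - g x).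
Proof. by move=> hf hg; apply: C11_add hf (C11_opp hg). Qed.

Lemma C11_sum (I : Type) (r : seq I) (P : pred I) (F : I -> V -> R) S :
  (forall i, C11 S (F i)) -> C11 S (fun x => \sum_(i <- r | P i) F i x).
Proof.
move=> HF; elim: r => [|i r IH].
  by apply: (@C11_ext _ (fun=> 0)) => [x _|]; [rewrite big_nil|exact: C11_cst].
apply: (@C11_ext _ (fun x => (if P i then F i x else 0) + \sum_(j <- r | P j) F j x)).
  by move=> x _; rewrite big_cons; case: ifP => // _; rewrite add0r.
by apply: C11_add => //; case: (P i) => //; exact: C11_cst.
Qed.

Lemma C11_prod (I : Type) (r : seq I) (P : pred I) (F : I -> V -> R) S :
  (forall i, C11 S (F i)) -> C11 S (fun x => \prod_(i <- r | P i) F i x).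
Proof.
move=> HF; elim: r => [|i r IH].
  by apply: (@C11_ext _ (fun=> 1)) => [x _|]; [rewrite big_nil|exact: C11_cst].
apply: (@C11_ext _ (fun x => (if P i then F i x else 1) * \prod_(j <- r | P j) F j x)).
  by move=> x _; rewrite big_cons; case: ifP => // _; rewrite mul1r.
by apply: C11_mul => //; case: (P i) => //; exact: C11_cst.
Qed.

Lemma C11_inv S f (c : R) : 0 < c -> (forall x, S x -> c <= `|f x|) ->
  C11 S f -> C11 S (fun x => (f x)^-1).
Proof.
move=> c0 fc [df [K [K0 l b d lp e]]].
have f0 x : S x -> f x != 0.
  by move=> Sx; rewrite -normr_gt0; exact: lt_le_trans (fc x Sx).
have fi x : S x -> `|(f x)^-1| <= c^-1.
  by move=> Sx; rewrite normfV lef_pV2 ?posrE ?normr_gt0 ?f0// fc.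
have c1 : 0 < c^-1 by rewrite invr_gt0.
set k := c^-1 in fi c1 *.
have k2 : 0 <= k * k by rewrite mulr_ge0// ltW.
have Kk : 0 <= K * (k * k) by rewrite mulr_ge0.
have Kk3 : 0 <= K * (k * k) * (K * K * (k * k)) by rewrite !mulr_ge0// ltW.
exists (fun p v => - df p v * ((f p)^-1 * (f p)^-1)),
  (k + K * (k * k) + K * (k * k) * (K * K * (k * k))); split; first by lra.
- by move=> p Sp a u v; rewrite l//; ring.
- by move=> p Sp; apply: (le_trans (fi p Sp)); lra.
- move=> p v Sp; rewrite !normrM normrN.
  have h : `|(f p)^-1| * `|(f p)^-1| <= k * k by rewrite ler_pM// fi.
  have h1 : `|df p v| * (`|(f p)^-1| * `|(f p)^-1|) <= K * `|v| * (k * k).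
    by rewrite ler_pM// ?mulr_ge0// d.
  apply: (le_trans h1); rewrite mulrAC ler_wpM2r//; lra.
- move=> x y Sx Sy.
  rewrite (_ : _ - _ = (f y - f x) * ((f x)^-1 * (f y)^-1)); last by field; rewrite f0// f0.
  rewrite !normrM.
  have h : `|(f x)^-1| * `|(f y)^-1| <= k * k by rewrite ler_pM// fi.
  have h1 : `|f y - f x| * (`|(f x)^-1| * `|(f y)^-1|) <= K * `|x - y| * (k * k).
    by rewrite ler_pM// ?mulr_ge0// distrC lp.
  apply: (le_trans h1); rewrite mulrAC ler_wpM2r//; lra.
- move=> x y p Sx Sy Sp; set D := x - y; set A := `|x - p| + `|y - p|.
  have A0 : 0 <= A by exact: addr_ge0.
  rewrite (_ : _ - _ = - ((f x - f y - df p D) * ((f x)^-1 * (f y)^-1)) -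
      df p D * ((f p * (f p - f x) + f x * (f p - f y)) *
      (((f x)^-1 * (f y)^-1) * ((f p)^-1 * (f p)^-1)))); last first.
    by field; rewrite !f0.
  have hxy : `|(f x)^-1 * (f y)^-1| <= k * k by rewrite normrM ler_pM// fi.
  have hpp : `|(f p)^-1 * (f p)^-1| <= k * k by rewrite normrM ler_pM// fi.
  have h1 : `|(f x - f y - df p D) * ((f x)^-1 * (f y)^-1)| <= K * A * `|D| * (k * k).
    by rewrite normrM ler_pM// e.
  have h2 : `|f p * (f p - f x) + f x * (f p - f y)| <= K * K * A.
    apply: (le_trans (ler_normD _ _)); rewrite !normrM.
    have g1 : `|f p| * `|f p - f x| <= K * (K * `|x - p|).
      by rewrite ler_pM// ?b// distrC lp.
    have g2 : `|f x| * `|f p - f y| <= K * (K * `|y - p|).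
      by rewrite ler_pM// ?b// distrC lp.
    by rewrite /A mulrDr -!mulrA lerD.
  have h3 : `|df p D * ((f p * (f p - f x) + f x * (f p - f y)) *
      (((f x)^-1 * (f y)^-1) * ((f p)^-1 * (f p)^-1)))| <=
      K * `|D| * (K * K * A * ((k * k) * (k * k))).
    rewrite normrM ler_pM// ?d// normrM ler_pM// normrM ler_pM//.
  apply: (le_trans (ler_normB _ _)); rewrite normrN.
  apply: (le_trans (lerD h1 h3)).
  rewrite (_ : _ + _ = (K * (k * k) + K * (k * k) * (K * K * (k * k))) * A * `|D|); last by ring.
  by rewrite ler_wpM2r// ler_wpM2r//; lra.
Qed.

End Closure.

Lemma C11_comp_linear (V V' : normedModType R) (S : set V) (S' : set V')
    (A : {linear V' -> V}) (f : V -> R) :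
  (forall v, `|A v| <= `|v|) -> (forall x, S' x -> S (A x)) -> C11 S f ->
  C11 S' (fun x => f (A x)).
Proof.
move=> Ab SA [df [K [K0 l b d lp e]]].
exists (fun p v => df (A p) (A v)), K; split => //.
- by move=> p Sp a u v; rewrite linearP l//; exact: SA.
- by move=> p Sp; apply: b; exact: SA.
- by move=> p v Sp; apply: (le_trans (d _ _ (SA _ Sp))); rewrite ler_wpM2l.
- by move=> x y Sx Sy; apply: (le_trans (lp _ _ (SA _ Sx) (SA _ Sy))); rewrite -linearB ler_wpM2l.
- move=> x y p Sx Sy Sp; rewrite linearB.
  apply: (le_trans (e _ _ _ (SA _ Sx) (SA _ Sy) (SA _ Sp))).
  rewrite -!linearB ler_pM//; first by rewrite mulr_ge0// addr_ge0.
  by rewrite ler_wpM2l// lerD.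
Qed.

Section Matrix.
Context {V : normedModType R} (S : set V).

Lemma C11_det k (A : V -> 'M[R]_k) :
  (forall i j, C11 S (fun x => A x i j)) -> C11 S (fun x => \det (A x)).
Proof.
move=> HA; rewrite /determinant; apply: C11_sum => s.
by apply: C11_mul; [exact: C11_cst|apply: C11_prod => i; exact: HA].
Qed.

Lemma C11_invmx k (A : V -> 'M[R]_k) (c : R) :
  0 < c -> (forall x, S x -> c <= `|\det (A x)|) ->
  (forall i j, C11 S (fun x => A x i j)) -> forall i j, C11 S (fun x => invmx (A x) i j).
Proof.
move=> c0 Hc HA i j.
apply: (@C11_ext _ _ (fun x => (\det (A x))^-1 * cofactor (A x) j i)) => [x Sx|].
  rewrite /invmx unitmxE unitfE -normr_gt0 (lt_le_trans c0 (Hc x Sx)).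
  by rewrite !mxE.
apply: C11_mul; first exact: (C11_inv c0 Hc (C11_det HA)).
rewrite /cofactor; apply: C11_mul; first exact: C11_cst.
apply: C11_det => a b.
by apply: (@C11_ext _ _ (fun x => A x (lift j a) (lift i b))) => [x _|//]; rewrite !mxE.
Qed.

End Matrix.

(** All components share the constant, as the Gronwall estimates need. *)
Record c11v (V : normedModType R) m (S : set V) (f : V -> 'rV[R]_m)
    (df : V -> V -> 'rV[R]_m) (K : R) : Prop := C11vData {
  c11v_K : 0 <= K ;
  c11v_lin : forall p, S p -> forall a u v, df p (a *: u + v) = a *: df p u + df p v ;
  c11v_bd : forall p, S p -> `|f p| <= K ;
  c11v_dbd : forall p v, S p -> `|df p v| <= K * `|v| ;
  c11v_lip : forall x y, S x -> S y -> `|f x - f y| <= K * `|x - y| ;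
  c11v_est : forall x y p, S x -> S y -> S p ->
    `|f x - f y - df p (x - y)| <= K * (`|x - p| + `|y - p|) * `|x - y| }.

Lemma C11_vec (V : normedModType R) m (S : set V) (f : V -> 'rV[R]_m) :
  (forall j, C11 S (fun x => f x ord0 j)) -> exists df K, c11v S f df K.
Proof.
move=> /choice[df /choice[K HK]].
have [L [L0 HL]] := bounded_family K.
have KL j : K j <= L by exact: le_trans (ler_norm _) (HL j).
have {}HK j := c11_weaken (KL j) (HK j).
exists (fun p v => \row_j df j p v), L; split => //.
- by move=> p Sp a u v; apply/rowP => j; rewrite !mxE (c11_lin (HK j)).
- by move=> p Sp; apply: norm_le_row => // j; exact: (c11_bd (HK j)).
- move=> p v Sp; apply: norm_le_row => [|j]; first by rewrite mulr_ge0.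
  by rewrite mxE; exact: (c11_dbd (HK j)).
- move=> x y Sx Sy; apply: norm_le_row => [|j]; first by rewrite mulr_ge0.
  by rewrite !mxE; exact: (c11_lip (HK j)).
- move=> x y p Sx Sy Sp; apply: norm_le_row => [|j].
    by rewrite !mulr_ge0// addr_ge0.
  by rewrite !mxE; exact: (c11_est (HK j)).
Qed.

End C11.

(** * Short-time flows *)

Section Picard.
Context {R : realType} {m : nat}.
Implicit Types (G : 'rV[R]_m -> 'rV[R]_m) (v : R -> 'rV[R]_m).

Lemma is_deriveBv v1 v2 (t : R) d1 d2 : is_derive t 1 v1 d1 -> is_derive t 1 v2 d2 ->
  is_derive t 1 (fun s => v1 s - v2 s) (d1 - d2).
Proof. by move=> h1 h2; exact: (@is_deriveB _ _ _ v1 v2 t 1 d1 d2 h1 h2). Qed.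

Lemma is_deriveDv v1 v2 (t : R) d1 d2 : is_derive t 1 v1 d1 -> is_derive t 1 v2 d2 ->
  is_derive t 1 (fun s => v1 s + v2 s) (d1 + d2).
Proof. by move=> h1 h2; exact: (@is_deriveD _ _ _ v1 v2 t 1 d1 d2 h1 h2). Qed.

Lemma is_deriveZv v (t c : R) d : is_derive t 1 v d ->
  is_derive t 1 (fun s => c *: v s) (c *: d).
Proof. by move=> h1; exact: (@is_deriveZ _ _ _ v c t 1 d h1). Qed.

Lemma is_derive_cstaddv (Z : 'rV[R]_m) v (t : R) d : is_derive t 1 v d ->
  is_derive t 1 (fun s => Z + v s) d.
Proof.
move=> h; have h0 := is_derive_cst Z t (1 : R).
by have := is_deriveDv h0 h; rewrite add0r.
Qed.

Definition prim v : R -> 'rV[R]_m :=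
  xget (fun=> 0) [set F | F 0 = 0 /\ forall t : R, is_derive t 1 F (v t)].

Lemma primP v : continuous v ->
  prim v 0 = 0 /\ forall t : R, is_derive t 1 (prim v) (v t).
Proof.
move=> cv; rewrite /prim; case: xgetP => [F _ //|H].
by have [F HF] := primitive_vec cv; have := H F.
Qed.

Lemma half_pow_small (c e : R) : 0 < e -> exists k, c * 2^-1 ^+ k < e.
Proof.
move=> e0.
have : (fun k => c * 2^-1 ^+ k) @ \oo --> (c * 0 : R).
  by apply: cvgM; [exact: cvg_cst|apply: cvg_expr; rewrite ger0_norm ?invr_ge0//; lra].
rewrite mulr0 => /cvgrPdist_lt/(_ _ e0)[N _ HN].
exists N; have := HN N (leqnn N); rewrite /= sub0r normrN; exact: le_lt_trans (ler_norm _).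
Qed.

Lemma le_half_pow (a b c : R) : (forall k, a <= b + c * 2^-1 ^+ k) -> a <= b.
Proof.
move=> H; apply/ler_addgt0Pr => e e0; have [k hk] := half_pow_small c e0.
by apply: le_trans (H k) _; rewrite lerD2l ltW.
Qed.

Lemma lipschitz_continuous (v : R -> 'rV[R]_m) (K : R) : 0 <= K ->
  (forall s t, `|v s - v t| <= K * `|s - t|) -> continuous v.
Proof.
move=> K0 H t; apply: ex_cont => e e0.
exists (e / (K + 1)); split; first by rewrite divr_gt0//; lra.
move=> s hs; apply: le_trans (H s t) _; apply: (@le_trans _ _ (K * (e / (K + 1)))).
  by rewrite ler_wpM2l// ltW.
rewrite mulrCA ler_piMr ?ltW// ltr_pdivrMr; lra.
Qed.

Lemma comp_lipschitz_continuous G v (K : R) : 0 <= K ->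
  (forall x y, `|G x - G y| <= K * `|x - y|) -> continuous v -> continuous (G \o v).
Proof.
move=> K0 H cv t; apply: ex_cont => e e0.
have e1 : 0 < e / (K + 1) by rewrite divr_gt0//; lra.
have [r [r0 Hr]] := cont_ex (cv t) e1.
exists r; split => // s /Hr hs; apply: le_trans (H _ _) _.
apply: (@le_trans _ _ (K * (e / (K + 1)))).
  by rewrite ler_wpM2l// ltW.
rewrite mulrCA ler_piMr ?ltW// ltr_pdivrMr; lra.
Qed.

Definition clamp (A t : R) : R := Num.max (- A) (Num.min A t).

Lemma clampP (A t : R) : 0 <= A -> [\/ t < - A /\ clamp A t = - A,
  A < t /\ clamp A t = A | - A <= t <= A /\ clamp A t = t].
Proof.
move=> A0; rewrite /clamp.
have [h1|h1] := ltP t (- A).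
  by apply: Or31; split => //; rewrite min_r ?max_l//; lra.
have [h2|h2] := ltP A t.
  by apply: Or32; split => //; rewrite max_r//; lra.
by apply: Or33; rewrite max_r// h1 h2.
Qed.

Lemma clamp_bound (A t : R) : 0 <= A -> `|clamp A t| <= A.
Proof. by move=> A0; rewrite ler_norml; case: (clampP t A0) => -[h ->]; lra. Qed.

Lemma clamp_id (A t : R) : `|t| <= A -> clamp A t = t.
Proof.
move=> tA; have A0 : 0 <= A by exact: le_trans tA.
move: tA; rewrite ler_norml => h; case: (clampP t A0) => -[h' ->]; lra.
Qed.

Lemma clamp_lip (A s t : R) : 0 <= A -> `|clamp A s - clamp A t| <= `|s - t|.
Proof.
move=> A0; case: (clampP s A0) => -[h1 ->]; case: (clampP t A0) => -[h2 ->];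
  rewrite ler_norml; case: (ger0P (s - t)) => h3; lra.
Qed.

(** Picard iterates converge geometrically because K A is at most one half.  The
    limit is defined by clamping time to [-A, A], which makes it a continuous
    function on the whole line, so that it has a primitive. *)
Lemma picard G (K A : R) (Z0 : 'rV[R]_m) : 0 <= K -> 0 < A -> K * A <= 2^-1 ->
  (forall Z, `|G Z| <= K) -> (forall x y, `|G x - G y| <= K * `|x - y|) ->
  exists X : R -> 'rV[R]_m, X 0 = Z0 /\
    forall t : R, `|t| <= A -> is_derive t 1 X (G (X t)).
Proof.
move=> K0 A0 KA GK GL; have A0' := ltW A0.
pose Phi v := fun t => Z0 + prim (G \o v) t.
pose x k := iter k Phi (fun=> Z0).
have cx k : continuous (x k).
  elim: k => [|k IH] t; first exact: cst_continuous.
  have [_ h] := primP (comp_lipschitz_continuous K0 GL IH).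
  exact: is_derive_continuous (is_derive_cstaddv Z0 (h t)).
have Px k := primP (comp_lipschitz_continuous K0 GL (cx k)).
have dx k (t : R) : is_derive t 1 (x k.+1) (G (x k t)).
  have -> : x k.+1 = Phi (x k) by [].
  have h := (Px k).2 t.
  exact: (is_derive_cstaddv Z0 h).
have x0 k : x k 0 = Z0 by case: k => // k; rewrite /x iterS /Phi (Px k).1 addr0.
pose C := K * A; have C0 : 0 <= C by rewrite mulr_ge0.
have n0A : `|0 : R| <= A by rewrite normr0.
have stepd k t : `|t| <= A -> `|x k.+1 t - x k t| <= C * 2^-1 ^+ k.
  elim: k t => [|k IH] t tA.
    rewrite expr0 mulr1 [x 0%N t]/= -(x0 1%N).
    apply: (le_trans (@vec_le_const_sym _ _ _ _ K 0 t A n0A tA (fun s _ => dx 0%N s) _)).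
      by move=> s _; exact: GK.
    by rewrite subr0 ler_wpM2l.
  have dd (s : R) : `|s| <= A -> is_derive s 1 (fun s => x k.+2 s - x k.+1 s)
      (G (x k.+1 s) - G (x k s)) by move=> _; exact: (is_deriveBv (dx _ s) (dx _ s)).
  have Kk : forall s : R, `|s| <= A -> `|G (x k.+1 s) - G (x k s)| <= K * (C * 2^-1 ^+ k).
    by move=> s sA; apply: (le_trans (GL _ _)); rewrite ler_wpM2l// IH.
  have := @vec_le_const_sym _ _ _ _ _ 0 t A n0A tA dd Kk.
  rewrite !x0 subrr !subr0 => h; apply: (le_trans h).
  apply: (@le_trans _ _ (K * (C * 2^-1 ^+ k) * A)); first by rewrite ler_wpM2l// !mulr_ge0.
  rewrite exprS; have : (K * A) * (C * 2^-1 ^+ k) <= 2^-1 * (C * 2^-1 ^+ k).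
    by rewrite ler_wpM2r// mulr_ge0.
  lra.
have far k n t : `|t| <= A -> `|x (k + n)%N t - x k t| <= 2 * C * 2^-1 ^+ k - 2 * C * 2^-1 ^+ (k + n).
  move=> tA; elim: n => [|n IH]; first by rewrite addn0 !subrr normr0.
  have h := stepd (k + n)%N t tA.
  rewrite addnS -(subrK (x (k + n)%N t) (x (k + n).+1 t)) -addrA.
  apply: (le_trans (ler_normD _ _)); apply: (le_trans (lerD h IH)).
  by rewrite exprS; lra.
(* Geometric series: the iterates are Cauchy on [-A, A]. *)
have lim_ex t : exists l, `|t| <= A -> forall k, `|l - x k t| <= 2 * C * 2^-1 ^+ k.
  have [tA|tA] := lerP `|t| A; last by exists 0.
  have pw k : 0 <= 2 * C * 2^-1 ^+ k by rewrite !mulr_ge0.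
  have cu : cvg ((fun k => x k t) @ \oo).
    apply/cauchy_cvgP/cauchy_exP => e e0.
    have [k hk] := half_pow_small (2 * C) e0; exists (x k t); exists k => // n /= kn.
    rewrite /= -ball_normE/= distrC -(subnKC kn).
    apply: le_lt_trans (far _ _ _ tA) _; have := pw (k + (n - k))%N; lra.
  exists (lim ((fun k => x k t) @ \oo)) => _ k.
  apply/ler_addgt0Pr => e e0.
  have /cvgrPdist_lt/(_ _ e0)[N _ HN] := cu.
  have h1 := HN (k + N)%N (leq_addl _ _).
  have h2 := far k N t tA.
  rewrite -(subrK (x (k + N)%N t) (lim _)) -addrA.
  apply: (le_trans (ler_normD _ _)); have := pw (k + N)%N; rewrite /= in h1; lra.
have [v Hv] := choice lim_ex.
have vlip s t : `|s| <= A -> `|t| <= A -> `|v s - v t| <= K * `|s - t|.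
  move=> sA tA; apply: (@le_half_pow _ _ (4 * C)) => k.
  have h1 := Hv s sA k; have h2 := Hv t tA k.
  have h3 : `|x k s - x k t| <= K * `|s - t|.
    case: k {h1 h2} => [|k]; first by rewrite /x/= subrr normr0 mulr_ge0.
    by apply: (@vec_le_const_sym _ _ _ _ K t s A tA sA (fun s _ => dx k s)) => r _; exact: GK.
  rewrite (_ : v s - v t = (v s - x k s) + (x k s - x k t) - (v t - x k t)); last first.
    by apply/rowP => j; rewrite !mxE; ring.
  apply: (le_trans (ler_normB _ _)); apply: (le_trans (lerD (ler_normD _ _) (lexx _))).
  lra.
pose w t := v (clamp A t).
have cw : continuous w.
  apply: (lipschitz_continuous K0) => s t; rewrite /w.
  apply: (le_trans (vlip _ _ (clamp_bound _ A0') (clamp_bound _ A0'))).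
  by rewrite ler_wpM2l// clamp_lip.
have [P0 dP] := primP (comp_lipschitz_continuous K0 GL cw).
set P := prim _ in P0 dP.
have vP t : `|t| <= A -> v t = Z0 + P t.
  move=> tA; apply/eqP; rewrite -subr_eq0 -normr_eq0 eq_le normr_ge0 andbT.
  apply: (@le_half_pow _ _ (4 * C)) => k; rewrite add0r.
  have dd (s : R) : `|s| <= A -> is_derive s 1 (fun s => x k.+1 s - (Z0 + P s)) (G (x k s) - G (w s)).
    by move=> _; exact: (is_deriveBv (dx k s) (is_derive_cstaddv Z0 (dP s))).
  have Kk : forall s : R, `|s| <= A -> `|G (x k s) - G (w s)| <= K * (2 * C * 2^-1 ^+ k).
    move=> s sA; apply: (le_trans (GL _ _)); rewrite ler_wpM2l//.
    by rewrite /w clamp_id// distrC; exact: Hv.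
  have := @vec_le_const_sym _ _ _ _ _ 0 t A n0A tA dd Kk.
  rewrite P0 addr0 x0 subrr !subr0 => h.
  have h' : `|x k.+1 t - (Z0 + P t)| <= C * 2^-1 ^+ k.
    apply: (le_trans h); apply: (@le_trans _ _ (K * (2 * C * 2^-1 ^+ k) * A)).
      by rewrite ler_wpM2l// !mulr_ge0.
    have : (K * A) * (2 * C * 2^-1 ^+ k) <= 2^-1 * (2 * C * 2^-1 ^+ k).
      by rewrite ler_wpM2r// !mulr_ge0.
    lra.
  have h2 := Hv t tA k.+1; rewrite exprS in h2.
  rewrite -(subrK (x k.+1 t) (v t)) -addrA.
  apply: (le_trans (ler_normD _ _)).
  have : 0 <= C * 2^-1 ^+ k by rewrite mulr_ge0.
  lra.
exists (fun t => Z0 + P t); split; first by rewrite P0 addr0.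
move=> t tA; rewrite -(vP t tA).
have -> : v t = w t by rewrite /w clamp_id.
exact: (is_derive_cstaddv Z0 (dP t)).
Qed.

(** Gronwall for short times, without exponentials: the supremum of |D| is at most
    |D 0| plus half of itself plus the forcing term. *)
Lemma ode_apriori (D dD : R -> 'rV[R]_m) (k e A : R) : 0 <= k -> 0 <= e -> 0 <= A ->
  k * A <= 2^-1 ->
  (forall t : R, `|t| <= A -> is_derive t 1 D (dD t)) ->
  (forall t : R, `|t| <= A -> `|dD t| <= k * `|D t| + e) ->
  forall t : R, `|t| <= A -> `|D t| <= 2 * (`|D 0| + A * e) /\
    `|D t - D 0| <= A * (2 * k * (`|D 0| + A * e) + e).
Proof.
move=> k0 e0 A0 kA HD Hb.
have AA : - A <= A by lra.
have inA (t : R) : t \in `[- A, A]%R -> `|t| <= A by rewrite in_itv/= ler_norml.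
have cD : {within `[- A, A], continuous (fun t => `|D t|)}.
  apply: continuous_in_subspaceT => t; rewrite inE/= => /inA tA.
  apply: (@continuous_comp _ _ _ D (fun x => `|x|)); last exact: norm_continuous.
  exact: is_derive_continuous (HD t tA).
have [c /inA cA Hc] := EVT_max AA cD.
have n0A : `|0 : R| <= A by rewrite normr0.
have M0 : 0 <= `|D c| by [].
set M := `|D c| in Hc M0.
have HM : forall t : R, `|t| <= A -> `|dD t| <= k * M + e.
  move=> t tA; apply: (le_trans (Hb t tA)); rewrite lerD2r ler_wpM2l// Hc//.
  by rewrite in_itv/= -ler_norml.
have kM : 0 <= k * M + e by rewrite addr_ge0// mulr_ge0.
have Hd t : `|t| <= A -> `|D t - D 0| <= A * (k * M + e).
  move=> tA; apply: (le_trans (@vec_le_const_sym _ _ _ _ _ 0 t A n0A tA HD HM)).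
  by rewrite subr0 mulrC ler_wpM2r.
have MM : M <= 2 * (`|D 0| + A * e).
  have h := Hd c cA.
  have : M <= `|D c - D 0| + `|D 0|.
    by rewrite /M -{1}(subrK (D 0) (D c)) ler_normD.
  have : (k * A) * M <= 2^-1 * M by rewrite ler_wpM2r.
  lra.
move=> t tA; split.
  by apply: le_trans MM; apply: Hc; rewrite in_itv/= -ler_norml.
apply: (le_trans (Hd t tA)); rewrite ler_wpM2l// lerD2r.
have := ler_wpM2l k0 MM; lra.
Qed.

Section Flow.
Variables (H : 'rV[R]_m -> 'rV[R]_m) (dH : 'rV[R]_m -> 'rV[R]_m -> 'rV[R]_m).
Variables (Zs : 'rV[R]_m) (r K A : R).
Hypotheses (r0 : 0 < r) (A0 : 0 < A) (cH : c11v (nball Zs r) H dH K).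
Hypotheses (KA : K * A <= 16^-1) (KAr : K * A <= r / 8).

Let K0 : 0 <= K. Proof. exact: c11v_K cH. Qed.

Definition solves (X : R -> 'rV[R]_m) := forall t : R, `|t| <= A ->
  is_derive t 1 X (H (X t)) /\ nball Zs r (X t).

(** Clamping the coordinates extends the field to a bounded Lipschitz field on the
    whole space; its integral curves stay in the half ball, where it is the
    original one, since they have speed at most K during a time at most A. *)
Lemma flow_exists Z0 : `|Z0 - Zs| < r / 4 ->
  exists X : R -> 'rV[R]_m, [/\ X 0 = Z0, solves X &
    forall t : R, `|t| <= A -> `|X t - Z0| <= K * A /\ `|X t - Zs| < r / 2].
Proof.
have [r0' A0' KA' KAr'] := And4 r0 A0 KA KAr.
move=> Z0r.
(* Clamping retracts the space onto the closed ball of radius r / 2 without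
   increasing distances. *)
pose cl (Z : 'rV[R]_m) : 'rV[R]_m := Zs + \row_j clamp (r / 2) (Z ord0 j - Zs ord0 j).
have r2 : 0 <= r / 2 by rewrite divr_ge0// ltW.
have clb Z : nball Zs r (cl Z).
  rewrite /nball/= /cl addrAC subrr add0r; apply: (@le_lt_trans _ _ (r / 2)); last by lra.
  by apply: norm_le_row => // j; rewrite mxE clamp_bound.
have cll Z Z' : `|cl Z - cl Z'| <= `|Z - Z'|.
  apply: norm_le_row => // j; rewrite !mxE [_ + clamp _ _]addrC addrKA.
  apply: (le_trans (clamp_lip _ _ r2)).
  rewrite (_ : _ - _ = (Z - Z') ord0 j); last by rewrite !mxE; ring.
  exact: coord_le_norm.
have cli Z : `|Z - Zs| <= r / 2 -> cl Z = Z.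
  move=> h; apply/rowP => j; rewrite !mxE clamp_id; first by ring.
  by have := le_trans (coord_le_norm (Z - Zs) ord0 j) h; rewrite !mxE.
have KA2 : K * A <= 2^-1 by lra.
have GK Z : `|H (cl Z)| <= K by exact: c11v_bd cH _ (clb Z).
have GL x y : `|H (cl x) - H (cl y)| <= K * `|x - y|.
  by apply: (le_trans (c11v_lip cH (clb x) (clb y))); rewrite ler_wpM2l.
have [X [X0 dX]] := picard Z0 K0 A0 KA2 GK GL.
have n0A : `|0 : R| <= A by rewrite normr0 ltW.
have Xd t : `|t| <= A -> `|X t - Z0| <= K * A.
  move=> tA; rewrite -X0.
  apply: (le_trans (@vec_le_const_sym _ _ _ _ K 0 t A n0A tA dX (fun s _ => GK _))).
  by rewrite subr0 ler_wpM2l.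
have Xr t : `|t| <= A -> `|X t - Zs| < r / 2.
  move=> tA; have := Xd t tA; have := ler_normD (X t - Z0) (Z0 - Zs).
  by rewrite addrA subrK; lra.
exists X; split => // t tA; last by split; [exact: Xd|exact: Xr].
split; last by rewrite /nball/=; have := Xr t tA; lra.
by have := dX t tA; rewrite cli//; exact/ltW/Xr.
Qed.

(** The difference of two solutions moves by at most one eighth of its initial
    value: flows over a time A are close to translations. *)
Lemma flow_diff X Y : solves X -> solves Y -> forall t : R, `|t| <= A ->
  `|X t - Y t| <= 2 * `|X 0 - Y 0| /\
  `|(X t - Y t) - (X 0 - Y 0)| <= 8^-1 * `|X 0 - Y 0|.
Proof.
have [r0' A0' KA' KAr'] := And4 r0 A0 KA KAr.
move=> sX sY t tA.
have HD (s : R) : `|s| <= A -> is_derive s 1 (fun s => X s - Y s) (H (X s) - H (Y s)).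
  by move=> sA; exact: (is_deriveBv (sX s sA).1 (sY s sA).1).
have Hb (s : R) : `|s| <= A -> `|H (X s) - H (Y s)| <= K * `|X s - Y s| + 0.
  by move=> sA; rewrite addr0; have h := c11v_lip cH (sX s sA).2 (sY s sA).2; exact: h.
have KA2 : K * A <= 2^-1 by lra.
have [h1 h2] := ode_apriori K0 (lexx 0) (ltW A0) KA2 HD Hb tA.
rewrite mulr0 !addr0 in h1 h2; split => //; apply: (le_trans h2).
have : (K * A) * `|X 0 - Y 0| <= 16^-1 * `|X 0 - Y 0| by rewrite ler_wpM2r.
lra.
Qed.

(** This replaces differentiability of the flow in the initial data.  The combined
    difference D solves the equation linearized along Xc, up to an error which is
    rho times the size of the two differences, by the estimate of c11 at the third
    point Xc. *)
Lemma flow_diff2 Xc X1 Y1 X2 Y2 (a1 a2 rho L1 L2 : R) :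
  solves Xc -> solves X1 -> solves Y1 -> solves X2 -> solves Y2 ->
  `|X1 0 - Xc 0| <= rho -> `|Y1 0 - Xc 0| <= rho ->
  `|X2 0 - Xc 0| <= rho -> `|Y2 0 - Xc 0| <= rho ->
  `|a1| * `|X1 0 - Y1 0| <= L1 -> `|a2| * `|X2 0 - Y2 0| <= L2 ->
  let D t := a1 *: (X1 t - Y1 t) - a2 *: (X2 t - Y2 t) in
  forall t : R, `|t| <= A -> `|D t - D 0| <= 8^-1 * `|D 0| + rho * (L1 + L2).
Proof.
have [r0' A0' KA' KAr'] := And4 r0 A0 KA KAr.
move=> sc s1 t1 s2 t2 r1 u1 r2 u2 l1 l2 D.
have rho0 : 0 <= rho by exact: le_trans r1.
have L10 : 0 <= L1 by apply: le_trans l1; rewrite mulr_ge0.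
have L20 : 0 <= L2 by apply: le_trans l2; rewrite mulr_ge0.
pose dD t := a1 *: (H (X1 t) - H (Y1 t)) - a2 *: (H (X2 t) - H (Y2 t)).
have HD (s : R) : `|s| <= A -> is_derive s 1 D (dD s).
  move=> sA; exact: (is_deriveBv
    (is_deriveZv a1 (is_deriveBv (s1 s sA).1 (t1 s sA).1))
    (is_deriveZv a2 (is_deriveBv (s2 s sA).1 (t2 s sA).1))).
pose e := 8 * K * rho * (L1 + L2).
have e0 : 0 <= e by rewrite /e !mulr_ge0// addr_ge0.
(* The estimate of c11 at the third point Xc; the factors 2 come from flow_diff. *)
have est X Y (a L : R) s : solves X -> solves Y -> `|s| <= A ->
    `|X 0 - Xc 0| <= rho -> `|Y 0 - Xc 0| <= rho -> `|a| * `|X 0 - Y 0| <= L ->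
    `|a *: (H (X s) - H (Y s) - dH (Xc s) (X s - Y s))| <= 8 * K * rho * L.
  move=> sX sY sA hX hY hL; rewrite normrZ.
  have g1 := (flow_diff sX sc sA).1; have g2 := (flow_diff sY sc sA).1.
  have g3 := (flow_diff sX sY sA).1.
  have g4 := c11v_est cH (sX s sA).2 (sY s sA).2 (sc s sA).2.
  have g5 : K * (`|X s - Xc s| + `|Y s - Xc s|) * `|X s - Y s| <=
      K * (4 * rho) * (2 * `|X 0 - Y 0|).
    rewrite ler_pM//; first by rewrite mulr_ge0// addr_ge0.
    by rewrite ler_wpM2l//; lra.
  apply: (@le_trans _ _ (`|a| * (K * (4 * rho) * (2 * `|X 0 - Y 0|)))).
    by rewrite ler_wpM2l// (le_trans g4).
  have : (8 * K * rho) * (`|a| * `|X 0 - Y 0|) <= (8 * K * rho) * L.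
    by rewrite ler_wpM2l// !mulr_ge0.
  lra.
have dHB p (u v : 'rV[R]_m) : nball Zs r p -> dH p (u - v) = dH p u - dH p v.
  by move=> Sp; rewrite -scaleN1r addrC (c11v_lin cH Sp) scaleN1r addrC.
have dHZ p a u : nball Zs r p -> dH p (a *: u) = a *: dH p u.
  move=> Sp; have dH0 : dH p 0 = 0 by have := dHB p 0 0 Sp; rewrite !subrr.
  by rewrite -[a *: u]addr0 (c11v_lin cH Sp) dH0 addr0.
have Hb (s : R) : `|s| <= A -> `|dD s| <= K * `|D s| + e.
  move=> sA; have Sc := (sc s sA).2.
  have E : dD s = dH (Xc s) (D s) +
     (a1 *: (H (X1 s) - H (Y1 s) - dH (Xc s) (X1 s - Y1 s)) -
      a2 *: (H (X2 s) - H (Y2 s) - dH (Xc s) (X2 s - Y2 s))).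
    rewrite /dD /D (dHB _ (a1 *: (X1 s - Y1 s)) (a2 *: (X2 s - Y2 s)) Sc) !(dHZ _ _ _ Sc) !scalerBr.
    set u1' := a1 *: H _; set u2' := a1 *: H _; set u3 := a2 *: H _; set u4 := a2 *: H _.
    by apply/rowP => j; rewrite !mxE; ring.
  rewrite E; apply: (le_trans (ler_normD _ _)); apply: lerD; first exact: (c11v_dbd cH (D s) Sc).
  apply: (le_trans (ler_normB _ _)).
  have := est X1 Y1 a1 L1 s s1 t1 sA r1 u1 l1.
  have := est X2 Y2 a2 L2 s s2 t2 sA r2 u2 l2.
  rewrite /e mulrDr; lra.
have KA2 : K * A <= 2^-1 by lra.
move=> t tA; have [_ h2] := ode_apriori K0 e0 (ltW A0) KA2 HD Hb tA.
apply: (le_trans h2).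
have h3 : (K * A) * `|D 0| <= 16^-1 * `|D 0| by rewrite ler_wpM2r.
have h4 : (K * A) * (A * e) <= 16^-1 * (A * e) by rewrite ler_wpM2r// mulr_ge0// ltW.
have h5 : (K * A) * (8 * rho * (L1 + L2)) <= 16^-1 * (8 * rho * (L1 + L2)).
  by rewrite ler_wpM2r// !mulr_ge0// addr_ge0.
have rL : 0 <= rho * (L1 + L2) by rewrite mulr_ge0// addr_ge0.
have Ae : A * e = (K * A) * (8 * rho * (L1 + L2)) by rewrite /e; ring.
rewrite mulrDr (_ : A * (2 * K * (`|D 0| + A * e)) = 2 * (K * A * `|D 0|) + 2 * (K * A * (A * e))); last by ring.
rewrite Ae in h4 *; lra.
Qed.

End Flow.
End Picard.

(** * Bilinear forms *)

Section Gram.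
Context {R : realType} {n : nat}.
Implicit Types (G : 'M[R]_n) (u v w : 'rV[R]_n).

Lemma gram_mulE G u v : gram G u v = (u *m G *m v^T) ord0 ord0.
Proof. by []. Qed.

Lemma gramE G u v : gram G u v = \sum_a \sum_b u ord0 a * G a b * v ord0 b.
Proof.
rewrite /gram !mxE exchange_big/=; apply: eq_bigr => b _.
by rewrite !mxE mulr_suml.
Qed.

Lemma gramDl G u1 u2 v : gram G (u1 + u2) v = gram G u1 v + gram G u2 v.
Proof. by rewrite /gram !mulmxDl mxE. Qed.
Lemma gramDr G u v1 v2 : gram G u (v1 + v2) = gram G u v1 + gram G u v2.
Proof. by rewrite /gram linearD/= mulmxDr mxE. Qed.
Lemma gramZl G c u v : gram G (c *: u) v = c * gram G u v.
Proof. by rewrite /gram -!scalemxAl mxE. Qed.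
Lemma gramZr G c u v : gram G u (c *: v) = c * gram G u v.
Proof. by rewrite /gram linearZ/= -scalemxAr mxE. Qed.
Lemma gramNl G u v : gram G (- u) v = - gram G u v.
Proof. by rewrite -scaleN1r gramZl mulN1r. Qed.
Lemma gramNr G u v : gram G u (- v) = - gram G u v.
Proof. by rewrite -scaleN1r gramZr mulN1r. Qed.
Lemma gramBl G u1 u2 v : gram G (u1 - u2) v = gram G u1 v - gram G u2 v.
Proof. by rewrite gramDl gramNl. Qed.
Lemma gramBr G u v1 v2 : gram G u (v1 - v2) = gram G u v1 - gram G u v2.
Proof. by rewrite gramDr gramNr. Qed.
Lemma gram0l G v : gram G 0 v = 0.
Proof. by rewrite -(scale0r 0) gramZl mul0r. Qed.
Lemma gram0r G v : gram G v 0 = 0.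
Proof. by rewrite -(scale0r 0) gramZr mul0r. Qed.
Lemma gramMD G1 G2 u v : gram (G1 + G2) u v = gram G1 u v + gram G2 u v.
Proof. by rewrite /gram mulmxDr mulmxDl mxE. Qed.
Lemma gramMZ G (c : R) u v : gram (c *: G) u v = c * gram G u v.
Proof. by rewrite /gram -scalemxAr -scalemxAl mxE. Qed.
Lemma gramMB G1 G2 u v : gram (G1 - G2) u v = gram G1 u v - gram G2 u v.
Proof. by rewrite gramMD -scaleN1r gramMZ mulN1r. Qed.

Lemma gram_sym G u v : G^T = G -> gram G u v = gram G v u.
Proof.
move=> GT; rewrite /gram -[in LHS](trmxK (u *m G *m v^T)) mxE.
by rewrite !trmx_mul trmxK GT mulmxA.
Qed.

Lemma gram_le (G : 'M[R]_n) (K : R) u v : 0 <= K -> (forall a b, `|G a b| <= K) ->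
  `|gram G u v| <= n%:R * n%:R * K * `|u| * `|v|.
Proof.
move=> K0 HG; rewrite gramE; apply: (le_trans (ler_norm_sum _ _ _)).
apply: (@le_trans _ _ (\sum_(a < n) \sum_(b < n) (K * `|u| * `|v|))); last first.
  by rewrite !sum_cst_ord !mulrA.
apply: ler_sum => a _; apply: (le_trans (ler_norm_sum _ _ _)); apply: ler_sum => b _.
rewrite !normrM; apply: ler_pM => //; last exact: coord_le_norm.
by rewrite mulrC ler_pM//; exact: coord_le_norm.
Qed.

Lemma posdef_unit G : (forall u, u != 0 -> 0 < gram G u u) -> G \in unitmx.
Proof.
move=> Gpos; rewrite -row_free_unit -kermx_eq0; apply/rowV0P => v /sub_kermxP vG0.
apply/eqP; apply: contraT => v0; have := Gpos v v0.
by rewrite /gram vG0 mul0mx mxE ltxx.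
Qed.

(** Identities between vectors, such as the transformation rule of Christoffel
    symbols, are proved by pairing with an arbitrary vector. *)
Lemma gram_inj G u v : G \in unitmx -> (forall w, gram G u w = gram G v w) -> u = v.
Proof.
move=> GU H; have : (u - v) *m G = 0.
  apply/rowP => j; have := H (delta_mx ord0 j).
  move/eqP; rewrite -subr_eq0 -gramBl => /eqP; rewrite /gram.
  by rewrite trmx_delta -colE !mxE.
move=> /(congr1 (mulmx^~ (invmx G))); rewrite mulmxK// mul0mx => /eqP.
by rewrite subr_eq0 => /eqP.
Qed.

Lemma is_derive_mul (f g : R -> R) (t a b : R) :
  is_derive t 1 f a -> is_derive t 1 g b ->
  is_derive t 1 (fun s => f s * g s) (a * g t + f t * b).
Proof.
move=> h1 h2; have := @is_deriveM _ _ f g t 1 _ _ h1 h2.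
rewrite /GRing.scale/= => h; rewrite addrC (mulrC a); exact: h.
Qed.

Lemma is_derive_add (f g : R -> R) (t a b : R) :
  is_derive t 1 f a -> is_derive t 1 g b ->
  is_derive t 1 (fun s => f s + g s) (a + b).
Proof. by move=> h1 h2; exact: (@is_deriveD _ _ _ f g t 1 _ _ h1 h2). Qed.

Lemma is_derive_sumf (I : Type) (r : seq I) (f : I -> R -> R) (t : R) (d : I -> R) :
  (forall i, is_derive t 1 (f i) (d i)) ->
  is_derive t 1 (fun s => \sum_(i <- r) f i s) (\sum_(i <- r) d i).
Proof.
move=> H; elim: r => [|i r IH].
  rewrite big_nil; have -> : (fun s => \sum_(i <- [::]) f i s) = cst 0.
    by apply/funext => s; rewrite big_nil.
  exact: is_derive_cst.
rewrite big_cons; have -> : (fun s => \sum_(i <- i :: r) f i s) =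
    (fun s => f i s + \sum_(i <- r) f i s).
  by apply/funext => s; rewrite big_cons.
exact: (is_derive_add (H i) IH).
Qed.

Lemma is_derive_gram (G : R -> 'M[R]_n) (a b : R -> 'rV[R]_n) (t : R) G' a' b' :
  is_derive t 1 G G' -> is_derive t 1 a a' -> is_derive t 1 b b' ->
  is_derive t 1 (fun s => gram (G s) (a s) (b s))
    (gram G' (a t) (b t) + gram (G t) a' (b t) + gram (G t) (a t) b').
Proof.
move=> hG ha hb.
have -> : (fun s => gram (G s) (a s) (b s)) =
    (fun s => \sum_i \sum_j a s ord0 i * G s i j * b s ord0 j).
  by apply/funext => s; rewrite gramE.
have -> : gram G' (a t) (b t) + gram (G t) a' (b t) + gram (G t) (a t) b' =
  \sum_i \sum_j ((a' ord0 i * G t i j + a t ord0 i * G' i j) * b t ord0 j +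
     a t ord0 i * G t i j * b' ord0 j).
  rewrite !gramE -!big_split/=; apply: eq_bigr => i _; rewrite -!big_split/=.
  by apply: eq_bigr => j _; ring.
apply: is_derive_sumf => i; apply: is_derive_sumf => j.
apply: is_derive_mul; last exact: (is_derive_coord ord0 j hb).
by apply: is_derive_mul; [exact: (is_derive_coord ord0 i ha)|exact: (is_derive_coord i j hG)].
Qed.

Lemma C11_gram (V : normedModType R) (S : set V) (G : V -> 'M[R]_n) (u v : V -> 'rV[R]_n) :
  (forall a b, C11 S (fun z => G z a b)) -> (forall a, C11 S (fun z => u z ord0 a)) ->
  (forall a, C11 S (fun z => v z ord0 a)) -> C11 S (fun z => gram (G z) (u z) (v z)).
Proof.
move=> hG hu hv.
apply: (@C11_ext _ _ _ (fun z => \sum_a \sum_b u z ord0 a * G z a b * v z ord0 b)).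
  by move=> z _; rewrite gramE.
by apply: C11_sum => a; apply: C11_sum => b; apply: C11_mul => //; apply: C11_mul.
Qed.

End Gram.

(** * Strict derivatives and the Schwarz theorem *)

Section Strict.
Context {R : realType} {n : nat}.

Lemma is_derive_epsP (W : normedModType R) (x : R -> W) (t : R) (d : W) :
  is_derive t 1 x d <-> forall e : R, 0 < e -> exists r : R, 0 < r /\
    forall s, `|s - t| < r -> `|x s - x t - (s - t) *: d| <= e * `|s - t|.
Proof.
split=> [[dx <-] e e0|H].
  have := dx; rewrite /derivable => /cvgrPdist_le/(_ _ e0)/dnbhs0_ex[r [r0 Hr]].
  exists r; split => // s sr.
  have [->|st] := eqVneq s t; first by rewrite !subrr scale0r subr0 !normr0 mulr0.
  have st0 : s - t != 0 by rewrite subr_eq0.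
  have := Hr _ sr st0; rewrite -/('D_1 x t) /= [(s - t)%:A]mulr1 subrK => h.
  have -> : x s - x t - (s - t) *: 'D_1 x t =
     - ((s - t) *: ('D_1 x t - (s - t)^-1 *: (x s - x t))).
    by rewrite scalerBr scalerA mulfV// scale1r opprB.
  by rewrite normrN normrZ mulrC ler_wpM2r.
have L : (fun h : R => h^-1 *: ((x \o shift t) (h *: 1) - x t)) @ 0^' --> d.
  apply/cvgrPdist_le => e e0; apply/dnbhs0_ex; have [r [r0 Hr]] := H e e0.
  exists r; split => // h hr h0; have := Hr (h + t); rewrite addrK => /(_ hr) h1.
  rewrite /= [h%:A]mulr1.
  have -> : d - h^-1 *: (x (h + t) - x t) = - (h^-1 *: (x (h + t) - x t - h *: d)).
    by rewrite [in RHS]scalerBr scalerA mulVf// scale1r opprB.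
  by rewrite normrN normrZ normfV mulrC ler_pdivrMr ?normr_gt0.
by split; [apply/cvg_ex; exists d|exact/cvg_lim].
Qed.

(** The strict derivative: one estimate for all pairs of points near t.  A curve
    with a strict derivative at every point is C^1, and strict derivatives are
    what difference quotients give when they are Cauchy. *)
Definition sder (W : normedModType R) (x : R -> W) (t : R) (d : W) :=
  forall e : R, 0 < e -> exists r : R, 0 < r /\
    forall a b, `|a - t| < r -> `|b - t| < r ->
      `|x a - x b - (a - b) *: d| <= e * `|a - b|.

Lemma sder_is_derive (W : normedModType R) (x : R -> W) (t : R) (d : W) :
  sder x t d -> is_derive t 1 x d.
Proof.
move=> H; apply/is_derive_epsP => e e0; have [r [r0 Hr]] := H e e0.
by exists r; split => // s sr; apply: Hr => //; rewrite subrr normr0.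
Qed.

Lemma Ck1_dbound (U : set 'rV[R]_n) (f : 'rV[R]_n -> R^o) p : open U -> Ck 1 U f -> U p ->
  exists L : R, 0 <= L /\ forall v, `|'D_v f p| <= L * `|v|.
Proof.
move=> oU Cf Up.
have [S [S0 HS]] := @bounded_family R _ (fun j : 'I_n => 'D_(delta_mx ord0 j) f p).
exists (n%:R * S); split; first by rewrite mulr_ge0.
move=> v; rewrite (derive_dir_sum _ oU Cf Up).
apply: (le_trans (ler_norm_sum _ _ _)).
apply: (@le_trans _ _ (\sum_(j < n) S * `|v|)); last first.
  by rewrite sum_cst_ord mulrA.
by apply: ler_sum => k _; rewrite normrM mulrC ler_pM//; exact: coord_le_norm.
Qed.

Lemma derive_dirB (U : set 'rV[R]_n) (f : 'rV[R]_n -> R^o) p u v : open U -> Ck 1 U f -> U p ->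
  'D_(u - v) f p = 'D_u f p - 'D_v f p.
Proof.
move=> oU Cf Up; rewrite (derive_dirD _ _ oU Cf Up) -scaleN1r.
by rewrite (derive_dirZ _ _ Cf Up) mulN1r.
Qed.

Lemma strict_comp (U : set 'rV[R]_n) (f : 'rV[R]_n -> R^o) p d (e : R) :
  open U -> Ck 1 U f -> U p -> 0 < e ->
  exists r e2 : R, [/\ 0 < r, 0 < e2 & forall x1 x2 (h : R),
    `|x1 - p| < r -> `|x2 - p| < r -> `|x1 - x2 - h *: d| <= e2 * `|h| ->
    `|f x1 - f x2 - h * 'D_d f p| <= e * `|h|].
Proof.
move=> oU Cf Up e0; have [L [L0 HL]] := Ck1_dbound oU Cf Up.
pose e1 := e / (2 * (`|d| + 1)).
have d0 := normr_ge0 d.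
have e1p : 0 < e1 by rewrite divr_gt0//; lra.
have [r [r0 Hr]] := Ck1_strict oU Cf Up e1p.
pose e2 := Num.min 1 (e / (2 * (L + 1))).
have e2p : 0 < e2 by rewrite lt_min ltr01 divr_gt0//; lra.
exists r, e2; split => // x1 x2 h r1 r2 hx.
have h0 := normr_ge0 h.
have n12 : `|x1 - x2| <= (`|d| + 1) * `|h|.
  have -> : x1 - x2 = (x1 - x2 - h *: d) + h *: d by rewrite subrK.
  apply: (le_trans (ler_normD _ _)); rewrite normrZ.
  have : e2 * `|h| <= 1 * `|h| by rewrite ler_wpM2r// /e2 ge_min lexx.
  lra.
have g1 := Hr _ _ r1 r2.
have g2 : `|'D_(x1 - x2 - h *: d) f p| <= L * (e2 * `|h|).
  by apply: (le_trans (HL _)); rewrite ler_wpM2l.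
rewrite (derive_dirB _ _ oU Cf Up) (derive_dirZ _ _ Cf Up) in g2.
have g3 : e1 * `|x1 - x2| <= e / 2 * `|h|.
  apply: (@le_trans _ _ (e1 * ((`|d| + 1) * `|h|))); first by rewrite ler_wpM2l// ltW.
  rewrite mulrA ler_wpM2r// /e1 invfM !mulrA -mulrA mulVf ?mulr1//; lra.
have g4 : L * (e2 * `|h|) <= e / 2 * `|h|.
  rewrite mulrA ler_wpM2r//.
  apply: (@le_trans _ _ ((L + 1) * (e / (2 * (L + 1))))).
    by apply: ler_pM => //; [exact: ltW|lra|rewrite /e2 ge_min lexx orbT].
  by have L1 : L + 1 != 0 by [apply: lt0r_neq0; lra]; rewrite le_eqVlt (_ : _ == _ = true)//; apply/eqP; field.
set Df := 'D_(x1 - x2) f p in g1 g2; set Dd := 'D_d f p in g2 *.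
rewrite (_ : f x1 - f x2 - h * Dd = (f x1 - f x2 - Df) + (Df - h * Dd)); last by ring.
apply: (le_trans (ler_normD _ _)).
apply: (le_trans (lerD (le_trans g1 g3) (le_trans g2 g4))); lra.
Qed.

Lemma sder_near (W : normedModType R) (x : R -> W) (t : R) (d : W) (r : R) : sder x t d -> 0 < r ->
  exists s : R, 0 < s /\ forall a, `|a - t| < s -> `|x a - x t| < r.
Proof.
move=> /sder_is_derive/is_derive_continuous cx r0.
exact: (cont_ex cx r0).
Qed.

Lemma sder_comp_scalar (U : set 'rV[R]_n) (f : 'rV[R]_n -> R^o) (x : R -> 'rV[R]_n) (t : R) d :
  open U -> Ck 1 U f -> U (x t) -> sder x t d -> sder (fun s => f (x s)) t ('D_d f (x t)).
Proof.
move=> oU Cf Ux sx e e0.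
have [r [e2 [r0 e20 H]]] := strict_comp d oU Cf Ux e0.
have [r1 [r10 H1]] := sx e2 e20; have [r2 [r20 H2]] := sder_near sx r0.
exists (Num.min r1 r2); split; first by rewrite lt_min r10.
move=> a b; rewrite !lt_min => /andP[a1 a2] /andP[b1 b2].
by apply: H; [exact: H2|exact: H2|exact: H1].
Qed.

Lemma is_derive_comp_scalar (U : set 'rV[R]_n) (f : 'rV[R]_n -> R^o) (x : R -> 'rV[R]_n) (t : R) d :
  open U -> Ck 1 U f -> U (x t) -> is_derive t 1 x d ->
  is_derive t 1 (fun s => f (x s)) ('D_d f (x t)).
Proof.
move=> oU Cf Ux sx; apply/is_derive_epsP => e e0.
have [r [e2 [r0 e20 H]]] := strict_comp d oU Cf Ux e0.
have [r1 [r10 H1]] := (is_derive_epsP _ _ _).1 sx e2 e20.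
have [r2 [r20 H2]] := cont_ex (is_derive_continuous sx) r0.
exists (Num.min r1 r2); split; first by rewrite lt_min r10.
move=> a; rewrite !lt_min => /andP[a1 a2].
by apply: H; [exact: H2|rewrite subrr normr0|exact: H1].
Qed.

Lemma sder_mx k l (x : R -> 'M[R]_(k, l)) (t : R) (d : 'M[R]_(k, l)) :
  (forall i j, sder (fun s => x s i j) t (d i j)) -> sder x t d.
Proof.
move=> H e e0.
have /choice[g Hg] : forall ij : 'I_k * 'I_l, exists r : R, 0 < r /\
    forall a b, `|a - t| < r -> `|b - t| < r ->
      `|x a ij.1 ij.2 - x b ij.1 ij.2 - (a - b) *: d ij.1 ij.2| <= e * `|a - b|.
  by move=> ij; exact: H.
exists (\big[Num.min/1]_ij g ij); split.
  by apply: lt_bigmin => // ij _; exact: (Hg ij).1.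
move=> a b ar br; apply: norm_le_coord => [|i j]; first by rewrite mulr_ge0// ltW.
rewrite !mxE; apply: (Hg (i, j)).2; [apply: lt_le_trans ar _|apply: lt_le_trans br _];
  exact: bigmin_le.
Qed.

Lemma sder_comp k l (U : set 'rV[R]_n) (f : 'rV[R]_n -> 'M[R]_(k, l)) (x : R -> 'rV[R]_n) (t : R) d :
  open U -> Ck 1 U f -> U (x t) -> sder x t d -> sder (fun s => f (x s)) t ('D_d f (x t)).
Proof.
move=> oU Cf Ux sx; apply: sder_mx => i j.
rewrite derive_mx; last exact: Cf.1.
by rewrite mxE; exact: (sder_comp_scalar oU (Ck_coord i j oU Cf) Ux sx).
Qed.

Lemma is_derive_comp k l (U : set 'rV[R]_n) (f : 'rV[R]_n -> 'M[R]_(k, l)) (x : R -> 'rV[R]_n) (t : R) d :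
  open U -> Ck 1 U f -> U (x t) -> is_derive t 1 x d ->
  is_derive t 1 (fun s => f (x s)) ('D_d f (x t)).
Proof.
move=> oU Cf Ux sx; apply: is_derive_mx => i j.
rewrite derive_mx; last exact: Cf.1.
by rewrite mxE; exact: (is_derive_comp_scalar oU (Ck_coord i j oU Cf) Ux sx).
Qed.

Lemma derive_mx_linear k l (U : set 'rV[R]_n) (f : 'rV[R]_n -> 'M[R]_(k, l)) p (c : R) u v :
  open U -> Ck 1 U f -> U p -> 'D_(c *: u + v) f p = c *: 'D_u f p + 'D_v f p.
Proof.
move=> oU Cf Up; rewrite !derive_mx; try exact: Cf.1.
apply/matrixP => i j; rewrite !mxE.
exact: (derive_dir_linear _ _ _ oU (Ck_coord i j oU Cf) Up).
Qed.

Lemma derive_mx_sum k l (U : set 'rV[R]_n) (f : 'rV[R]_n -> 'M[R]_(k, l)) p v :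
  open U -> Ck 1 U f -> U p -> 'D_v f p = \sum_j v ord0 j *: 'D_(delta_mx ord0 j) f p.
Proof.
move=> oU Cf Up; rewrite derive_mx; last exact: Cf.1.
apply/matrixP => i j; rewrite summxE mxE (derive_dir_sum _ oU (Ck_coord i j oU Cf) Up).
by apply: eq_bigr => a _; rewrite mxE derive_mx ?mxE//; exact: Cf.1.
Qed.

(** The second difference over a parallelogram of side s is compared with s^2
    times the mixed derivative, through the mean value theorem in one direction. *)
Lemma mixed_difference (U : set 'rV[R]_n) (f : 'rV[R]_n -> R^o) p u w (e : R) : open U ->
  Ck 1 U f -> Ck 2 U f -> U p -> 0 < e -> exists r : R, 0 < r /\ forall s, 0 < s < r ->
   `|f (p + s *: u + s *: w) - f (p + s *: u) - (f (p + s *: w) - f p)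
     - s * s * 'D_u ('D_w f) p| <= e * (s * s).
Proof.
move=> oU Cf1 Cf Up e0; have [df cf] := Cf.
have [r0 [r0p Hr0]] := open_ball_ex oU Up.
pose B := `|u| + `|w| + 1; have u0 := normr_ge0 u; have w0 := normr_ge0 w.
have B0 : 0 < B by rewrite /B; lra.
pose e1 := e / B; have e1p : 0 < e1 by rewrite divr_gt0.
have [r1 [r1p H1]] := Ck1_strict oU (cf w) Up e1p.
exists (Num.min r0 r1 / B); split; first by rewrite divr_gt0// lt_min r0p.
move=> s /andP[s0]; rewrite ltr_pdivlMr// => sB.
have near1 q : 0 <= q <= 1 -> `|p + s *: u + q *: (s *: w) - p| < Num.min r0 r1.
  move=> /andP[q0 q1]; apply: le_lt_trans sB.
  rewrite addrAC (addrC p) addrK scalerA mulrC -scalerA -scalerDr normrZ (gtr0_norm s0).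
  rewrite ler_wpM2l ?(ltW s0)// (le_trans (ler_normD _ _))// normrZ (ger0_norm q0) /B.
  have : q * `|w| <= 1 * `|w| by rewrite ler_wpM2r.
  lra.
have near2 q : 0 <= q <= 1 -> `|p + q *: (s *: w) - p| < Num.min r0 r1.
  move=> /andP[q0 q1]; apply: le_lt_trans sB.
  rewrite addrAC subrr add0r !normrZ (gtr0_norm s0) (ger0_norm q0).
  rewrite mulrCA ler_wpM2l ?(ltW s0)// /B.
  have : q * `|w| <= 1 * `|w| by rewrite ler_wpM2r.
  lra.
(* The increment of phi over [0, 1] is the second difference, and dphi is a
   difference of derivatives in the direction w, which is estimated strictly. *)
pose phi (q : R) := f (p + s *: u + q *: (s *: w)) - f (p + q *: (s *: w)).
pose dphi (q : R) := 'D_(s *: w) f (p + s *: u + q *: (s *: w)) - 'D_(s *: w) f (p + q *: (s *: w)).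
have U1 q : 0 <= q <= 1 -> U (p + s *: u + q *: (s *: w)).
  by move=> /near1; rewrite lt_min => /andP[/Hr0].
have U2 q : 0 <= q <= 1 -> U (p + q *: (s *: w)).
  by move=> /near2; rewrite lt_min => /andP[/Hr0].
have dp (q : R) : 0 <= q <= 1 -> is_derive q 1 phi (dphi q).
  move=> q01.
  have h1 := is_derive_line (df _ (s *: w) (U1 q q01)).
  have h2 := is_derive_line (df _ (s *: w) (U2 q q01)).
  exact: (@is_deriveB _ _ _ _ _ q 1 _ _ h1 h2).
have [||q] := @MVT_segment R phi dphi 0 1 ler01.
- by move=> q; rewrite in_itv/= => /andP[/ltW q0 /ltW q1]; apply: dp; rewrite q0.
- apply: derivable_within_continuous => q; rewrite in_itv/= => q01.
  by case: (dp q q01).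
rewrite in_itv/= => q01; rewrite /phi /dphi !scale1r !scale0r !addr0 subr0 mulr1.
have Uq1 := U1 q q01; have Uq2 := U2 q q01.
rewrite !(derive_dirZ _ _ Cf1)// => E.
rewrite (_ : f (p + s *: u + s *: w) - f (p + s *: u) - (f (p + s *: w) - f p) =
   f (p + s *: u + s *: w) - f (p + s *: w) - (f (p + s *: u) - f p)); last by ring.
rewrite E.
have b1 := near1 q q01; have b2 := near2 q q01.
rewrite !lt_min in b1 b2; move: b1 b2 => /andP[_ b1] /andP[_ b2].
have := H1 _ _ b1 b2.
have -> : p + s *: u + q *: (s *: w) - (p + q *: (s *: w)) = s *: u.
  by apply/rowP => j; rewrite !mxE; ring.
rewrite (derive_dirZ _ _ (cf w) Up) normrZ (gtr0_norm s0) => h.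
rewrite -mulrBr -mulrA -mulrBr normrM (gtr0_norm s0).
rewrite [leRHS]mulrCA ler_wpM2l ?(ltW s0)//.
apply: (le_trans h); rewrite mulrCA [leRHS]mulrC ler_wpM2l ?(ltW s0)//.
rewrite /e1 mulrAC ler_pdivrMr// ler_wpM2l ?(ltW e0)// /B; lra.
Qed.

(** The second difference is symmetric in the two directions. *)
Lemma schwarz (U : set 'rV[R]_n) (f : 'rV[R]_n -> R^o) p u w : open U -> Ck 1 U f -> Ck 2 U f ->
  U p -> 'D_u ('D_w f) p = 'D_w ('D_u f) p.
Proof.
move=> oU Cf1 Cf Up.
apply/eqP; rewrite -subr_eq0 -normr_eq0 eq_le normr_ge0 andbT.
apply/ler_addgt0Pr => e e0; rewrite add0r.
have e2 : 0 < e / 2 by rewrite divr_gt0.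
have [r1 [r1p H1]] := mixed_difference u w oU Cf1 Cf Up e2; have [r2 [r2p H2]] := mixed_difference w u oU Cf1 Cf Up e2.
pose s := Num.min r1 r2 / 2.
have m0 : 0 < Num.min r1 r2 by rewrite lt_min r1p.
have ms : s < Num.min r1 r2 by rewrite /s; lra.
have s0 : 0 < s by rewrite /s divr_gt0.
move: ms; rewrite lt_min => /andP[s1 s2].
have := H1 s; rewrite s0 s1 => /(_ isT) h1.
have := H2 s; rewrite s0 s2 => /(_ isT) h2.
have ss : 0 < s * s by rewrite mulr_gt0.
rewrite -(ler_pM2l ss) -[X in X * `|_|](gtr0_norm ss) -normrM.
rewrite [p + s *: w + s *: u]addrAC in h2.
move: h1 h2; set a := f _; set b := f _; set c := f _; set d := f p; set A := 'D_u _ p; set B := 'D_w _ p.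
move=> h1 h2.
rewrite (_ : s * s * (A - B) = (a - c - (b - d) - s * s * B) - (a - b - (c - d) - s * s * A)); last by ring.
apply: (le_trans (ler_normB _ _)).
have -> : s * s * e = e / 2 * (s * s) + e / 2 * (s * s) by rewrite -mulrDl -splitr mulrC.
exact: lerD h2 h1.
Qed.

End Strict.

(** * Calculus of matrix-valued functions *)

Section Prelim.
Context {R : realType} {n : nat}.

Lemma Ck1_continuous (U : set 'rV[R]_n) (f : 'rV[R]_n -> R^o) p :
  open U -> Ck 1 U f -> U p -> {for p, continuous f}.
Proof.
move=> oU Cf Up; have [L [L0 HL]] := Ck1_dbound oU Cf Up.
have [r [r0 Hr]] := Ck1_strict oU Cf Up ltr01.
apply: ex_cont => e e0; exists (Num.min r (e / (L + 1))).
have L1 : 0 < L + 1 by lra.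
split; first by rewrite lt_min r0 divr_gt0.
move=> y; rewrite lt_min => /andP[yr]; rewrite ltr_pdivlMr// => ye.
have := Hr y p yr; rewrite subrr normr0 => /(_ r0) h1.
have h2 := HL (y - p).
have h3 := norm_le_split h1 h2.
by apply: (le_trans h3); lra.
Qed.

Lemma Ck2_Ck1 (U : set 'rV[R]_n) (f : 'rV[R]_n -> R^o) : open U -> Ck 2 U f -> Ck 1 U f.
Proof.
by move=> oU [df cf]; split=> // v x Ux; exact: Ck1_continuous oU (cf v) Ux.
Qed.

Lemma Ck2_to_C11 (U : set 'rV[R]_n) (f : 'rV[R]_n -> R^o) p : open U -> Ck 2 U f -> U p ->
  exists r : R, [/\ 0 < r, nball p r `<=` U & exists K : R,
     c11 (nball p r) f (fun x v => 'D_v f x) K].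
Proof.
move=> oU Cf Up; have [r [K [r0 K0 rU [b d l e]]]] := Ck2_C11 oU Cf Up.
exists r; split => //; exists K; split => //.
by move=> q qr a u v; rewrite (derive_dir_linear _ _ _ oU (Ck2_Ck1 oU Cf) (rU _ qr)).
Qed.

Lemma nball_sub (p : 'rV[R]_n) (r r' : R) : r' <= r -> nball p r' `<=` nball p r.
Proof. by move=> rr x; rewrite /nball/= => h; exact: lt_le_trans rr. Qed.

Lemma radius_forall_mono (I : finType) (P : I -> R -> Prop) :
  (forall j, exists r : R, 0 < r /\ P j r) ->
  (forall j r r', 0 < r' -> r' <= r -> P j r -> P j r') ->
  exists r : R, 0 < r /\ forall j, P j r.
Proof.
move=> /choice[g Hg] mono; exists (\big[Num.min/1]_j g j).
have m0 : 0 < \big[Num.min/1]_j g j by apply: lt_bigmin => // j _; exact: (Hg j).1.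
split=> // j; apply: mono (Hg j).2 => //; exact: bigmin_le.
Qed.

Lemma gram_sumr (G : 'M[R]_n) u (I : Type) (r : seq I) (F : I -> 'rV[R]_n) :
  gram G u (\sum_(i <- r) F i) = \sum_(i <- r) gram G u (F i).
Proof. by rewrite (big_morph (gram G u) (gramDr G u) (gram0r G u)). Qed.

Lemma gram_Msum (I : Type) (r : seq I) (F : I -> 'M[R]_n) u v :
  gram (\sum_(i <- r) F i) u v = \sum_(i <- r) gram (F i) u v.
Proof.
have g0 : gram (0 : 'M[R]_n) u v = 0 by rewrite /gram mulmx0 mul0mx mxE.
by rewrite (big_morph (fun G => gram G u v) (fun A B => gramMD A B u v) g0).
Qed.

Lemma derive_dir_outer k l (U : set 'rV[R]_n) (f : 'rV[R]_n -> 'M[R]_(k, l)) p u a :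
  open U -> Ck 1 U f -> Ck 2 U f -> U p ->
  'D_a ('D_u f) p = \sum_j u ord0 j *: 'D_a ('D_(delta_mx ord0 j) f) p.
Proof.
move=> oU Cf1 Cf Up.
have E : \forall q \near p, 'D_u f q =
    (\sum_(j < n) (u ord0 j \*: 'D_(delta_mx ord0 j) f)) q.
  have := open_nbhs_nbhs (conj oU Up); apply: filterS => q Uq.
  by rewrite (derive_mx_sum _ oU Cf1 Uq) fct_sumE.
rewrite (near_eq_derive a E).
have d j : derivable (u ord0 j \*: 'D_(delta_mx ord0 j) f) p a.
  by apply: derivableZ; exact: (Cf.2 (delta_mx ord0 j)).1.
rewrite derive_sum//; apply: eq_bigr => j _; rewrite deriveZ//.
exact: (Cf.2 (delta_mx ord0 j)).1.
Qed.

Lemma is_derive_scalemx k l (f : R -> R) (g : R -> 'M[R]_(k, l)) (t a : R) b :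
  is_derive t 1 f a -> is_derive t 1 g b ->
  is_derive t 1 (fun s => f s *: g s) (a *: g t + f t *: b).
Proof.
move=> hf hg; apply: is_derive_mx => i j.
have -> : (fun s => (f s *: g s) i j) = (fun s => f s * g s i j).
  by apply/funext => s; rewrite mxE.
rewrite !mxE; exact: is_derive_mul hf (is_derive_coord i j hg).
Qed.

Lemma is_derive_summx k l (I : Type) (r : seq I) (f : I -> R -> 'M[R]_(k, l)) (t : R)
    (d : I -> 'M[R]_(k, l)) : (forall i, is_derive t 1 (f i) (d i)) ->
  is_derive t 1 (fun s => \sum_(i <- r) f i s) (\sum_(i <- r) d i).
Proof.
move=> H; apply: is_derive_mx => a b.
have -> : (fun s => (\sum_(i <- r) f i s) a b) = (fun s => \sum_(i <- r) f i s a b).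
  by apply/funext => s; rewrite summxE.
by rewrite summxE; apply: is_derive_sumf => i; exact: (is_derive_coord a b (H i)).
Qed.

Lemma is_derive_dir k l (U : set 'rV[R]_n) (f : 'rV[R]_n -> 'M[R]_(k, l))
    (x v : R -> 'rV[R]_n) (t : R) a b :
  open U -> Ck 1 U f -> Ck 2 U f -> U (x t) -> is_derive t 1 x a -> is_derive t 1 v b ->
  is_derive t 1 (fun s => 'D_(v s) f (x s)) ('D_b f (x t) + 'D_a ('D_(v t) f) (x t)).
Proof.
move=> oU Cf1 Cf Ux hx hv.
have nU : \forall s \near t, U (x s).
  have /= := is_derive_continuous hx; apply.
  exact: open_nbhs_nbhs (conj oU Ux).
apply: (@near_eq_is_derive _ _ _ (fun s => \sum_j v s ord0 j *: 'D_(delta_mx ord0 j) f (x s))).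
  by apply: filterS nU => s Us; rewrite (derive_mx_sum _ oU Cf1 Us).
have -> : 'D_b f (x t) + 'D_a ('D_(v t) f) (x t) =
    \sum_j (b ord0 j *: 'D_(delta_mx ord0 j) f (x t) +
            v t ord0 j *: 'D_a ('D_(delta_mx ord0 j) f) (x t)).
  by rewrite (derive_mx_sum _ oU Cf1 Ux) (derive_dir_outer _ _ oU Cf1 Cf Ux) -big_split.
apply: is_derive_summx => j; apply: is_derive_scalemx; first exact: (is_derive_coord ord0 j hv).
exact: (is_derive_comp oU (Cf.2 (delta_mx ord0 j)) Ux hx).
Qed.

Lemma schwarz_mx k l (U : set 'rV[R]_n) (f : 'rV[R]_n -> 'M[R]_(k, l)) p u w :
  open U -> Ck 1 U f -> Ck 2 U f -> U p -> 'D_u ('D_w f) p = 'D_w ('D_u f) p.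
Proof.
move=> oU Cf1 Cf Up; apply/matrixP => i j.
have E a : \forall q \near p, 'D_a f q i j = 'D_a (fun x => f x i j : R^o) q.
  have := open_nbhs_nbhs (conj oU Up); apply: filterS => q Uq.
  by rewrite derive_mx ?mxE//; exact: Cf1.1.
rewrite derive_mx; last exact: (Cf.2 w).1.
rewrite derive_mx; last exact: (Cf.2 u).1.
have h := schwarz u w oU (Ck_coord i j oU Cf1) (Ck_coord i j oU Cf) Up.
rewrite [LHS]mxE [RHS]mxE.
exact: (etrans (near_eq_derive u (E w)) (etrans h (esym (near_eq_derive w (E u))))).
Qed.

Lemma is_derive_affine (V : normedModType R) (p a : V) (t : R) :
  is_derive t 1 (fun s : R => p + s *: a) a.
Proof.
apply/is_derive_epsP => e e0; exists 1; split => // s _.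
have -> : p + s *: a - (p + t *: a) - (s - t) *: a = 0.
  by rewrite [p + _]addrC addrKA scalerBl subrr.
by rewrite normr0 mulr_ge0// ltW.
Qed.

End Prelim.

(** * Christoffel symbols and changes of charts *)

Lemma koszul_term {R : realFieldType} (a b c : R) :
  2^-1 * (a + a - b) * c = c * a - 2^-1 * (c * b).
Proof. by lra. Qed.

Lemma christoffel_trans_sum {R : realFieldType} (x y a b c c' d : R) :
  x = a + b + c -> y = d + c' + c -> c = c' -> x - 2^-1 * y = a - 2^-1 * d + b.
Proof. by move=> *; lra. Qed.

Section Chart.
Context {R : realType} {n : nat} (M : riemannianManifold R n).
Implicit Types (i j : atlas M) (p u v w : 'rV[R]_n).

Definition img i : set 'rV[R]_n := chart i @` dom i.
Definition overlap i j : set 'rV[R]_n := chart i @` (dom i `&` dom j).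
Definition trans i j := chart j \o (unchart i : 'rV[R]_n -> M).

Lemma img_open i : open (img i). Proof. exact: image_open. Qed.
Arguments img_open : clear implicits.

Lemma chart_img i (x : M) : dom i x -> img i (chart i x).
Proof. by move=> ?; exists x. Qed.

Lemma unchart_dom i p : img i p -> dom i (unchart i p).
Proof. by move=> [x dx <-]; rewrite chartK. Qed.

Lemma unchartK i p : img i p -> chart i (unchart i p) = p.
Proof. by move=> [x dx <-]; rewrite chartK. Qed.

Lemma overlapP i j p : overlap i j p <-> img i p /\ dom j (unchart i p).
Proof.
split=> [[x [di dj] <-]|[[x di <-]]]; first by rewrite chartK//; split => //; exists x.
by rewrite chartK// => dj; exists x.
Qed.

Lemma overlap_img i j : overlap i j `<=` img i.
Proof. by move=> p /overlapP[]. Qed.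

Lemma overlap_chart i j (x : M) : dom i x -> dom j x -> overlap i j (chart i x).
Proof. by move=> di dj; exists x. Qed.

Lemma overlap_open i j : open (overlap i j).
Proof.
rewrite openE => p Op; have [ip djp] := (overlapP _ _ _).1 Op.
have h1 : \forall q \near p, img i q by exact: open_nbhs_nbhs (conj (img_open i) ip).
have h2 : \forall q \near p, dom j (unchart i q).
  have := @unchart_continuous _ _ M i p ip; apply.
  exact: open_nbhs_nbhs (conj (dom_open j) djp).
rewrite /interior; apply: filterS2 h1 h2 => q h1 h2; exact/overlapP.
Qed.

Arguments overlap_open : clear implicits.

Lemma trans_Ck i j k : Ck k (overlap i j) (trans i j).
Proof. exact: transition_smooth. Qed.

Lemma metric_Ck i k : Ck k (img i) (metric i).
Proof. exact: metric_smooth. Qed.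

Lemma trans_img i j p : overlap i j p -> img j (trans i j p).
Proof. by move=> /overlapP[_ dj]; exists (unchart i p). Qed.

Lemma trans_chart i j (x : M) : dom i x -> trans i j (chart i x) = chart j x.
Proof. by move=> dx; rewrite /trans/= chartK. Qed.

Lemma metric_gram_trans i j p u v : overlap i j p ->
  gram (metric j (trans i j p)) ('D_u (trans i j) p) ('D_v (trans i j) p)
  = gram (metric i p) u v.
Proof. exact: metric_compat. Qed.

Lemma metric_unit i p : img i p -> metric i p \in unitmx.
Proof. by move=> ip; apply: posdef_unit => u u0; exact: metric_pos. Qed.

Lemma metric_gram_sym i p u v : img i p -> gram (metric i p) u v = gram (metric i p) v u.
Proof. by move=> ip; have h := Defs.metric_sym ip; exact: gram_sym. Qed.

Lemma metric_gram_ge0 i p u : img i p -> 0 <= gram (metric i p) u u.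
Proof.
move=> ip; have [->|u0] := eqVneq u 0; first by rewrite gram0l.
exact/ltW/metric_pos.
Qed.

(** Injectivity comes from compatibility with the metrics: the derivative of a
    transition map is an isometry. *)
Lemma dtrans_mx i j p : overlap i j p ->
  exists A : 'M[R]_n, A \in unitmx /\ forall v, 'D_v (trans i j) p = v *m A.
Proof.
move=> Op; pose A : 'M[R]_n := \matrix_(k < n) 'D_(delta_mx ord0 k) (trans i j) p.
have HA v : 'D_v (trans i j) p = v *m A.
  rewrite (derive_mx_sum _ (overlap_open i j) (trans_Ck i j 1) Op) mulmx_sum_row.
  by apply: eq_bigr => k _; rewrite rowK.
exists A; split => //.
rewrite -row_free_unit -kermx_eq0; apply/rowV0P => v /sub_kermxP vA0.
apply/eqP; apply: contraT => v0.
have := metric_pos (overlap_img Op) v0.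
by rewrite -(metric_gram_trans _ _ Op) HA vA0 gram0l ltxx.
Qed.

Lemma dtrans_surj i j p w : overlap i j p -> exists v, 'D_v (trans i j) p = w.
Proof.
move=> /dtrans_mx[A [AU HA]]; exists (w *m invmx A).
by rewrite HA mulmxKV.
Qed.

Lemma dmetric_sum i p u : img i p ->
  'D_u (metric i) p = \sum_k u ord0 k *: 'D_(delta_mx ord0 k) (metric i) p.
Proof. by move=> ip; exact: (derive_mx_sum _ (img_open i) (metric_Ck i 1) ip). Qed.

(** The Koszul formula on the diagonal, which is all that geodesics involve. *)
Lemma christoffel_gram i p u w : img i p ->
  gram (metric i p) (christoffel i p u u) w =
  gram ('D_u (metric i) p) u w - 2^-1 * gram ('D_w (metric i) p) u u.
Proof.
move=> ip; rewrite /christoffel {1}/gram mulmxKV ?metric_unit//.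
have e1 : gram ('D_u (metric i) p) u w =
    \sum_k w ord0 k * gram ('D_u (metric i) p) u (delta_mx ord0 k).
  by rewrite {1}(row_sum_delta w) gram_sumr; apply: eq_bigr => k _; exact: gramZr.
have e2 : gram ('D_w (metric i) p) u u =
    \sum_k w ord0 k * gram ('D_(delta_mx ord0 k) (metric i) p) u u.
  by rewrite (dmetric_sum w ip) gram_Msum; apply: eq_bigr => k _; exact: gramMZ.
rewrite mxE; apply: (etrans _ (congr2 (fun x y => x - 2^-1 * y) (esym e1) (esym e2))).
rewrite mulr_sumr -sumrB; apply: eq_bigr => k _; rewrite !mxE; exact: koszul_term.
Qed.

(** Differentiate the compatibility of the metrics along a line. *)
Lemma dmetric_trans i j p a b c : overlap i j p ->
  gram ('D_a (metric i) p) b c =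
  gram ('D_('D_a (trans i j) p) (metric j) (trans i j p))
      ('D_b (trans i j) p) ('D_c (trans i j) p)
  + gram (metric j (trans i j p)) ('D_a ('D_b (trans i j)) p) ('D_c (trans i j) p)
  + gram (metric j (trans i j p)) ('D_b (trans i j) p) ('D_a ('D_c (trans i j)) p).
Proof.
move=> Op; have oO := overlap_open i j; set tau := trans i j.
pose x (s : R) := p + s *: a.
have x0 : x 0 = p by rewrite /x scale0r addr0.
have dx : is_derive (0 : R) 1 x a by exact: is_derive_affine.
have Ox : overlap i j (x 0) by rewrite x0.
have h1 : is_derive (0 : R) 1 (fun s => gram (metric i (x s)) b c)
   (gram ('D_a (metric i) p) b c).
  have ix : img i (x 0) by exact: overlap_img Ox.
  have hm := is_derive_comp (img_open i) (metric_Ck i 1) ix dx.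
  have := is_derive_gram hm (is_derive_cst b (0 : R) (1 : R)) (is_derive_cst c (0 : R) (1 : R)).
  by rewrite gram0l gram0r !addr0 x0.
have ht := is_derive_comp oO (trans_Ck i j 1) Ox dx.
have hb := is_derive_comp oO ((trans_Ck i j 2).2 b) Ox dx.
have hc := is_derive_comp oO ((trans_Ck i j 2).2 c) Ox dx.
have jx : img j (tau (x 0)) by exact: trans_img.
have hm := is_derive_comp (img_open j) (metric_Ck j 1) jx ht.
have h2 := is_derive_gram hm hb hc.
have E : \forall s \near (0 : R), gram (metric j (tau (x s))) ('D_b tau (x s)) ('D_c tau (x s)) =
    gram (metric i (x s)) b c.
  have nO : \forall s \near (0 : R), overlap i j (x s).
    by apply: (is_derive_continuous dx); exact: open_nbhs_nbhs (conj oO Ox).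
  by apply: filterS nO => s Os; exact: metric_gram_trans.
have h3 := near_eq_is_derive E h2.
have := is_derive1E h1; rewrite (is_derive1E h3) x0 => <-.
by [].
Qed.

(** Combine dmetric_trans with the Koszul formula; the second derivatives of the
    transition map cancel but for one, by the Schwarz theorem.  Hence being a
    geodesic can be checked in one chart. *)
Lemma christoffel_trans i j p u : overlap i j p ->
  'D_(christoffel i p u u) (trans i j) p =
  christoffel j (trans i j p) ('D_u (trans i j) p) ('D_u (trans i j) p)
  + 'D_u ('D_u (trans i j)) p.
Proof.
move=> Op; have oO := overlap_open i j.
have jp := trans_img Op; have ip := overlap_img Op.
apply: (gram_inj (metric_unit jp)) => w.
have [v <-] := dtrans_surj w Op.
rewrite metric_gram_trans// christoffel_gram// gramDl christoffel_gram//.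
have e1 := dmetric_trans u u v Op; have e2 := dmetric_trans v u u Op.
rewrite (schwarz_mx v u oO (trans_Ck i j 1) (trans_Ck i j 2) Op) in e2.
have e3 := metric_gram_sym ('D_u (trans i j) p) ('D_u ('D_v (trans i j)) p) jp.
exact: (christoffel_trans_sum e1 e2 e3).
Qed.

(** The derivative of the metric along the curve cancels the two terms in the
    Christoffel symbols. *)
Lemma geodesic_speed i (x v : R -> 'rV[R]_n) (t : R) : img i (x t) ->
  is_derive t 1 x (v t) -> is_derive t 1 v (- christoffel i (x t) (v t) (v t)) ->
  is_derive t 1 (fun s => gram (metric i (x s)) (v s) (v s)) 0.
Proof.
move=> ix hx hv.
have hm := is_derive_comp (img_open i) (metric_Ck i 1) ix hx.
have := is_derive_gram hm hv hv; rewrite gramNl gramNr.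
rewrite (metric_gram_sym (v t) _ ix) (christoffel_gram _ _ ix).
by set a := gram _ _ _; rewrite (_ : _ + _ = 0)//; lra.
Qed.

Lemma chart_change_derive i j (c : R -> M) (s : R) a : dom i (c s) -> dom j (c s) ->
  {for s, continuous c} ->
  is_derive (s : R) 1 (chart i \o c) a ->
  is_derive (s : R) 1 (chart j \o c) ('D_a (trans i j) (chart i (c s))).
Proof.
move=> di dj cc hx; have oO := overlap_open i j.
have Ox : overlap i j ((chart i \o c) s) by exact: overlap_chart.
have := is_derive_comp oO (trans_Ck i j 1) Ox hx.
apply: near_eq_is_derive.
have : \forall r \near s, dom i (c r).
  by apply: cc; exact: open_nbhs_nbhs (conj (dom_open i) di).
by apply: filterS => r dr /=; rewrite /trans/= chartK.
Qed.

Lemma geodesic_chart_change i j (c : R -> M) (v : R -> 'rV[R]_n) (t : R) :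
  dom i (c t) -> dom j (c t) ->
  (\forall s \near t, {for s, continuous c}) ->
  (\forall s \near t, is_derive (s : R) 1 (chart i \o c) (v s)) ->
  is_derive t 1 v (- christoffel i (chart i (c t)) (v t) (v t)) ->
  exists w : R -> 'rV[R]_n, (\forall s \near t, is_derive (s : R) 1 (chart j \o c) (w s)) /\
     is_derive t 1 w (- christoffel j (chart j (c t)) (w t) (w t)).
Proof.
move=> di dj nc nx hv; have oO := overlap_open i j.
have cc : {for t, continuous c} by exact: nbhs_singleton nc.
have ndi : \forall r \near t, dom i (c r).
  by apply: cc; exact: open_nbhs_nbhs (conj (dom_open i) di).
have ndj : \forall r \near t, dom j (c r).
  by apply: cc; exact: open_nbhs_nbhs (conj (dom_open j) dj).
have hx := nbhs_singleton nx.
exists (fun s => 'D_(v s) (trans i j) (chart i (c s))); split.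
  near=> s; apply: chart_change_derive.
  - by near: s.
  - by near: s.
  - by near: s.
  - by near: s.
have Ox : overlap i j ((chart i \o c) t) by exact: overlap_chart.
have := is_derive_dir oO (trans_Ck i j 1) (trans_Ck i j 2) Ox hx hv.
rewrite /= -(trans_chart j di).
have -> : - christoffel i (chart i (c t)) (v t) (v t) =
    (-1) *: christoffel i (chart i (c t)) (v t) (v t) + 0 by rewrite scaleN1r addr0.
rewrite (derive_mx_linear _ _ _ oO (trans_Ck i j 1) Ox) (christoffel_trans _ Ox) derive0.
by rewrite addr0 scaleN1r opprD subrK.
Unshelve. all: by end_near. Qed.

Lemma christoffel0r i p u : christoffel i p u 0 = 0.
Proof.
have z (w : 'rV[R]_n) : gram (0 : 'M[R]_n) u w = 0 by rewrite /gram mulmx0 mul0mx mxE.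
rewrite /christoffel (_ : \row_k _ = 0) ?mul0mx//.
by apply/rowP => k; rewrite !mxE derive0 gram0l gram0r z; lra.
Qed.

(** The Christoffel symbols are polynomial in the velocity, with coefficients built
    from the metric, its derivatives and its inverse, all of class C^2 at least. *)
Lemma christoffel_C11 i p : img i p -> exists r : R, [/\ 0 < r, nball p r `<=` img i &
  forall k, C11 (nball (row_mx p 0 : 'rV[R]_(n + n)) r)
    (fun z : 'rV[R]_(n + n) => christoffel i (lsubmx z) (rsubmx z) (rsubmx z) ord0 k)].
Proof.
move=> ip; have oI := img_open i.
pose g a b := fun q => metric i q a b : R^o.
have gk a b k : Ck k (img i) (g a b) := Ck_coord a b oI (metric_Ck i k).
have [||r1 [r10 H1]] := @radius_forall_mono R ('I_n * 'I_n)%type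
    (fun ab r => C11 (nball p r) (g ab.1 ab.2)).
- move=> [a b] /=; have [r [r0 _ [K HK]]] := Ck2_to_C11 oI (gk a b 2) ip.
  by exists r; split => //; exists (fun x v => 'D_v (g a b) x), K.
- by move=> j r r' _ rr; apply: C11_sub; exact: nball_sub.
have [||r2 [r20 H2]] := @radius_forall_mono R ('I_n * ('I_n * 'I_n))%type
    (fun cab r => C11 (nball p r) ('D_(delta_mx ord0 cab.1) (g cab.2.1 cab.2.2))).
- move=> [c [a b]] /=.
  have [r [r0 _ [K HK]]] := Ck2_to_C11 oI ((gk a b 3).2 (delta_mx ord0 c)) ip.
  by exists r; split => //; eexists; exists K; exact: HK.
- by move=> j r r' _ rr; apply: C11_sub; exact: nball_sub.
have [r3 [r30 H3]] := open_ball_ex oI ip.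
have dp0 : \det (metric i p) != 0 by rewrite -unitfE -unitmxE; exact: metric_unit.
have Cdet : C11 (nball p r1) (fun q => \det (metric i q)).
  by apply: C11_det => a b; exact: (H1 (a, b)).
have [ddet [K Hdet]] := Cdet.
pose d0 := `|\det (metric i p)|.
have d00 : 0 < d0 by rewrite normr_gt0.
have K0 := c11_K Hdet.
pose r := Num.min (Num.min r1 r2) (Num.min (Num.min r3 1) (d0 / 2 / (K + 1))).
have K1 : 0 < K + 1 by lra.
have r0 : 0 < r by rewrite !lt_min r10 r20 r30 ltr01 !divr_gt0.
have rr1 : r <= r1 by rewrite /r !ge_min lexx.
have rr2 : r <= r2 by rewrite /r !ge_min lexx orbT.
have rr3 : r <= r3 by rewrite /r !ge_min lexx !orbT.
have rr4 : r <= 1 by rewrite /r !ge_min lexx !orbT.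
have rr5 : r <= d0 / 2 / (K + 1) by rewrite /r !ge_min lexx !orbT.
pose S := nball (row_mx p 0 : 'rV[R]_(n + n)) r.
have nl (z : 'rV[R]_(n + n)) : `|lsubmx z| <= `|z|.
  by apply: norm_le_row => // k; rewrite mxE coord_le_norm.
have nr (z : 'rV[R]_(n + n)) : `|rsubmx z| <= `|z|.
  by apply: norm_le_row => // k; rewrite mxE coord_le_norm.
have Sl z : S z -> nball p r (lsubmx z).
  rewrite /S /nball/= => zr; apply: le_lt_trans zr.
  by have -> : lsubmx z - p = lsubmx (z - row_mx p 0) by [rewrite linearB/= row_mxKl]; exact: nl.
have Sn z : S z -> `|z| <= `|row_mx p (0 : 'rV[R]_n)| + 1.
  rewrite /S /nball/= => zr; rewrite -(subrK (row_mx p 0) z) addrC.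
  by apply: (le_trans (ler_normD _ _)); rewrite lerD2l (le_trans (ltW zr)).
pose lsub : {linear 'rV[R]_(n + n) -> 'rV[R]_n} := @lsubmx R 1 n n.
have Cg a b : C11 S (fun z => metric i (lsubmx z) a b).
  have h : C11 (nball p r) (g a b) by apply: C11_sub (H1 (a, b)); exact: nball_sub.
  exact: (@C11_comp_linear R _ _ _ S lsub _ nl Sl h).
have CDg c a b : C11 S (fun z => 'D_(delta_mx ord0 c) (g a b) (lsubmx z)).
  have h : C11 (nball p r) ('D_(delta_mx ord0 c) (g a b)).
    by apply: C11_sub (H2 (c, (a, b))); exact: nball_sub.
  exact: (@C11_comp_linear R _ _ _ S lsub _ nl Sl h).
have Cu a : C11 S (fun z : 'rV[R]_(n + n) => rsubmx z ord0 a).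
  apply: (C11_linear (B := `|row_mx p (0 : 'rV[R]_n)| + 1)) => //.
    by move=> c u v; rewrite !mxE.
  by move=> v; apply: le_trans (nr v); exact: coord_le_norm.
have CDc c a b : C11 S (fun z => 'D_(delta_mx ord0 c) (metric i) (lsubmx z) a b).
  apply: C11_ext (CDg c a b) => z /Sl zr; rewrite derive_mx ?mxE//.
  by apply: (metric_Ck i 1).1; apply: H3; exact: lt_le_trans zr rr3.
have CDu a b : C11 S (fun z => 'D_(rsubmx z) (metric i) (lsubmx z) a b).
  apply: (@C11_ext _ _ _ (fun z => \sum_c rsubmx z ord0 c * 'D_(delta_mx ord0 c) (metric i) (lsubmx z) a b)).
    move=> z /Sl zr; rewrite (dmetric_sum (rsubmx z)) ?summxE.
      by apply: eq_bigr => c _; rewrite [in RHS]mxE.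
    by apply: H3; exact: lt_le_trans zr rr3.
  by apply: C11_sum => c; apply: C11_mul.
have Cinv a b : C11 S (fun z => invmx (metric i (lsubmx z)) a b).
  apply: (@C11_invmx _ _ _ _ _ (d0 / 2)) => //; first by rewrite divr_gt0.
  move=> z /Sl zr; have zr1 : nball p r1 (lsubmx z) by exact: nball_sub zr.
  have pr1 : nball p r1 p by rewrite /nball/= subrr normr0.
  have h := c11_lip Hdet pr1 zr1.
  have hz : K * `|p - lsubmx z| <= d0 / 2.
    rewrite distrC; apply: (@le_trans _ _ (K * (d0 / 2 / (K + 1)))).
      by rewrite ler_wpM2l// (le_trans (ltW zr)).
    rewrite mulrCA ler_piMr ?divr_ge0 ?(ltW d00)// ler_pdivrMr; lra.
  have := ler_normD (\det (metric i p) - \det (metric i (lsubmx z))) (\det (metric i (lsubmx z))).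
  rewrite subrK -/d0; lra.
exists r; split => //; first by move=> q /(nball_sub rr3); exact: H3.
move=> k; rewrite /christoffel.
apply: (@C11_ext _ _ _ (fun z => \sum_l (2^-1 * (gram ('D_(rsubmx z) (metric i) (lsubmx z)) (rsubmx z) (delta_mx ord0 l)
                 + gram ('D_(rsubmx z) (metric i) (lsubmx z)) (rsubmx z) (delta_mx ord0 l)
                 - gram ('D_(delta_mx ord0 l) (metric i) (lsubmx z)) (rsubmx z) (rsubmx z)))
   * invmx (metric i (lsubmx z)) l k)).
  by move=> z _; rewrite [RHS]mxE; apply: eq_bigr => l _; rewrite mxE.
have G1 l : C11 S (fun z => gram ('D_(rsubmx z) (metric i) (lsubmx z)) (rsubmx z) (delta_mx ord0 l)).
  by apply: (C11_gram CDu Cu) => a; exact: C11_cst.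
have G2 l : C11 S (fun z => gram ('D_(delta_mx ord0 l) (metric i) (lsubmx z)) (rsubmx z) (rsubmx z)).
  exact: (C11_gram (CDc l) Cu Cu).
apply: C11_sum => l; apply: C11_mul; last exact: Cinv.
apply: C11_mul; first exact: C11_cst.
exact: (C11_sub_fun (C11_add (G1 l) (G1 l)) (G2 l)).
Qed.

End Chart.
Arguments img_open {R n M} i.
Arguments overlap_open {R n M} i j.

Opaque gram christoffel.

(** * Geodesics as integral curves of the spray *)

Lemma norm_close {R : realType} (V : normedModType R) (x y z : V) (e : R) :
  `|z - x| < e / 2 -> `|z - y| < e / 2 -> `|x - y| <= e.
Proof.
move=> h1 h2; rewrite -(subrK z x) -addrA (splitr e) (le_trans (ler_normD _ _))//.
by rewrite lerD ?(ltW h2)// distrC ltW.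
Qed.

Section Geodesic.
Context {R : realType} {n : nat} (M : riemannianManifold R n).
Implicit Types (i j : atlas M) (p u v w : 'rV[R]_n) (c : R -> M).

Lemma norm_lsub (z : 'rV[R]_(n + n)) : `|lsubmx z| <= `|z|.
Proof. by apply: norm_le_row => // k; rewrite mxE coord_le_norm. Qed.

Lemma norm_rsub (z : 'rV[R]_(n + n)) : `|rsubmx z| <= `|z|.
Proof. by apply: norm_le_row => // k; rewrite mxE coord_le_norm. Qed.

Lemma norm_row_mx_lt u w (r : R) : `|u| < r -> `|w| < r -> `|row_mx u w| < r.
Proof.
move=> ur wr; apply: norm_lt_row => [|k]; first exact: le_lt_trans ur.
rewrite mxE; case: splitP => a _.
  exact: le_lt_trans (coord_le_norm u ord0 a) ur.
exact: le_lt_trans (coord_le_norm w ord0 a) wr.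
Qed.

Lemma norm_row_mx0 w : `|row_mx (0 : 'rV[R]_n) w| = `|w|.
Proof.
apply/eqP; rewrite eq_le; apply/andP; split.
  apply: norm_le_row => // k; rewrite mxE; case: splitP => a _; last exact: coord_le_norm.
  by rewrite mxE normr0.
by rewrite -{1}(row_mxKr (0 : 'rV[R]_n) w) norm_rsub.
Qed.

Definition spray i (z : 'rV[R]_(n + n)) : 'rV[R]_(n + n) :=
  row_mx (rsubmx z) (- christoffel i (lsubmx z) (rsubmx z) (rsubmx z)).

Lemma spray_c11 i p : img i p -> exists r dH K, [/\ 0 < r, nball p r `<=` img i &
  c11v (nball (row_mx p 0 : 'rV[R]_(n + n)) r) (spray i) dH K].
Proof.
move=> ip; have [r [r0 rI HC]] := christoffel_C11 ip.
set S := nball _ _ in HC.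
have [dH [K HK]] : exists dH K, c11v S (spray i) dH K.
  apply: C11_vec => k.
  case: (splitP k) => a ka.
    have -> : k = lshift n a by exact/val_inj.
    apply: (@C11_ext _ _ _ (fun z : 'rV[R]_(n + n) => z ord0 (rshift n a))).
      by move=> z _; rewrite /spray row_mxEl mxE.
    apply: (C11_linear (B := `|row_mx p (0 : 'rV[R]_n)| + r)).
    - by move=> c u v; rewrite !mxE.
    - by move=> v; exact: coord_le_norm.
    - move=> x; rewrite /S /nball/= => xr; rewrite -(subrK (row_mx p 0) x) addrC.
      by apply: (le_trans (ler_normD _ _)); rewrite lerD2l ltW.
  have -> : k = rshift n a by exact/val_inj.
  apply: (@C11_ext _ _ _ (fun z : 'rV[R]_(n + n) =>
      - christoffel i (lsubmx z) (rsubmx z) (rsubmx z) ord0 a)).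
    by move=> z _; rewrite /spray row_mxEr [RHS]mxE.
  exact: C11_opp.
by exists r, dH, K.
Qed.

(** A ball on which the flow of the spray over the time A exists and is close to a
    translation; 16^-1 and r / 8 are the thresholds of the short-time flow. *)
Record flow_box i p (r K A : R) dH : Prop := FlowBox {
  fb_r : 0 < r ; fb_A : 0 < A ; fb_img : nball p r `<=` img i ;
  fb_c11 : c11v (nball (row_mx p 0 : 'rV[R]_(n + n)) r) (spray i) dH K ;
  fb_KA : K * A <= 16^-1 ; fb_KAr : K * A <= r / 8 }.

Lemma flow_box_exists i p : img i p -> exists r K A dH, flow_box i p r K A dH.
Proof.
move=> ip; have [r [dH [K [r0 rI HK]]]] := spray_c11 ip.
have K0 := c11v_K HK; have K1 : 0 < K + 1 by lra.
pose A := Num.min 16^-1 (r / 8) / (K + 1).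
have m0 : 0 < Num.min 16^-1 (r / 8) by rewrite lt_min; apply/andP; split; lra.
have A0 : 0 < A by rewrite divr_gt0.
have KA : K * A <= Num.min 16^-1 (r / 8).
  by rewrite /A mulrCA ler_piMr ?(ltW m0)// ler_pdivrMr//; lra.
exists r, K, A, dH; split => //; apply: (le_trans KA); rewrite ge_min lexx ?orbT//.
Qed.

Lemma flow_box_le i p r K A A' dH : 0 < A' -> A' <= A ->
  flow_box i p r K A dH -> flow_box i p r K A' dH.
Proof.
move=> A0 AA [r0 _ rI HK h1 h2]; have K0 := c11v_K HK.
by split => //; apply: le_trans (ler_wpM2l K0 AA) _.
Qed.

(** Homogeneity in the velocity, which makes affine reparametrizations of
    geodesics geodesics. *)
Lemma christoffelZ i p (a : R) u : img i p ->
  christoffel i p (a *: u) (a *: u) = (a * a) *: christoffel i p u u.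
Proof.
move=> ip; apply: (gram_inj (metric_unit ip)) => w.
have hD : 'D_(a *: u) (metric i) p = a *: 'D_u (metric i) p.
  have := derive_mx_linear a u 0 (img_open i) (metric_Ck i 1) ip.
  by rewrite addr0 derive0 addr0.
have aux (x y : R) : a * (a * x) - 2^-1 * (a * (a * y)) = a * a * (x - 2^-1 * y) by ring.
have e1 : gram ('D_(a *: u) (metric i) p) (a *: u) w = a * (a * gram ('D_u (metric i) p) u w).
  by rewrite hD; exact: (etrans (gramMZ _ _ _ _) (congr1 _ (gramZl _ _ _ _))).
have e2 : gram ('D_w (metric i) p) (a *: u) (a *: u) = a * (a * gram ('D_w (metric i) p) u u).
  exact: (etrans (gramZl _ _ _ _) (congr1 _ (gramZr _ _ _ _))).
have e3 := gramZl (metric i p) (a * a) (christoffel i p u u) w.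
rewrite e3 (christoffel_gram (a *: u) w ip) (christoffel_gram u w ip) -aux; congr (_ - _ * _).
  exact: e1.
exact: e2.
Qed.

(** The pointwise condition in geodesic_on, so that it can be localized. *)
Definition geo c (t : R) : Prop := {for t, continuous c} /\
    forall i, dom i (c t) ->
      let x := chart i \o c in
      [/\ derivable x t 1, derivable (derive1 x) t 1 &
          derive1 (derive1 x) t
          = - christoffel i (x t) (derive1 x t) (derive1 x t)].

Lemma near_derive1 (W : normedModType R) (f g : R -> W) (t : R) :
  (\forall s \near t, f s = g s) -> \forall s \near t, derive1 f s = derive1 g s.
Proof.
move=> fg; have := near_join fg; apply: filterS => s fgs.
by rewrite !derive1E; exact: near_eq_derive.
Qed.

Lemma near_continuous (c c' : R -> M) (t : R) :
  (\forall s \near t, c s = c' s) -> {for t, continuous c} -> {for t, continuous c'}.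
Proof.
move=> cc ct; suff : c' s @[s --> t] --> c' t by [].
rewrite -(nbhs_singleton cc); exact: (cvg_trans (near_eq_cvg cc) ct).
Qed.

Lemma near_dom i c (t : R) : {for t, continuous c} -> dom i (c t) ->
  \forall s \near t, dom i (c s).
Proof. by move=> cc di; apply: cc; exact: open_nbhs_nbhs (conj (dom_open i) di). Qed.

Lemma geo_local c c' (t : R) : (\forall s \near t, c s = c' s) -> geo c t -> geo c' t.
Proof.
move=> cc [ct H]; split; first exact: near_continuous ct.
have e := nbhs_singleton cc; rewrite -e => i di; have [h1 h2 h3] := H i di.
have cx : \forall s \near t, (chart i \o c) s = (chart i \o c') s.
  by apply: filterS cc => s /= ->.
have cx1 := near_derive1 cx.
move=> x; split.
- exact: near_eq_derivable h1.
- exact: near_eq_derivable h2.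
- rewrite -(nbhs_singleton (near_derive1 cx1)) h3.
  by rewrite -(nbhs_singleton cx1) /x /= -e.
Qed.

(** By the transformation rule one chart suffices. *)
Lemma geo_chart c (t : R) i (v : R -> 'rV[R]_n) : dom i (c t) ->
  (\forall s \near t, {for s, continuous c}) ->
  (\forall s \near t, is_derive (s : R) 1 (chart i \o c) (v s)) ->
  is_derive t 1 v (- christoffel i (chart i (c t)) (v t) (v t)) -> geo c t.
Proof.
move=> di nc nx hv; split; first exact: nbhs_singleton nc.
move=> j dj x; have [w [nw hw]] := geodesic_chart_change di dj nc nx hv.
have e : \forall s \near t, derive1 x s = w s.
  by apply: filterS nw => s; exact: is_derive1E.
have dx := nbhs_singleton nw.
have e' : \forall s \near t, w s = derive1 x s by apply: filterS e => s ->.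
split; first by case: dx.
- by apply: near_eq_derivable e' _; case: hw.
- rewrite derive1E -(near_eq_derive (1 : R) e') -derive1E (is_derive1E hw).
  by rewrite -(nbhs_singleton e').
Qed.

Lemma geodesic_near (J : set R) c (t : R) i : open J -> J t -> geodesic_on J c -> dom i (c t) ->
  [/\ \forall s \near t, J s /\ dom i (c s),
      \forall s \near t, {for s, continuous c},
      \forall s \near t, is_derive (s : R) 1 (chart i \o c) (derive1 (chart i \o c) s) &
      is_derive t 1 (derive1 (chart i \o c))
        (- christoffel i (chart i (c t)) (derive1 (chart i \o c) t) (derive1 (chart i \o c) t))].
Proof.
move=> oJ Jt gc di; have [ct Ht] := gc t Jt.
have nJ : \forall s \near t, J s by exact: open_nbhs_nbhs.
have nd := near_dom ct di.
split.
- by apply: filterS2 nJ nd.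
- by apply: filterS nJ => s /gc[].
- apply: filterS2 nJ nd => s /gc[_ H] ds.
  by have [h _ _] := H i ds; exact: derivable_is_derive1.
- have [_ h2 h3] := Ht i di.
  by have := derivable_is_derive1 h2; rewrite h3.
Qed.

Lemma is_derive_affine_comp (W : normedModType R) (x : R -> W) (a b t : R) (d : W) :
  is_derive (a * t + b) 1 x d -> is_derive t 1 (fun s => x (a * s + b)) (a *: d).
Proof.
move=> /is_derive_epsP H; apply/is_derive_epsP => e e0.
pose k := `|a| + 1; have a0 := normr_ge0 a.
have k0 : 0 < k by rewrite /k; lra.
have ek : 0 < e / k by rewrite divr_gt0.
have [r [r0 Hr]] := H _ ek.
exists (r / k); split; first by rewrite divr_gt0.
move=> s; rewrite ltr_pdivlMr// => sk.
have E : (a * s + b) - (a * t + b) = a * (s - t) by ring.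
have ak : `|a * (s - t)| <= k * `|s - t| by rewrite normrM ler_wpM2r// /k; lra.
have := Hr (a * s + b); rewrite E scalerA (mulrC (s - t)) => h.
apply: (le_trans (h _)); first by apply: le_lt_trans ak _; rewrite mulrC.
apply: (@le_trans _ _ (e / k * (k * `|s - t|))).
  by rewrite ler_wpM2l// ltW.
by rewrite mulrA divfK// gt_eqF.
Qed.

Lemma near_affine (P : R -> Prop) (a b t : R) : (\forall s \near (a * t + b), P s) ->
  \forall s \near t, P (a * s + b).
Proof.
move=> /near_ex[r [r0 Hr]]; apply/near_ex.
have a0 := normr_ge0 a; have k0 : 0 < `|a| + 1 by lra.
exists (r / (`|a| + 1)); split; first by rewrite divr_gt0.
move=> s; rewrite ltr_pdivlMr// => h; apply: Hr.
rewrite (_ : _ - _ = a * (s - t)); last by ring.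
rewrite normrM; apply: le_lt_trans h; rewrite mulrC ler_wpM2l//; lra.
Qed.

Lemma continuous_affine_comp c (a b t : R) : {for a * t + b, continuous c} ->
  {for t, continuous (fun s => c (a * s + b))}.
Proof.
by move=> cc V Vc; exact: (@near_affine (fun s => V (c s)) a b t (cc V Vc)).
Qed.

Lemma geodesic_affine (J : set R) c (a b : R) : open J -> geodesic_on J c ->
  geodesic_on [set t | J (a * t + b)] (fun t => c (a * t + b)).
Proof.
move=> oJ gc t Jt; pose c' s := c (a * s + b).
pose i := chart_at (c' t); have di : dom i (c' t) := mem_chart_at _.
have [nd nc nx hv] := geodesic_near oJ Jt gc di.
apply: (@geo_chart c' t i (fun s => a *: derive1 (chart i \o c) (a * s + b))) => //.
- have := near_affine nc; apply: filterS => s; exact: continuous_affine_comp.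
- have := near_affine nx; apply: filterS => s; exact: is_derive_affine_comp.
have ip : img i (chart i (c' t)) by exact: chart_img.
rewrite christoffelZ// -scalerA -!scalerN.
have h := is_derive_affine_comp hv.
exact: (@is_deriveZ _ _ _ _ a t 1 _ h).
Qed.

Lemma lift_spray i (x v : R -> 'rV[R]_n) (s : R) : is_derive s 1 x (v s) ->
  is_derive s 1 v (- christoffel i (x s) (v s) (v s)) ->
  is_derive s 1 (fun r => row_mx (x r) (v r)) (spray i (row_mx (x s) (v s))).
Proof.
move=> hx hv; rewrite /spray row_mxKl row_mxKr; apply: is_derive_mx => a k.
rewrite (ord1 a); case: (splitP k) => l kl.
  have -> : k = lshift n l by exact/val_inj.
  rewrite row_mxEl; have -> : (fun r => row_mx (x r) (v r) ord0 (lshift n l)) = (fun r => x r ord0 l).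
    by apply/funext => r; rewrite row_mxEl.
  exact: (is_derive_coord ord0 l hx).
have -> : k = rshift n l by exact/val_inj.
rewrite row_mxEr; have -> : (fun r => row_mx (x r) (v r) ord0 (rshift n l)) = (fun r => v r ord0 l).
  by apply/funext => r; rewrite row_mxEr.
exact: (is_derive_coord ord0 l hv).
Qed.

Lemma spray_unlift i (X : R -> 'rV[R]_(n + n)) (s : R) : is_derive s 1 X (spray i (X s)) ->
  is_derive s 1 (fun r => lsubmx (X r)) (rsubmx (X s)) /\
  is_derive s 1 (fun r => rsubmx (X r)) (- christoffel i (lsubmx (X s)) (rsubmx (X s)) (rsubmx (X s))).
Proof.
move=> hX; split; apply: is_derive_mx => a k.
  have -> : (fun r => lsubmx (X r) a k) = (fun r => X r a (lshift n k)).
    by apply/funext => r; rewrite mxE.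
  have := is_derive_coord a (lshift n k) hX.
  by rewrite /spray (ord1 a) row_mxEl.
have -> : (fun r => rsubmx (X r) a k) = (fun r => X r a (rshift n k)).
  by apply/funext => r; rewrite mxE.
have := is_derive_coord a (rshift n k) hX.
by rewrite /spray (ord1 a) row_mxEr.
Qed.

(** In the chart both curves, slowed down by a factor a so that their velocities
    enter the flow box, are integral curves of the spray with the same initial
    value; flow_diff shows that they agree. *)
Lemma geodesic_uniq_local (J1 J2 : set R) c1 c2 (t : R) i : open J1 -> open J2 ->
  J1 t -> J2 t -> geodesic_on J1 c1 -> geodesic_on J2 c2 -> c1 t = c2 t -> dom i (c1 t) ->
  derive1 (chart i \o c1) t = derive1 (chart i \o c2) t ->
  \forall s \near t, c1 s = c2 s.
Proof.
move=> o1 o2 J1t J2t g1 g2 e12 di ed.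
have di2 : dom i (c2 t) by rewrite -e12.
have ip := chart_img di; set p := chart i (c1 t) in ip.
have [r [K [A [dH fb]]]] := flow_box_exists ip.
have [r0 A0 rI HK KA KAr] := fb.
set x1 := chart i \o c1; set x2 := chart i \o c2.
set w := derive1 x1 t; have w0 := normr_ge0 w.
(* Slowing time down by a brings the velocity w into the flow box. *)
pose a := r / (2 * (`|w| + 1)).
have a0 : 0 < a by rewrite divr_gt0//; lra.
have aw : `|a *: w| < r.
  rewrite normrZ (gtr0_norm a0) /a mulrAC ltr_pdivrMr; last lra.
  rewrite ltr_pM2l//; lra.
have oA : open [set z : 'rV[R]_(n + n) | nball (row_mx p 0) r z].
  have -> : [set z : 'rV[R]_(n + n) | nball (row_mx p 0) r z] = ball (row_mx p 0) r.
    by apply/seteqP; split => z; rewrite /nball -ball_normE/= distrC.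
  exact: ball_open.
have key (J : set R) c : open J -> J t -> geodesic_on J c -> c t = c1 t ->
    derive1 (chart i \o c) t = w -> dom i (c t) ->
    \forall s \near (0 : R), dom i (c (a * s + t)) /\
     let X r := row_mx (chart i (c (a * r + t))) (a *: derive1 (chart i \o c) (a * r + t)) in
     is_derive (s : R) 1 X (spray i (X s)) /\ nball (row_mx p 0) r (X s).
  move=> oJ Jt gc ec edc dc.
  have E0 : a * 0 + t = t by rewrite mulr0 add0r.
  have := geodesic_near oJ Jt gc dc => -[].
  set x := chart i \o c; set v := derive1 x => nd nc nx hv.
  have nall : \forall s \near t, [/\ dom i (c s), is_derive (s : R) 1 x (v s) &
      is_derive (s : R) 1 v (- christoffel i (x s) (v s) (v s))].
    apply: filterS2 nd nx => s [Js ds] hx; split; [exact: ds|exact: hx|].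
    by have [_ _ _ h] := geodesic_near oJ Js gc ds; exact: h.
  pose X r := row_mx (x (a * r + t)) (a *: v (a * r + t)).
  have dX : \forall s \near (0 : R), dom i (c (a * s + t)) /\ is_derive (s : R) 1 X (spray i (X s)).
    have : \forall s \near (a * 0 + t), [/\ dom i (c s), is_derive (s : R) 1 x (v s) &
      is_derive (s : R) 1 v (- christoffel i (x s) (v s) (v s))] by rewrite E0.
    move=> /near_affine; apply: filterS => s [ds hx hv']; split; first exact: ds.
    have h1 := is_derive_affine_comp hx; have h2 := is_derive_affine_comp hv'.
    have h3 := @is_deriveZ _ _ _ _ a s 1 _ h2.
    apply: (@lift_spray i (fun r => x (a * r + t)) (fun r => a *: v (a * r + t)) s h1).
    rewrite (christoffelZ a _ (chart_img ds)) -scalerA -!scalerN; exact: h3.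
  have X0 : nball (row_mx p 0) r (X 0).
    rewrite /nball/= /X E0 /x /= ec -/p opp_row_mx add_row_mx subrr subr0 norm_row_mx0.
    by rewrite /v edc.
  have nX : \forall s \near (0 : R), nball (row_mx p 0) r (X s).
    apply: (is_derive_continuous (nbhs_singleton dX).2).
    exact: open_nbhs_nbhs.
  by apply: filterS2 dX nX => s [ds hs] ns; split; [exact: ds|split; [exact: hs|exact: ns]].
have k1 := key J1 c1 o1 J1t g1 erefl erefl di.
have k2 := key J2 c2 o2 J2t g2 (esym e12) (esym ed) di2.
have [r1 [r10 H]] := (near_ex _ _).1 (filterI k1 k2).
pose A' := Num.min A (r1 / 2).
have A'0 : 0 < A' by rewrite lt_min A0 divr_gt0.
have A'A : A' <= A by rewrite ge_min lexx.
have [_ _ _ _ KA' KAr'] := flow_box_le A'0 A'A fb.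
have lt1 (s : R) : `|s| <= A' -> `|s - 0| < r1.
  rewrite subr0 => h; apply: le_lt_trans h _; apply: (@le_lt_trans _ _ (r1 / 2)).
    by rewrite ge_min lexx orbT.
  lra.
pose X c (r : R) := row_mx (chart i (c (a * r + t))) (a *: derive1 (chart i \o c) (a * r + t)).
have s1 : solves (spray i) (row_mx p 0) r A' (X c1).
  by move=> s /lt1/H[[_ h] _].
have s2 : solves (spray i) (row_mx p 0) r A' (X c2).
  by move=> s /lt1/H[_ [_ h]].
have X12 : X c1 0 - X c2 0 = 0.
  by rewrite /X mulr0 add0r -e12 ed subrr.
apply/near_ex; exists (a * A'); split; first by rewrite mulr_gt0.
move=> s sA; pose q := (s - t) / a.
have sq : a * q + t = s by rewrite /q mulrCA mulfV ?mulr1 ?subrK// gt_eqF.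
have qA : `|q| <= A'.
  by rewrite /q normrM normfV (gtr0_norm a0) ler_pdivrMr// mulrC ltW.
have [h1 _] := flow_diff r0 A'0 HK KA' KAr' s1 s2 qA.
have eX : X c1 q = X c2 q.
  apply/eqP; rewrite -subr_eq0 -normr_eq0 eq_le normr_ge0 andbT.
  by apply: (le_trans h1); rewrite X12 normr0 mulr0.
have [[d1 _] [d2 _]] := H q (lt1 q qA).
rewrite sq in d1 d2.
have [+ _] := eq_row_mx eX; rewrite sq.
by move=> /(congr1 (unchart i)); rewrite (chartK d1) (chartK d2).
Qed.

(** The set of times near which the two geodesics agree is open and closed in the
    interval between 0 and t. *)
Lemma geodesic_uniq (J1 J2 : set R) c1 c2 : open J1 -> open J2 -> is_interval J1 -> is_interval J2 ->
  J1 0 -> J2 0 -> geodesic_on J1 c1 -> geodesic_on J2 c2 -> c1 0 = c2 0 ->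
  velocity c1 0 = velocity c2 0 -> forall t, J1 t -> J2 t -> \forall s \near t, c1 s = c2 s.
Proof.
move=> o1 o2 i1 i2 z1 z2 g1 g2 e0 v0 t J1t J2t.
pose I : set R := [set s | Num.min 0 t <= s <= Num.max 0 t].
have II : is_interval I.
  move=> x y; rewrite /I/= => /andP[x1 x2] /andP[y1 y2] z /andP[z1' z2'].
  by rewrite (le_trans x1 z1') (le_trans z2' y2).
have I12 s : I s -> J1 s /\ J2 s.
  rewrite /I/=; case: (leP 0 t) => t0 h; split.
  - exact: (i1 0 t).
  - exact: (i2 0 t).
  - by apply: (i1 t 0).
  - by apply: (i2 t 0).
have I0 : I 0 by rewrite /I/= ge_min le_max lexx.
have It : I t by rewrite /I/= ge_min le_max lexx !orbT.
pose E : set R := [set s | \forall r \near s, c1 r = c2 r].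
have E0 : E 0.
  apply: (geodesic_uniq_local o1 o2 z1 z2 g1 g2 e0 (mem_chart_at _)).
  by have := v0; rewrite /velocity -e0.
suff : I `&` E = I by move=> h; have := It; rewrite -h => -[].
have /connected_intervalP cI := II.
apply: cI.
- by exists 0.
- exists E => //; rewrite openE => s Es; rewrite /interior; exact: near_join Es.
(* E is closed in I: at a limit point s the positions agree because M is
   Hausdorff, the velocities by continuity in a chart around it. *)
exists (closure (I `&` E)); first exact: closed_closure.
apply/seteqP; split => s [Is Es]; first by split => //; exact: subset_closure.
split => //; have [J1s J2s] := I12 s Is.
have [cc1 _] := g1 s J1s; have [cc2 _] := g2 s J2s.
have ec : c1 s = c2 s.
  apply: contrapT => /eqP nc; have HM := @carrier_hausdorff _ _ M.
  rewrite open_hausdorff in HM.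
  have [[U V] /= [Us Vs] [oU oV /eqP UV]] := HM _ _ nc.
  rewrite !inE in Us Vs.
  have nU : \forall r \near s, U (c1 r) by apply: cc1; exact: open_nbhs_nbhs.
  have nV : \forall r \near s, V (c2 r) by apply: cc2; exact: open_nbhs_nbhs.
  have [r [[_ Er] [Ur Vr]]] := Es _ (filterI nU nV).
  have : (U `&` V) (c1 r) by split => //; rewrite (nbhs_singleton Er).
  by rewrite UV.
pose i := chart_at (c1 s); have di : dom i (c1 s) := mem_chart_at _.
have di2 : dom i (c2 s) by rewrite -ec.
apply: (geodesic_uniq_local o1 o2 J1s J2s g1 g2 ec di).
have [_ _ _ h1] := geodesic_near o1 J1s g1 di.
have [_ _ _ h2] := geodesic_near o2 J2s g2 di2.
apply/eqP; rewrite -subr_eq0 -normr_eq0 eq_le normr_ge0 andbT.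
apply/ler_addgt0Pr => e e0'; rewrite add0r.
have e2 : 0 < e / 2 by rewrite divr_gt0.
have [r1 [r10 H1]] := cont_ex (is_derive_continuous h1) e2.
have [r2 [r20 H2]] := cont_ex (is_derive_continuous h2) e2.
have n12 : \forall r \near s, `|r - s| < Num.min r1 r2.
  by apply/near_ex; exists (Num.min r1 r2); split; [rewrite lt_min r10|].
have [r [[_ Er] rr]] := Es _ n12.
move: rr; rewrite lt_min => /andP[/H1 l1 /H2 l2].
have ed : derive1 (chart i \o c1) r = derive1 (chart i \o c2) r.
  apply: (nbhs_singleton (near_derive1 _)); apply: filterS Er => q /= ->; done.
rewrite ed in l1; exact: norm_close l1 l2.
Qed.

Definition geodesic_to (J : set R) c q v := [/\ open J, is_interval J, `[0, 1] `<=` J & geodesic_on J c]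
  /\ c 0 = q /\ velocity c 0 = v.

Lemma Exp_geodesic (J : set R) c q v : geodesic_to J c q v -> Exp q v = c 1.
Proof.
move=> [[oJ iJ J01 gc] [c0 vc]]; rewrite /Exp.
have in0 : (0 : R) \in `[0, 1] by rewrite in_itv/= lexx ler01.
have in1 : (1 : R) \in `[0, 1] by rewrite in_itv/= lexx ler01.
case: xgetP => [y _ [J' [c' [[oJ' iJ' J'01 gc'] [c'0 vc' c'1]]]]|H].
  rewrite -c'1.
  apply: (nbhs_singleton (geodesic_uniq oJ' oJ iJ' iJ (J'01 0 in0) (J01 0 in0) gc' gc _ _
    (J'01 1 in1) (J01 1 in1))); rewrite ?c'0 ?c0 ?vc' ?vc //.
by exfalso; apply: (H (c 1)); exists J, c.
Qed.

End Geodesic.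

(** * Lengths, distances and paths of bounded speed *)

Lemma is_derive_ex {R : numFieldType} (V W : normedModType R) (f : V -> W) a v d :
  is_derive a v f d -> derivable f a v.
Proof. by case. Qed.

Lemma eq_of_sub {R : realType} (a b : R) : a - b <= 0 -> 0 <= a - b -> a = b.
Proof. by move=> h1 h2; lra. Qed.

Lemma near_all {R : realType} (P : R -> Prop) (s : R) :
  (forall r, P r) -> \forall r \near s, P r.
Proof. by move=> H; apply/near_ex; exists 1; split. Qed.

Section Length.
Context {R : realType} {n : nat} (M : riemannianManifold R n).
Implicit Types (i j : atlas M) (p u v w : 'rV[R]_n) (c : R -> M).

Definition energy c (t : R) : R :=
  gram (metric (chart_at (c t)) (chart (chart_at (c t)) (c t))) (velocity c t) (velocity c t).

Definition speed c (t : R) : R := tnorm (c t) (velocity c t).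

Lemma speedE c t : speed c t = Num.sqrt (energy c t). Proof. by []. Qed.

Lemma energy_chart i c (t : R) d : dom i (c t) -> {for t, continuous c} ->
  is_derive t 1 (chart i \o c) d ->
  energy c t = gram (metric i (chart i (c t))) d d.
Proof.
move=> di cc hx; pose j := chart_at (c t); have dj : dom j (c t) := mem_chart_at _.
have h := is_derive1E (chart_change_derive di dj cc hx).
rewrite /energy /velocity -/j h.
have Op := overlap_chart di dj.
by rewrite -(metric_gram_trans d d Op) trans_chart.
Qed.

Lemma speed_ge0 c t : 0 <= speed c t.
Proof. exact: sqrtr_ge0. Qed.

Lemma energy_near c c' (t : R) : (\forall s \near t, c s = c' s) -> energy c t = energy c' t.
Proof.
move=> cc; have e := nbhs_singleton cc.
rewrite /energy /velocity -e; set i := chart_at (c t).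
have : \forall s \near t, (chart i \o c) s = (chart i \o c') s.
  by apply: filterS cc => s /= ->.
by move=> /near_derive1/nbhs_singleton ->.
Qed.

Lemma cont_sum (I : Type) (r : seq I) (f : I -> R -> R) (t : R) :
  (forall k, {for t, continuous (f k)}) -> {for t, continuous (fun s => \sum_(k <- r) f k s)}.
Proof.
move=> H; elim: r => [|k r IH].
  have -> : (fun s => \sum_(k <- [::]) f k s) = cst 0.
    by apply/funext => s; rewrite big_nil.
  exact: cst_continuous.
have -> : (fun s => \sum_(i <- k :: r) f i s) = (fun s => f k s + \sum_(i <- r) f i s).
  by apply/funext => s; rewrite big_cons.
exact: (@continuousD _ _ _ (f k) (fun s => \sum_(i <- r) f i s) t (H k) IH).
Qed.

Lemma cont_gram (G : R -> 'M[R]_n) (a b : R -> 'rV[R]_n) (t : R) :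
  {for t, continuous G} -> {for t, continuous a} -> {for t, continuous b} ->
  {for t, continuous (fun s => gram (G s) (a s) (b s))}.
Proof.
move=> cG ca cb.
have -> : (fun s => gram (G s) (a s) (b s)) =
    (fun s => \sum_i \sum_j a s ord0 i * G s i j * b s ord0 j).
  by apply/funext => s; rewrite gramE.
apply: cont_sum => i; apply: cont_sum => j.
have h1 := @continuous_coord R _ _ a t ord0 i ca.
have h2 := @continuous_coord R _ _ G t i j cG.
have h3 := @continuous_coord R _ _ b t ord0 j cb.
exact: (@continuousM _ _ (fun s => a s ord0 i * G s i j) (fun s => b s ord0 j) t
  (@continuousM _ _ (fun s => a s ord0 i) (fun s => G s i j) t h1 h2) h3).
Qed.

Definition C1_at c (t : R) := {for t, continuous c} /\ forall i, dom i (c t) ->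
  derivable (chart i \o c) t 1 /\ {for t, continuous (derive1 (chart i \o c))}.

Lemma C1_curveP c : C1_curve c <-> forall t, C1_at c t.
Proof.
split=> [[cc H] t|H]; first by split; [exact: cc|move=> i; exact: H].
by split=> [t|i t]; [exact: (H t).1|exact: (H t).2].
Qed.

Lemma C1_at_local c c' (t : R) : (\forall s \near t, c s = c' s) -> C1_at c t -> C1_at c' t.
Proof.
move=> cc [ct H]; split; first exact: near_continuous ct.
have e := nbhs_singleton cc => i; rewrite -e => di; have [h1 h2] := H i di.
have cx : \forall s \near t, (chart i \o c) s = (chart i \o c') s.
  by apply: filterS cc => s /= ->.
split; first exact: near_eq_derivable h1.
have cx1 := near_derive1 cx.
suff : derive1 (chart i \o c') s @[s --> t] --> derive1 (chart i \o c') t by [].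
rewrite -(nbhs_singleton cx1); exact: (cvg_trans (near_eq_cvg cx1) h2).
Qed.

Lemma C1_near c (t : R) i : (\forall s \near t, C1_at c s) -> dom i (c t) ->
  \forall s \near t, [/\ dom i (c s), {for s, continuous c} &
    is_derive (s : R) 1 (chart i \o c) (derive1 (chart i \o c) s)].
Proof.
move=> nc di; have [ct _] := nbhs_singleton nc.
apply: filterS2 nc (near_dom ct di) => s [cs H] ds; split; [exact: ds|exact: cs|].
by apply: derivable_is_derive1; exact: (H i ds).1.
Qed.

Lemma C1_speed_continuous c : C1_curve c -> continuous (speed c).
Proof.
move=> /C1_curveP Hc t; pose i := chart_at (c t); have di : dom i (c t) := mem_chart_at _.
have nc : \forall s \near t, C1_at c s by exact: near_all.
have H := C1_near nc di; have [_ ct hx] := nbhs_singleton H.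
have E : \forall s \near t, gram (metric i (chart i (c s))) (derive1 (chart i \o c) s) (derive1 (chart i \o c) s) = energy c s.
  by apply: filterS H => s [ds cs hs]; rewrite (energy_chart ds cs hs).
have ce : {for t, continuous (energy c)}.
  suff : energy c s @[s --> t] --> energy c t by [].
  rewrite -(nbhs_singleton E); apply: cvg_trans (near_eq_cvg E) _.
  apply: cont_gram; [|exact: ((Hc t).2 i di).2|exact: ((Hc t).2 i di).2].
  have cm : {for chart i (c t), continuous (metric i)}.
    by apply: (metric_Ck i 0); exact: chart_img.
  exact: (@continuous_comp _ _ _ (chart i \o c) (metric i) t (is_derive_continuous hx) cm).
exact: (@continuous_comp _ _ _ (energy c) Num.sqrt t ce (@sqrt_continuous R _)).
Qed.

(** Lengths are handled through primitives of the speed instead of integrals. *)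
Lemma curve_length_prim c F : C1_curve c -> (forall t : R, is_derive t 1 F (speed c t)) ->
  curve_length c = (F 1 - F 0)%:E.
Proof.
move=> Hc HF; rewrite /curve_length EFinB.
apply: (@continuous_FTC2 R (speed c) F 0 1 ltr01).
- by apply: continuous_subspaceT; exact: C1_speed_continuous.
- split; first by move=> x _; case: (HF x).
  + by apply: cvg_at_right_filter; exact: is_derive_continuous (HF 0).
  + by apply: cvg_at_left_filter; exact: is_derive_continuous (HF 1).
- by move=> x _; exact: is_derive1E (HF x).
Qed.

Lemma rdist_le c x y (B : R) : C1_curve c -> c 0 = x -> c 1 = y ->
  (forall t, 0 <= t <= 1 -> speed c t <= B) -> (rdist x y <= B%:E)%E.
Proof.
move=> Hc c0 c1 HB; have [F [F0 HF]] := primitive_scalar (C1_speed_continuous Hc).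
apply: (@le_trans _ _ (curve_length c)).
  by apply: ereal_inf_lbound; exists c.
rewrite (curve_length_prim Hc HF) lee_fin.
have := @le_of_derive_le R F (speed c) (fun t => 0 + t *: B) (fun=> B) 0 1 ler01 (fun t _ => HF t)
  (fun t _ => is_derive_affine 0 B t) HB.
by rewrite scale0r addr0 subr0 add0r scale1r.
Qed.

Lemma rdist_ge x y (L : R) : (forall c F, C1_curve c -> c 0 = x -> c 1 = y ->
    F 0 = 0 -> (forall t : R, is_derive t 1 F (speed c t)) -> L <= F 1) ->
  (L%:E <= rdist x y)%E.
Proof.
move=> H; apply: le_ereal_inf_tmp => _ [c [Hc [c0 c1]] <-].
have [F [F0 HF]] := primitive_scalar (C1_speed_continuous Hc).
by rewrite (curve_length_prim Hc HF) F0 subr0 lee_fin; exact: H F0 HF.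
Qed.

Lemma is_derive_right_const (W : normedModType R) (x : R -> W) (t : R) (d : W) :
  is_derive t 1 x d -> (forall s, t <= s -> x s = x t) -> d = 0.
Proof.
move=> /is_derive_epsP H Hc; apply/eqP; rewrite -normr_eq0 eq_le normr_ge0 andbT.
apply/ler_addgt0Pr => e e0; rewrite add0r; have [r [r0 Hr]] := H e e0.
have := Hr (t + r / 2); rewrite addrC addKr gtr0_norm; last lra.
move=> /(_ ltac:(lra)); rewrite Hc; last lra.
rewrite subrr sub0r normrN normrZ gtr0_norm; last lra.
by rewrite mulrC ler_pM2r//; lra.
Qed.

Lemma is_derive_left_const (W : normedModType R) (x : R -> W) (t : R) (d : W) :
  is_derive t 1 x d -> (forall s, s <= t -> x s = x t) -> d = 0.
Proof.
move=> /is_derive_epsP H Hc; apply/eqP; rewrite -normr_eq0 eq_le normr_ge0 andbT.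
apply/ler_addgt0Pr => e e0; rewrite add0r; have [r [r0 Hr]] := H e e0.
have := Hr (t - r / 2); rewrite addrC addKr normrN gtr0_norm; last lra.
move=> /(_ ltac:(lra)); rewrite Hc; last lra.
rewrite subrr sub0r normrN normrZ normrN gtr0_norm; last lra.
by rewrite mulrC ler_pM2r//; lra.
Qed.

(** A chain of such paths can be concatenated within C^1 curves, since they rest at
    their end points; the bound on the speed bounds the distance. *)
Definition spath (x y : M) (B : R) := exists c, [/\ C1_curve c,
  forall t, t <= 0 -> c t = x, forall t, 1 <= t -> c t = y & forall t, speed c t <= B].

Lemma spath_rdist x y B : spath x y B -> (rdist x y <= B%:E)%E.
Proof. by move=> [c [Hc c0 c1 HB]]; apply: (rdist_le Hc); [exact: c0|exact: c1|move=> t _; exact: HB]. Qed.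

Lemma C1_affine c (a b t : R) : C1_at c (a * t + b) -> (\forall s \near (a * t + b), C1_at c s) ->
  C1_at (fun s => c (a * s + b)) t /\
  energy (fun s => c (a * s + b)) t = a * a * energy c (a * t + b).
Proof.
move=> [cc H] nc; have ca := continuous_affine_comp cc.
have key i (di : dom i (c (a * t + b))) : \forall s \near t,
    is_derive (s : R) 1 (chart i \o (fun s => c (a * s + b))) (a *: derive1 (chart i \o c) (a * s + b)).
  have h := C1_near nc di.
  by have := near_affine h; apply: filterS => s [_ _ hs]; exact: is_derive_affine_comp hs.
split.
  split; first exact: ca.
  move=> i di; have k := key i di; split; first exact: is_derive_ex (nbhs_singleton k).
  have E : \forall s \near t, a *: derive1 (chart i \o c) (a * s + b) =
      derive1 (chart i \o (fun s => c (a * s + b))) s.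
    by apply: filterS k => s hs; rewrite (is_derive1E hs).
  suff : derive1 (chart i \o (fun s => c (a * s + b))) s @[s --> t] -->
      derive1 (chart i \o (fun s => c (a * s + b))) t by [].
  rewrite -(nbhs_singleton E); apply: cvg_trans (near_eq_cvg E) _.
  have h2 : {for t, continuous (fun s => derive1 (chart i \o c) (a * s + b))}.
    have h2 := (H i di).2.
    exact: (fun V Vc => @near_affine R (fun s => V (derive1 (chart i \o c) s)) a b t (h2 V Vc)).
  exact: (cvgZ (cvg_cst a) h2).
pose i := chart_at (c (a * t + b)); have di : dom i (c (a * t + b)) := mem_chart_at _.
have [_ _ h] := nbhs_singleton (C1_near nc di).
rewrite (energy_chart di ca (nbhs_singleton (key i di))) (energy_chart di cc h).
by rewrite gramZl gramZr mulrA.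
Qed.

Lemma speed_affine c (a b : R) : C1_curve c -> C1_curve (fun s => c (a * s + b)) /\
  forall t, speed (fun s => c (a * s + b)) t = `|a| * speed c (a * t + b).
Proof.
move=> /C1_curveP H.
have nH (s : R) : \forall r \near s, C1_at c r by exact: near_all.
split; first by apply/C1_curveP => t; have [] := C1_affine (H _) (nH (a * t + b)).
move=> t; rewrite !speedE; have [_ ->] := C1_affine (H _) (nH (a * t + b)).
have aa : 0 <= a * a by rewrite -expr2 sqr_ge0.
by rewrite (sqrtrM _ aa) -expr2 sqrtr_sqr.
Qed.

(** Both curves are at rest at the junction, so the velocities agree there. *)
Lemma glue_C1 (d1 d2 : R -> M) (y : M) (l B : R) : C1_curve d1 -> C1_curve d2 ->
  (forall t, l <= t -> d1 t = y) -> (forall t, t <= l -> d2 t = y) ->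
  (forall t, speed d1 t <= B) -> (forall t, speed d2 t <= B) ->
  C1_curve (fun t => if t <= l then d1 t else d2 t) /\
  forall t, speed (fun t => if t <= l then d1 t else d2 t) t <= B.
Proof.
move=> /C1_curveP H1 /C1_curveP H2 e1 e2 B1 B2; set c := fun t => _.
have ncs (d : R -> M) (s : R) : (forall t, C1_at d t) -> \forall r \near s, C1_at d r by move=> h; exact: near_all.
have lt t : t < l -> \forall s \near t, d1 s = c s.
  by move=> tl; have := lt_nbhsl tl; apply: filterS => s sl; rewrite /c ltW.
have gt t : l < t -> \forall s \near t, d2 s = c s.
  by move=> tl; have := lt_nbhsr tl; apply: filterS => s sl; rewrite /c leNgt sl.
have cl : {for l, continuous c}.
  have n1 := (H1 l).1; have n2 := (H2 l).1.
  move=> V; rewrite /c lexx e1// => Vy.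
  have {}n1 : \forall s \near l, V (d1 s) by apply: n1; rewrite e1.
  have {}n2 : \forall s \near l, V (d2 s) by apply: n2; rewrite e2.
  by apply: filterS2 n1 n2 => s v1 v2; rewrite /=; case: ifP.
have cE i t : chart i (c t) = chart i (d1 t) + chart i (d2 t) - chart i y.
  rewrite /c; case: ifPn => tl; first by rewrite (e2 t tl) addrK.
  have -> : d1 t = y by apply: e1; apply: ltW; rewrite ltNge.
  by rewrite [chart i y + _]addrC addrK.
have dl i : dom i y -> \forall s \near l,
    is_derive (s : R) 1 (chart i \o c) (derive1 (chart i \o d1) s + derive1 (chart i \o d2) s).
  move=> di; have di1 : dom i (d1 l) by rewrite e1.
  have di2 : dom i (d2 l) by rewrite e2.
  apply: filterS2 (C1_near (ncs d1 l H1) di1) (C1_near (ncs d2 l H2) di2) => s [_ _ h1] [_ _ h2].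
  have -> : chart i \o c = (fun t => (chart i \o d1) t + (chart i \o d2) t - chart i y).
    by apply/funext => t; exact: cE.
  have h := is_deriveBv (is_deriveDv h1 h2) (is_derive_cst (chart i y) s 1).
  by rewrite subr0 in h; exact: h.
have el : c l = y by rewrite /c lexx e1.
have sl i : dom i y -> derive1 (chart i \o d1) l = 0 /\ derive1 (chart i \o d2) l = 0.
  move=> di; have di1 : dom i (d1 l) by rewrite e1.
  have di2 : dom i (d2 l) by rewrite e2.
  have [_ _ h1] := nbhs_singleton (C1_near (ncs d1 l H1) di1).
  have [_ _ h2] := nbhs_singleton (C1_near (ncs d2 l H2) di2).
  split; [apply: is_derive_right_const h1 _|apply: is_derive_left_const h2 _] => s ls /=.
    by rewrite !e1.
  by rewrite !e2.
split.
  apply/C1_curveP => t; case: (ltgtP t l) => [tl|tl|->].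
  - exact: C1_at_local (lt t tl) (H1 t).
  - exact: C1_at_local (gt t tl) (H2 t).
  split; first exact: cl.
  move=> i; rewrite el => di; have k := dl i di; split; first exact: is_derive_ex (nbhs_singleton k).
  have E : \forall s \near l, derive1 (chart i \o d1) s + derive1 (chart i \o d2) s =
      derive1 (chart i \o c) s.
    by apply: filterS k => s hs; rewrite (is_derive1E hs).
  suff : derive1 (chart i \o c) s @[s --> l] --> derive1 (chart i \o c) l by [].
  rewrite -(nbhs_singleton E); apply: cvg_trans (near_eq_cvg E) _.
  apply: cvgD.
    by apply: ((H1 l).2 i _).2; rewrite e1.
  by apply: ((H2 l).2 i _).2; rewrite e2.
move=> t; case: (ltgtP t l) => [tl|tl|->].
- by rewrite speedE -(energy_near (lt t tl)) -speedE.
- by rewrite speedE -(energy_near (gt t tl)) -speedE.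
pose i := chart_at (c l); have di : dom i (c l) := mem_chart_at _.
have diy : dom i y by rewrite -el.
rewrite speedE (energy_chart di cl (nbhs_singleton (dl i diy))).
have [-> ->] := sl i diy; rewrite addr0 gram0l sqrtr0.
exact: le_trans (speed_ge0 d1 l) (B1 l).
Qed.

(** The two paths are run one after the other, during times proportional to the
    bounds B1 and B2, so that both are slowed down to the speed B1 + B2. *)
Lemma spath_trans x y z (B1 B2 : R) : 0 < B1 -> 0 < B2 -> spath x y B1 -> spath y z B2 ->
  spath x z (B1 + B2).
Proof.
move=> b1 b2 [c1 [H1 c10 c11 s1]] [c2 [H2 c20 c21 s2]].
(* Both pieces run at speed at most B1 + B2, the first one up to time l. *)
pose l := B1 / (B1 + B2); have b12 : 0 < B1 + B2 by lra.
have l0 : 0 < l by rewrite divr_gt0.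
have l1 : l < 1 by rewrite ltr_pdivrMr//; lra.
pose a1 := (B1 + B2) / B1; pose a2 := (B1 + B2) / B2.
have a10 : 0 < a1 by rewrite divr_gt0.
have a20 : 0 < a2 by rewrite divr_gt0.
have [D1 S1] := speed_affine a1 0 H1.
have [D2 S2] := speed_affine a2 (- (B1 / B2)) H2.
have a1l : a1 * l = 1 by rewrite /a1 /l; field; rewrite !gt_eqF.
have a2l : a2 * l = B1 / B2 by rewrite /a2 /l; field; rewrite !gt_eqF.
have a21 : a2 = 1 + B1 / B2 by rewrite /a2; field; rewrite gt_eqF.
have [||||G SG] := @glue_C1 _ _ y l (B1 + B2) D1 D2.
- by move=> t lt; apply: c11; rewrite addr0 -a1l ler_pM2l.
- by move=> t lt; apply: c20; rewrite -a2l subr_le0 ler_pM2l.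
- move=> t; rewrite S1 gtr0_norm//; apply: le_trans (ler_wpM2l (ltW a10) (s1 _)) _.
  by rewrite /a1 divfK// gt_eqF.
- move=> t; rewrite S2 gtr0_norm//; apply: le_trans (ler_wpM2l (ltW a20) (s2 _)) _.
  by rewrite /a2 divfK// gt_eqF.
exists (fun t => if t <= l then c1 (a1 * t + 0) else c2 (a2 * t - B1 / B2)); split => //.
- move=> t t0; rewrite (_ : t <= l); last by lra.
  by apply: c10; rewrite addr0 pmulr_rle0.
- move=> t t1; rewrite leNgt (_ : l < t)/=; last by lra.
  apply: c21; have : a2 * 1 <= a2 * t by rewrite ler_pM2l.
  rewrite mulr1 {1}a21; lra.
Qed.

(** A C^1 step from 0 to 1 whose slope exceeds 1 by as little as desired: composed
    with a curve it brings it to rest at both ends, at the cost of a factor 1 + e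
    on the speed.  The slope is a trapezoid. *)
Lemma step_function (e : R) : 0 < e -> exists s ds : R -> R,
  [/\ forall t : R, is_derive t 1 s (ds t), continuous ds,
      forall t, t <= 0 -> s t = 0, forall t, 1 <= t -> s t = 1 &
      forall t, 0 <= s t <= 1 /\ 0 <= ds t <= 1 + e].
Proof.
move=> e0; pose K := 2 * (1 + e) / e.
have K2 : 2 < K by rewrite /K ltr_pdivlMr//; lra.
have K0 : 0 < K by lra.
(* A trapezoid with ramps of width 1 / K: its mass is at least 1 - 2 / K, which for
   this K is 1 / (1 + e), so that the normalized slope is at most 1 + e. *)
pose tau (t : R) := Num.max 0 (Num.min 1 (Num.min (K * t) (K * (1 - t)))).
have tau0 t : 0 <= tau t by rewrite /tau le_max lexx.
have tau1 t : tau t <= 1 by rewrite /tau ge_max ler01 ge_min lexx.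
have tauc : continuous tau.
  have h0 : continuous (fun t : R => K * t) by move=> t; exact: mulrl_continuous.
  have h1 : continuous (fun t : R => K * (1 - t)).
    have -> : (fun t : R => K * (1 - t)) = (fun t : R => K + t *: (- K)).
      by apply/funext => t; rewrite /GRing.scale/=; ring.
    by move=> t; exact: is_derive_continuous (is_derive_affine K (- K) t).
  have hc (k t : R) : {for t, continuous (fun=> k : R^o)} by exact: cst_continuous.
  move=> t; exact: (@continuous_max R R (fun=> 0 : R^o) _ t (hc 0 t)
    (@continuous_min R R (fun=> 1 : R^o) _ t (hc 1 t) (@continuous_min R R _ _ t (h0 t) (h1 t)))).
have [F [F0 HF]] := primitive_scalar tauc.
have tauL t : t <= 0 -> tau t = 0.
  move=> t0; apply/eqP; rewrite eq_le tau0 andbT /tau ge_max lexx !ge_min.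
  by rewrite (_ : K * t <= 0) ?orbT// pmulr_rle0.
have tauR t : 1 <= t -> tau t = 0.
  move=> t0; apply/eqP; rewrite eq_le tau0 andbT /tau ge_max lexx !ge_min.
  by rewrite (_ : K * (1 - t) <= 0) ?orbT// pmulr_rle0//; lra.
have mono a b : a <= b -> F a <= F b.
  move=> ab; have := @le_of_derive_le R (cst 0) (fun=> 0) F tau a b ab (fun t _ => is_derive_cst 0 t 1)
    (fun t _ => HF t) (fun t _ => tau0 t).
  rewrite /=; lra.
have cst_of a b : a <= b -> (forall t, a <= t <= b -> tau t = 0) -> F b = F a.
  move=> ab H; apply/eqP; rewrite eq_le (mono _ _ ab) andbT.
  have := @le_of_derive_le R F tau (cst 0) (fun=> 0) a b ab (fun t _ => HF t)
    (fun t _ => is_derive_cst 0 t 1) _.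
  rewrite /= subrr => h; rewrite -subr_le0 h// => t /H ->; done.
have FL t : t <= 0 -> F t = 0.
  by move=> t0; rewrite -F0; apply/esym; apply: cst_of => // s /andP[_ /tauL].
have FR t : 1 <= t -> F t = F 1.
  by move=> t0; apply: cst_of => // s /andP[/tauR].
pose m := F 1.
have Ki : 0 < K^-1 by rewrite invr_gt0.
have Ki2 : K^-1 <= 1 - K^-1.
  have : K^-1 <= 2^-1 by rewrite lef_pV2 ?posrE//; lra.
  lra.
have mge : 1 - 2 * K^-1 <= m.
  have h := @le_of_derive_le R (fun t => 0 + t *: (1 : R)) (fun=> 1) F tau _ _ Ki2
    (fun t _ => is_derive_affine (0 : R) (1 : R) t) (fun t _ => HF t).
  have /h : forall t, K^-1 <= t <= 1 - K^-1 -> 1 <= tau t.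
    move=> t /andP[t1 t2]; rewrite /tau le_max le_min lexx le_min.
    have -> : 1 <= K * t by rewrite mulrC -ler_pdivrMr// div1r.
    have -> : 1 <= K * (1 - t) by rewrite mulrC -ler_pdivrMr// div1r; lra.
    by rewrite orbT.
  rewrite ![_ *: 1]mulr1 !add0r => h1.
  have h2 := mono 0 K^-1 (ltW Ki); rewrite F0 in h2.
  have h3 : F (1 - K^-1) <= F 1 by apply: mono; lra.
  rewrite /m; lra.
have m1 : (1 + e)^-1 <= m.
  apply: le_trans mge; rewrite /K invfM invrK !invfM.
  rewrite -[leLHS]mulr1 -subr_ge0 le_eqVlt; apply/orP; left; apply/eqP; field.
  by rewrite gt_eqF//; lra.
have e1 : 0 < (1 + e)^-1 by rewrite invr_gt0; lra.
have m0 : 0 < m by lra.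
exists (fun t => m^-1 * F t), (fun t => m^-1 * tau t); split.
- by move=> t; exact: (@is_deriveZ _ _ _ F m^-1 t 1 _ (HF t)).
- by move=> t; exact: (@continuousM _ _ (fun=> m^-1) tau t (cvg_cst m^-1) (tauc t)).
- by move=> t /FL ->; rewrite mulr0.
- by move=> t /FR ->; rewrite mulVf// gt_eqF.
move=> t; have im : 0 <= m^-1 by rewrite invr_ge0 ltW.
have F0t : 0 <= F t.
  by case: (lerP t 0) => [/FL ->//|/ltW/mono]; rewrite F0.
have Ftm : F t <= m.
  by case: (lerP 1 t) => [/FR ->//|/ltW/mono].
split; apply/andP; split; rewrite ?mulr_ge0//.
  by rewrite mulrC ler_pdivrMr// mul1r.
apply: (@le_trans _ _ (m^-1 * 1)); first by rewrite ler_wpM2l.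
by rewrite mulr1 invf_ple ?posrE//; lra.
Qed.

Lemma comp_C1 c (s ds : R -> R) (L : R) :
  (forall t : R, is_derive t 1 s (ds t)) -> continuous ds ->
  (forall t, C1_at c (s t)) ->
  C1_curve (fun t => c (s t)) /\ forall t, energy (fun t => c (s t)) t = ds t * ds t * energy c (s t).
Proof.
move=> Hs cds Hc.
have cs t : {for t, continuous s} := is_derive_continuous (Hs t).
have cc t : {for t, continuous (fun t => c (s t))}.
  exact: (@continuous_comp _ _ _ s c t (cs t) (Hc t).1).
have key t i : dom i (c (s t)) -> \forall r \near t,
   is_derive (r : R) 1 (chart i \o (fun t => c (s t))) (ds r *: derive1 (chart i \o c) (s r)).
  move=> di; apply: filterS (near_dom (cc t) di) => r dr.
  have [h _] := (Hc r).2 i dr.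
  have hx := derivable_is_derive1 h.
  apply: is_derive_mx => a b; rewrite mxE.
  have hxab := is_derive_coord a b hx.
  have := @is_derive1_comp R (fun q => (chart i \o c) q a b) s r _ _ hxab (Hs r).
  by rewrite mulrC.
split.
  apply/C1_curveP => t; split; first exact: cc.
  move=> i di; have k := key t i di.
  split; first exact: is_derive_ex (nbhs_singleton k).
  have E : \forall r \near t, ds r *: derive1 (chart i \o c) (s r) =
      derive1 (chart i \o (fun t => c (s t))) r.
    by apply: filterS k => r hr; rewrite (is_derive1E hr).
  suff : derive1 (chart i \o (fun t => c (s t))) r @[r --> t] -->
      derive1 (chart i \o (fun t => c (s t))) t by [].
  rewrite -(nbhs_singleton E); apply: cvg_trans (near_eq_cvg E) _.
  exact: (cvgZ (cds t)
    (@continuous_comp _ _ _ s (derive1 (chart i \o c)) t (cs t) ((Hc t).2 i di).2)).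
move=> t; pose i := chart_at (c (s t)); have di : dom i (c (s t)) := mem_chart_at _.
have [h _] := (Hc t).2 i di.
rewrite (energy_chart di (cc t) (nbhs_singleton (key t i di))).
rewrite (energy_chart di (Hc t).1 (derivable_is_derive1 h)).
by rewrite gramZl gramZr mulrA.
Qed.

Lemma spath_of_curve c (L e : R) : 0 <= L -> 0 < e ->
  (forall t, 0 <= t <= 1 -> C1_at c t /\ speed c t <= L) ->
  spath (c 0) (c 1) ((1 + e) * L).
Proof.
move=> L0 e0 H; have [s [ds [hs cds s0 s1 sb]]] := step_function e0.
have [|G E] := @comp_C1 c s ds L hs cds; first by move=> t; exact: (H _ (sb t).1).1.
exists (fun t => c (s t)); split => //.
- by move=> t /s0 ->.
- by move=> t /s1 ->.
move=> t; have [s01 /andP[d0 d1]] := sb t; rewrite speedE E.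
rewrite sqrtrM ?mulr_ge0// -expr2 sqrtr_sqr ger0_norm// -speedE.
by rewrite ler_pM// ?speed_ge0// (H _ s01).2.
Qed.

Lemma geo_C1_at (J : set R) c (t : R) : open J -> J t -> geodesic_on J c -> C1_at c t.
Proof.
move=> oJ Jt gc; split; first exact: (gc t Jt).1.
move=> i di; have [_ _ nx hv] := geodesic_near oJ Jt gc di.
split; first exact: is_derive_ex (nbhs_singleton nx).
exact: is_derive_continuous hv.
Qed.

Lemma geodesic_energy (J : set R) c (t : R) : open J -> is_interval J -> J 0 -> J t ->
  geodesic_on J c -> energy c t = energy c 0.
Proof.
move=> oJ iJ J0 Jt gc.
have dE s : J s -> is_derive s 1 (energy c) 0.
  move=> Js; pose i := chart_at (c s); have di : dom i (c s) := mem_chart_at _.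
  have [nd nc nx hv] := geodesic_near oJ Js gc di.
  have hx := nbhs_singleton nx.
  have := geodesic_speed (chart_img di) hx hv.
  apply: near_eq_is_derive.
  have : \forall r \near s, [/\ dom i (c r), {for r, continuous c} &
     is_derive (r : R) 1 (chart i \o c) (derive1 (chart i \o c) r)].
    near=> r; split.
    - by have [] : J r /\ dom i (c r) by near: r; exact: nd.
    - by near: r; exact: nc.
    - by near: r; exact: nx.
  by apply: filterS => r [dr cr hr]; rewrite (energy_chart dr cr hr).
case: (lerP 0 t) => t0.
  have inJ s : 0 <= s <= t -> J s by move=> /andP[? ?]; apply: (iJ 0 t) => //; apply/andP.
  have h1 := @le_of_derive_le R (energy c) (fun=> 0) (cst 0) (fun=> 0) 0 t t0
     (fun s hs => dE s (inJ s hs)) (fun s _ => is_derive_cst 0 s 1) (fun _ _ => lexx 0).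
  have h2 := @le_of_derive_le R (cst 0) (fun=> 0) (energy c) (fun=> 0) 0 t t0
     (fun s _ => is_derive_cst 0 s 1) (fun s hs => dE s (inJ s hs)) (fun _ _ => lexx 0).
  by rewrite [cst 0 _ - cst 0 _]subrr in h1 h2; exact: eq_of_sub h1 h2.
have inJ s : t <= s <= 0 -> J s by move=> /andP[? ?]; apply: (iJ t 0) => //; apply/andP.
have h1 := @le_of_derive_le R (energy c) (fun=> 0) (cst 0) (fun=> 0) t 0 (ltW t0)
   (fun s hs => dE s (inJ s hs)) (fun s _ => is_derive_cst 0 s 1) (fun _ _ => lexx 0).
have h2 := @le_of_derive_le R (cst 0) (fun=> 0) (energy c) (fun=> 0) t 0 (ltW t0)
   (fun s _ => is_derive_cst 0 s 1) (fun s hs => dE s (inJ s hs)) (fun _ _ => lexx 0).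
by rewrite [cst 0 _ - cst 0 _]subrr in h1 h2; apply/esym; exact: eq_of_sub h1 h2.
Unshelve. all: by end_near. Qed.

End Length.

(** * Calibration of short geodesics *)

Section Box.
Context {R : realType} {n : nat} (M : riemannianManifold R n).
Implicit Types (i j : atlas M) (p u v w : 'rV[R]_n) (c : R -> M).

Lemma gram_CS (G : 'M[R]_n) u v : G^T = G -> (forall w, w != 0 -> 0 < gram G w w) ->
  gram G u v * gram G u v <= gram G u u * gram G v v.
Proof.
move=> GT Gp; have [->|v0] := eqVneq v 0; first by rewrite !gram0r !mulr0.
have vv := Gp v v0.
set a := gram G u u; set b := gram G u v; set d := gram G v v in vv *.
have : 0 <= gram G (d *: u - b *: v) (d *: u - b *: v).
  have [->|w0] := eqVneq (d *: u - b *: v) 0; first by rewrite gram0l.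
  exact/ltW/Gp.
rewrite gramBl !gramBr !gramZl !gramZr (gram_sym v u GT) -/a -/b -/d => h.
have : 0 <= d * (a * d - b * b) by move: h; set X := _ - _; have -> : X = d * (a * d - b * b) by [rewrite /X; ring].
by rewrite pmulr_rge0// subr_ge0.
Qed.

(** Cauchy-Schwarz against the dual basis w bounds each coordinate of u. *)
Lemma posdef_lower (G : 'M[R]_n) : G^T = G -> (forall w, w != 0 -> 0 < gram G w w) ->
  exists lam : R, 0 < lam /\ forall u, lam * (`|u| * `|u|) <= gram G u u.
Proof.
move=> GT Gp; have GU := posdef_unit Gp.
have G0 u : 0 <= gram G u u.
  by have [->|w0] := eqVneq u 0; [rewrite gram0l|exact/ltW/Gp].
pose w (j : 'I_n) : 'rV[R]_n := delta_mx ord0 j *m invmx G.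
have uw u (j : 'I_n) : gram G u (w j) = u ord0 j.
  rewrite (gram_sym _ _ GT) gram_mulE /w mulmxKV//.
  by rewrite -rowE !mxE.
have [S [S0 HS]] := @bounded_family R 'I_n (fun j : 'I_n => gram G (w j) (w j)).
have S1 : 0 < S + 1 by lra.
exists (S + 1)^-1; split; first by rewrite invr_gt0.
move=> u; rewrite mulrC ler_pdivrMr//.
have h (j : 'I_n) : `|u ord0 j| * `|u ord0 j| <= gram G u u * (S + 1).
  rewrite -normrM ger0_norm; last by rewrite -expr2 sqr_ge0.
  rewrite -!(uw u j); apply: (le_trans (gram_CS u (w j) GT Gp)).
  rewrite ler_wpM2l//; have := HS j; rewrite ger0_norm//; lra.
have g0 : 0 <= gram G u u * (S + 1) by rewrite mulr_ge0// ltW.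
have hs : `|u| <= Num.sqrt (gram G u u * (S + 1)).
  apply: norm_le_row => [|j]; first exact: sqrtr_ge0.
  by rewrite -[leLHS]ger0_norm// -sqrtr_sqr ler_wsqrtr// expr2.
rewrite -[leRHS]sqr_sqrtr// expr2; apply: ler_pM => //.
Qed.

(** Ellipticity of the metric and its second-order Taylor estimate, uniformly on a
    chart ball. *)
Record metric_box i p (r lam Lam K : R) : Prop := MetricBox {
  mb_r : 0 < r ; mb_lam : 0 < lam ; mb_Lam : 0 < Lam ; mb_K : 0 <= K ;
  mb_img : nball p r `<=` img i ;
  mb_low : forall q u, nball p r q -> lam * (`|u| * `|u|) <= gram (metric i q) u u ;
  mb_up : forall q u v, nball p r q -> `|gram (metric i q) u v| <= Lam * `|u| * `|v| ;
  mb_lip : forall q q' u v, nball p r q -> nball p r q' ->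
    `|gram (metric i q - metric i q') u v| <= K * `|q - q'| * `|u| * `|v| ;
  mb_c11 : forall q q' u v, nball p r q -> nball p r q' ->
    `|gram (metric i q - metric i q' - 'D_(q - q') (metric i) q') u v|
      <= K * `|q - q'| * `|q - q'| * `|u| * `|v| }.

Lemma metric_box_exists i p : img i p -> exists r lam Lam K, metric_box i p r lam Lam K.
Proof.
move=> ip; have oI := img_open i.
pose g a b := fun q => metric i q a b : R^o.
have gk a b k : Ck k (img i) (g a b) := Ck_coord a b oI (metric_Ck i k).
have [||r1 [r10 H1]] := @radius_forall_mono R ('I_n * 'I_n)%type
    (fun ab r => exists K, c11 (nball p r) (g ab.1 ab.2) (fun x v => 'D_v (g ab.1 ab.2) x) K).
- move=> [a b] /=; have [r [r0 _ [K HK]]] := Ck2_to_C11 oI (gk a b 2) ip.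
  by exists r; split => //; exists K.
- move=> ab r r' _ rr [K [K0 l b d lp e]]; have sub := nball_sub (p := p) rr.
  exists K; split => //.
  + by move=> q /sub; exact: l.
  + by move=> q /sub; exact: b.
  + by move=> q v /sub; exact: d.
  + by move=> x y /sub ? /sub; exact: lp.
  + by move=> x y q /sub ? /sub ? /sub; exact: e.
have [r3 [r30 H3]] := open_ball_ex oI ip.
have /choice[K HK] := H1.
have [L [L0 HL]] := bounded_family K.
have KL ab : K ab <= L by exact: le_trans (ler_norm _) (HL ab).
have {}HK ab := c11_weaken (KL ab) (HK ab).
have Gp w : w != 0 -> 0 < gram (metric i p) w w by move=> w0; exact: metric_pos.
have [lam [lam0 Hlam]] := posdef_lower (Defs.metric_sym ip) Gp.
pose N : R := n%:R * n%:R * L; have N0 : 0 <= N by rewrite !mulr_ge0.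
have N1 : 0 < N + 1 by lra.
(* Within this radius the form moves by at most half of its ellipticity constant
   lam at p. *)
pose r := Num.min (Num.min r1 r3) (lam / 2 / (N + 1)).
have r0 : 0 < r by rewrite !lt_min r10 r30 !divr_gt0.
have rr1 : r <= r1 by rewrite /r !ge_min lexx.
have rr3 : r <= r3 by rewrite /r !ge_min lexx orbT.
have rr4 : r <= lam / 2 / (N + 1) by rewrite /r !ge_min lexx !orbT.
have pr : nball p r p by rewrite /nball/= subrr normr0.
have rI : nball p r `<=` img i by move=> q /(nball_sub rr3); exact: H3.
have lip q q' u v : nball p r q -> nball p r q' ->
    `|gram (metric i q - metric i q') u v| <= N * `|q - q'| * `|u| * `|v|.
  move=> /(nball_sub rr1) qr /(nball_sub rr1) qr'.
  have Lq : 0 <= L * `|q - q'| by rewrite mulr_ge0.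
  apply: (le_trans (gram_le u v Lq _)).
    by move=> a b; rewrite !mxE; exact: (c11_lip (HK (a, b)) qr qr').
  by rewrite /N !mulrA.
exists r, (lam / 2), (N + 1), N; split => //.
- by rewrite divr_gt0.
- move=> q u qr; have := lip q p u u qr pr; rewrite gramMB => h.
  have h2 := Hlam u; have uu : 0 <= `|u| * `|u| by rewrite mulr_ge0.
  have h3 : N * `|q - p| * `|u| * `|u| <= lam / 2 * (`|u| * `|u|).
    rewrite -mulrA; apply: ler_wpM2r => //.
    have qr' : `|q - p| <= lam / 2 / (N + 1) by exact/ltW/(lt_le_trans qr).
    apply: (@le_trans _ _ ((N + 1) * (lam / 2 / (N + 1)))); last first.
      by rewrite mulrC divfK// gt_eqF.
    by apply: ler_pM => //; lra.
  have := le_trans h h3; rewrite ler_norml => /andP[h4 _].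
  set a := gram _ u u in h4 *; set b := gram _ u u in h2 h4; lra.
- move=> q u v qr.
  have h := @gram_le R n (metric i q) L u v L0 _.
  apply: (le_trans (h _)).
    by move=> a b; exact: (c11_bd (HK (a, b)) (nball_sub rr1 qr)).
  by rewrite -/N ler_wpM2r// ler_wpM2r//; lra.
- move=> q q' u v qr qr'; have Lq : 0 <= L * `|q - q'| * `|q - q'| by rewrite !mulr_ge0.
  apply: (le_trans (gram_le u v Lq _)); last by rewrite /N !mulrA.
  move=> a b; rewrite derive_mx; last by apply: (metric_Ck i 1).1; exact: rI.
  rewrite !mxE.
  have := c11_est (HK (a, b)) (nball_sub rr1 qr) (nball_sub rr1 qr') (nball_sub rr1 qr').
  by rewrite subrr normr0 addr0.
Qed.

Lemma metric_box_le i p (r r' lam Lam K : R) : 0 < r' -> r' <= r ->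
  metric_box i p r lam Lam K -> metric_box i p r' lam Lam K.
Proof.
move=> r0 rr [_ l0 L0 K0 im lo up lp e]; have sub := nball_sub (p := p) rr.
split => //.
- by move=> q /sub; exact: im.
- by move=> q u /sub; exact: lo.
- by move=> q u v /sub; exact: up.
- by move=> q q' u v /sub ? /sub; exact: lp.
- by move=> q q' u v /sub ? /sub; exact: e.
Qed.

(** This choice of m makes a quadratic form in (Y, Z) a square. *)
Lemma quad_nonneg (m lam Lam Y Z : R) : 0 < lam -> 0 < Lam -> m = lam * lam / (8 * (Lam * Lam)) ->
  2 * m * Lam * (Y * Z) <= m * lam / 4 * (Y * Y) + lam / 2 * (Z * Z).
Proof.
move=> l0 L0 ->; rewrite -subr_ge0.
have -> : lam * lam / (8 * (Lam * Lam)) * lam / 4 * (Y * Y) + lam / 2 * (Z * Z) -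
  2 * (lam * lam / (8 * (Lam * Lam))) * Lam * (Y * Z) =
  lam / 2 * (Z - lam / (4 * Lam) * Y) ^+ 2.
  by field; rewrite gt_eqF.
by rewrite mulr_ge0 ?sqr_ge0// divr_ge0// ltW.
Qed.

Section Calibration.
Variables (i : atlas M) (p0 : 'rV[R]_n) (r lam Lam K V : R).
Hypothesis box : metric_box i p0 r lam Lam K.
Let m : R := lam * lam / (8 * (Lam * Lam)).
Hypotheses (V0 : 0 <= V) (HV1 : K * (V * V) <= m * lam / 2) (HV2 : K * V <= m * Lam).

(** The Hamilton-Jacobi inequality for the calibrating function, at the point
    x + y with velocity v + z, where x and v are the position and the velocity of
    the geodesic.  The Taylor remainder of the metric has size K |y|^2 |v|^2 and is
    absorbed by the term in m, since v is small; the cross terms in |y| |z| are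
    absorbed by the two definite ones. *)
Lemma calibration_pointwise (x y v z : 'rV[R]_n) (th : R) : nball p0 r x -> nball p0 r (x + y) ->
  `|v| <= V -> 0 <= th <= 1 ->
  2^-1 * gram (metric i x) v v + 2^-1 * gram ('D_y (metric i) x) v v + gram (metric i x) v z
   - m / 2 * gram (metric i p0) y y - m * th * gram (metric i p0) y z
  <= 2^-1 * gram (metric i (x + y)) (v + z) (v + z).
Proof.
move=> xr xyr vV th01.
have [r0 l0 L0 K0 im lo up lp e] := box.
have V0' := V0; have HV1' := HV1; have HV2' := HV2.
have m0 : 0 < m by rewrite /m !mulr_gt0// invr_gt0 !mulr_gt0.
have p0r : nball p0 r p0 by rewrite /nball/= subrr normr0.
have exy : x + y - x = y by rewrite addrC addKr.
have e1 := e (x + y) x v v xyr xr; rewrite exy !gramMB in e1.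
have e2 := lp (x + y) x v z xyr xr; rewrite exy gramMB in e2.
have e3 := lo (x + y) z xyr.
have e4 := lo p0 y p0r.
have e5 := up p0 y z p0r.
have sy : gram (metric i (x + y)) z v = gram (metric i (x + y)) v z.
  by rewrite metric_gram_sym//; exact: im.
rewrite gramDl !gramDr sy.
move: e1 e2 e3 e4 e5.
set g1 := gram (metric i (x + y)) v v; set g2 := gram (metric i (x + y)) v z.
set g3 := gram (metric i (x + y)) z z; set g4 := gram (metric i x) v v.
set g5 := gram (metric i x) v z; set g6 := gram ('D_y _ _) v v.
set g7 := gram (metric i p0) y y; set g8 := gram (metric i p0) y z.
move=> e1 e2 e3 e4 e5.
set Y := `|y| in e1 e2 e4 e5; set Z := `|z| in e2 e3 e5; set v1 := `|v| in vV e1 e2.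
have Y0 : 0 <= Y by exact: normr_ge0.
have Z0 : 0 <= Z by exact: normr_ge0.
have v10 : 0 <= v1 by exact: normr_ge0.
have b1 : K * Y * Y * v1 * v1 <= m * lam / 2 * (Y * Y).
  have h : v1 * v1 <= V * V by apply: ler_pM.
  have : K * (Y * Y) * (v1 * v1) <= K * (Y * Y) * (V * V) by rewrite ler_wpM2l// !mulr_ge0.
  have : K * (V * V) * (Y * Y) <= m * lam / 2 * (Y * Y) by rewrite ler_wpM2r// mulr_ge0.
  lra.
have b2 : K * Y * v1 * Z <= m * Lam * (Y * Z).
  have : K * (Y * Z) * v1 <= K * (Y * Z) * V by rewrite ler_wpM2l// !mulr_ge0.
  have : K * V * (Y * Z) <= m * Lam * (Y * Z) by rewrite ler_wpM2r// mulr_ge0.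
  lra.
have b3 : - (m * Lam * (Y * Z)) <= m * th * g8.
  have h : `|m * th * g8| <= m * Lam * (Y * Z).
    have /andP[t0 t1] := th01.
    have -> : m * th * g8 = m * (th * g8) by ring.
    rewrite (normrM m) (gtr0_norm m0) (normrM th) (ger0_norm t0).
    have : m * (th * `|g8|) <= m * (1 * (Lam * Y * Z)).
      by rewrite ler_wpM2l ?(ltW m0)// ler_pM.
    lra.
  by move: h; rewrite ler_norml => /andP[].
have b4 : m / 2 * (lam * (Y * Y)) <= m / 2 * g7 by rewrite ler_wpM2l// divr_ge0// ltW.
have q := quad_nonneg Y Z l0 L0 (erefl m).
move: e1 e2; rewrite !ler_norml => /andP[e1 _] /andP[e2 _].
lra.
Qed.

(** Let l be the length of the competing curve p.  Run with the parameter th, whose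
    derivative is proportional to the speed of p plus eps, the curve has energy at
    most (l + eps)^2 / 2.  The calibrating function is 0 at the start and E at the
    end, so integrating the pointwise inequality gives E <= (l + eps)^2 / 2. *)
Lemma calibration (x v : R -> 'rV[R]_n) (E : R) (p dp : R -> 'rV[R]_n) (F : R -> R) :
  (forall t : R, 0 <= t <= 1 -> [/\ nball p0 r (x t), is_derive t 1 x (v t),
     is_derive t 1 v (- christoffel i (x t) (v t) (v t)), `|v t| <= V &
     gram (metric i (x t)) (v t) (v t) = 2 * E]) ->
  (forall s : R, 0 <= s <= 1 -> [/\ nball p0 r (p s), is_derive s 1 p (dp s) &
     is_derive s 1 F (Num.sqrt (gram (metric i (p s)) (dp s) (dp s)))]) ->
  p 0 = x 0 -> p 1 = x 1 -> Num.sqrt (2 * E) <= F 1 - F 0.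
Proof.
move=> Hx Hp e0 e1.
have [r0 l0 L0 K0 im lo up lp e] := box.
have in0 : 0 <= (0 : R) <= 1 by rewrite lexx ler01.
have in1 : 0 <= (1 : R) <= 1 by rewrite lexx ler01.
pose sg s := Num.sqrt (gram (metric i (p s)) (dp s) (dp s)).
have sg0 s : 0 <= sg s by exact: sqrtr_ge0.
set l := F 1 - F 0.
have Fmono a b : 0 <= a -> a <= b -> b <= 1 -> F a <= F b.
  move=> a0 ab b1.
  have h := @le_of_derive_le R (cst 0) (fun=> 0) F sg a b ab (fun t _ => is_derive_cst 0 t 1).
  rewrite -subr_ge0; apply: le_trans (h _ _); rewrite ?subrr// => t /andP[t1 t2].
    have t01 : 0 <= t <= 1 by rewrite (le_trans a0 t1) (le_trans t2 b1).
    by have [_ _ hF] := Hp t t01.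
have l00 : 0 <= l by rewrite subr_ge0 Fmono.
have E0 : 0 <= 2 * E.
  have [xr _ _ _ <-] := Hx 0 in0; exact: metric_gram_ge0 (im _ xr).
suff main eps : 0 < eps -> 2 * E <= (l + eps) * (l + eps).
  apply/ler_addgt0Pr => eps eps0; have := main eps eps0.
  have le0 : 0 <= l + eps by lra.
  by move=> h; rewrite -[leRHS](ger0_norm le0) -sqrtr_sqr expr2 ler_wsqrtr.
move=> eps0; have le0 : 0 < l + eps by lra.
(* With eps the parameter is strictly increasing even where p is at rest. *)
pose th s := (l + eps)^-1 * (F s - F 0 + eps * s).
pose kap s := (l + eps)^-1 * (sg s + eps).
have kap0 s : 0 < kap s by rewrite mulr_gt0 ?invr_gt0//; have := sg0 s; lra.
have th0 : th 0 = 0 by rewrite /th subrr mulr0 addr0 mulr0.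
have th1 : th 1 = 1 by rewrite /th mulr1 mulVf// gt_eqF.
have th01 s : 0 <= s <= 1 -> 0 <= th s <= 1.
  move=> /andP[s0 s1]; have f0 := Fmono 0 s (lexx _) s0 s1; have f1 := Fmono s 1 s0 s1 (lexx _).
  have es : eps * s <= eps * 1 by rewrite ler_wpM2l// ltW.
  have es0 : 0 <= eps * s by rewrite mulr_ge0// ltW.
  rewrite /th mulr_ge0 ?invr_ge0 ?(ltW le0)//=; last by lra.
  by rewrite mulrC ler_pdivrMr// mul1r /l; lra.
have dth (s : R) : 0 <= s <= 1 -> is_derive s 1 th (kap s).
  move=> s01; have [_ _ hF] := Hp s s01.
  have h1 : is_derive s 1 (fun s => - F 0 + s *: eps) eps by exact: is_derive_affine.
  have h2 := is_derive_add hF h1.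
  have := @is_deriveZ _ _ _ _ (l + eps)^-1 s 1 _ h2.
  have -> : (l + eps)^-1 \*: (fun s => F s + (- F 0 + s *: eps)) = th.
    by apply/funext => t; rewrite /th /= /GRing.scale/=; ring.
  by [].
(* Phi is the calibrating function along p, run with the parameter th. *)
pose y s := p s - x (th s).
pose Phi s := E * th s + gram (metric i (x (th s))) (v (th s)) (y s)
   - m / 2 * th s * gram (metric i p0) (y s) (y s).
have ip0 : img i p0 by apply: im; rewrite /nball/= subrr normr0.
have comp (f : R -> 'rV[R]_n) d (s : R) : 0 <= s <= 1 -> is_derive (th s) 1 f d ->
    is_derive s 1 (fun s => f (th s)) (kap s *: d).
  move=> s01 hf; apply: is_derive_mx => a b; rewrite mxE.
  have := @is_derive1_comp R (fun q => f q a b) th s _ _ (is_derive_coord a b hf) (dth s s01).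
  by rewrite mulrC.
(* kap sends the speed of p to at most l + eps, so the right-hand side of the
   pointwise inequality is at most (l + eps)^2 / 2. *)
have dPhi (s : R) : 0 <= s <= 1 -> exists2 d, is_derive s 1 Phi d & d <= kap s * (2^-1 * ((l + eps) * (l + eps))).
  move=> s01; have [pr hp hF] := Hp s s01; have t01 := th01 s s01.
  have [xr hx hv vV vE] := Hx (th s) t01.
  have hxt := comp _ _ _ s01 hx; have hvt := comp _ _ _ s01 hv.
  pose k := kap s; have k0 : 0 < k := kap0 s.
  pose z := k^-1 *: dp s - v (th s).
  have hy : is_derive s 1 y (k *: z).
    have := is_deriveBv hp hxt.
    have -> : dp s - kap s *: v (th s) = k *: z.
      by rewrite /z scalerBr scalerA mulfV ?scale1r// gt_eqF.
    by [].
  have ix : img i (x (th s)) := im _ xr.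
  have hm := is_derive_comp (img_open i) (metric_Ck i 1) ix hxt.
  have hg1 := is_derive_gram hm hvt hy.
  have hg0 := is_derive_gram (is_derive_cst (metric i p0) s (1 : R)) hy hy.
  have hE := is_derive_mul (is_derive_cst E s (1 : R)) (dth s s01).
  have hmt := is_derive_mul (is_derive_cst (m / 2) s (1 : R)) (dth s s01).
  have h2 := is_derive_mul hmt hg0.
  have h1 := is_derive_add hE hg1.
  have h3 := @is_deriveB _ _ _ _ _ s 1 _ _ h1 h2.
  eexists; first exact: h3.
  have ey : x (th s) + y s = p s by rewrite /y addrC subrK.
  have xyr : nball p0 r (x (th s) + y s) by rewrite ey.
  have := calibration_pointwise z xr xyr vV t01; rewrite ey vE.
  have -> : v (th s) + z = k^-1 *: dp s by rewrite /z addrC subrK.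
  have dmk : 'D_(kap s *: v (th s)) (metric i) (x (th s)) = k *: 'D_(v (th s)) (metric i) (x (th s)).
    have := derive_mx_linear k (v (th s)) 0 (img_open i) (metric_Ck i 1) ix.
    by rewrite addr0 derive0 addr0.
  rewrite dmk /= (gramMZ _ k) (gramZl _ (kap s)) gramNl (christoffel_gram _ _ ix).
  rewrite (gramZr _ k) (gramZl _ k z) (gramZr _ k (y s) z).
  rewrite (gramZl _ k^-1) (gramZr _ k^-1) (metric_gram_sym z (y s) ip0).
  have gz0 : gram (0 : 'M[R]_n) (y s) (y s) = 0 by rewrite -(scale0r (0 : 'M[R]_n)) gramMZ mul0r.
  have sg2 : gram (metric i (p s)) (dp s) (dp s) = sg s * sg s.
    by rewrite /sg -expr2 sqr_sqrtr// metric_gram_ge0//; exact: im.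
  rewrite gz0 sg2.
  have kE : (l + eps) * k = sg s + eps by rewrite /k /kap mulrA mulfV ?mul1r// gt_eqF.
  have sgk : 2^-1 * (k^-1 * (k^-1 * (sg s * sg s))) <= 2^-1 * ((l + eps) * (l + eps)).
    rewrite ler_wpM2l// mulrA mulrACA ler_pM ?mulr_ge0 ?invr_ge0 ?(ltW k0)//.
      by rewrite mulrC ler_pdivrMr// kE; lra.
    by rewrite mulrC ler_pdivrMr// kE; lra.
  move=> h; have := ler_wpM2l (ltW k0) (le_trans h sgk).
  apply: le_trans; rewrite -/k le_eqVlt; apply/orP; left; apply/eqP.
  set G1 := gram _ _ (y s); set G2 := gram _ _ (v (th s)); set G3 := gram _ _ z.
  set G4 := gram _ (y s) (y s); set G5 := gram _ (y s) z.
  by field.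
pose dP s := derive1 Phi s.
have hdP (s : R) : 0 <= s <= 1 -> is_derive s 1 Phi (dP s).
  by move=> s01; have [d hd _] := dPhi s s01; rewrite /dP (is_derive1E hd).
have h := @le_of_derive_le R Phi dP (fun s => 2^-1 * ((l + eps) * (l + eps)) * th s)
  (fun s => kap s * (2^-1 * ((l + eps) * (l + eps)))) 0 1 ler01 hdP _ _.
have {h} : Phi 1 - Phi 0 <= 2^-1 * ((l + eps) * (l + eps)) * th 1 -
    2^-1 * ((l + eps) * (l + eps)) * th 0.
  apply: h => s s01.
    have := @is_deriveZ _ _ _ _ (2^-1 * ((l + eps) * (l + eps))) s 1 _ (dth s s01).
    by rewrite (mulrC (kap s)).
  by have [d hd dle] := dPhi s s01; rewrite /dP (is_derive1E hd).
rewrite /Phi /y th0 th1 e0 e1 !subrr !gram0r; lra.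
Qed.

End Calibration.
End Box.

(** * Short geodesics minimize the distance *)

Lemma real_induction {R : realType} (P : R -> Prop) (a b : R) : a <= b -> P a ->
  (forall s, a <= s < b -> P s -> exists e, 0 < e /\ forall s', s <= s' < s + e -> P s') ->
  (forall s, a < s <= b -> (forall s', a <= s' < s -> P s') -> P s) ->
  forall s, a <= s <= b -> P s.
Proof.
move=> ab Pa Hopen Hlim.
pose S : set R := [set t | a <= t <= b /\ forall s, a <= s <= t -> P s].
have Sa : S a by split; [rewrite lexx ab|move=> s sa; have -> : s = a by apply: le_anti; rewrite andbC].
have hS : has_sup S by split; [exists a|exists b => t [/andP[]]].
have ub := sup_upper_bound hS.
set sg := sup S in ub.
have asg : a <= sg by exact: ub.
have sgb : sg <= b by apply: ge_sup => [|t [/andP[]]//]; exists a.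
have Pbefore s : a <= s < sg -> P s.
  move=> /andP[as_ ss]; have e0 : 0 < sg - s by rewrite subr_gt0.
  have [t [tab Ht] st] := sup_adherent e0 hS; apply: Ht; rewrite as_ /=.
  by move: st; rewrite -/sg opprB addrC subrK => /ltW.
have Psg : P sg.
  have [->//|ne] := eqVneq sg a; apply: Hlim => //.
  by rewrite lt_neqAle eq_sym ne asg.
have {}Pbefore s : a <= s <= sg -> P s.
  move=> /andP[as_]; rewrite le_eqVlt => /orP[/eqP->//|ss]; apply: Pbefore; exact/andP.
suff : sg = b by move=> <-.
apply/eqP; rewrite eq_le sgb /= leNgt; apply/negP => lt.
have sgab : a <= sg < b by rewrite asg.
have [e [e0 He]] := Hopen sg sgab Psg.
pose t := Num.min (sg + e / 2) b.
have st : sg < t by rewrite lt_min lt andbT ltrDl divr_gt0.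
have te : t < sg + e by apply: (@le_lt_trans _ _ (sg + e / 2)); [by rewrite ge_min lexx|lra].
suff : S t by move=> /ub; rewrite leNgt st.
split; first by rewrite (le_trans asg (ltW st)) ge_min lexx orbT.
move=> s /andP[as_ st']; have [h|h] := leP s sg; first by apply: Pbefore; rewrite as_.
by apply: He; rewrite (ltW h) (le_lt_trans st').
Qed.

Section RdistLower.
Context {R : realType} {n : nat} (M : riemannianManifold R n).
Implicit Types (c : R -> M).

Lemma closed_cball (p : 'rV[R]_n) (r : R) : closed [set x : 'rV[R]_n | `|x - p| <= r].
Proof.
move=> x Hx /=; apply/ler_addgt0Pr => e e0.
have [|y [/= yr]] := Hx (ball x e); first exact: nbhsx_ballx.
rewrite -ball_normE/= => xy; have := ler_distD y x p; lra.
Qed.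

Lemma compact_cball (p : 'rV[R]_n) (r : R) : compact [set x : 'rV[R]_n | `|x - p| <= r].
Proof.
apply: bounded_closed_compact; last exact: closed_cball.
exists (r + `|p|); split; first exact: num_real.
move=> x xr y /= yr; have := ler_normD (y - p) p; rewrite subrK; lra.
Qed.

(** The image of a closed ball of the chart is closed in M, not only in the domain
    of the chart, because it is compact.  A curve that stays in it up to a time
    therefore is still in it at that time. *)
Lemma closed_unchart_ball i (p : 'rV[R]_n) (r : R) : [set x : 'rV[R]_n | `|x - p| <= r] `<=` img i ->
  closed (unchart i @` [set x : 'rV[R]_n | `|x - p| <= r] : set M).
Proof.
move=> sub; apply: compact_closed; first exact: carrier_hausdorff.
apply: continuous_compact; last exact: compact_cball.
apply: continuous_in_subspaceT => x /set_mem /sub xi; exact: unchart_continuous.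
Qed.

Lemma continuous_speed_bound i c (p : 'rV[R]_n) (r lam Lam K t : R) : C1_curve c ->
  metric_box i p r lam Lam K -> dom i (c t) -> nball p r (chart i (c t)) ->
  [/\ is_derive t 1 (chart i \o c) (derive1 (chart i \o c) t),
     speed c t = Num.sqrt (gram (metric i (chart i (c t))) (derive1 (chart i \o c) t) (derive1 (chart i \o c) t)) &
     Num.sqrt lam * `|derive1 (chart i \o c) t| <= speed c t].
Proof.
move=> /C1_curveP Hc box di pr; have [cc H] := Hc t; have [h1 h2] := H i di.
have hx := derivable_is_derive1 h1.
have E : speed c t = Num.sqrt (gram (metric i (chart i (c t))) (derive1 (chart i \o c) t) (derive1 (chart i \o c) t)).
  by rewrite speedE (energy_chart di cc hx).
split; [exact: hx|exact: E|rewrite E].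
have -> : `|derive1 (chart i \o c) t| = Num.sqrt (`|derive1 (chart i \o c) t| * `|derive1 (chart i \o c) t|).
  by rewrite -expr2 sqrtr_sqr normr_id.
rewrite -sqrtrM; last exact/ltW/(mb_lam box).
apply: ler_wsqrtr; exact: (mb_low box _ pr).
Qed.

(** If a competing curve were shorter than sqrt(2E), it would stay within r / 4 of
    its starting point in the chart, by real induction on the time, and the
    calibration would apply to it. *)
Lemma rdist_lower i (p0 : 'rV[R]_n) (r lam Lam K V E : R) (x v : R -> 'rV[R]_n) :
  metric_box i p0 r lam Lam K -> 0 <= V ->
  K * (V * V) <= lam * lam / (8 * (Lam * Lam)) * lam / 2 ->
  K * V <= lam * lam / (8 * (Lam * Lam)) * Lam ->
  (forall t : R, 0 <= t <= 1 -> [/\ nball p0 r (x t), is_derive t 1 x (v t),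
     is_derive t 1 v (- christoffel i (x t) (v t) (v t)), `|v t| <= V &
     gram (metric i (x t)) (v t) (v t) = 2 * E]) ->
  `|x 0 - p0| < r / 2 -> Num.sqrt (2 * E) <= Num.sqrt lam * (r / 4) ->
  ((Num.sqrt (2 * E))%:E <= rdist (unchart i (x 0%R) : M) (unchart i (x 1%R)))%E.
Proof.
move=> box V0 hV1 hV2 Hx x0r Er; apply: rdist_ge => c F Hc c0 c1 F0 HF.
rewrite leNgt; apply/negP => Flt.
have r0 := mb_r box; have lam0 := mb_lam box; have sl0 : 0 < Num.sqrt lam by rewrite sqrtr_gt0.
have im := mb_img box; have /C1_curveP Hc' := Hc.
have in0 : 0 <= (0 : R) <= 1 by rewrite lexx ler01.
have in1 : 0 <= (1 : R) <= 1 by rewrite lexx ler01.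
pose W (s : R) := dom i (c s) /\ nball p0 r (chart i (c s)).
have xin t : 0 <= t <= 1 -> img i (x t) by move=> /Hx[/im].
have Fmono a b : a <= b -> F a <= F b.
  move=> ab; have h := @le_of_derive_le R (cst 0) (fun=> 0) F (speed c) a b ab
    (fun t _ => is_derive_cst 0 t 1) (fun t _ => HF t) (fun t _ => speed_ge0 (c : R -> M) t).
  by rewrite -subr_ge0; move: h; rewrite subrr.
have Hcb s (Ws : W s) := continuous_speed_bound Hc box Ws.1 Ws.2.
have clb : [set z : 'rV[R]_n | `|z - p0| <= 3 * r / 4] `<=` nball p0 r.
  by move=> z /= zr; rewrite /nball/=; lra.
have clK := closed_unchart_ball (subset_trans clb im).
have Wall : forall s : R, 0 <= s <= 1 -> W s.
  apply: (@real_induction _ W 0 1) => //.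
  - rewrite /W c0; split; first exact: unchart_dom (xin 0 in0).
    by rewrite (unchartK (xin 0 in0)) /nball/=; lra.
  - move=> s _ [di pr]; have [cc _] := Hc' s.
    have cx : {for s, continuous (chart i \o c)}.
      by apply: continuous_comp => //; exact: chart_continuous.
    have e0 : 0 < r - `|chart i (c s) - p0| by rewrite subr_gt0.
    have [r1 [r10 H1]] := cont_ex cx e0; have /near_ex[r2 [r20 H2]] := near_dom cc di.
    exists (Num.min r1 r2); split; first by rewrite lt_min r10.
    move=> s' /andP[ss' s's].
    have : `|s' - s| < Num.min r1 r2 by rewrite ger0_norm ?subr_ge0// ltrBlDl.
    rewrite lt_min => /andP[/H1 h1 /H2 h2]; split; first exact: h2.
    rewrite /nball/= in h1 *; have := ler_distD (chart i (c s)) (chart i (c s')) p0; lra.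
  - move=> s /andP[s0 s1] Hs.
    have Hb s' : 0 <= s' < s -> (unchart i @` [set z : 'rV[R]_n | `|z - p0| <= 3 * r / 4]) (c s').
      move=> /andP[s'0 s's]; have [di pr] : W s' by apply: Hs; rewrite s'0.
      exists (chart i (c s')); last exact: chartK.
      have h := @vec_le_of_derive_le R _ (chart i \o c) (fun t => derive1 (chart i \o c) t)
        (fun t => (Num.sqrt lam)^-1 * F t) (fun t => (Num.sqrt lam)^-1 * speed c t) 0 s' s'0.
      have : `|(chart i \o c) s' - (chart i \o c) 0| <= (Num.sqrt lam)^-1 * F s' - (Num.sqrt lam)^-1 * F 0.
        apply: h => t /andP[t0 ts].
        + by have [] := Hcb t (Hs t _); rewrite ?t0 ?(le_lt_trans ts).
        + have [|_ _ b] := Hcb t (Hs t _); first by rewrite t0 (le_lt_trans ts).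
          by rewrite mulrC ler_pdivlMr// mulrC.
      rewrite /= c0 (unchartK (xin 0 in0)) F0 mulr0 subr0 => h2.
      have h3 : (Num.sqrt lam)^-1 * F s' <= r / 4.
        rewrite mulrC ler_pdivrMr// mulrC; apply: le_trans Er.
        by apply: ltW; apply: le_lt_trans Flt; apply: Fmono; lra.
      have -> : chart i (c s') - p0 = (chart i (c s') - x 0) + (x 0 - p0) by rewrite addrA subrK.
      by apply: (le_trans (ler_normD _ _)); lra.
    (* At time s itself only the closed ball is obtained, by compactness; it lies in
       the open ball of radius r. *)
    have Ks : (unchart i @` [set z : 'rV[R]_n | `|z - p0| <= 3 * r / 4]) (c s).
      apply: clK => B nB; have [cc _] := Hc' s; have /near_ex[e [e0 He]] := cc B nB.
      pose s' := Num.max 0 (s - e / 2).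
      have s's : s' < s by rewrite gt_max s0 /=; lra.
      have s'0 : 0 <= s' by rewrite le_max lexx.
      exists (c s'); split; first by apply: Hb; rewrite s'0.
      apply: He; rewrite ltr_norml; apply/andP; split; last by lra.
      have : s - e / 2 <= s' by rewrite le_max lexx orbT.
      lra.
    have [z zr zc] := Ks; have zr' := clb z zr.
    by rewrite /W -zc; split; [exact: unchart_dom (im _ zr')|rewrite unchartK//; exact: im].
have := @calibration R n M i p0 r lam Lam K V box V0 hV1 hV2 x v E (chart i \o c) (fun t => derive1 (chart i \o c) t) F Hx.
move=> H; have : Num.sqrt (2 * E) <= F 1 - F 0.
  apply: H.
  - move=> s s01; have Ws := Wall s s01; have [h1 h2 _] := Hcb s Ws.
    by split; [exact: Ws.2|exact: h1|rewrite -h2; exact: HF].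
  - by rewrite /= c0 unchartK//; exact: xin.
  - by rewrite /= c1 unchartK//; exact: xin.
by rewrite F0 subr0 leNgt Flt.
Qed.

End RdistLower.

(** * The exponential map in a chart *)

Section Tvec.
Context {R : realType} {n : nat} (M : riemannianManifold R n).

(** The tangent space at q is identified with coordinates in chart_at q; this is the
    vector with coordinates u in the chart i. *)
Definition tvec (i : atlas M) (q : M) (u : 'rV[R]_n) : 'rV[R]_n :=
  'D_u (trans i (chart_at q)) (chart i q).

Lemma tvec_mx i q : dom i q -> exists B : 'M[R]_n, B \in unitmx /\ forall u, tvec i q u = u *m B.
Proof. by move=> di; exact: dtrans_mx (overlap_chart di (mem_chart_at q)). Qed.

Lemma tvec_surj i q xi : dom i q -> exists u, tvec i q u = xi.
Proof. by move=> di; exact: dtrans_surj (overlap_chart di (mem_chart_at q)). Qed.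

Lemma tvecZ i q (a : R) u : dom i q -> tvec i q (a *: u) = a *: tvec i q u.
Proof. by move=> /tvec_mx[B [_ H]]; rewrite !H scalemxAl. Qed.

Lemma tvecB i q u v : dom i q -> tvec i q (u - v) = tvec i q u - tvec i q v.
Proof. by move=> /tvec_mx[B [_ H]]; rewrite !H mulmxBl. Qed.

Lemma tnorm_tvec i q u : dom i q -> tnorm q (tvec i q u) = Num.sqrt (gram (metric i (chart i q)) u u).
Proof.
move=> di; rewrite /tnorm -(trans_chart (chart_at q) di) metric_gram_trans//.
exact: overlap_chart (mem_chart_at q).
Qed.

End Tvec.

Section FlowBox.
Context {R : realType} {n : nat} (M : riemannianManifold R n).
Variables (i : atlas M) (p0 : 'rV[R]_n) (r K A T : R) (dH : 'rV[R]_(n + n) -> 'rV[R]_(n + n) -> 'rV[R]_(n + n)).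
Hypotheses (fb : flow_box i p0 r K A dH) (T0 : 0 < T) (TA : 2 * T <= A).
Implicit Types (p u w : 'rV[R]_n).

Notation sol := (solves (spray i) (row_mx p0 0 : 'rV[R]_(n + n)) r A).

Definition flow p w : R -> 'rV[R]_(n + n) := xget (fun=> 0) [set X | X 0 = row_mx p w /\ sol X].
Definition flow_pos p w t := lsubmx (flow p w t).
Definition flow_vel p w t := rsubmx (flow p w t).

Definition start p w := `|p - p0| < r / 4 /\ `|w| < r / 4.

Lemma flowP p w : start p w -> flow p w 0 = row_mx p w /\ sol (flow p w).
Proof.
move=> [pr wr]; have [r0 A0 rI HK KA KAr] := fb.
have h : `|row_mx p w - row_mx p0 0| < r / 4.
  by rewrite opp_row_mx add_row_mx subr0 norm_row_mx_lt.
have [X [X0 sX _]] := flow_exists r0 A0 HK KA KAr h.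
by rewrite /flow; case: xgetP => [Y _ //|/(_ X)[]].
Qed.

Lemma sol_static p : nball p0 r p -> sol (fun=> row_mx p 0).
Proof.
move=> pr t tA; have [r0 A0 rI HK KA KAr] := fb; split; last first.
  by rewrite /nball/= opp_row_mx add_row_mx subr0; apply: norm_row_mx_lt => //; rewrite normr0.
have ip := rI _ pr.
have c0 : christoffel i p 0 0 = 0.
  by have := christoffelZ 0 0 ip; rewrite mulr0 !scale0r.
rewrite /spray row_mxKl row_mxKr c0 oppr0.
have -> : row_mx (0 : 'rV[R]_n) (0 : 'rV[R]_n) = 0 by exact: row_mx0.
exact: is_derive_cst.
Qed.

Lemma flow_pos0 p w : start p w -> flow_pos p w 0 = p.
Proof. by move=> /flowP[h _]; rewrite /flow_pos h row_mxKl. Qed.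

Lemma flow_vel0 p w : start p w -> flow_vel p w 0 = w.
Proof. by move=> /flowP[h _]; rewrite /flow_vel h row_mxKr. Qed.

Lemma flow_derive p w (t : R) : start p w -> `|t| <= A ->
  [/\ nball p0 r (flow_pos p w t), is_derive t 1 (flow_pos p w) (flow_vel p w t) &
      is_derive t 1 (flow_vel p w)
        (- christoffel i (flow_pos p w t) (flow_vel p w t) (flow_vel p w t))].
Proof.
move=> /flowP[_ sX] tA; have [hX nX] := sX t tA; have [h1 h2] := spray_unlift hX.
split; [|exact: h1|exact: h2].
rewrite /nball/= /flow_pos; apply: le_lt_trans nX.
have -> : lsubmx (flow p w t) - p0 = lsubmx (flow p w t - row_mx p0 0).
  by rewrite linearB/= row_mxKl.
exact: norm_lsub.
Qed.

Lemma start0 p w : start p w -> start p 0.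
Proof.
move=> [h1 h2]; split => //; rewrite normr0; exact: le_lt_trans (normr_ge0 w) h2.
Qed.

Lemma start_nball p w : start p w -> nball p0 r p.
Proof. by move=> [h1 h2]; rewrite /nball/=; have := fb_r fb; lra. Qed.

Lemma flow_near p w (t : R) : start p w -> `|t| <= A ->
  `|flow_pos p w t - p| <= 2 * `|w| /\ `|flow_vel p w t| <= 2 * `|w|.
Proof.
move=> sw tA; have [r0 A0 rI HK KA KAr] := fb.
have [X0 sX] := flowP sw; have sY := sol_static (start_nball sw).
have [h _] := flow_diff r0 A0 HK KA KAr sX sY tA.
rewrite X0 in h; have e : `|row_mx p w - row_mx p 0| = `|w|.
  by rewrite opp_row_mx add_row_mx subrr subr0 norm_row_mx0.
rewrite e in h; split; apply: le_trans h.
  have -> : flow_pos p w t - p = lsubmx (flow p w t - row_mx p 0) by rewrite linearB/= row_mxKl.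
  exact: norm_lsub.
have -> : flow_vel p w t = rsubmx (flow p w t - row_mx p 0) by rewrite linearB/= row_mxKr subr0.
exact: norm_rsub.
Qed.

Lemma flow_pos_static p w (t : R) : start p w -> `|t| <= A -> flow_pos p 0 t = p.
Proof.
move=> /start0 sw tA; have [h _] := flow_near sw tA.
by apply/eqP; rewrite -subr_eq0 -normr_eq0 eq_le normr_ge0 andbT; rewrite normr0 mulr0 in h.
Qed.

(** The exponential map in the chart, by homogeneity: the geodesic with initial
    velocity u / T reaches at time T the point reached at time 1 with velocity u. *)
Definition expc p u := flow_pos p (T^-1 *: u) T.

Definition startu p u := `|p - p0| < r / 4 /\ `|u| < T * r / 4.

Lemma startuP p u : startu p u -> start p (T^-1 *: u).
Proof.
move=> [h1 h2]; split => //; rewrite normrZ gtr0_norm ?invr_gt0// mulrC ltr_pdivrMr//.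
by rewrite mulrC mulrA.
Qed.

Let TT : `|T| <= A. Proof. by have t0 := T0; have tA := TA; rewrite gtr0_norm//; lra. Qed.

Lemma expc0 p u : startu p u -> expc p 0 = p.
Proof. by move=> /startuP sw; rewrite /expc scaler0 (flow_pos_static sw TT). Qed.

Lemma expc_defect (x v : R -> 'rV[R]_n) (d : 'rV[R]_n) (e : R) :
  (forall t : R, `|t| <= A -> is_derive t 1 x (v t)) ->
  (forall t : R, `|t| <= A -> `|v t - d| <= e) -> `|x T - x 0 - T *: d| <= T * e.
Proof.
move=> hx hv; have t0 := ltW T0.
have h := @vec_le_const R n (fun t => x t - t *: d) (fun t => v t - d) e 0 T t0.
have -> : x T - x 0 - T *: d = (x T - T *: d) - (x 0 - 0 *: d) by rewrite scale0r subr0 addrAC.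
rewrite mulrC -[T in e * T]subr0; apply: h => t /andP[t1 t2].
- have tA : `|t| <= A by rewrite ger0_norm//; have tA := TA; lra.
  apply: (is_deriveBv (hx t tA)).
  have := is_derive_affine (0 : 'rV[R]_n) d t.
  by have -> : (fun s : R => 0 + s *: d) = (fun s : R => s *: d) by apply/funext => s; rewrite add0r.
- by apply: hv; rewrite ger0_norm//; have tA := TA; lra.
Qed.

(** The position at time T is obtained by integrating the velocity, and velocities
    differ from their initial values by at most one eighth (flow_diff). *)
Lemma expc_diff p u u' : startu p u -> startu p u' ->
  `|expc p u - expc p u' - (u - u')| <= 8^-1 * `|u - u'|.
Proof.
move=> /startuP su /startuP su'; have [r0 A0 rI HK KA KAr] := fb.
set w := T^-1 *: u in su *; set w' := T^-1 *: u' in su' *.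
have [X0 sX] := flowP su; have [Y0 sY] := flowP su'.
have e : `|flow p w 0 - flow p w' 0| = `|w - w'|.
  by rewrite X0 Y0 opp_row_mx add_row_mx subrr norm_row_mx0.
have := @expc_defect (fun t => flow_pos p w t - flow_pos p w' t)
  (fun t => flow_vel p w t - flow_vel p w' t) (w - w') (8^-1 * `|w - w'|).
rewrite !flow_pos0// subrr subr0.
have -> : T *: (w - w') = u - u' by rewrite /w /w' -scalerBr scalerA mulfV ?scale1r// gt_eqF.
have -> : T * (8^-1 * `|w - w'|) = 8^-1 * `|u - u'|.
  rewrite /w /w' -scalerBr normrZ gtr0_norm ?invr_gt0//.
  by field; rewrite gt_eqF.
apply => t tA.
  have [_ h1 _] := flow_derive su tA; have [_ h2 _] := flow_derive su' tA.
  exact: (is_deriveBv h1 h2).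
have [_ h] := flow_diff r0 A0 HK KA KAr sX sY tA; rewrite e in h; apply: le_trans h.
have -> : flow_vel p w t - flow_vel p w' t - (w - w') =
   rsubmx ((flow p w t - flow p w' t) - (flow p w 0 - flow p w' 0)).
  by rewrite X0 Y0 !linearB/= !row_mxKr.
exact: norm_rsub.
Qed.

(** The same integration, from flow_diff2. *)
Lemma expc_diff2 p u0 u1 u2 u3 u4 (a1 a2 rho L1 L2 : R) :
  startu p u0 -> startu p u1 -> startu p u2 -> startu p u3 -> startu p u4 ->
  `|u1 - u0| <= rho -> `|u2 - u0| <= rho -> `|u3 - u0| <= rho -> `|u4 - u0| <= rho ->
  `|a1| * `|u1 - u2| <= L1 -> `|a2| * `|u3 - u4| <= L2 ->
  forall d, d = a1 *: (u1 - u2) - a2 *: (u3 - u4) ->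
  `|a1 *: (expc p u1 - expc p u2) - a2 *: (expc p u3 - expc p u4) - d|
   <= 8^-1 * `|d| + T^-1 * rho * (L1 + L2).
Proof.
move=> /startuP s0 /startuP s1 /startuP s2 /startuP s3 /startuP s4 h1 h2 h3 h4 k1 k2 d dE.
have [r0 A0 rI HK KA KAr] := fb.
pose w u := T^-1 *: u; pose X u := flow p (w u).
have Ti0 : 0 < T^-1 by rewrite invr_gt0.
have X0 u : start p (w u) -> X u 0 = row_mx p (w u) by move=> /flowP[].
have sX u : start p (w u) -> sol (X u) by move=> /flowP[].
have nX u v : start p (w u) -> start p (w v) -> `|X u 0 - X v 0| = T^-1 * `|u - v|.
  move=> su sv; rewrite !X0// opp_row_mx add_row_mx subrr norm_row_mx0 /w -scalerBr normrZ.
  by rewrite gtr0_norm.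
have hr u : start p (w u) -> `|u - u0| <= rho -> `|X u 0 - X u0 0| <= T^-1 * rho.
  by move=> su hu; rewrite nX// ler_pM2l.
have kr (a : R) u v (L : R) : start p (w u) -> start p (w v) -> `|a| * `|u - v| <= L ->
    `|a| * `|X u 0 - X v 0| <= T^-1 * L.
  by move=> su sv hu; rewrite nX// mulrCA ler_pM2l.
pose D t := a1 *: (X u1 t - X u2 t) - a2 *: (X u3 t - X u4 t).
have main := flow_diff2 r0 A0 HK KA KAr (sX _ s0) (sX _ s1) (sX _ s2) (sX _ s3) (sX _ s4)
   (hr _ s1 h1) (hr _ s2 h2) (hr _ s3 h3) (hr _ s4 h4) (kr _ _ _ _ s1 s2 k1) (kr _ _ _ _ s3 s4 k2).
have D0 : D 0 = row_mx 0 (T^-1 *: d).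
  rewrite /D !X0// !opp_row_mx !add_row_mx !scale_row_mx opp_row_mx add_row_mx !subrr !scaler0 subrr.
  congr row_mx; rewrite /w dE -!scalerBr !scalerA [a1 * _]mulrC [a2 * _]mulrC -!scalerA.
  by rewrite -scalerBr.
have nD0 : `|D 0| = T^-1 * `|d| by rewrite D0 norm_row_mx0 normrZ gtr0_norm.
have := @expc_defect (fun t => lsubmx (D t)) (fun t => rsubmx (D t)) (T^-1 *: d)
  (8^-1 * (T^-1 * `|d|) + T^-1 * rho * (T^-1 * L1 + T^-1 * L2)).
have -> : T *: (T^-1 *: d) = d by rewrite scalerA mulfV ?scale1r// gt_eqF.
rewrite D0 row_mxKl subr0.
have -> : lsubmx (D T) = a1 *: (expc p u1 - expc p u2) - a2 *: (expc p u3 - expc p u4).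
  by apply/rowP => k; rewrite /expc /flow_pos !mxE.
have -> : T * (8^-1 * (T^-1 * `|d|) + T^-1 * rho * (T^-1 * L1 + T^-1 * L2)) =
  8^-1 * `|d| + T^-1 * rho * (L1 + L2) by field; rewrite gt_eqF.
apply => t tA.
- have q u : start p (w u) -> is_derive t 1 (fun s => lsubmx (X u s)) (rsubmx (X u t)).
    by move=> su; have [_ h _] := flow_derive su tA; exact: h.
  have g := is_deriveBv (is_deriveZv a1 (is_deriveBv (q _ s1) (q _ s2)))
     (is_deriveZv a2 (is_deriveBv (q _ s3) (q _ s4))).
  have E1 : (fun t => lsubmx (D t)) = (fun s => a1 *: (lsubmx (X u1 s) - lsubmx (X u2 s)) -
     a2 *: (lsubmx (X u3 s) - lsubmx (X u4 s))).
    by apply/funext => s; apply/rowP => k; rewrite /D !mxE.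
  have E2 : rsubmx (D t) = a1 *: (rsubmx (X u1 t) - rsubmx (X u2 t)) -
     a2 *: (rsubmx (X u3 t) - rsubmx (X u4 t)).
    by apply/rowP => k; rewrite /D !mxE.
  by rewrite E1 E2.
- have -> : rsubmx (D t) - T^-1 *: d = rsubmx (D t - D 0).
    have aux (a b : 'rV[R]_(n + n)) : rsubmx a - rsubmx b = rsubmx (a - b) by rewrite linearB.
    by rewrite -(aux (D t) (D 0)) D0 row_mxKr.
  apply: (le_trans (norm_rsub _)); rewrite -nD0.
  exact: (main t tA).
Qed.

Definition gcurve p u (t : R) : M := unchart i (flow_pos p (T^-1 *: u) (T * t)).

(** The geodesics run beyond time 1, so that 1 is interior. *)
Definition two_sided : set R := [set t | `|t| < 2].

Lemma two_sided_open : open two_sided.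
Proof.
have -> : two_sided = ball (0 : R) 2 by apply/seteqP; split => t; rewrite /two_sided -ball_normE/= sub0r normrN.
exact: ball_open.
Qed.

Lemma two_sided_interval : is_interval two_sided.
Proof.
move=> x y; rewrite /two_sided/= !ltr_norml => /andP[x1 x2] /andP[y1 y2] z /andP[z1 z2].
by rewrite ltr_norml; apply/andP; split; lra.
Qed.

Lemma two_sided_time (t : R) : two_sided t -> `|T * t| <= A.
Proof.
rewrite /two_sided/= normrM gtr0_norm// => t2; have tA := TA; have t0 := T0.
have : T * `|t| <= T * 2 by rewrite ler_pM2l// ltW.
lra.
Qed.

Lemma gcurve_chart p u (t : R) : startu p u -> two_sided t ->
  [/\ dom i (gcurve p u t), chart i (gcurve p u t) = flow_pos p (T^-1 *: u) (T * t) &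
   is_derive t 1 (chart i \o gcurve p u) (T *: flow_vel p (T^-1 *: u) (T * t))].
Proof.
move=> /startuP su t2; have rI := fb_img fb.
have im s : two_sided s -> img i (flow_pos p (T^-1 *: u) (T * s)).
  by move=> s2; have [h _ _] := flow_derive su (two_sided_time s2); exact: rI.
split; [exact: unchart_dom (im t t2)|exact: unchartK (im t t2)|].
have [_ h _] := flow_derive su (two_sided_time t2).
rewrite -[T * t]addr0 in h; have := is_derive_affine_comp h; rewrite addr0.
apply: near_eq_is_derive.
have : \forall s \near t, two_sided s by exact: open_nbhs_nbhs (conj two_sided_open t2).
by apply: filterS => s s2; rewrite /= unchartK ?addr0//; exact: im.
Qed.

Lemma gcurve_geodesic p u : startu p u -> geodesic_on two_sided (gcurve p u).
Proof.
move=> su t t2; have sw := startuP su.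
have cc (s : R) : two_sided s -> {for s, continuous (gcurve p u)}.
  move=> s2; have [nb h _] := flow_derive sw (two_sided_time s2).
  apply: continuous_comp; last exact: unchart_continuous (fb_img fb nb).
  rewrite -[T * s]addr0 in h; have := is_derive_continuous (is_derive_affine_comp h).
  by have -> : (fun s => flow_pos p (T^-1 *: u) (T * s + 0)) = (fun s => flow_pos p (T^-1 *: u) (T * s))
    by apply/funext => ?; rewrite addr0.
have n2 : \forall s \near t, two_sided s by exact: open_nbhs_nbhs (conj two_sided_open t2).
have [di ci _] := gcurve_chart su t2.
apply: (@geo_chart R n M _ t i (fun s => T *: flow_vel p (T^-1 *: u) (T * s))).
- exact: di.
- by apply: filterS n2 => s; exact: cc.
- by apply: filterS n2 => s s2; have [_ _ h] := gcurve_chart su s2; exact: h.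
have [nb _ h] := flow_derive sw (two_sided_time t2).
rewrite ci christoffelZ; last exact: (fb_img fb nb).
rewrite -scalerA -!scalerN.
rewrite -[T * t]addr0 in h; have := is_deriveZv T (is_derive_affine_comp h).
by have -> : (fun s => T *: flow_vel p (T^-1 *: u) (T * s + 0)) = (fun s => T *: flow_vel p (T^-1 *: u) (T * s))
    by [apply/funext => ?; rewrite addr0]; rewrite addr0.
Qed.

Lemma gcurve_to p q u : dom i q -> chart i q = p -> startu p u ->
  geodesic_to two_sided (gcurve p u) q (tvec i q u).
Proof.
move=> di cq su; have z2 : two_sided 0 by rewrite /two_sided/= normr0.
have [d0 c0 h0] := gcurve_chart su z2.
have e0 : gcurve p u 0 = q.
  by rewrite -(chartK d0) c0 mulr0 (flow_pos0 (startuP su)) -cq chartK.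
split; first split.
- exact: two_sided_open.
- exact: two_sided_interval.
- move=> t /=; rewrite in_itv/= /two_sided/= => /andP[t0 t1]; rewrite ger0_norm//; lra.
- exact: gcurve_geodesic.
split; [exact: e0|rewrite /velocity e0].
have [cc _] := gcurve_geodesic su z2.
have dj : dom (chart_at q) (gcurve p u 0) by rewrite e0; exact: mem_chart_at.
have := chart_change_derive d0 dj cc h0 => /is_derive1E ->.
rewrite /tvec c0 !mulr0 (flow_vel0 (startuP su)) (flow_pos0 (startuP su)) -cq scalerA mulfV ?scale1r//.
by rewrite gt_eqF.
Qed.

Lemma Exp_chart q u : dom i q -> startu (chart i q) u ->
  Exp q (tvec i q u) = unchart i (expc (chart i q) u).
Proof.
by move=> di su; rewrite (Exp_geodesic (gcurve_to di erefl su)) /gcurve mulr1.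
Qed.

End FlowBox.

(** * Normal charts *)

Section NormalChart.
Context {R : realType} {n : nat} (M : riemannianManifold R n).
Implicit Types (p u w : 'rV[R]_n) (c : R -> M).

Lemma le_of_le_mulDe (a b : R) : (forall e : R, 0 < e -> a <= (1 + e) * b) -> a <= b.
Proof.
move=> H; apply/ler_addgt0Pr => e e0; have b0 := normr_ge0 b.
have b1 : 0 < `|b| + 1 by lra.
have := H (e / (`|b| + 1)) (divr_gt0 e0 b1).
move=> h; apply: (le_trans h); rewrite mulrDl mul1r lerD2l.
apply: (@le_trans _ _ (e / (`|b| + 1) * `|b|)).
  by rewrite ler_wpM2l ?ler_norm// divr_ge0// ltW.
rewrite mulrAC ler_pdivrMr//.
by rewrite ler_wpM2l ?(ltW e0)//; lra.
Qed.

Lemma lee_of_mulDe (x : \bar R) (b : R) :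
  (forall e : R, 0 < e -> (x <= ((1 + e) * b)%:E)%E) -> (x <= b%:E)%E.
Proof.
case: x => [d| |] H; last exact: leNye.
  by rewrite lee_fin; apply: le_of_le_mulDe => a a0; have := H a a0; rewrite lee_fin.
by have := H 1 ltr01; rewrite leye_eq.
Qed.

Lemma two_sided01 (t : R) : 0 <= t <= 1 -> two_sided t.
Proof. by move=> /andP[t0 t1]; rewrite /two_sided/= ger0_norm//; lra. Qed.

(** A segment of a geodesic, brought to rest at its ends; 1 + e is the loss of
    step_function. *)
Lemma geodesic_spath (J : set R) c (a b e : R) : open J -> is_interval J -> J 0 ->
  geodesic_on J (c : R -> M) -> J a -> J b -> 0 < e ->
  spath (c a) (c b) ((1 + e) * (`|b - a| * speed c 0)).
Proof.
move=> oJ iJ J0 gc Ja Jb e0; pose c' s := c ((b - a) * s + a).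
have inJ s : 0 <= s <= 1 -> J ((b - a) * s + a).
  move=> /andP[s0 s1]; have [ab|ab] := leP a b.
    apply: (iJ a b) => //; have h : 0 <= (b - a) * s by rewrite mulr_ge0// subr_ge0.
    have : (b - a) * s <= (b - a) * 1 by rewrite ler_wpM2l// subr_ge0.
    by move=> h2; apply/andP; split; lra.
  apply: (iJ b a) => //; have h : 0 <= (a - b) * s by rewrite mulr_ge0// subr_ge0 ltW.
  have : (a - b) * s <= (a - b) * 1 by rewrite ler_wpM2l// subr_ge0 ltW.
  by move=> h2; apply/andP; split; lra.
have -> : c a = c' 0 by rewrite /c' mulr0 add0r.
have -> : c b = c' 1 by rewrite /c' mulr1 subrK.
apply: spath_of_curve => // [|s s01]; first by rewrite mulr_ge0// speed_ge0.
have Js := inJ s s01.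
have n1 : \forall t \near ((b - a) * s + a), C1_at c t.
  have : \forall t \near ((b - a) * s + a), J t by exact: open_nbhs_nbhs.
  by apply: filterS => t Jt; exact: geo_C1_at Jt gc.
have [h1 h2] := C1_affine (nbhs_singleton n1) n1; split; first exact: h1.
rewrite speedE h2 (geodesic_energy oJ iJ J0 Js gc) sqrtrM; last by rewrite -expr2 sqr_ge0.
by rewrite -expr2 sqrtr_sqr -speedE.
Qed.

Lemma line_C1_at (i : atlas M) p d (t : R) : img i (p + t *: d) ->
  C1_at (fun s => unchart i (p + s *: d) : M) t /\
  energy (fun s => unchart i (p + s *: d) : M) t = gram (metric i (p + t *: d)) d d.
Proof.
move=> it; pose x (s : R) := p + s *: d; set c := fun s => _.
have hx (s : R) : is_derive s 1 x d by exact: is_derive_affine.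
have cx (s : R) := is_derive_continuous (hx s).
have n1 : \forall s \near t, img i (x s).
  by apply: (cx t); exact: open_nbhs_nbhs (conj (img_open i) it).
have cc (s : R) : img i (x s) -> {for s, continuous c}.
  by move=> si; apply: continuous_comp; [exact: cx|exact: unchart_continuous].
have hc (s : R) : img i (x s) -> is_derive s 1 (chart i \o c) d.
  move=> si; apply: near_eq_is_derive (hx s).
  have : \forall r \near s, img i (x r).
    by apply: (cx s); exact: open_nbhs_nbhs (conj (img_open i) si).
  by apply: filterS => r ri; rewrite /= /c (unchartK ri).
have dc (s : R) : img i (x s) -> dom i (c s) by exact: unchart_dom.
have Ec (s : R) : img i (x s) -> chart i (c s) = x s by exact: unchartK.
split; last by rewrite (energy_chart (dc t it) (cc t it) (hc t it)) (Ec t it).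
split; first exact: cc.
move=> j dj.
have hj (s : R) : img i (x s) -> dom j (c s) ->
    is_derive s 1 (chart j \o c) ('D_d (trans i j) (x s)).
  by move=> si sj; rewrite -(Ec s si); apply: (chart_change_derive (dc s si) sj (cc s si) (hc s si)).
have nj := near_dom (cc t it) dj.
split; first exact: (is_derive_ex (hj t it dj)).
have nE : \forall s \near t, 'D_d (trans i j) (x s) = derive1 (chart j \o c) s.
  by apply: filterS2 n1 nj => s si sj; rewrite (is_derive1E (hj s si sj)).
have ot : overlap i j (x t) by apply/overlapP.
have hd := is_derive_comp (@overlap_open _ _ M i j) ((@trans_Ck _ _ M i j 2).2 d) ot (hx t).
have cd := is_derive_continuous hd.
have e := nbhs_singleton nE.
suff : derive1 (chart j \o c) s @[s --> t] --> derive1 (chart j \o c) t by [].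
rewrite -e; exact: (cvg_trans (near_eq_cvg nE) cd).
Qed.

(** The path is the segment in the chart. *)
Lemma chart_spath (i : atlas M) p0 (r lam Lam K : R) p p' : metric_box i p0 r lam Lam K ->
  nball p0 r p -> nball p0 r p' ->
  spath (unchart i p : M) (unchart i p') (2 * (Num.sqrt Lam * `|p' - p|)).
Proof.
move=> box pr pr'; pose c s : M := unchart i (p + s *: (p' - p)).
have -> : unchart i p = c 0 by rewrite /c scale0r addr0.
have -> : unchart i p' = c 1 by rewrite /c scale1r addrC subrK.
have -> : (2 : R) = 1 + 1 by [].
apply: spath_of_curve => // t /andP[t0 t1].
have tr : nball p0 r (p + t *: (p' - p)).
  rewrite /nball/=; have -> : p + t *: (p' - p) - p0 = (1 - t) *: (p - p0) + t *: (p' - p0).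
    by rewrite scalerBl scale1r !scalerBr; apply/rowP => k; rewrite !mxE; ring.
  apply: (le_lt_trans (ler_normD _ _)); rewrite !normrZ ger0_norm ?subr_ge0// (ger0_norm t0).
  rewrite /nball/= in pr pr'; set a := `|p - p0| in pr *; set b := `|p' - p0| in pr' *.
  have [tz|tz] := eqVneq t 0; first by rewrite tz; lra.
  have : t * b < t * r by rewrite ltr_pM2l// lt_neqAle eq_sym tz.
  have : (1 - t) * a <= (1 - t) * r by rewrite ler_wpM2l ?subr_ge0// ltW.
  lra.
have [h1 h2] := line_C1_at (mb_img box tr); split; first exact: h1.
rewrite speedE /c h2; apply: (@le_trans _ _ (Num.sqrt (Lam * `|p' - p| * `|p' - p|))).
  apply: ler_wsqrtr; apply: le_trans (ler_norm _) _; exact: (mb_up box _ _ tr).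
rewrite -mulrA sqrtrM; last exact/ltW/(mb_Lam box).
by rewrite -expr2 sqrtr_sqr normr_id.
Qed.

(** The upper bound is the length of the geodesic itself, the lower bound is
    rdist_lower. *)
Lemma exp_rdist (i : atlas M) p0 (rf Kf A T r lam Lam K V : R) dH (q : M) u :
  flow_box i p0 rf Kf A dH -> 0 < T -> 2 * T <= A -> metric_box i p0 r lam Lam K -> 0 <= V ->
  K * (V * V) <= lam * lam / (8 * (Lam * Lam)) * lam / 2 ->
  K * V <= lam * lam / (8 * (Lam * Lam)) * Lam ->
  dom i q -> startu p0 rf T (chart i q) u ->
  (forall t : R, `|t| <= A -> nball p0 r (flow_pos i p0 rf A (chart i q) (T^-1 *: u) t) /\
    `|flow_vel i p0 rf A (chart i q) (T^-1 *: u) t| * T <= V) ->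
  nball p0 (r / 2) (chart i q) -> Num.sqrt Lam * `|u| <= Num.sqrt lam * (r / 4) ->
  rdist q (Exp q (tvec i q u)) = (tnorm q (tvec i q u))%:E.
Proof.
move=> fb T0 TA box V0 KV2 KV1 di su near qr b.
have r2 : r / 2 <= r by have := mb_r box; lra.
have TN : T != 0 by rewrite gt_eqF.
have [[oJ iJ J01 gc] [c0 v0]] := gcurve_to fb T0 TA di erefl su.
have Ee := Exp_geodesic (gcurve_to fb T0 TA di erefl su).
set c := gcurve i p0 rf A T (chart i q) u in gc c0 v0 Ee.
have J0 : two_sided (0 : R) by rewrite /two_sided/= normr0.
have J1 : two_sided (1 : R) by rewrite /two_sided/= normr1; lra.
have sp : speed c 0 = tnorm q (tvec i q u) by rewrite /speed c0 v0.
apply/eqP; rewrite eq_le; apply/andP; split.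
  rewrite Ee -{1}c0; apply: lee_of_mulDe => a a0.
  have := spath_rdist (geodesic_spath oJ iJ J0 gc J0 J1 a0).
  by rewrite subr0 normr1 mul1r sp.
pose x t := flow_pos i p0 rf A (chart i q) (T^-1 *: u) (T * t).
pose v t := T *: flow_vel i p0 rf A (chart i q) (T^-1 *: u) (T * t).
have in01 (t : R) (h : 0 <= t <= 1) := two_sided01 h.
have x0 : x 0 = chart i q by rewrite /x mulr0 (flow_pos0 fb (startuP T0 su)).
have v00 : v 0 = u by rewrite /v mulr0 (flow_vel0 fb (startuP T0 su)) scalerA (mulfV TN) scale1r.
have Hgeo (t : R) : 0 <= t <= 1 -> [/\ nball p0 r (x t), is_derive t 1 x (v t),
    is_derive t 1 v (- christoffel i (x t) (v t) (v t)) & `|v t| <= V].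
  move=> t01; have tA := two_sided_time T0 TA (in01 t t01).
  have [n1 n2] := near _ tA.
  have [nb h1 h2] := flow_derive fb (startuP T0 su) tA.
  have E1 : (fun s => x (s)) = (fun s => flow_pos i p0 rf A (chart i q) (T^-1 *: u) (T * s + 0)).
    by apply/funext => s; rewrite addr0.
  have E2 : v = (fun s => T *: flow_vel i p0 rf A (chart i q) (T^-1 *: u) (T * s + 0)).
    by apply/funext => s; rewrite addr0.
  rewrite -[T * t]addr0 in h1 h2.
  split; [exact: n1| | |].
  - have := is_derive_affine_comp h1; rewrite -E1 addr0; exact.
  - have eC : - christoffel i (x t) (v t) (v t) = T *: (T *: - christoffel i (x t)
        (flow_vel i p0 rf A (chart i q) (T^-1 *: u) (T * t))
        (flow_vel i p0 rf A (chart i q) (T^-1 *: u) (T * t))).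
      by rewrite /v (christoffelZ T _ (mb_img box n1)) -scalerA !scalerN.
    by rewrite eC {1}E2; have := is_deriveZv T (is_derive_affine_comp h2); rewrite addr0.
  - by rewrite /v normrZ (gtr0_norm T0) mulrC.
pose E := gram (metric i (chart i q)) u u / 2.
have E2 : 2 * E = gram (metric i (chart i q)) u u by rewrite /E mulrC divfK.
have Hgeo2 (t : R) : 0 <= t <= 1 -> [/\ nball p0 r (x t), is_derive t 1 x (v t),
    is_derive t 1 v (- christoffel i (x t) (v t) (v t)), `|v t| <= V & gram (metric i (x t)) (v t) (v t) = 2 * E].
  move=> t01; have [h1 h2 h3 h4] := Hgeo t t01; split; [exact: h1|exact: h2|exact: h3|exact: h4|].
  have [d1 cc1 hx1] := gcurve_chart fb T0 TA su (in01 t t01).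
  have [d0 cc0 hx0] := gcurve_chart fb T0 TA su J0.
  have [ct _] := gc t (in01 t t01); have [c0' _] := gc 0 J0.
  have := geodesic_energy oJ iJ J0 (in01 t t01) gc.
  rewrite (energy_chart d1 ct hx1) (energy_chart d0 c0' hx0) cc1 cc0.
  by rewrite -/(x t) -/(v t) -/(x 0) -/(v 0) x0 v00 E2.
have qr' : nball p0 r (chart i q) := nball_sub r2 qr.
have := rdist_lower box V0 KV2 KV1 Hgeo2; rewrite x0 E2 -(tnorm_tvec u di).
rewrite Ee (chartK di) => h.
have -> : c 1 = unchart i (x 1) by [].
apply: h; first exact: qr.
apply: le_trans b; rewrite (tnorm_tvec u di).
apply: (@le_trans _ _ (Num.sqrt (Lam * `|u| * `|u|))).
  apply: ler_wsqrtr; apply: le_trans (ler_norm _) _; exact: (mb_up box _ _ qr').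
rewrite -mulrA sqrtrM; last exact/ltW/(mb_Lam box).
by rewrite -expr2 sqrtr_sqr normr_id.
Qed.

(** What is needed of the exponential maps at all points of a chart ball of radius
    rho: they are given there by e, almost a translation, with controlled second
    differences, and short geodesics minimize.  The larger ball of radius r contains
    the values of e and carries the bounds on the metric. *)
Record normal_chart (i : atlas M) p0 (r rho sigma lam Lam C : R) (e : 'rV[R]_n -> 'rV[R]_n -> 'rV[R]_n) : Prop := NormalChart {
  nc_rho : 0 < rho ; nc_sigma : 0 < sigma ; nc_lam : 0 < lam ; nc_Lam : 0 < Lam ; nc_C : 0 < C ;
  nc_rr : rho <= r ;
  nc_img : nball p0 r `<=` img i ;
  nc_low : forall q u, nball p0 r q -> lam * (`|u| * `|u|) <= gram (metric i q) u u ;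
  nc_up : forall q u, nball p0 r q -> gram (metric i q) u u <= Lam * (`|u| * `|u|) ;
  nc_spath : forall p p', nball p0 r p -> nball p0 r p' ->
    spath (unchart i p : M) (unchart i p') (2 * (Num.sqrt Lam * `|p' - p|)) ;
  nc_in : forall p u, nball p0 rho p -> `|u| < sigma -> nball p0 r (e p u) ;
  nc_e0 : forall p, nball p0 rho p -> e p 0 = p ;
  nc_diff : forall p u u', nball p0 rho p -> `|u| < sigma -> `|u'| < sigma ->
    `|e p u - e p u' - (u - u')| <= 8^-1 * `|u - u'| ;
  nc_diff2 : forall p u0 u1 u2 u3 u4 (a1 a2 eta L1 L2 : R), nball p0 rho p ->
    `|u0| < sigma -> `|u1| < sigma -> `|u2| < sigma -> `|u3| < sigma -> `|u4| < sigma ->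
    `|u1 - u0| <= eta -> `|u2 - u0| <= eta -> `|u3 - u0| <= eta -> `|u4 - u0| <= eta ->
    `|a1| * `|u1 - u2| <= L1 -> `|a2| * `|u3 - u4| <= L2 ->
    forall d, d = a1 *: (u1 - u2) - a2 *: (u3 - u4) ->
    `|a1 *: (e p u1 - e p u2) - a2 *: (e p u3 - e p u4) - d|
       <= 8^-1 * `|d| + C * eta * (L1 + L2) ;
  nc_geo : forall q u, dom i q -> nball p0 rho (chart i q) -> `|u| < sigma ->
    exists J c, geodesic_to J c q (tvec i q u) ;
  nc_exp : forall q u, dom i q -> nball p0 rho (chart i q) -> `|u| < sigma ->
    Exp q (tvec i q u) = unchart i (e (chart i q) u) ;
  nc_dist : forall q u, dom i q -> nball p0 rho (chart i q) -> `|u| < sigma ->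
    rdist q (Exp q (tvec i q u)) = (tnorm q (tvec i q u))%:E }.

Lemma normal_chart_exists (i : atlas M) p0 : img i p0 ->
  exists r rho sigma lam Lam C e, normal_chart i p0 r rho sigma lam Lam C e.
Proof.
move=> ip; have [rf [Kf [A [dH fb]]]] := flow_box_exists ip.
have [rm [lam [Lam [K box0]]]] := metric_box_exists ip.
have rf0 := fb_r fb; have A0 := fb_A fb.
have rm0 := mb_r box0.
pose r := Num.min rf rm.
have r0 : 0 < r by rewrite lt_min rf0.
have rrf : r <= rf by rewrite ge_min lexx.
have box : metric_box i p0 r lam Lam K by apply: metric_box_le box0 => //; rewrite ge_min lexx orbT.
have lam0 := mb_lam box; have Lam0 := mb_Lam box; have K0 := mb_K box.
(* Velocities are scaled so that time 1 of the geodesic is time T of the flow;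
   the flow runs up to 2 T, which leaves room beyond time 1. *)
pose T := A / 2; have T0 : 0 < T by rewrite divr_gt0.
have TA : 2 * T <= A by rewrite /T mulrC divfK.
have [m mE] : exists m, m = lam * lam / (8 * (Lam * Lam)) by eexists.
have m0 : 0 < m by rewrite mE divr_gt0 ?mulr_gt0.
(* The bound on velocities under which the calibration applies. *)
pose V := Num.min 1 (Num.min (m * lam / 2) (m * Lam) / (K + 1)).
have k0 : 0 < Num.min (m * lam / 2) (m * Lam) by rewrite lt_min !mulr_gt0// invr_gt0.
have V0 : 0 < V by rewrite lt_min ltr01 divr_gt0//; lra.
have V1 : V <= 1 by rewrite ge_min lexx.
have KV : K * V <= Num.min (m * lam / 2) (m * Lam).
  apply: (@le_trans _ _ ((K + 1) * V)); first by rewrite ler_wpM2r ?(ltW V0)//; lra.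
  rewrite mulrC -ler_pdivlMr; last lra.
  by rewrite ge_min lexx orbT.
have KV1 : K * V <= m * Lam by apply: (le_trans KV); rewrite ge_min lexx orbT.
have KV2 : K * (V * V) <= m * lam / 2.
  apply: (@le_trans _ _ (K * V)); last by apply: (le_trans KV); rewrite ge_min lexx.
  by rewrite ler_wpM2l// -[leRHS]mul1r ler_wpM2r// ltW.
have sl0 : 0 < Num.sqrt lam by rewrite sqrtr_gt0.
have sL0 : 0 < Num.sqrt Lam by rewrite sqrtr_gt0.
pose rho := r / 4; have rho0 : 0 < rho by rewrite divr_gt0.
have rhor : rho <= r by rewrite /rho; lra.
have rhor2 : rho <= r / 2 by rewrite /rho; lra.
(* In order: the flow starts in its box; the geodesic stays within r / 8 of its
   starting point; its velocity is at most V; its length is at most what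
   rdist_lower allows. *)
pose sigma := Num.min (Num.min (T * rf / 4) (T * r / 8)) (Num.min (V / 2) (Num.sqrt lam * (r / 4) / Num.sqrt Lam)).
have sigma0 : 0 < sigma by rewrite !lt_min !divr_gt0 ?mulr_gt0// divr_gt0.
pose e := expc i p0 rf A T.
have st p u : nball p0 rho p -> `|u| < sigma -> startu p0 rf T p u.
  rewrite /nball/= => pr us; split; first by apply: lt_le_trans pr _; rewrite /rho; lra.
  by apply: lt_le_trans us _; rewrite /sigma !ge_min lexx.
have ub u : `|u| < sigma -> [/\ `|u| <= T * r / 8, 2 * `|u| <= V & Num.sqrt Lam * `|u| <= Num.sqrt lam * (r / 4)].
  rewrite /sigma !lt_min => /andP[/andP[_ h1] /andP[h2 h3]].
  split; [exact: ltW|lra|]; by rewrite mulrC -ler_pdivlMr// ltW.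
have near p u (t : R) : nball p0 rho p -> `|u| < sigma -> `|t| <= A ->
    nball p0 r (flow_pos i p0 rf A p (T^-1 *: u) t) /\
    `|flow_vel i p0 rf A p (T^-1 *: u) t| * T <= V.
  move=> pr us tA; have su := st p u pr us; have [b1 b2 _] := ub u us.
  have [h1 h2] := flow_near fb (startuP T0 su) tA.
  have w : `|T^-1 *: u| = `|u| / T by rewrite normrZ gtr0_norm ?invr_gt0// mulrC.
  rewrite w in h1 h2; split; last first.
    by apply: (le_trans _ b2); rewrite -ler_pdivlMr// -mulrA.
  have h3 : `|u| / T <= r / 8 by rewrite ler_pdivrMr//; lra.
  rewrite /nball/= in pr *; have h4 : `|p - p0| < r / 4 by exact: pr.
  have := ler_distD p (flow_pos i p0 rf A p (T^-1 *: u) t) p0; lra.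
have TT : `|T| <= A by rewrite gtr0_norm//; lra.
exists r, rho, sigma, lam, Lam, T^-1, e; split => //.
- by rewrite invr_gt0.
- exact: mb_img box.
- exact: mb_low box.
- by move=> q u qr; rewrite mulrA; apply: le_trans (ler_norm _) _; exact: (mb_up box _ _ qr).
- by move=> p p' pr pr'; exact: (chart_spath box pr pr').
- by move=> p u pr us; exact: (near p u T pr us TT).1.
- by move=> p pr; apply: (expc0 fb T0 TA (st p 0 pr _)); rewrite normr0.
- by move=> p u u' pr us us'; exact: (expc_diff fb T0 TA (st p u pr us) (st p u' pr us')).
- move=> p u0 u1 u2 u3 u4 a1 a2 eta L1 L2 pr s0 s1 s2 s3 s4 h1 h2 h3 h4 k1 k2.
  exact: (expc_diff2 fb T0 TA (st p u0 pr s0) (st p u1 pr s1) (st p u2 pr s2) (st p u3 pr s3) (st p u4 pr s4) h1 h2 h3 h4 k1 k2).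
- by move=> q u di qr us; do 2 eexists; exact: (gcurve_to fb T0 TA di erefl (st _ u qr us)).
- by move=> q u di qr us; exact: (Exp_chart fb T0 TA di (st _ u qr us)).
move=> q u di qr us; have [_ _ b] := ub u us.
apply: (exp_rdist fb T0 TA box (ltW V0) _ _ di (st _ u qr us) _ (lt_le_trans qr rhor2) b).
- by rewrite -mE.
- by rewrite -mE.
- by move=> t tA; exact: near.
Qed.

End NormalChart.

(** * Completeness of compact manifolds *)

Lemma compact_uniform {R : realType} (X : topologicalType) (K : set X) (P : R -> X -> Prop) :
  compact K ->
  (forall x r r', 0 < r' -> r' <= r -> P r x -> P r' x) ->
  (forall x, K x -> exists r, 0 < r /\ \forall y \near x, P r y) ->
  exists r, 0 < r /\ forall x, K x -> P r x.
Proof.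
move=> /compact_near_coveringP cK mono loc.
have H : \forall r \near (0 : R)^'+, K `<=` P r.
  apply: cK => x /loc[r [r0 Hr]].
  exists ([set y | P r y], [set s : R | 0 < s /\ s <= r]).
    split; first exact: Hr.
    by near=> s; split; near: s; [exact: nbhs_right_gt|exact: nbhs_right_le].
  by move=> [y s] /= [Py [s0 sr]]; exact: mono Py.
have [r [r0 Hr]] := filter_ex (filterI (nbhs_right_gt (0 : R)) H).
by exists r; split => // x Kx; exact: Hr.
Unshelve. all: by end_near. Qed.

Section Completeness.
Context {R : realType} {n : nat} (M : riemannianManifold R n).
Implicit Types (p u w : 'rV[R]_n) (c : R -> M).

Lemma velocity_near c c' (t : R) : (\forall s \near t, c s = c' s) -> velocity c t = velocity c' t.
Proof.
move=> cc; have e := nbhs_singleton cc; rewrite /velocity -e; set i := chart_at (c t).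
have : \forall s \near t, (chart i \o c) s = (chart i \o c') s.
  by apply: filterS cc => s /= ->.
by move=> /near_derive1/nbhs_singleton.
Qed.

Lemma velocity_affine (J : set R) c (a b t : R) : open J -> J (a * t + b) -> geodesic_on J c ->
  velocity (fun s => c (a * s + b)) t = a *: velocity c (a * t + b).
Proof.
move=> oJ Jt gc; rewrite /velocity; set i := chart_at _.
have di : dom i (c (a * t + b)) := mem_chart_at _.
have [_ _ nx _] := geodesic_near oJ Jt gc di.
exact: (is_derive1E (is_derive_affine_comp (nbhs_singleton nx))).
Qed.

(** By uniqueness the two geodesics agree near a, so the glued curve is one of them
    near each point. *)
Lemma geodesic_glue (J1 J2 : set R) c1 c2 (a : R) : open J1 -> open J2 -> is_interval J1 ->
  is_interval J2 -> J1 a -> J2 a -> geodesic_on J1 c1 -> geodesic_on J2 c2 ->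
  c1 a = c2 a -> velocity c1 a = velocity c2 a ->
  exists (J : set R) c, [/\ open J, is_interval J & geodesic_on J c] /\
    [/\ forall s, s <= a -> J1 s -> J s, forall s, a <= s -> J2 s -> J s &
        forall s, s <= a -> \forall r \near s, c r = c1 r].
Proof.
move=> o1 o2 i1 i2 J1a J2a g1 g2 e12 v12.
pose J : set R := [set s | (s <= a -> J1 s) /\ (a <= s -> J2 s)].
pose c s := if s <= a then c1 s else c2 s.
have n12 : \forall s \near a, c1 s = c2 s.
  apply: (geodesic_uniq_local o1 o2 J1a J2a g1 g2 e12 (mem_chart_at _)).
  by move: v12; rewrite /velocity -e12.
have nlt s : s < a -> \forall r \near s, c r = c1 r.
  move=> sa; apply/near_ex; exists (a - s); split; first by rewrite subr_gt0.
  move=> r; rewrite ltr_norml => /andP[_ h]; have ra : r < a by lra.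
  by rewrite /c ltW.
have ngt s : a < s -> \forall r \near s, c r = c2 r.
  move=> sa; apply/near_ex; exists (s - a); split; first by rewrite subr_gt0.
  move=> r; rewrite ltr_norml => /andP[h _]; have ra : a < r by lra.
  by rewrite /c leNgt ra.
have neq : \forall r \near a, c r = c1 r.
  by apply: filterS n12 => r e; rewrite /c; case: ifP.
exists J, c; split; split.
- have -> : J = (J1 `|` [set s | a < s]) `&` (J2 `|` [set s | s < a]).
    apply/seteqP; split => s; rewrite /J/=.
      move=> [h1 h2]; split.
        by have [sa|sa] := leP s a; [left; exact: h1|right].
      by have [sa|sa] := leP a s; [left; exact: h2|right].
    move=> [h1 h2]; split => sa.
      by case: h1 => // h; have := lt_le_trans h sa; rewrite ltxx.
    by case: h2 => // h; have := lt_le_trans h sa; rewrite ltxx.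
  by apply: openI; apply: openU => //; first [exact: open_gt|exact: open_lt].
- move=> x y [x1 x2] [y1 y2] z /andP[xz zy]; split => za.
    have h : x <= z <= a by rewrite xz.
    exact: (i1 _ _ (x1 (le_trans xz za)) J1a _ h).
  have h : a <= z <= y by rewrite za.
  exact: (i2 _ _ J2a (y2 (le_trans za zy)) _ h).
- move=> s [s1 s2]; case: (ltgtP s a) => sa.
  + apply: (@geo_local _ _ _ c1 c s); first by apply: filterS (nlt s sa) => r ->.
    exact: g1 (s1 (ltW sa)).
  + apply: (@geo_local _ _ _ c2 c s); first by apply: filterS (ngt s sa) => r ->.
    exact: g2 (s2 (ltW sa)).
  + rewrite sa; apply: (@geo_local _ _ _ c1 c a); first by apply: filterS neq => r ->.
    exact: g1.
- move=> s sa Js; split => // sa'; have -> : s = a by apply: le_anti; rewrite sa.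
  exact: J2a.
- move=> s sa Js; split => // sa'; have -> : s = a by apply: le_anti; rewrite sa'.
  exact: J1a.
- by move=> s; rewrite le_eqVlt => /orP[/eqP->|]; [exact: neq|exact: nlt].
Qed.

(** Geodesics have constant speed, so that the same time tau can be gained again
    and again. *)
Lemma geodesic_continue (N tau : R) q xi : 0 < tau ->
  (forall q' xi', tnorm q' xi' <= N -> exists J c, geodesic_to (M := M) J c q' (tau *: xi')) ->
  tnorm q xi <= N -> forall k : nat, exists (J : set R) c,
    [/\ open J, is_interval J, J 0, J (k%:R * tau) & geodesic_on J c] /\
    c 0 = q /\ velocity c 0 = xi.
Proof.
move=> t0 H xiN; have tn0 : tau != 0 by rewrite gt_eqF.
have in01 (J : set R) : `[0, 1] `<=` J -> J 0 /\ J 1.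
  by move=> J01; split; apply: J01; rewrite /= in_itv/= ?lexx ?ler01.
have openJ (J : set R) b : open J -> open [set s | J (tau^-1 * s + b)].
  move=> oJ; rewrite openE => s Js.
  by apply: (@near_affine R J tau^-1 b s); exact: open_nbhs_nbhs.
have intJ (J : set R) b : is_interval J -> is_interval [set s | J (tau^-1 * s + b)].
  move=> iJ x y Jx Jy z /andP[xz zy]; apply: (iJ _ _ Jx Jy).
  by rewrite !lerD2r !ler_pM2l ?invr_gt0// xz.
elim=> [|k [J [c [[oJ iJ J0 Jk gc] [c0 v0]]]]].
  have [J [c [[oJ iJ J01 gc] [c0 v0]]]] := H q xi xiN; have [J0 _] := in01 J J01.
  exists [set s | J (tau^-1 * s + 0)], (fun s => c (tau^-1 * s + 0)).
  have E0 : tau^-1 * 0 + 0 = 0 by rewrite mulr0 addr0.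
  split; first split.
  - exact: openJ.
  - exact: intJ.
  - by rewrite /= E0.
  - by rewrite /= mul0r E0.
  - exact: geodesic_affine.
  split; first by rewrite E0.
  by rewrite (velocity_affine oJ _ gc) ?E0// v0 scalerA mulVf// scale1r.
set a := k%:R * tau in Jk; have a0 : 0 <= a by rewrite mulr_ge0// ltW.
have sp : tnorm (c a) (velocity c a) <= N.
  rewrite -/(speed c a) speedE (geodesic_energy oJ iJ J0 Jk gc) -speedE.
  by rewrite /speed c0 v0.
have [J2 [d [[oJ2 iJ2 J01 gd] [d0 vd]]]] := H _ _ sp; have [J20 J21] := in01 J2 J01.
have Ea : tau^-1 * a + - k%:R = 0 by rewrite /a mulrCA mulVf// mulr1 subrr.
have E1 : tau^-1 * (k.+1%:R * tau) + - k%:R = 1.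
  by rewrite mulrCA mulVf// mulr1 -natr1 addrC addKr.
pose d' s := d (tau^-1 * s + - k%:R).
have J2a : J2 (tau^-1 * a + - k%:R) by rewrite Ea.
have eca : c a = d' a by rewrite /d' Ea d0.
have eva : velocity c a = velocity d' a.
  by rewrite /d' (velocity_affine oJ2 J2a gd) Ea vd scalerA mulVf// scale1r.
have [Jn [cn [[on jn gn] [h1 h2 h3]]]] :=
  geodesic_glue oJ (openJ J2 (- k%:R) oJ2) iJ (intJ J2 (- k%:R) iJ2) Jk J2a gc
   (geodesic_affine (a := tau^-1) (b := - k%:R) oJ2 gd) eca eva.
exists Jn, cn; split; first split => //.
- exact: h1.
- apply: h2; last by rewrite /= E1.
  by rewrite /a ler_wpM2r ?(ltW t0)// ler_nat.
have n0 := h3 0 a0; split; first by rewrite (nbhs_singleton n0).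
by rewrite (velocity_near n0).
Qed.

Lemma tnormZ (q : M) (a : R) v : tnorm q (a *: v) = `|a| * tnorm q v.
Proof.
by rewrite /tnorm gramZl gramZr mulrA sqrtrM -?expr2 ?sqr_ge0// sqrtr_sqr.
Qed.

Lemma tnorm_ge0 (q : M) v : 0 <= tnorm q v. Proof. exact: sqrtr_ge0. Qed.

Lemma normal_chart_tnorm (i : atlas M) p0 (r rho sigma lam Lam C : R) e q u :
  normal_chart i p0 r rho sigma lam Lam C e -> dom i q -> nball p0 r (chart i q) ->
  Num.sqrt lam * `|u| <= tnorm q (tvec i q u) /\ tnorm q (tvec i q u) <= Num.sqrt Lam * `|u|.
Proof.
move=> nc di qr; rewrite (tnorm_tvec u di).
have E (a : R) : 0 <= a -> Num.sqrt a * `|u| = Num.sqrt (a * (`|u| * `|u|)).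
  by move=> a0; rewrite sqrtrM// -expr2 sqrtr_sqr normr_id.
rewrite !E ?(ltW (nc_lam nc)) ?(ltW (nc_Lam nc))//.
by split; apply: ler_wsqrtr; [exact: nc_low nc _ _ qr|exact: nc_up nc _ _ qr].
Qed.

Lemma chart_near (i : atlas M) (q0 : M) (rho : R) : dom i q0 -> 0 < rho ->
  \forall y \near q0, dom i y /\ nball (chart i q0) rho (chart i y).
Proof.
move=> di r0; apply: filterI; first exact: open_nbhs_nbhs (conj (dom_open i) di).
have h : nbhs (chart i q0) (nball (chart i q0) rho) by apply/(near_ex (nball (chart i q0) rho)); exists rho.
exact: (chart_continuous di h).
Qed.

(** By compactness geodesics of bounded speed exist for a time which does not depend
    on the starting point. *)
Lemma geodesic_complete q xi : compact [set: M] -> exists J c, geodesic_to (M := M) J c q xi.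
Proof.
move=> cM; pose N := tnorm q xi.
have [||tau [t0 Ht]] := @compact_uniform R M [set: M]
   (fun tau q' => forall xi', tnorm q' xi' <= N -> exists J c, geodesic_to (M := M) J c q' (tau *: xi')) cM.
- move=> x t t' t'0 tt' H xi' xiN.
  have [J [c [[oJ iJ J01 gc] [c0 v0]]]] := H xi' xiN.
  have t0 : 0 < t by exact: lt_le_trans tt'.
  pose s := t' / t; have s0 : 0 < s by rewrite divr_gt0.
  have s1 : s <= 1 by rewrite ler_pdivrMr// mul1r.
  have J0 : J 0 by apply: J01; rewrite /= in_itv/= lexx ler01.
  exists [set r | J (s * r + 0)], (fun r => c (s * r + 0)).
  have E0 : s * 0 + 0 = 0 by rewrite mulr0 addr0.
  split; first split.
  + rewrite openE => r Jr; apply: (@near_affine R J s 0 r); exact: open_nbhs_nbhs.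
  + move=> a b Ja Jb z /andP[az zb]; apply: (iJ _ _ Ja Jb).
    by rewrite !lerD2r !ler_pM2l// az.
  + move=> r /=; rewrite in_itv/= addr0 => /andP[r0 r1]; apply: J01; rewrite /= in_itv/=.
    by rewrite mulr_ge0 ?(ltW s0)//= mulr_ile1// ltW.
  + exact: geodesic_affine.
  split; first by rewrite E0.
  by rewrite (velocity_affine oJ _ gc) ?E0// v0 scalerA /s divfK// gt_eqF.
- move=> q0 _; pose i := chart_at q0; have di : dom i q0 := mem_chart_at _.
  have [r [rho [sigma [lam [Lam [C [e nc]]]]]]] := normal_chart_exists (chart_img di).
  have N0 : 0 <= N := tnorm_ge0 _ _; have N1 : 0 < N + 1 by lra.
  have sl0 : 0 < Num.sqrt lam by rewrite sqrtr_gt0 (nc_lam nc).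
  have sg0 := nc_sigma nc.
  exists (sigma * Num.sqrt lam / (N + 1)); split; first by rewrite divr_gt0// mulr_gt0.
  apply: filterS (chart_near di (nc_rho nc)) => y [dy yr] xi' xiN.
  have [u uE] := tvec_surj xi' dy.
  have yr' := nball_sub (nc_rr nc) yr.
  have [h _] := normal_chart_tnorm u nc dy yr'; rewrite uE in h.
  rewrite -uE -tvecZ//; apply: (nc_geo nc) => //.
  rewrite normrZ gtr0_norm ?divr_gt0 ?mulr_gt0// mulrAC ltr_pdivrMr//.
  rewrite -mulrA ltr_pM2l//.
  by apply: (le_lt_trans h); apply: (le_lt_trans xiN); rewrite ltrDl.
have H := geodesic_continue t0 (fun q' xi' => Ht q' I xi') (lexx N).
have [J [c [[oJ iJ J0 Jk gc] [c0 v0]]]] := H (Num.truncn tau^-1).+1.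
exists J, c; split; last by [].
split => //; move=> s /=; rewrite in_itv/= => /andP[s0 s1]; apply: (iJ _ _ J0 Jk).
rewrite s0/=; apply: (le_trans s1).
have k1 := ltW (truncnS_gt tau^-1).
by have := ler_wpM2r (ltW t0) k1; rewrite (mulVf (lt0r_neq0 t0)).
Qed.

End Completeness.

(** * Cut times and the local logarithm *)

Section CutTime.
Context {R : realType} {n : nat} (M : riemannianManifold R n).
Implicit Types (p u w : 'rV[R]_n) (c : R -> M).

Lemma spath_le (x y : M) (B B' : R) : B <= B' -> spath x y B -> spath x y B'.
Proof.
move=> BB [c [h1 h2 h3 h4]]; exists c; split => // t; exact: le_trans (h4 t) BB.
Qed.

Lemma spath_triangle (x y z : M) (B1 B2 d : R) : 0 <= B1 -> 0 <= B2 -> 0 < d ->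
  spath x y B1 -> spath y z B2 -> spath x z (B1 + B2 + d).
Proof.
move=> b1 b2 d0 s1 s2; have -> : B1 + B2 + d = (B1 + d / 2) + (B2 + d / 2) by field.
by apply: (@spath_trans _ _ _ x y z); [lra|lra|apply: spath_le s1; lra|apply: spath_le s2; lra].
Qed.

Lemma Exp_scale (J : set R) c q xi (a : R) : geodesic_to (M := M) J c q xi -> 0 <= a <= 1 ->
  Exp q (a *: xi) = c a.
Proof.
move=> [[oJ iJ J01 gc] [c0 v0]] /andP[a0 a1].
have J0 : J 0 by apply: J01; rewrite /= in_itv/= lexx ler01.
have E0 : a * 0 + 0 = 0 by rewrite mulr0 addr0.
have -> : c a = c (a * 1 + 0) by rewrite mulr1 addr0.
apply: (@Exp_geodesic _ _ _ [set s | J (a * s + 0)] (fun s => c (a * s + 0))); split; first split.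
- rewrite openE => s Js; apply: (@near_affine R J a 0 s); exact: open_nbhs_nbhs.
- move=> x y Jx Jy z /andP[xz zy]; apply: (iJ _ _ Jx Jy).
  by rewrite !lerD2r !ler_wpM2l.
- move=> s /=; rewrite in_itv/= addr0 => /andP[s0 s1]; apply: J01.
  by rewrite /= in_itv/= mulr_ge0//= mulr_ile1.
- exact: geodesic_affine.
split; first by rewrite E0.
by rewrite (velocity_affine oJ _ gc) ?E0// v0.
Qed.

(** The supremum in cut_time need not be attained: at cut time 1 only times slightly
    below 1 are available. *)
Lemma cut_time_approx q xi (d : R) : 0 < d -> (1%:E <= cut_time (M := M) q xi)%E ->
  exists t : R, [/\ 0 <= t, 1 - d < t & rdist q (Exp q (t *: xi)) = (t * tnorm q xi)%:E].
Proof.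
move=> d0 ct; apply: contrapT => H.
suff : (cut_time q xi <= (1 - d)%:E)%E.
  by move=> /(le_trans ct); rewrite lee_fin; lra.
apply: ge_ereal_sup => _ [t [t0 Ht] <-]; rewrite lee_fin leNgt; apply/negP => td.
by apply: H; exists t.
Qed.

(** Take a time t, either above 1 or close to 1, up to which the geodesic minimizes,
    and compare it with the path that goes to y and then follows the geodesic from
    time 1 to time t: t N <= B + |t - 1| N, up to small errors. *)
Lemma cut_time_bound q y xi (B : R) : compact [set: M] -> 0 <= B -> spath q y B ->
  Exp q xi = y -> (1%:E <= cut_time (M := M) q xi)%E -> tnorm q xi <= B.
Proof.
move=> cM B0 sB Ey ct; set N := tnorm q xi; rewrite leNgt; apply/negP => BN.
have N0 : 0 < N by exact: le_lt_trans BN.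
have d0 : 0 < (N - B) / (4 * N) by rewrite divr_gt0 ?mulr_gt0// subr_gt0.
(* Minimization up to t > 1 - (N - B) / (4 N) turns the inequality below into
   N - B <= a proper fraction of N - B. *)
have [t [t0 td Et]] := cut_time_approx d0 ct.
pose T := Num.max t 1.
have T0 : 0 < T by rewrite lt_max ltr01 orbT.
have tT : t <= T by rewrite le_max lexx.
have oT : 1 <= T by rewrite le_max lexx orbT.
have TN : T != 0 by rewrite gt_eqF.
have [J [c gto]] := geodesic_complete q (T *: xi) cM.
have b01 (s : R) : 0 <= s -> s <= T -> 0 <= s / T <= 1.
  by move=> s0 sT; rewrite divr_ge0 ?(ltW T0)//= ler_pdivrMr// mul1r.
have scal (s : R) : 0 <= s -> s <= T -> Exp q (s *: xi) = c (s / T).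
  by move=> s0 sT; rewrite -(Exp_scale gto (b01 s s0 sT)) scalerA divfK.
have E1 : c (1 / T) = y by rewrite -scal// ?scale1r// ler01.
rewrite scal// in Et.
have [[oJ iJ J01 gc] [c0 v0]] := gto.
have inJ (s : R) : 0 <= s -> s <= T -> J (s / T) by move=> s0 sT; apply: J01; rewrite /= in_itv/= b01.
have J0 : J 0 by apply: J01; rewrite /= in_itv/= lexx ler01.
have sp : speed c 0 = T * N by rewrite /speed c0 v0 tnormZ gtr0_norm.
(* The loss e of geodesic_spath costs at most (N - B) / 4, since |t - 1| <= t + 1. *)
pose e := (N - B) / (4 * ((t + 1) * N)).
have tp : 0 < t + 1 by lra.
have NB : 0 < N - B by rewrite subr_gt0.
have e0 : 0 < e by rewrite divr_gt0// !mulr_gt0.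
have sc := geodesic_spath oJ iJ J0 gc (inJ 1 ler01 oT) (inJ t t0 tT) e0.
rewrite E1 sp in sc.
have eq1 : (1 + e) * (`|t / T - 1 / T| * (T * N)) = (1 + e) * (`|t - 1| * N).
  by rewrite -mulrBl normrM normfV (gtr0_norm T0) -mulrA (mulrA T^-1) mulVf// mul1r.
rewrite eq1 in sc.
have e1 : e * ((t + 1) * N) = (N - B) / 4 by rewrite /e; field; rewrite !gt_eqF.
have b2 : 0 <= (1 + e) * (`|t - 1| * N) by rewrite !mulr_ge0// ?(ltW N0)//; lra.
have e8 : 0 < (N - B) / 8 by lra.
have := spath_rdist (spath_triangle B0 b2 e8 sB sc); rewrite Et lee_fin -/N.
have dN : (N - B) / (4 * N) * N = (N - B) / 4 by field; rewrite gt_eqF.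
have [t1|t1] := leP t 1.
  rewrite ler0_norm ?subr_le0//.
  have h1 : (1 - (N - B) / (4 * N)) * N < t * N by rewrite ltr_pM2r.
  rewrite mulrBl mul1r dN in h1.
  have ee : e * (1 - t) * N <= (N - B) / 4.
    by rewrite -e1 -mulrA ler_pM2l// ler_pM2r//; lra.
  by lra.
rewrite gtr0_norm ?subr_gt0//.
have ee : e * ((t - 1) * N) <= (N - B) / 4 by rewrite -e1 ler_pM2l// ler_pM2r//; lra.
lra.
Qed.

End CutTime.

Lemma quotient_bound {R : realFieldType} (a b : R) : 0 <= a -> b <= 1 -> 8 / 7 * (a + b) <= 2 * (a + 1).
Proof. by move=> *; lra. Qed.

Lemma quotient_gap {R : realFieldType} (D X Y e eps : R) : 0 <= eps -> D <= X + Y -> X <= 8^-1 * D + eps / 8 ->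
  Y <= e + e -> e <= eps / 8 -> D <= eps.
Proof. by move=> *; lra. Qed.

Section LocalLog.
Context {R : realType} {n : nat} (M : riemannianManifold R n).
Implicit Types (p u w : 'rV[R]_n) (c : R -> M).
Variables (i : atlas M) (p0 : 'rV[R]_n) (r rho sigma lam Lam C : R) (e : 'rV[R]_n -> 'rV[R]_n -> 'rV[R]_n).
Hypothesis nc : normal_chart i p0 r rho sigma lam Lam C e.

Lemma expmap_lower p u u' : nball p0 rho p -> `|u| < sigma -> `|u'| < sigma ->
  `|u - u'| <= 8 / 7 * `|e p u - e p u'|.
Proof.
move=> pr us us'; have h := nc_diff nc pr us us'.
have := ler_distD (e p u - e p u') (u - u') 0; rewrite !subr0 (distrC (u - u')); lra.
Qed.

Lemma expmap_upper p u u' : nball p0 rho p -> `|u| < sigma -> `|u'| < sigma ->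
  `|e p u - e p u'| <= 2 * `|u - u'|.
Proof.
move=> pr us us'; have h := nc_diff nc pr us us'; have h0 := normr_ge0 (u - u').
have := ler_distD (u - u') (e p u - e p u') 0; rewrite !subr0; lra.
Qed.

Lemma expmap_inj p u u' : nball p0 rho p -> `|u| < sigma -> `|u'| < sigma ->
  e p u = e p u' -> u = u'.
Proof.
move=> pr us us' E; have := expmap_lower pr us us'; rewrite E subrr normr0 mulr0 => h.
by apply/eqP; rewrite -subr_eq0 -normr_eq0 eq_le h normr_ge0.
Qed.

(** The map u - (e p u - y) contracts by 8^-1 and preserves a compact ball; a point
    where it moves least is fixed. *)
Lemma expmap_surj p y : nball p0 rho p -> `|y - p| < sigma / 4 ->
  exists u, `|u| <= 2 * `|y - p| /\ e p u = y.
Proof.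
move=> pr ys; have s0 := nc_sigma nc; have y0 := normr_ge0 (y - p).
pose U : set 'rV[R]_n := [set u | `|u - 0| <= 2 * `|y - p|].
(* The fixed points of f are the solutions of e p u = y. *)
pose f u := u - (e p u - y).
have US u : U u -> `|u| < sigma by rewrite /U/= subr0; lra.
have U0 : U 0 by rewrite /U/= subr0 normr0 mulr_ge0.
have lips u u' : `|u| < sigma -> `|u'| < sigma -> `|f u - f u'| <= 8^-1 * `|u - u'|.
  move=> us us'; have := nc_diff nc pr us us'; rewrite distrC; congr (_ <= _).
  by congr (`|_|); rewrite /f; apply/rowP => k; rewrite !mxE; ring.
have lip u u' (Uu : U u) (Uu' : U u') := lips u u' (US u Uu) (US u' Uu').
have fU u : U u -> U (f u).
  move=> Uu; have h := lip u 0 Uu U0; have := Uu; rewrite /U/= in h *; rewrite subr0 in h *.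
  have f0 : f 0 = y - p by rewrite /f (nc_e0 nc pr) sub0r opprB.
  rewrite f0 in h; rewrite subr0 => uu; have := ler_distD (y - p) (f u) 0; rewrite !subr0; lra.
have cont u : U u -> {for u, continuous (fun x => `|f x - x| : R^o)}.
  move=> Uu; have us := US u Uu; apply: ex_cont => eps eps0.
  exists (Num.min (sigma - `|u|) (eps / 2)); split; first by rewrite lt_min subr_gt0 us divr_gt0.
  move=> x; rewrite lt_min => /andP[x1 x2].
  have xs : `|x| < sigma by have := ler_distD u x 0; rewrite !subr0; lra.
  have h := lips x u xs us; apply: le_trans (ler_dist_dist _ _) _.
  have -> : f x - x - (f u - u) = (f x - f u) - (x - u) by apply/rowP => k; rewrite !mxE; ring.
  apply: (le_trans (ler_normB _ _)); have := normr_ge0 (x - u); lra.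
have [||u /set_mem Uu fmin] := @compact_EVT_min _ R (fun x => `|f x - x|) U _ (@compact_cball R n 0 (2 * `|y - p|)).
- by exists 0.
- by apply: continuous_in_subspaceT => x /set_mem; exact: cont.
have fu : u = f u.
  have h := lip _ _ (fU u Uu) Uu; have := fmin (f u); rewrite inE => /(_ (fU u Uu)) h2.
  have h0 := normr_ge0 (f u - u).
  by apply/eqP; rewrite eq_sym -subr_eq0 -normr_eq0 eq_le h0 andbT; lra.
exists u; split; first by move: Uu; rewrite /U/= subr0.
apply/eqP; rewrite -subr_eq0; apply/eqP.
move: fu; rewrite /= /f => /(congr1 (fun x => u - x)); rewrite subrr opprB addrC subrK.
by move=> ->.
Qed.

(** The vector 2 u is still small, so the geodesic minimizes up to time 2. *)
Lemma cut_time_small q u : dom i q -> nball p0 rho (chart i q) -> `|u| < sigma / 2 ->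
  (1%:E < cut_time q (tvec i q u))%E.
Proof.
move=> di qr us; apply: (@lt_le_trans _ _ 2%:E); first by rewrite lte_fin; lra.
apply: ereal_sup_ubound; exists 2 => //; split; first by [].
have u2 : `|2 *: u| < sigma by rewrite normrZ ger0_norm//; lra.
by rewrite -tvecZ// (nc_dist nc di qr u2) tvecZ// tnormZ ger0_norm.
Qed.

(** A small solution u of e (chart i q) u = chart i y exists by expmap_surj.  Any
    other logarithm, even one of cut time exactly 1, is small by cut_time_bound,
    hence equal to u by expmap_inj. *)
Lemma log_local : compact [set: M] -> exists rho' : R, [/\ 0 < rho', rho' <= rho &
  forall q y, dom i q -> dom i y -> nball p0 rho' (chart i q) -> nball p0 rho' (chart i y) ->
  exists u, [/\ `|u| < sigma / 2, `|u| <= 2 * `|chart i y - chart i q|, e (chart i q) u = chart i y,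
    interior_set q y & (exists! xi, tangent_interior_set q xi /\ Exp q xi = y) /\
    Log q y = tvec i q u]].
Proof.
move=> cM; have s0 := nc_sigma nc; have r0 := nc_rho nc.
have sl0 : 0 < Num.sqrt lam by rewrite sqrtr_gt0 (nc_lam nc).
have sL0 : 0 < Num.sqrt Lam by rewrite sqrtr_gt0 (nc_Lam nc).
(* By cut_time_bound a logarithm xi of y at q has norm at most
   2 sqrt(Lam) |y - q| < 4 sqrt(Lam) a, so its coordinates are below sigma. *)
pose a := Num.sqrt lam * sigma / (8 * Num.sqrt Lam).
have a0 : 0 < a by rewrite divr_gt0 ?mulr_gt0.
exists (Num.min rho (Num.min (sigma / 16) a)).
split; [by rewrite !lt_min r0 a0 divr_gt0|by rewrite ge_min lexx|].
move=> q y dq dy; rewrite /nball/= !lt_min => /andP[qr /andP[qs qa]] /andP[yr /andP[ys ya]].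
have yq : `|chart i y - chart i q| < sigma / 8 /\ `|chart i y - chart i q| < 2 * a.
  have := ler_distD p0 (chart i y) (chart i q); rewrite (distrC p0) => h; split; lra.
have [yq1 yq2] := yq.
have [|u [u2 Eu]] := @expmap_surj (chart i q) (chart i y) qr; first by lra.
have us : `|u| < sigma / 2 by lra.
have us1 : `|u| < sigma by lra.
have Ey : Exp q (tvec i q u) = y by rewrite (nc_exp nc dq qr us1) Eu chartK.
have ct := cut_time_small dq qr us.
have uniq xi : (1%:E <= cut_time q xi)%E -> Exp q xi = y -> xi = tvec i q u.
  move=> cx Ex; have qr' := nball_sub (nc_rr nc) qr; have yr' := nball_sub (nc_rr nc) yr.
  have sp := nc_spath nc qr' yr'; rewrite !chartK// in sp.
  have B0 : 0 <= 2 * (Num.sqrt Lam * `|chart i y - chart i q|) by rewrite !mulr_ge0// ltW.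
  have hB := cut_time_bound cM B0 sp Ex cx.
  have [w wE] := tvec_surj xi dq; rewrite -wE in hB Ex *.
  have [h _] := normal_chart_tnorm w nc dq qr'.
  have ws : `|w| < sigma.
    rewrite -(ltr_pM2l sl0); apply: (le_lt_trans h); apply: (le_lt_trans hB).
    apply: (@lt_le_trans _ _ (2 * (Num.sqrt Lam * (2 * a)))); first by rewrite !ltr_pM2l.
    rewrite /a le_eqVlt; apply/orP; right.
    have -> : 2 * (Num.sqrt Lam * (2 * (Num.sqrt lam * sigma / (8 * Num.sqrt Lam)))) =
      2^-1 * (Num.sqrt lam * sigma) by field; rewrite gt_eqF.
    have := mulr_gt0 sl0 s0; set z := _ * sigma; lra.
  congr tvec; apply: (expmap_inj qr ws us1); rewrite Eu.
  rewrite (nc_exp nc dq qr ws) in Ex.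
  by rewrite -Ex unchartK//; exact: (nc_img nc (nc_in nc qr ws)).
exists u; split => //.
  move=> [xi /= cx Ex]; have E := uniq xi _ Ex; rewrite /tangent_cut_locus/= in cx.
  by have := ct; rewrite -E ?cx ?ltxx.
have Hu : tangent_interior_set q (tvec i q u) /\ Exp q (tvec i q u) = y by split.
split; first by exists (tvec i q u); split => // xi [/ltW cx Ex]; rewrite (uniq xi).
rewrite /Log; case: xgetP => [xi _ [/ltW cx Ex]|/(_ (tvec i q u))//].
exact: uniq.
Qed.

Lemma sder_of_cauchy (u : R -> 'rV[R]_n) (t : R) :
  (forall eps : R, 0 < eps -> exists s : R, 0 < s /\ forall a b a' b' : R,
     `|a - t| < s -> `|b - t| < s -> `|a' - t| < s -> `|b' - t| < s -> a != b -> a' != b' ->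
     `|(a - b)^-1 *: (u a - u b) - (a' - b')^-1 *: (u a' - u b')| <= eps) ->
  exists d, sder u t d.
Proof.
move=> H; pose x (k : nat) : R := t + k.+1%:R^-1.
pose Q k := (x k - t)^-1 *: (u (x k) - u t).
have xt k : x k != t by rewrite /x -subr_eq0 addrC addKr invr_eq0 pnatr_eq0.
have xs (s : R) : 0 < s -> exists N, forall k, (N <= k)%N -> `|x k - t| < s.
  move=> s0; exists (Num.truncn s^-1) => k Nk.
  rewrite /x addrC addKr gtr0_norm ?invr_gt0 ?ltr0n//.
  rewrite invf_plt ?posrE ?ltr0n//; apply: lt_le_trans (truncnS_gt _) _.
  by rewrite ler_nat.
have cQ : cvg (Q @ \oo).
  apply/cauchy_cvgP/cauchy_exP => eps eps0.
  have [|s [s0 Hs]] := H (eps / 2); first by rewrite divr_gt0.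
  have [N HN] := xs s s0; exists (Q N); exists N => // k /= Nk.
  rewrite -ball_normE/=; apply: (@le_lt_trans _ _ (eps / 2)); last lra.
  by apply: Hs; rewrite ?subrr ?normr0 ?HN ?xt.
exists (lim (Q @ \oo)) => eps eps0.
have [|s [s0 Hs]] := H (eps / 2); first by rewrite divr_gt0.
exists s; split => // a b as_ bs; have [->|ab] := eqVneq a b.
  by rewrite !subrr scale0r subr0 !normr0 mulr0.
have h : `|(a - b)^-1 *: (u a - u b) - lim (Q @ \oo)| <= eps.
  have e2 : 0 < eps / 2 by rewrite divr_gt0.
  have /cvgrPdist_lt/(_ _ e2)[N1 _ HN1] := cQ.
  have [N HN] := xs s s0; pose k := maxn N1 N.
  have h1 := HN1 k (leq_maxl _ _); have h2 := HN k (leq_maxr _ _).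
  have ts : `|t - t| < s by rewrite subrr normr0.
  have h3 := Hs a b (x k) t as_ bs h2 ts ab (xt k).
  rewrite -/(Q k) in h3; rewrite /= distrC in h1.
  by have := ler_distD (Q k) ((a - b)^-1 *: (u a - u b)) (lim (Q @ \oo)); lra.
have ab0 : a - b != 0 by rewrite subr_eq0.
have -> : u a - u b - (a - b) *: lim (Q @ \oo) =
  (a - b) *: ((a - b)^-1 *: (u a - u b) - lim (Q @ \oo)).
  by rewrite scalerBr scalerA mulfV// scale1r.
by rewrite normrZ mulrC ler_wpM2r.
Qed.

(** The second difference of e compares the difference quotients of u with those of
    y, which are Cauchy; the errors tend to 0 because u is continuous. *)
Lemma log_sder p (u y : R -> 'rV[R]_n) (t : R) d : nball p0 rho p ->
  (\forall s \near t, `|u s| < sigma /\ e p (u s) = y s) -> sder y t d ->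
  exists d', sder u t d' /\ `|d'| <= 2 * `|d|.
Proof.
move=> pr nu sy; have [r1 [r10 H1]] := (near_ex _ _).1 nu.
have C0 := nc_C nc; have d0 := normr_ge0 d.
pose L := 2 * (`|d| + 1); have L0 : 0 < L by rewrite /L; lra.
have low a b : `|a - t| < r1 -> `|b - t| < r1 -> `|u a - u b| <= 8 / 7 * `|y a - y b|.
  by move=> /H1[ua ea] /H1[ub eb]; rewrite -ea -eb; exact: expmap_lower.
have qy (eps : R) : 0 < eps -> exists s : R, [/\ 0 < s, s <= r1 & forall a b, `|a - t| < s -> `|b - t| < s ->
    `|y a - y b| <= (`|d| + eps) * `|a - b| /\
    (a != b -> `|(a - b)^-1 *: (y a - y b) - d| <= eps)].
  move=> eps0; have [s [s0 Hs]] := sy eps eps0.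
  exists (Num.min s r1); split; [by rewrite lt_min s0|by rewrite ge_min lexx orbT|].
  move=> a b; rewrite !lt_min => /andP[as_ _] /andP[bs _]; have h := Hs a b as_ bs.
  split.
    have := ler_normD (y a - y b - (a - b) *: d) ((a - b) *: d); rewrite subrK normrZ; lra.
  move=> ab; have ab0 : a - b != 0 by rewrite subr_eq0.
  have -> : (a - b)^-1 *: (y a - y b) - d = (a - b)^-1 *: (y a - y b - (a - b) *: d).
    by rewrite [RHS]scalerBr scalerA mulVf// scale1r.
  by rewrite normrZ normfV mulrC ler_pdivrMr// normr_gt0.
have t0 : forall s : R, 0 < s -> `|t - t| < s by move=> s s0; rewrite subrr normr0.
have [|d' sd] := @sder_of_cauchy u t.
  move=> eps eps0.
  pose e1 := Num.min 1 (eps / 8); have e10 : 0 < e1 by rewrite lt_min ltr01 divr_gt0.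
  have e11 : e1 <= 1 by rewrite ge_min lexx.
  have e18 : e1 <= eps / 8 by rewrite ge_min lexx orbT.
  have [s1 [s10 s1r Hs1]] := qy e1 e10.
  (* eta bounds the distance to u t and L the difference quotients of u, so that the
     error C eta (L + L) in the second difference is eps / 8. *)
  pose eta := eps / (16 * C * L); have eta0 : 0 < eta by rewrite divr_gt0 ?mulr_gt0.
  pose s2 := eta / L; have s20 : 0 < s2 by rewrite divr_gt0.
  exists (Num.min s1 s2); split; first by rewrite lt_min s10.
  have near_t a : `|a - t| < Num.min s1 s2 -> [/\ `|a - t| < s1, `|a - t| < r1, `|u a| < sigma, e p (u a) = y a & `|u a - u t| <= eta].
    rewrite lt_min => /andP[a1 a2]; have ar : `|a - t| < r1 by exact: lt_le_trans s1r.
    have [ua ea] := H1 a ar; split => //.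
    apply: (le_trans (low a t ar (t0 _ r10))).
    have [h _] := Hs1 a t a1 (t0 _ s10).
    have h2 : (`|d| + e1) * `|a - t| <= (`|d| + 1) * s2.
      by rewrite ler_pM ?addr_ge0 ?(ltW e10) ?lerD2l ?(ltW a2).
    have h3 : 2 * ((`|d| + 1) * s2) = eta by rewrite /s2 mulrA -/L mulrC divfK// gt_eqF.
    lra.
  move=> a b a' b' /near_t[a1 a2 a3 a4 a5] /near_t[b1 b2 b3 b4 b5] /near_t[c1 c2 c3 c4 c5] /near_t[f1 f2 f3 f4 f5] ab ab'.
  have quo x z : `|x - t| < s1 -> `|z - t| < s1 -> `|x - t| < r1 -> `|z - t| < r1 -> x != z ->
      `|(x - z)^-1| * `|u x - u z| <= L.
    move=> x1 z1 x2 z2 xz; have [h _] := Hs1 x z x1 z1; have h2 := low x z x2 z2.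
    have xz0 : 0 < `|x - z| by rewrite normr_gt0 subr_eq0.
    rewrite normfV mulrC ler_pdivrMr// (le_trans h2)// (le_trans (ler_wpM2l _ h))// mulrA.
    by rewrite ler_wpM2r// /L quotient_bound.
  have tu : `|u t| < sigma by have [] := H1 t (t0 _ r10).
  have := nc_diff2 nc pr tu a3 b3 c3 f3 a5 b5 c5 f5 (quo a b a1 b1 a2 b2 ab) (quo a' b' c1 f1 c2 f2 ab') erefl.
  rewrite a4 b4 c4 f4.
  have [_ /(_ ab) q1] := Hs1 a b a1 b1; have [_ /(_ ab') q2] := Hs1 a' b' c1 f1.
  move: q1 q2; set q1 := _ *: (y a - y b); set q2 := _ *: (y a' - y b'); set D := (_ *: (u a - u b)) - _.
  have CL : C * eta * (L + L) = eps / 8 by rewrite /eta; field; rewrite !gt_eqF.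
  rewrite CL => k1 k2 k3.
  have k4 : `|q1 - q2| <= e1 + e1.
    by apply: (le_trans (ler_distD d q1 q2)); rewrite (distrC d q2); exact: lerD.
  have := ler_distD (q1 - q2) D 0; rewrite !subr0 (distrC D) => k5; exact: (quotient_gap (ltW eps0) k5 k3 k4 e18).
exists d'; split => //; apply/ler_addgt0Pr => eps eps0.
have [|s1 [s10 s1r Hs1]] := qy (eps / 4); first by rewrite divr_gt0.
have [|s2 [s20 Hs2]] := sd (eps / 4); first by rewrite divr_gt0.
pose h := Num.min s1 s2 / 2.
have h0 : 0 < h by rewrite divr_gt0// lt_min s10.
have hs : h < Num.min s1 s2 by rewrite /h; have : 0 < Num.min s1 s2 by [rewrite lt_min s10]; lra.
move: hs; rewrite lt_min => /andP[hs1 hs2].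
have th : `|t + h - t| = h by rewrite addrC addKr gtr0_norm.
have ht : t + h - t = h by rewrite addrC addKr.
have k1 := Hs2 (t + h) t; rewrite th ht in k1.
have {}k1 := k1 hs2 (t0 _ s20).
have th1 : `|t + h - t| < s1 by rewrite th.
have [k2 _] := Hs1 (t + h) t th1 (t0 _ s10).
rewrite th in k2.
have k3 : `|u (t + h) - u t| <= 8 / 7 * `|y (t + h) - y t|.
  by apply: low; rewrite ?th ?(lt_le_trans hs1)// t0.
have k4 := ler_normB (u (t + h) - u t) (u (t + h) - u t - h *: d').
rewrite subKr normrZ (gtr0_norm h0) in k4.
have k5 : h * `|d'| <= h * (2 * `|d| + eps).
  have := mulr_ge0 (ltW h0) d0; have := mulr_gt0 h0 eps0.
  set z1 := h * eps; set z2 := h * `|d|.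
  have -> : h * (2 * `|d| + eps) = 2 * z2 + z1 by rewrite /z1 /z2; ring.
  have e1 : (`|d| + eps / 4) * h = z2 + z1 / 4 by rewrite /z1 /z2; ring.
  have e2 : eps / 4 * h = z1 / 4 by rewrite /z1; ring.
  rewrite e1 in k2; rewrite e2 in k1; lra.
by rewrite ler_pM2l in k5.
Qed.

End LocalLog.

(** * The curve of minimizers *)

Lemma implicit_row_sum {R : realFieldType} (A B C D d e e1 t z : R) :
  A <= e1 * d -> B <= t * (e1 * d) -> C <= e / 4 * d -> D <= z * e -> e1 * (t + 1) * d <= e / 4 * d ->
  0 <= e * d -> A + B + C + D <= e * (d + z).
Proof. by move=> *; lra. Qed.

Section Implicit.
Context {R : realType} {n : nat}.

Lemma mulmx_bound (B : 'M[R]_n) : exists K : R, 0 <= K /\ forall v : 'rV[R]_n, `|v *m B| <= K * `|v|.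
Proof.
have [S [S0 HS]] := @bounded_family R _ (fun ab : 'I_n * 'I_n => B ab.1 ab.2).
exists (n%:R * S); split; first by rewrite mulr_ge0.
move=> v; apply: norm_le_row => [|j]; first by rewrite !mulr_ge0.
rewrite mxE; apply: (le_trans (ler_norm_sum _ _ _)).
apply: (@le_trans _ _ (\sum_(k < n) S * `|v|)); last by rewrite sum_cst_ord mulrA.
apply: ler_sum => k _; rewrite normrM mulrC ler_pM//; first exact: (HS (k, j)).
exact: coord_le_norm.
Qed.

(** One component of the linearized equation, with an error controlled by strict
    differentiability and by the variation of s. *)
Lemma implicit_row (U : set 'rV[R]_n) (a b : 'rV[R]_n -> R^o) (y : R -> 'rV[R]_n) (t e : R) :
  open U -> Ck 1 U a -> Ck 1 U b -> U (y t) -> {for t, continuous y} -> 0 < e ->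
  (\forall s \near t, a (y s) + s * b (y s) = 0) ->
  exists r : R, 0 < r /\ forall s1 s2, `|s1 - t| < r -> `|s2 - t| < r ->
    `|'D_(y s1 - y s2) a (y t) + t * 'D_(y s1 - y s2) b (y t) + (s1 - s2) * b (y t)|
      <= e * (`|y s1 - y s2| + `|s1 - s2|).
Proof.
move=> oU Ca Cb Up cy e0 H; set p := y t in Up *.
have [L [L0 HL]] := Ck1_dbound oU Cb Up.
have t1 : 0 < `|t| + 1 by have := normr_ge0 t; lra.
pose e1 := Num.min 1 (e / (4 * (`|t| + 1))).
have e10 : 0 < e1 by rewrite lt_min ltr01 divr_gt0 ?mulr_gt0.
have e11 : e1 <= 1 by rewrite ge_min lexx.
have e1t : e1 * (`|t| + 1) <= e / 4.
  apply: (@le_trans _ _ (e / (4 * (`|t| + 1)) * (`|t| + 1))).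
    by rewrite ler_pM2r// ge_min lexx orbT.
  by rewrite invfM mulrA divfK// gt_eqF.
have [ra [ra0 Ha]] := Ck1_strict oU Ca Up e10.
have [rb [rb0 Hb]] := Ck1_strict oU Cb Up e10.
have cb := Ck1_continuous oU Cb Up.
have [rc [rc0 Hc]] := cont_ex cb e0.
have rabc : 0 < Num.min ra (Num.min rb rc) by rewrite !lt_min ra0 rb0.
have [r1 [r10 H1]] := cont_ex cy rabc.
have [r2 [r20 H2]] := (near_ex _ _).1 H.
have r30 : 0 < e / (4 * (L + 1)) by rewrite divr_gt0// mulr_gt0//; lra.
exists (Num.min (Num.min r1 r2) (e / (4 * (L + 1)))); split; first by rewrite !lt_min r10 r20.
move=> s1 s2; rewrite !lt_min => /andP[/andP[a1 a2] a3] /andP[/andP[b1 b2] b3].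
have := H1 s1 a1; have := H1 s2 b1; rewrite -/p !lt_min => /andP[k1 /andP[k2 k3]] /andP[l1 /andP[l2 l3]].
have E1 := H2 s1 a2; have E2 := H2 s2 b2.
have A := Ha _ _ l1 k1; have B := Hb _ _ l2 k2; have Cc := ltW (Hc _ k3).
have HLd := HL (y s1 - y s2).
set d := `|y s1 - y s2| in A B HLd *; have d0 : 0 <= d by exact: normr_ge0.
set Da := 'D_(y s1 - y s2) a p in A *; set Db := 'D_(y s1 - y s2) b p in B HLd *.
set A1 := a (y s1) - a (y s2) - Da in A; set B1 := b (y s1) - b (y s2) - Db in B.
set C1 := b (y s2) - b p in Cc.
have -> : Da + t * Db + (s1 - s2) * b p =
   - (A1 + t * B1 + (s1 - t) * (B1 + Db) + (s1 - s2) * C1).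
  have e1' : a (y s1) = - (s1 * b (y s1)) by apply/eqP; rewrite -addr_eq0 E1.
  have e2' : a (y s2) = - (s2 * b (y s2)) by apply/eqP; rewrite -addr_eq0 E2.
  by rewrite /A1 /B1 /C1 e1' e2'; ring.
rewrite normrN.
apply: (le_trans (ler_normD _ _)); apply: (le_trans (lerD (ler_normD _ _) (lexx _))).
apply: (le_trans (lerD (lerD (ler_normD _ _) (lexx _)) (lexx _))).
rewrite !normrM.
have x1 : `|t| * `|B1| <= `|t| * (e1 * d) by rewrite ler_wpM2l.
have x2 : `|s1 - t| * `|B1 + Db| <= e / (4 * (L + 1)) * ((L + 1) * d).
  apply: ler_pM => //; first exact: ltW.
  apply: (le_trans (ler_normD _ _)).
  by rewrite mulrDl [leRHS]addrC lerD// (le_trans B)// ler_wpM2r.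
have x3 : e / (4 * (L + 1)) * ((L + 1) * d) = e / 4 * d.
  by field; rewrite gt_eqF// ltr_wpDl.
rewrite x3 in x2.
have x4 : `|s1 - s2| * `|C1| <= `|s1 - s2| * e by rewrite ler_wpM2l.
have x5 : e1 * (`|t| + 1) * d <= e / 4 * d by rewrite ler_wpM2r.
have x6 : 0 <= e * d by rewrite mulr_ge0// ltW.
exact: (implicit_row_sum A x1 x2 x4 x5 x6).
Qed.

(** The linearized equation says that y s1 - y s2 is (s1 - s2) d up to small errors
    after multiplication by the invertible matrix A; the part of the error which
    involves y itself is absorbed on the left. *)
Lemma implicit_sder (U : set 'rV[R]_n) (a b : 'I_n -> 'rV[R]_n -> R^o) (y : R -> 'rV[R]_n) (t : R) :
  open U -> (forall k, Ck 1 U (a k)) -> (forall k, Ck 1 U (b k)) -> U (y t) -> {for t, continuous y} ->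
  (forall k, \forall s \near t, a k (y s) + s * b k (y s) = 0) ->
  (forall v, (forall k, 'D_v (a k) (y t) + t * 'D_v (b k) (y t) = 0) -> v = 0) ->
  exists d, sder y t d.
Proof.
move=> oU Ca Cb Up cy H inj; set p := y t in Up inj *.
pose A : 'M[R]_n := \matrix_(j, k) ('D_(delta_mx ord0 j) (a k) p + t * 'D_(delta_mx ord0 j) (b k) p).
have vA v k : (v *m A) ord0 k = 'D_v (a k) p + t * 'D_v (b k) p.
  rewrite (derive_dir_sum v oU (Ca k) Up) (derive_dir_sum v oU (Cb k) Up) mulr_sumr -big_split/= mxE.
  by apply: eq_bigr => j _; rewrite mxE; ring.
have AU : A \in unitmx.
  rewrite -row_free_unit -kermx_eq0; apply/rowV0P => v /sub_kermxP vA0.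
  by apply: inj => k; rewrite -vA vA0 mxE.
have [K [K0 HK]] := mulmx_bound (invmx A).
have lowA (v : 'rV[R]_n) : `|v| <= K * `|v *m A| by have := HK (v *m A); rewrite (mulmxK AU).
(* d solves the linearized equation d A + b = 0. *)
pose bp : 'rV[R]_n := \row_k b k p.
pose d := - bp *m invmx A.
have dA : d *m A = - bp by rewrite /d mulmxKV.
exists d => eps eps0; have d0 := normr_ge0 d.
have K1 : 0 < K + 1 by lra.
have d1 : 0 < `|d| + 1 by lra.
(* With K e <= 1/2 the term in |D| on the right is absorbed. *)
pose e := Num.min (2^-1 / (K + 1)) (eps / (2 * (K + 1) * (`|d| + 1))).
have e0 : 0 < e by rewrite lt_min !divr_gt0// !mulr_gt0.
have [||r [r0 Hr]] := @radius_forall_mono R 'I_n (fun k r => forall s1 s2, `|s1 - t| < r -> `|s2 - t| < r ->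
    `|'D_(y s1 - y s2) (a k) p + t * 'D_(y s1 - y s2) (b k) p + (s1 - s2) * b k p|
      <= e * (`|y s1 - y s2| + `|s1 - s2|)).
- by move=> k; exact: (implicit_row oU (Ca k) (Cb k) Up cy e0 (H k)).
- by move=> k r r' _ rr Hk s1 s2 h1 h2; apply: Hk; exact: lt_le_trans rr.
exists r; split => // s1 s2 h1 h2.
set D := y s1 - y s2 - (s1 - s2) *: d.
have nD : `|D *m A| <= e * (`|y s1 - y s2| + `|s1 - s2|).
  apply: norm_le_row => [|k]; first by rewrite mulr_ge0 ?addr_ge0// ltW.
  have -> : (D *m A) ord0 k = 'D_(y s1 - y s2) (a k) p + t * 'D_(y s1 - y s2) (b k) p + (s1 - s2) * b k p.
    rewrite -vA /D mulmxBl -scalemxAl dA scalerN opprK !mxE; congr (_ + _).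
  exact: Hr.
have n1 : `|y s1 - y s2| <= `|D| + `|s1 - s2| * `|d|.
  have -> : y s1 - y s2 = D + (s1 - s2) *: d by rewrite /D subrK.
  by apply: (le_trans (ler_normD _ _)); rewrite normrZ.
have n2 := lowA D; have D0 := normr_ge0 D; have s0 := normr_ge0 (s1 - s2).
have Ke : K * e <= 2^-1.
  apply: (@le_trans _ _ ((K + 1) * (2^-1 / (K + 1)))).
    by apply: ler_pM => //; [exact: ltW|lra|rewrite ge_min lexx].
  by rewrite mulrC divfK// gt_eqF.
have Ke2 : K * e * (`|d| + 1) <= eps / 2.
  apply: (@le_trans _ _ ((K + 1) * (eps / (2 * (K + 1) * (`|d| + 1))) * (`|d| + 1))).
    rewrite ler_pM2r//; apply: ler_pM => //; [exact: ltW|lra|by rewrite ge_min lexx orbT].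
  by rewrite le_eqVlt; apply/orP; left; apply/eqP; field; rewrite !gt_eqF.
have m1 : K * (e * (`|y s1 - y s2| + `|s1 - s2|)) <= K * (e * (`|D| + `|s1 - s2| * `|d| + `|s1 - s2|)).
  by rewrite ler_wpM2l// ler_pM2l// lerD2r.
have m2 : K * `|D *m A| <= K * (e * (`|y s1 - y s2| + `|s1 - s2|)) by rewrite ler_wpM2l.
have m3 : K * e * `|D| <= 2^-1 * `|D| by rewrite ler_wpM2r.
have m4 : K * e * (`|d| + 1) * `|s1 - s2| <= eps / 2 * `|s1 - s2| by rewrite ler_wpM2r.
lra.
Qed.

End Implicit.

Section Argmin.
Context {R : realType} {n : nat} (M : riemannianManifold R n).
Implicit Types (i : atlas M) (p u v w : 'rV[R]_n).

Lemma C2_continuous (f : M -> R) : C2_function f -> continuous f.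
Proof.
move=> Hf x; pose i := chart_at x; have di : dom i x := mem_chart_at x.
have cf := Ck1_continuous (img_open i) (Ck2_Ck1 (img_open i) (Hf i)) (chart_img di).
have c2 : {for x, continuous ((f \o unchart i) \o chart i)}.
  by apply: continuous_comp; [exact: chart_continuous|exact: cf].
have E : \forall y \near x, ((f \o unchart i) \o chart i) y = f y.
  have : \forall y \near x, dom i y by exact: open_nbhs_nbhs (conj (dom_open i) di).
  by apply: filterS => y dy; rewrite /= chartK.
suff : f y @[y --> x] --> f x by [].
rewrite -(nbhs_singleton E); exact: (cvg_trans (near_eq_cvg E) c2).
Qed.

(** On the compact complement of a neighbourhood of gamma mu the objective exceeds
    its minimum by a positive gap, which survives for nearby parameters because f2
    is bounded. *)
Lemma argmin_continuous (f1 f2 : M -> R) (gamma : R -> M) (mu : R) : compact [set: M] ->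
  continuous f1 -> continuous f2 ->
  (forall s, 0 < s -> argmin (scalarization f1 f2 s) = [set gamma s]) -> 0 < mu ->
  {for mu, continuous gamma}.
Proof.
move=> cM c1 c2 H mu0 B nB.
suff : \forall s \near mu, B (gamma s) by [].
have ming s y : 0 < s -> scalarization f1 f2 s (gamma s) <= scalarization f1 f2 s y.
  by move=> s0; have : argmin (scalarization f1 f2 s) (gamma s) by [rewrite H]; exact.
have uniq y : scalarization f1 f2 mu y <= scalarization f1 f2 mu (gamma mu) -> y = gamma mu.
  move=> h; suff : argmin (scalarization f1 f2 mu) y by rewrite H.
  by move=> z; exact: le_trans h (ming mu z mu0).
have cphi : continuous (scalarization f1 f2 mu).
  move=> x; have h := @cvgD R R^o M (nbhs x) _ f1 (fun y => mu *: (f2 y : R^o)) (f1 x) (mu *: (f2 x : R^o)).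
  apply: h; first exact: c1.
  exact: (@cvgZl_tmp R R^o M (nbhs x) _ mu f2 (f2 x) (c2 x)).
have [F2 HF2] : exists F2 : R, forall y, `|f2 y| <= F2.
  have [||c _ Hc] := @compact_EVT_max _ R (fun y => `|f2 y|) [set: M] _ cM.
  - by exists (gamma mu).
  - apply: continuous_subspaceT => x.
    by apply: (@continuous_comp _ _ _ f2 (fun z => `|z|)); [exact: c2|exact: norm_continuous].
  by exists `|f2 c| => y; apply: Hc; rewrite inE.
have F20 : 0 <= F2 by exact: le_trans (HF2 (gamma mu)).
move: nB; rewrite nbhsE => -[U [oU Ug] UB].
pose K := ~` U.
have cK : compact K.
  by apply: (subclosed_compact _ cM) => //; exact: open_closedC.
have [K0|/set0P[y0 Ky0]] := eqVneq K set0.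
  apply: near_all => s; apply: UB; apply: contrapT => nU.
  by have : K (gamma s) by []; rewrite K0.
have [||c /set_mem Kc Hc] := @compact_EVT_min _ R (scalarization f1 f2 mu) K _ cK.
- by exists y0.
- exact: continuous_subspaceT.
pose gap := scalarization f1 f2 mu c - scalarization f1 f2 mu (gamma mu).
have gap0 : 0 < gap.
  rewrite subr_gt0 ltNge; apply/negP => /uniq E.
  by move: Kc; rewrite E.
have F21 : 0 < F2 + 1 by lra.
apply/near_ex; exists (Num.min mu (gap / (2 * (F2 + 1)))).
split; first by rewrite lt_min mu0 divr_gt0// mulr_gt0.
move=> s; rewrite lt_min => /andP[s1 s2]; apply: UB; apply: contrapT => Ks.
have s0 : 0 < s by move: s1; rewrite ltr_norml => /andP[h _]; lra.
have h1 := Hc (gamma s) (mem_set Ks); have h2 := ming s (gamma mu) s0.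
rewrite /gap /scalarization in gap0 s2 h1 h2.
have b1 := HF2 (gamma s); have b2 := HF2 (gamma mu).
(* Changing the parameter from mu to s changes the gap by at most
   2 F2 |s - mu|, which is less than the gap. *)
have b3 : `|(s - mu) * (f2 (gamma mu) - f2 (gamma s))| <= `|s - mu| * (2 * F2).
  by rewrite normrM ler_wpM2l// (le_trans (ler_normB _ _))//; lra.
have b4 : `|s - mu| * (2 * (F2 + 1)) < f1 c + mu * f2 c - (f1 (gamma mu) + mu * f2 (gamma mu)).
  by rewrite -ltr_pdivlMr// mulr_gt0.
have b5 := normr_ge0 (s - mu).
move: b3; rewrite ler_norml => /andP[_ b3].
lra.
Qed.

Lemma scalarization_derive (f1 f2 : M -> R) i p (s : R) v : C2_function f1 -> C2_function f2 -> img i p ->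
  'D_v (scalarization f1 f2 s \o unchart i : 'rV[R]_n -> R^o) p =
  'D_v (f1 \o unchart i : 'rV[R]_n -> R^o) p + s * 'D_v (f2 \o unchart i : 'rV[R]_n -> R^o) p.
Proof.
move=> h1 h2 ip; have d1 := (h1 i).1 p v ip; have d2 := (h2 i).1 p v ip.
have -> : (scalarization f1 f2 s \o unchart i : 'rV[R]_n -> R^o) =
  (f1 \o unchart i : 'rV[R]_n -> R^o) + s *: (f2 \o unchart i : 'rV[R]_n -> R^o) by [].
by rewrite (deriveD d1 (@derivableZ R _ _ _ s p v d2)) (deriveZ s d2).
Qed.

Lemma argmin_critical (f1 f2 : M -> R) i (s : R) x v : C2_function f1 -> C2_function f2 -> dom i x ->
  argmin (scalarization f1 f2 s) x ->
  'D_v (f1 \o unchart i : 'rV[R]_n -> R^o) (chart i x) +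
  s * 'D_v (f2 \o unchart i : 'rV[R]_n -> R^o) (chart i x) = 0.
Proof.
move=> h1 h2 di am; have ip := chart_img di; set p := chart i x in ip *.
have d1 := (h1 i).1 p v ip; have d2 := (h2 i).1 p v ip.
rewrite -(scalarization_derive s v h1 h2 ip).
set g := (_ \o unchart i : 'rV[R]_n -> R^o); set D := 'D_v g p.
have dg : derivable g p v.
  have -> : g = (f1 \o unchart i : 'rV[R]_n -> R^o) + s *: (f2 \o unchart i : 'rV[R]_n -> R^o) by [].
  exact: (derivableD d1 (@derivableZ R _ _ _ s p v d2)).
have hd : is_derive (0 : R) 1 (fun r : R => g (p + r *: v)) D.
  have E0 : p + 0 *: v = p by rewrite scale0r addr0.
  by have := @is_derive_line R _ _ g p v 0; rewrite E0 => /(_ dg).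
have gm (r : R) : 0 <= g (p + r *: v) - g (p + 0 *: v).
  by rewrite subr_ge0 scale0r addr0 /g/= (chartK di); exact: am.
move/is_derive_epsP: hd => hd.
apply/eqP; rewrite -normr_eq0 eq_le normr_ge0 andbT; apply/ler_addgt0Pr => e e0; rewrite add0r.
have [r [r0 Hr]] := hd e e0.
have r2 : 0 < r / 2 by rewrite divr_gt0.
have rr : `|r / 2 - 0| < r by rewrite subr0 gtr0_norm//; lra.
have rr' : `|- (r / 2) - 0| < r by rewrite subr0 normrN gtr0_norm//; lra.
have k1 := Hr _ rr; have k2 := Hr _ rr'; have g1 := gm (r / 2); have g2 := gm (- (r / 2)).
rewrite !subr0 ?normrN (gtr0_norm r2) in k1 k2.
move: k1 k2; set z1 := g _ - _ in g1 *; set z2 := g _ - _ in g2 *.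
rewrite /GRing.scale/= => /ler_normlP[k1 k1'] /ler_normlP[k2 k2'].
have q1 : r / 2 * - D <= r / 2 * e by lra.
have q2 : r / 2 * D <= r / 2 * e by lra.
rewrite !ler_pM2l// in q1 q2; rewrite ler_norml; apply/andP; split; lra.
Qed.

Lemma derive_line0 (W : normedModType R) (g : 'rV[R]_n -> W) p v :
  'D_v g p = 'D_1 (fun s : R => g (p + s *: v)) (0 : R).
Proof.
rewrite /derive; suff -> : (fun h : R => h^-1 *: ((g \o shift p) (h *: v) - g p)) =
  (fun h : R => h^-1 *: (((fun s : R => g (p + s *: v)) \o shift (0 : R)) (h *: (1 : R)) - g (p + 0 *: v))) by [].
apply/funext => h /=; have -> : h *: (1 : R) + 0 = h by rewrite addr0; exact: mulr1.
by rewrite scale0r addr0 [h *: v + p]addrC.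
Qed.

(** Applying the inverse of the metric costs a factor which is uniform on a ball,
    by ellipticity. *)
Lemma gradient_bound (i : atlas M) p : img i p -> exists (r K : R), [/\ 0 < r, 0 <= K &
  forall q (w : 'rV[R]_n), nball p r q -> `|w *m invmx (metric i q)| <= K * `|w|].
Proof.
move=> ip; have [r [lam [Lam [K box]]]] := metric_box_exists ip.
have lam0 := mb_lam box.
exists r, (n%:R / lam); split; [exact: mb_r box|by rewrite divr_ge0// ltW|].
move=> q w qr; have iq := mb_img box qr; set z := w *m _.
have [->|z0] := eqVneq z 0; first by rewrite normr0 mulr_ge0// divr_ge0// ltW.
have nz : 0 < `|z| by rewrite normr_gt0.
have h := mb_low box z qr.
have E : gram (metric i q) z z = \sum_k w ord0 k * z ord0 k.
  rewrite gram_mulE /z mulmxKV ?metric_unit// mxE; apply: eq_bigr => k _; by rewrite [z^T _ _]mxE.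
have h2 : gram (metric i q) z z <= n%:R * (`|w| * `|z|).
  rewrite E -sum_cst_ord; apply: ler_sum => k _; apply: le_trans (ler_norm _) _.
  by rewrite normrM ler_pM// coord_le_norm.
have := le_trans h h2; rewrite !mulrA ler_pM2r// => h3.
by rewrite mulrAC ler_pdivlMr// mulrC.
Qed.

(** A vector v in the kernel of the linearized critical point equation is in the
    kernel of the Hessian: at a critical point the Christoffel term vanishes, and
    the gradient along the line of direction v is o(s), since its covector is. *)
Lemma gamma_sder_at (f1 f2 : M -> R) (gamma : R -> M) (mu : R) : compact [set: M] ->
  C2_function f1 -> C2_function f2 ->
  (forall s, 0 < s -> argmin (scalarization f1 f2 s) = [set gamma s]) -> 0 < mu ->
  bijective (hessian (scalarization f1 f2 mu) (gamma mu)) ->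
  exists d, sder (chart (chart_at (gamma mu)) \o gamma) mu d.
Proof.
move=> cM h1 h2 H mu0 [hinv hK _]; set i := chart_at (gamma mu).
have di : dom i (gamma mu) := mem_chart_at _.
have ip := chart_img di; set p := chart i (gamma mu) in ip.
have cg := argmin_continuous cM (C2_continuous h1) (C2_continuous h2) H mu0.
pose a k := 'D_(delta_mx ord0 k) (f1 \o unchart i : 'rV[R]_n -> R^o) : 'rV[R]_n -> R^o.
pose b k := 'D_(delta_mx ord0 k) (f2 \o unchart i : 'rV[R]_n -> R^o) : 'rV[R]_n -> R^o.
have am s : 0 < s -> argmin (scalarization f1 f2 s) (gamma s) by move=> s0; rewrite H.
have nd : \forall s \near mu, 0 < s /\ dom i (gamma s).
  apply: filterI; last exact: near_dom.
  apply/(near_ex (fun x : R => 0 < x)); exists mu; split; [exact: mu0|move=> s; rewrite ltr_norml => /andP[h _]; lra].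
have Ca k : Ck 1 (img i) (a k) := (h1 i).2 _.
have Cb k : Ck 1 (img i) (b k) := (h2 i).2 _.
apply: (@implicit_sder R n (img i) a b (chart i \o gamma) mu (img_open i) Ca Cb ip).
- by apply: continuous_comp => //; exact: chart_continuous.
- move=> k; apply: filterS nd => s [s0 ds]; exact: argmin_critical (am s s0).
move=> v Hv; suff E u : (u = v \/ u = 0) -> hessian (scalarization f1 f2 mu) (gamma mu) u = 0.
  by apply: (can_inj hK); rewrite !E; [|right|left].
move=> uv; have {}Hv k : 'D_u (a k) p + mu * 'D_u (b k) p = 0.
  case: uv => ->; first exact: Hv.
  by rewrite !derive0 mulr0 addr0.
pose rho q : 'rV[R]_n := \row_k (a k q + mu * b k q).
have rho0 : rho p = 0.
  by apply/rowP => k; rewrite !mxE; exact: argmin_critical (am mu mu0).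
(* rho is the differential of the objective, as a row of partial derivatives. *)
have gE q : img i q -> gradient (scalarization f1 f2 mu) i q = rho q *m invmx (metric i q).
  move=> iq; rewrite /gradient; congr (_ *m _); apply/rowP => k; rewrite !mxE.
  exact: scalarization_derive.
have gp : gradient (scalarization f1 f2 mu) i p = 0 by rewrite gE// rho0 mul0mx.
rewrite /hessian -/i -/p gp christoffel0r addr0 derive_line0.
have hrho : is_derive (0 : R) 1 (fun s : R => rho (p + s *: u)) 0.
  apply: is_derive_mx => a' k; rewrite (ord1 a') !mxE.
  have hx := is_derive_affine p u (0 : R).
  have i0 : img i (p + 0 *: u) by rewrite scale0r addr0.
  have ha := is_derive_comp_scalar (img_open i) (Ca k) i0 hx.
  have hb := is_derive_comp_scalar (img_open i) (Cb k) i0 hx.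
  have := is_derive_add ha (is_derive_mul (is_derive_cst mu (0 : R) (1 : R)) hb).
  rewrite scale0r addr0 mul0r add0r Hv.
  by have -> : (fun s : R => a k (p + s *: u) + cst mu s * b k (p + s *: u)) = (fun s => rho (p + s *: u) ord0 k)
    by apply/funext => s; rewrite mxE.
have [r [K [r0 K0 HK]]] := gradient_bound ip.
have [r1 [r10 Hr1]] := open_ball_ex (img_open i) ip.
have K1 : 0 < K + 1 by lra.
have hg : is_derive (0 : R) 1 (fun s : R => gradient (scalarization f1 f2 mu) i (p + s *: u)) 0.
  move/is_derive_epsP: hrho => hr; apply/is_derive_epsP => e e0.
  have [|r2 [r20 Hr2]] := hr (e / (K + 1)); first by rewrite divr_gt0.
  have u1 : 0 < `|u| + 1 by have := normr_ge0 u; lra.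
  exists (Num.min r2 (Num.min r r1 / (`|u| + 1))).
  split; first by rewrite lt_min r20 divr_gt0// lt_min r0.
  move=> s; rewrite lt_min subr0 => /andP[s1]; rewrite ltr_pdivlMr// => s2.
  have near : `|p + s *: u - p| < Num.min r r1.
    rewrite addrC addKr normrZ; apply: le_lt_trans s2; rewrite ler_wpM2l//; lra.
  move: near; rewrite lt_min => /andP[n1 n2].
  have ii : img i (p + s *: u) := Hr1 _ n2.
  have := Hr2 s; rewrite subr0 => /(_ s1).
  rewrite scale0r addr0 gp rho0 !scaler0 !subr0 (gE _ ii) => h.
  apply: (le_trans (HK _ _ n1)).
  apply: (@le_trans _ _ (K * (e / (K + 1) * `|s|))); first by rewrite ler_wpM2l.
  rewrite mulrA ler_wpM2r// mulrCA ler_piMr ?(ltW e0)//.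
  by rewrite ler_pdivrMr// mul1r; lra.
by rewrite derive_val.
Qed.

Lemma sder_eq (W : normedModType R) (x y : R -> W) (t : R) d : (\forall s \near t, x s = y s) ->
  sder x t d -> sder y t d.
Proof.
move=> /near_ex[r [r0 Hr]] sx e e0; have [s [s0 Hs]] := sx e e0.
exists (Num.min r s); split; first by rewrite lt_min r0.
move=> a b; rewrite !lt_min => /andP[a1 a2] /andP[b1 b2].
by rewrite -(Hr a a1) -(Hr b b1); exact: Hs.
Qed.

Lemma sder_chart_change i j (c : R -> M) (t : R) d : dom i (c t) -> dom j (c t) ->
  {for t, continuous c} -> sder (chart i \o c) t d ->
  sder (chart j \o c) t ('D_d (trans i j) (chart i (c t))).
Proof.
move=> di dj cc sx; have oi := overlap_chart di dj.
have := sder_comp (@overlap_open _ _ M i j) (@trans_Ck _ _ M i j 1) oi sx.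
apply: sder_eq; apply: filterS (near_dom cc di) => s ds.
exact: trans_chart.
Qed.

Lemma sder_derive_continuous (W : normedModType R) (x : R -> W) (t d : _) : sder x t d ->
  (\forall s \near t, exists d', sder x s d') -> {for t, continuous (derive1 x)}.
Proof.
move=> sx /near_ex[r1 [r10 H1]]; apply: ex_cont => e e0.
have e2 : 0 < e / 2 by rewrite divr_gt0.
have [r2 [r20 H2]] := sx _ e2.
exists (Num.min r1 (r2 / 2)); split; first by rewrite lt_min r10 divr_gt0.
move=> s; rewrite lt_min => /andP[s1 s2]; have [d' sd'] := H1 s s1.
rewrite (is_derive1E (sder_is_derive sx)) (is_derive1E (sder_is_derive sd')).
have [r3 [r30 H3]] := sd' _ e2.
pose h := Num.min (r2 / 2) r3 / 2.
have m0 : 0 < Num.min (r2 / 2) r3 by rewrite lt_min r30 divr_gt0.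
have h0 : 0 < h by rewrite divr_gt0.
have hm : h < Num.min (r2 / 2) r3 by rewrite /h; lra.
move: hm; rewrite lt_min => /andP[h2 h3].
have E : s + h - s = h by rewrite addrC addKr.
have k3 := H3 (s + h) s; rewrite E subrr normr0 (gtr0_norm h0) in k3.
have {}k3 := k3 h3 r30.
have k2 := H2 (s + h) s; rewrite E (gtr0_norm h0) in k2.
have {}k2 : `|x (s + h) - x s - h *: d| <= e / 2 * h.
  apply: k2; last by lra.
  have -> : s + h - t = (s - t) + h by rewrite addrAC.
  by apply: (le_lt_trans (ler_normD _ _)); rewrite (gtr0_norm h0); lra.
have k4 : h * `|d' - d| <= h * e.
  have -> : h * `|d' - d| = `|(x (s + h) - x s - h *: d) - (x (s + h) - x s - h *: d')|.
    rewrite -[h in LHS](gtr0_norm h0) -normrZ; congr (`|_|).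
    by rewrite scalerBr opprB [RHS]addrC addrA subrK.
  apply: (le_trans (ler_normB _ _)); lra.
by rewrite ler_pM2l in k4.
Qed.

Lemma gamma_sder (f1 f2 : M -> R) (gamma : R -> M) : compact [set: M] ->
  C2_function f1 -> C2_function f2 ->
  (forall s, 0 < s -> argmin (scalarization f1 f2 s) = [set gamma s]) ->
  (forall s, 0 < s -> bijective (hessian (scalarization f1 f2 s) (gamma s))) ->
  forall mu, 0 < mu -> {for mu, continuous gamma} /\
  forall i, dom i (gamma mu) -> exists d, sder (chart i \o gamma) mu d.
Proof.
move=> cM h1 h2 H Hh mu mu0.
have cg := argmin_continuous cM (C2_continuous h1) (C2_continuous h2) H mu0.
split => // i di; have [d sd] := gamma_sder_at cM h1 h2 H mu0 (Hh mu mu0).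
by eexists; exact: (sder_chart_change (mem_chart_at _) di cg sd).
Qed.

End Argmin.

(** * Logarithms along the curve, uniformly in the base point *)

Lemma quarter_half {R : realFieldType} (a b c s : R) : a <= b + c -> b <= s / 4 -> c < s / 2 ->
  0 < s -> a < s.
Proof. by move=> *; lra. Qed.

Section LogGood.
Context {R : realType} {n : nat} (M : riemannianManifold R n).
Implicit Types (i : atlas M) (p u v w : 'rV[R]_n).
Variable gamma : R -> M.

Definition log_curve (b : R) (x : R) : 'rV[R]_n := Log (gamma b) (gamma x).

(** The uniform facts about Gamma x = Log (gamma b) (gamma x).  In the last clause
    the vector xi need only be close to Gamma x, which is how the interpolant is
    used; this makes the record monotone in C, so that compactness applies. *)
Record log_good (C b x : R) : Prop := LogGood {
  lg_int : interior_set (gamma b) (gamma x) ;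
  lg_uniq : exists! xi, tangent_interior_set (gamma b) xi /\ Exp (gamma b) xi = gamma x ;
  lg_der : derivable (log_curve b) x 1 ;
  lg_cont : {for x, continuous (derive1 (log_curve b))} ;
  lg_bound : tnorm (gamma b) (derive1 (log_curve b) x) <= C ;
  lg_dist : forall xi, tnorm (gamma b) (xi - log_curve b x) <= C^-1 ->
    (rdist (gamma x) (Exp (gamma b) xi) <= (C * tnorm (gamma b) (xi - log_curve b x))%:E)%E }.

Lemma log_good_le (C C' b x : R) : 0 < C -> C <= C' -> log_good C b x -> log_good C' b x.
Proof.
move=> C0 CC [h1 h2 h3 h4 h5 h6]; split => //; first exact: le_trans CC.
move=> xi hx; apply: (@le_trans _ _ (C * tnorm (gamma b) (xi - log_curve b x))%:E).
  apply: h6; apply: (le_trans hx); rewrite lef_pV2 ?posrE//; exact: lt_le_trans CC.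
by rewrite lee_fin ler_wpM2r// tnorm_ge0.
Qed.

Lemma sder_mulmx (x : R -> 'rV[R]_n) (t : R) d (B : 'M[R]_n) : sder x t d ->
  sder (fun s => x s *m B) t (d *m B).
Proof.
move=> sx e e0; have [K [K0 HK]] := mulmx_bound B; have K1 : 0 < K + 1 by lra.
have [|r [r0 Hr]] := sx (e / (K + 1)); first by rewrite divr_gt0.
exists r; split => // a b ar br.
have -> : x a *m B - x b *m B - (a - b) *: (d *m B) = (x a - x b - (a - b) *: d) *m B.
  by rewrite !mulmxBl -scalemxAl.
apply: (le_trans (HK _)).
apply: (@le_trans _ _ (K * (e / (K + 1) * `|a - b|))); first by rewrite ler_wpM2l// Hr.
rewrite mulrA ler_wpM2r// mulrCA ler_piMr ?(ltW e0)//.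
by rewrite ler_pdivrMr// mul1r; lra.
Qed.

(** Near gamma mu all base points are treated in one normal chart. *)
Lemma log_good_local (mu : R) : compact [set: M] -> 0 < mu ->
  (forall s, 0 < s -> {for s, continuous gamma} /\
     forall i, dom i (gamma s) -> exists d, sder (chart i \o gamma) s d) ->
  exists r C : R, [/\ 0 < r, 0 < C & forall b x, `|b - mu| < r -> `|x - mu| < r -> log_good C b x].
Proof.
move=> cM mu0 Hg; pose i := chart_at (gamma mu); have di : dom i (gamma mu) := mem_chart_at _.
have [r [rho [sigma [lam [Lam [K [e nc]]]]]]] := normal_chart_exists (chart_img di).
set p0 := chart i (gamma mu) in nc.
have [rho' [rho'0 rho'rho Hlog]] := log_local nc cM.
have lam0 := nc_lam nc; have Lam0 := nc_Lam nc; have s0 := nc_sigma nc.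
have half_s : sigma / 2 < sigma by lra.
have sl0 : 0 < Num.sqrt lam by rewrite sqrtr_gt0.
have sL0 : 0 < Num.sqrt Lam by rewrite sqrtr_gt0.
pose y := chart i \o gamma.
have pos_near (s : R) : 0 < s -> \forall z \near s, 0 < z.
  move=> sp; apply/(near_ex (fun x : R => 0 < x)); exists s; split; [exact: sp|].
  by move=> z; rewrite ltr_norml => /andP[h _]; lra.
have ysd s : 0 < s -> dom i (gamma s) -> exists d, sder y s d by move=> h1 h2; exact: (Hg s h1).2.
have dnear s : 0 < s -> dom i (gamma s) -> \forall z \near s, 0 < z /\ dom i (gamma z).
  by move=> h1 h2; apply: filterI; [exact: pos_near|exact: near_dom (Hg s h1).1 h2].
have cy' : {for mu, continuous (derive1 y)}.
  have [d sd] := ysd mu mu0 di; apply: (sder_derive_continuous sd).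
  by apply: filterS (dnear mu mu0 di) => s [h1 h2]; exact: ysd.
have nball_near : \forall s \near mu, nball p0 rho' (y s).
  have cy : {for mu, continuous y}.
    by apply: continuous_comp; [exact: (Hg mu mu0).1|exact: chart_continuous].
  have [r1 [r10 H1]] := cont_ex cy rho'0.
  by apply/(near_ex (fun s => nball p0 rho' (y s))); exists r1; split.
pose Y := `|derive1 y mu| + 1.
have Y0 : 0 < Y by rewrite /Y; have := normr_ge0 (derive1 y mu); lra.
have bd_near : \forall s \near mu, `|derive1 y s| <= Y.
  have [r1 [r10 H1]] := cont_ex cy' (ltr01 : 0 < (1 : R)).
  apply/(near_ex (fun s => `|derive1 y s| <= Y)); exists r1; split => // s /H1 h.
  have := ler_normD (derive1 y s - derive1 y mu) (derive1 y mu); rewrite subrK => h2.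
  by apply: (le_trans h2); rewrite /Y [leRHS]addrC lerD2r ltW.
have [r1 [r10 H1]] := (near_ex _ _).1 (filterI (dnear mu mu0 di) (filterI nball_near bd_near)).
(* The three bounds: on the derivative of Gamma; on the distance between the values
   of Exp; and on the radius C^-1 in which these values are controlled. *)
pose C := Num.max (2 * Num.sqrt Lam * Y) (Num.max (4 * Num.sqrt Lam / Num.sqrt lam) (4 / (Num.sqrt lam * sigma))).
have C1 : 2 * Num.sqrt Lam * Y <= C by rewrite le_max lexx.
have C2 : 4 * Num.sqrt Lam / Num.sqrt lam <= C by rewrite !le_max lexx orbT.
have C3 : 4 / (Num.sqrt lam * sigma) <= C by rewrite !le_max lexx !orbT.
have C0 : 0 < C by apply: lt_le_trans C1; rewrite !mulr_gt0.
exists r1, C; split; [exact: r10|exact: C0|move=> b x br xr].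
have [[b0 db] [bn _]] := H1 b br.
have bn' : nball p0 rho (chart i (gamma b)) := nball_sub rho'rho bn.
have bn'' : nball p0 r (chart i (gamma b)) := nball_sub (nc_rr nc) bn'.
have Hu s : exists u, `|s - mu| < r1 -> [/\ `|u| < sigma / 2, e (chart i (gamma b)) u = y s,
    interior_set (gamma b) (gamma s), (exists! xi, tangent_interior_set (gamma b) xi /\ Exp (gamma b) xi = gamma s) &
    log_curve b s = tvec i (gamma b) u].
  have [sr|sr] := ltP `|s - mu| r1; last by exists 0.
  have [[sp ds] [sn _]] := H1 s sr; have [u [h1 _ h2 h3 [h4 h5]]] := Hlog _ _ db ds bn sn.
  by exists u.
have [u {}Hu] := choice Hu.
have [B [BU HB]] := tvec_mx db.
have near_in s : `|s - mu| < r1 -> \forall z \near s, `|z - mu| < r1.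
  move=> sr; apply/(near_ex (fun z => `|z - mu| < r1)); exists (r1 - `|s - mu|).
  split; first by rewrite subr_gt0.
  by move=> z; rewrite ltrBrDr; exact: le_lt_trans (ler_distD s z mu).
have usd s : `|s - mu| < r1 -> exists d, sder u s d /\ `|d| <= 2 * Y.
  move=> sr; have [[sp ds] [_ sY]] := H1 s sr; have [d sd] := ysd s sp ds.
  have nu : \forall z \near s, `|u z| < sigma /\ e (chart i (gamma b)) (u z) = y z.
    by apply: filterS (near_in s sr) => z /Hu[h1 h2 _ _ _]; split; [exact: lt_trans h1 half_s|exact: h2].
  have [d' [sd' d'd]] := log_sder nc bn' nu sd; exists d'; split => //.
  apply: (le_trans d'd); rewrite ler_pM2l//.
  by rewrite (is_derive1E (sder_is_derive sd)) in sY.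
have Lsd s : `|s - mu| < r1 -> exists d, sder (log_curve b) s d /\ tnorm (gamma b) d <= C.
  move=> sr; have [d [sd dY]] := usd s sr; exists (tvec i (gamma b) d); split.
    rewrite HB; apply: (sder_eq _ (sder_mulmx B sd)).
    by apply: filterS (near_in s sr) => z /Hu[_ _ _ _ ->]; rewrite HB.
  have [_ h] := normal_chart_tnorm d nc db bn''; apply: (le_trans h); apply: le_trans C1.
  by rewrite [2 * _]mulrC -mulrA ler_pM2l.
have [us Eu hint huniq hlog] := Hu x xr.
have [[xp dx] [xn _]] := H1 x xr.
have [d [sd dC]] := Lsd x xr.
split; [exact: hint|exact: huniq| | | |].
- exact: is_derive_ex (sder_is_derive sd).
- apply: (sder_derive_continuous sd); apply: filterS (near_in x xr) => z /Lsd[d' [h _]].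
  by exists d'.
- by rewrite (is_derive1E (sder_is_derive sd)).
move=> xi; rewrite hlog; have [w <-] := tvec_surj xi db; rewrite -tvecB// => hx.
have [h _] := normal_chart_tnorm (w - u x) nc db bn''.
have us' : `|u x| < sigma := lt_trans us half_s.
have ws : `|w| < sigma.
  have h2 : Num.sqrt lam * `|w - u x| <= Num.sqrt lam * (sigma / 4).
    apply: (le_trans h); apply: (le_trans hx).
    have -> : Num.sqrt lam * (sigma / 4) = (4 / (Num.sqrt lam * sigma))^-1.
      by rewrite invf_div mulrA.
    by rewrite lef_pV2 ?posrE ?divr_gt0 ?mulr_gt0.
  rewrite (ler_pM2l sl0) in h2; have := ler_distD (u x) w 0; rewrite !subr0 => h3.
  exact: quarter_half h3 h2 us s0.
rewrite (nc_exp nc db bn' ws) -[gamma x](chartK dx) -[chart i (gamma x)]Eu.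
have sp := nc_spath nc (nc_in nc bn' us') (nc_in nc bn' ws).
apply: (le_trans (spath_rdist sp)); rewrite lee_fin.
have h3 := expmap_upper nc bn' ws us'.
apply: (@le_trans _ _ (4 * Num.sqrt Lam / Num.sqrt lam * tnorm (gamma b) (tvec i (gamma b) (w - u x)))).
  apply: (@le_trans _ _ (4 * Num.sqrt Lam / Num.sqrt lam * (Num.sqrt lam * `|w - u x|))).
    have -> : 4 * Num.sqrt Lam / Num.sqrt lam * (Num.sqrt lam * `|w - u x|) = 2 * (Num.sqrt Lam * (2 * `|w - u x|)).
      by field; rewrite gt_eqF.
    by rewrite ler_pM2l// ler_pM2l.
  by rewrite ler_pM2l// divr_gt0// mulr_gt0.
by rewrite ler_wpM2r// tnorm_ge0.
Qed.

(** rho serves both as Lebesgue number and as inverse of the constant. *)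
Lemma log_good_uniform (mumin mumax : R) : compact [set: M] -> 0 < mumin ->
  (forall s, 0 < s -> {for s, continuous gamma} /\
     forall i, dom i (gamma s) -> exists d, sder (chart i \o gamma) s d) ->
  exists rho : R, 0 < rho /\ forall b x, mumin <= b <= mumax -> `|x - b| < rho -> log_good rho^-1 b x.
Proof.
move=> cM m0 Hg.
(* By log_good_le the property is monotone in rho, as compact_uniform requires. *)
have [||rho [rho0 Hrho]] := @compact_uniform R R `[mumin, mumax]
   (fun rho mu => forall b x : R, `|b - mu| < rho -> `|x - mu| < rho -> log_good rho^-1 b x) (@segment_compact _ _ _).
- move=> mu r r' r'0 rr H b x br xr; have r0 : 0 < r by exact: lt_le_trans rr.
  apply: (@log_good_le r^-1); first by rewrite invr_gt0.
    by rewrite lef_pV2.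
  by apply: H; exact: lt_le_trans rr.
- move=> mu /=; rewrite in_itv/= => /andP[mm _]; have mu0 : 0 < mu by exact: lt_le_trans mm.
  have [r [C [r0 C0 H]]] := log_good_local cM mu0 Hg.
  pose rho := Num.min (r / 2) C^-1.
  have rho0 : 0 < rho by rewrite lt_min divr_gt0// invr_gt0.
  exists rho; split => //.
  have r2 : 0 < r / 2 by rewrite divr_gt0.
  apply/(near_ex (fun mu' => forall b x : R, `|b - mu'| < rho -> `|x - mu'| < rho -> log_good rho^-1 b x)).
  exists (r / 2); split => // mu' h b x hb hx.
  have rr : rho <= r / 2 by rewrite ge_min lexx.
  apply: (@log_good_le C) => //; first by rewrite -[C]invrK lef_pV2 ?posrE ?invr_gt0// ge_min lexx orbT.
  apply: H; [have := ler_distD mu' b mu; lra|have := ler_distD mu' x mu; lra].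
exists rho; split => // b x hb hx; apply: (Hrho b) => //.
by rewrite subrr normr0.
Qed.

End LogGood.

(** * Hermite interpolation in a tangent space *)

Lemma hermite_sum {R : realFieldType} (h W eta X1 X2 X3 X4 : R) : X1 <= 1 * (W * h) ->
  h * X2 <= h * (1 * eta) -> h * X3 <= h * (1 * (eta + W)) -> X4 <= W * h -> 0 <= h * eta ->
  X1 + h * X2 + h * X3 + X4 <= 3 * h * (W + eta).
Proof. by move=> *; lra. Qed.

Section TangentNorm.
Context {R : realType} {n : nat} (M : riemannianManifold R n).
Implicit Types (q : M) (u v w : 'rV[R]_n).

Local Notation mx q := (metric (chart_at q) (chart (chart_at q) q)).

Lemma tnorm_CS q u v : gram (mx q) u v <= tnorm q u * tnorm q v.
Proof.
have im := chart_img (mem_chart_at q).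
have Gp w : w != 0 -> 0 < gram (mx q) w w by move=> w0; exact: metric_pos.
have h := gram_CS u v (Defs.metric_sym im) Gp.
rewrite /tnorm -sqrtrM ?metric_gram_ge0//; apply: (le_trans (ler_norm _)).
by rewrite -sqrtr_sqr expr2; exact: ler_wsqrtr.
Qed.

Lemma tnorm_sq q u : tnorm q u * tnorm q u = gram (mx q) u u.
Proof.
by rewrite /tnorm -expr2 sqr_sqrtr// metric_gram_ge0//; exact: chart_img (mem_chart_at q).
Qed.

Lemma tnormD q u v : tnorm q (u + v) <= tnorm q u + tnorm q v.
Proof.
have uv0 : 0 <= tnorm q u + tnorm q v by rewrite addr_ge0 ?tnorm_ge0.
have im := chart_img (mem_chart_at q).
suff : tnorm q (u + v) ^+ 2 <= (tnorm q u + tnorm q v) ^+ 2.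
  by rewrite ler_pXn2r// nnegrE ?tnorm_ge0.
rewrite expr2 tnorm_sq gramDl !gramDr (metric_gram_sym v u im).
have := tnorm_CS q u v; have := tnorm_sq q u; have := tnorm_sq q v.
rewrite expr2; set a := tnorm q u; set b := tnorm q v; set G := gram _ u v => <- <-; lra.
Qed.

Lemma tnormN q u : tnorm q (- u) = tnorm q u.
Proof. by rewrite -scaleN1r tnormZ normrN normr1 mul1r. Qed.

Lemma tnormB q u v : tnorm q (u - v) <= tnorm q u + tnorm q v.
Proof. by rewrite -(tnormN q v); exact: tnormD. Qed.

(** Mean value inequality for the Euclidean norm, by pairing with the increment
    itself. *)
Lemma tnorm_mvt q (D dD : R -> 'rV[R]_n) (a b W : R) : a <= b ->
  (forall s, a <= s <= b -> is_derive s 1 D (dD s)) ->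
  (forall s, a <= s <= b -> tnorm q (dD s) <= W) -> tnorm q (D b - D a) <= W * (b - a).
Proof.
move=> ab HD HW; set z := D b - D a.
have ab0 : 0 <= b - a by rewrite subr_ge0.
have W0 : 0 <= W by apply: le_trans (HW a _); rewrite ?tnorm_ge0// lexx.
have [z0|z0] := eqVneq (tnorm q z) 0; first by rewrite z0 mulr_ge0.
have zp : 0 < tnorm q z by rewrite lt_neqAle eq_sym z0 tnorm_ge0.
have h := @le_of_derive_le R (fun s => gram (mx q) (D s) z) (fun s => gram (mx q) (dD s) z)
  (fun s => W * tnorm q z * s) (fun=> W * tnorm q z) a b ab.
have : gram (mx q) (D b) z - gram (mx q) (D a) z <= W * tnorm q z * b - W * tnorm q z * a.
  apply: h => s sab.
  - have := is_derive_gram (is_derive_cst (mx q) s (1 : R)) (HD s sab) (is_derive_cst z s (1 : R)).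
    have g0 : gram (0 : 'M[R]_n) (D s) z = 0 by rewrite -(scale0r (0 : 'M[R]_n)) gramMZ mul0r.
    by rewrite g0 gram0r add0r addr0.
  - have := is_derive_mul (is_derive_cst (W * tnorm q z) s (1 : R)) (is_derive_id s (1 : R)).
    by rewrite mul0r add0r mulr1.
  - by apply: (le_trans (tnorm_CS q _ _)); rewrite ler_pM2r// HW.
rewrite -gramBl -/z -tnorm_sq -mulrBr => h2.
by rewrite -(ler_pM2r zp) (le_trans h2)// mulrAC.
Qed.

Lemma hermite_left (a b : R) (ya yb va vb : 'rV[R]_n) : hermite a b ya yb va vb a = ya.
Proof. by apply/rowP => k; rewrite /hermite subrr mul0r !mxE; ring. Qed.

Lemma hermite_right (a b : R) (ya yb va vb : 'rV[R]_n) : a < b -> hermite a b ya yb va vb b = yb.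
Proof.
move=> ab; have h : b - a != 0 by rewrite gt_eqF// subr_gt0.
by apply/rowP => k; rewrite /hermite divff// !mxE; ring.
Qed.

Lemma hermite_weights (t : R) : 0 <= t <= 1 ->
  [/\ `|- 2 * t ^+ 3 + 3 * t ^+ 2| <= 1, `|t ^+ 3 - 2 * t ^+ 2 + t| <= 1 & `|t ^+ 3 - t ^+ 2| <= 1].
Proof.
move=> /andP[t0 t1]; have t2 : 0 <= t * t by rewrite mulr_ge0.
have s0 : 0 <= 1 - t by lra.
have s2 : 0 <= (1 - t) * (1 - t) by rewrite mulr_ge0.
have a1 := mulr_ge0 t2 s0; have a2 := mulr_ge0 t0 s2; have a3 := mulr_ge0 t0 t2.
have a4 := mulr_ge0 s0 s2; have a5 := mulr_ge0 t0 s0.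
by split; rewrite ler_norml; apply/andP; split; rewrite !exprS !expr0 !mulr1; lra.
Qed.

(** After subtraction of the affine part, the interpolant combines the value at b
    and the two slopes with weights at most 1, h and h; the value at a is 0. *)
Lemma hermite_close q (G dG : R -> 'rV[R]_n) (a b W eta x : R) vL vR : a < b ->
  (forall s, a <= s <= b -> is_derive s 1 G (dG s)) ->
  (forall s, a <= s <= b -> tnorm q (dG s - dG a) <= W) ->
  tnorm q (vL - dG a) <= eta -> tnorm q (vR - dG b) <= eta -> a <= x <= b ->
  tnorm q (hermite a b (G a) (G b) vL vR x - G x) <= 3 * (b - a) * (W + eta).
Proof.
move=> ab HG HW hL hR /andP[ax xb]; set w := dG a in HW hL.
pose E s := G s - G a - (s - a) *: w.
have h0 : 0 < b - a by rewrite subr_gt0.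
have hn : b - a != 0 by rewrite gt_eqF.
have aa : a <= a <= b by rewrite lexx ltW.
have bb : a <= b <= b by rewrite lexx ltW.
have W0 : 0 <= W by apply: le_trans (HW a aa); exact: tnorm_ge0.
have e0 : 0 <= eta by apply: le_trans hL; exact: tnorm_ge0.
have EW s : a <= s <= b -> tnorm q (E s) <= W * (b - a).
  move=> /andP[as_ sb]; apply: (@le_trans _ _ (W * (s - a))); last by rewrite ler_wpM2l// lerD2r.
  have -> : E s = (G s - s *: w) - (G a - a *: w).
    by rewrite /E scalerBl; apply/rowP => k; rewrite !mxE; ring.
  apply: (@tnorm_mvt q (fun s => G s - s *: w) (fun s => dG s - w)) => // r /andP[r1 r2].
    have hr : a <= r <= b by rewrite r1 (le_trans r2).
    apply: (is_deriveBv (HG r hr)).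
    have := is_derive_affine (0 : 'rV[R]_n) w r.
    by have -> : (fun s : R => 0 + s *: w) = (fun s : R => s *: w) by apply/funext => z; rewrite add0r.
  by apply: HW; rewrite r1 (le_trans r2).
pose t := (x - a) / (b - a).
have t01 : 0 <= t <= 1 by rewrite divr_ge0 ?subr_ge0 ?(ltW ab)//= ler_pdivrMr// mul1r lerD2r.
have [b1 b2 b3] := hermite_weights t01.
(* G = G a + (x - a) w + E, and the interpolant of the affine part is itself. *)
have -> : hermite a b (G a) (G b) vL vR x - G x =
   (- 2 * t ^+ 3 + 3 * t ^+ 2) *: E b + ((b - a) * (t ^+ 3 - 2 * t ^+ 2 + t)) *: (vL - w)
   + ((b - a) * (t ^+ 3 - t ^+ 2)) *: (vR - w) - E x.
  have tx : x - a = (b - a) * t by rewrite /t mulrC divfK.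
  by rewrite /hermite -/t /E tx; apply/rowP => k; rewrite !mxE; ring.
apply: (le_trans (tnormB _ _ _)); apply: (le_trans (lerD (tnormD _ _ _) (lexx _))).
apply: (le_trans (lerD (lerD (tnormD _ _ _) (lexx _)) (lexx _))).
rewrite !tnormZ !normrM (gtr0_norm h0).
have c1 : `|- 2 * t ^+ 3 + 3 * t ^+ 2| * tnorm q (E b) <= 1 * (W * (b - a)).
  by rewrite ler_pM ?tnorm_ge0// EW.
have c2 : `|t ^+ 3 - 2 * t ^+ 2 + t| * tnorm q (vL - w) <= 1 * eta by rewrite ler_pM ?tnorm_ge0.
have c3 : `|t ^+ 3 - t ^+ 2| * tnorm q (vR - w) <= 1 * (eta + W).
  rewrite ler_pM ?tnorm_ge0//; have -> : vR - w = (vR - dG b) + (dG b - w) by rewrite addrA subrK.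
  by apply: (le_trans (tnormD _ _ _)); rewrite lerD// HW.
have c4 : tnorm q (E x) <= W * (b - a) by apply: EW; rewrite ax.
have c5 : (b - a) * (`|t ^+ 3 - 2 * t ^+ 2 + t| * tnorm q (vL - w)) <= (b - a) * (1 * eta) by rewrite ler_pM2l.
have c6 : (b - a) * (`|t ^+ 3 - t ^+ 2| * tnorm q (vR - w)) <= (b - a) * (1 * (eta + W)) by rewrite ler_pM2l.
have c7 : 0 <= (b - a) * eta by rewrite mulr_ge0// ltW.
rewrite -(mulrA (b - a) `|_| (tnorm q (vL - w))) -(mulrA (b - a) `|_| (tnorm q (vR - w))).
exact: (hermite_sum c1 c5 c6 c4 c7).
Qed.

End TangentNorm.

(** * Partitions, pieces and the front *)

Section Partition.
Context {R : realType} (a b : R) (N : nat) (mu : nat -> R).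
Hypothesis part : is_partition a b N mu.

Lemma partition_mono i j : (i <= j)%N -> (j <= N)%N -> mu i <= mu j.
Proof.
have [_ _ H] := part; elim: j => [|j IH]; first by rewrite leqn0 => /eqP->.
rewrite leq_eqVlt ltnS => /orP[/eqP-> //|ij] jN.
by apply: (le_trans (IH ij (ltnW jN))); exact/ltW/H.
Qed.

Lemma partition_in i : (i <= N)%N -> a <= mu i <= b.
Proof.
have [<- <- _] := part => iN.
by rewrite !partition_mono.
Qed.

Lemma mesh_ge i : (i < N)%N -> mu i.+1 - mu i <= mesh N mu.
Proof.
move=> iN; exact: (le_bigmax _ (fun i : 'I_N => mu i.+1 - mu i) (Ordinal iN)).
Qed.

Lemma mesh_ge0 : 0 <= mesh N mu.
Proof. by apply: (big_ind (fun x => 0 <= x)) => // [x y x0 y0|i _]; [rewrite le_max x0|have [_ _ H] := part; rewrite subr_ge0 ltW// H]. Qed.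

Lemma find_piece x : a < b -> a <= x <= b -> let k := find (fun i => x <= mu i.+1) (iota 0 N) in
  (k < N)%N /\ x \in `[mu k, mu k.+1].
Proof.
have [ma mb H] := part => ab /andP[ax xb] k.
have N0 : (0 < N)%N.
  by rewrite lt0n; apply: contraTneq ab => N0; rewrite -ma -mb N0 ltxx.
have hk : has (fun i => x <= mu i.+1) (iota 0 N).
  apply/hasP; exists N.-1; first by rewrite mem_iota add0n prednK// leqnn.
  by rewrite prednK// mb.
have kN : (k < N)%N by move: hk; rewrite has_find size_iota.
split => //; rewrite in_itv/=; apply/andP; split.
  have [->|k0] := posnP k; first by rewrite ma.
  have k1 : (k.-1 < k)%N by rewrite prednK.
  have := before_find 0%N k1; rewrite nth_iota ?(leq_trans k1 (ltnW kN))// add0n prednK// => /negbT.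
  by rewrite -ltNge => /ltW.
by have := nth_find 0%N hk; rewrite -/k nth_iota// add0n.
Qed.

(** At a node two pieces are candidates; interpolant takes the left one, whose value
    is the same. *)
Lemma find_piece_le i x : (i < N)%N -> x \in `[mu i, mu i.+1] ->
  let k := find (fun i => x <= mu i.+1) (iota 0 N) in (k < N)%N /\ (k = i \/ x = mu k.+1 /\ x = mu i).
Proof.
move=> iN + k; rewrite in_itv/= => /andP[ix xi].
have hk : has (fun i => x <= mu i.+1) (iota 0 N).
  by apply/hasP; exists i => //; rewrite mem_iota add0n iN.
have kN : (k < N)%N by move: hk; rewrite has_find size_iota.
split => //; have ki : (k <= i)%N.
  rewrite leqNgt; apply/negP => ik; have := before_find 0%N ik.
  by rewrite nth_iota// add0n xi.
move: ki; rewrite leq_eqVlt => /orP[/eqP->|ki]; [by left|right].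
have xk : x <= mu k.+1 by have := nth_find 0%N hk; rewrite -/k nth_iota// add0n.
have kmi := partition_mono ki (ltnW iN).
split; apply: le_anti; first by rewrite xk (le_trans kmi ix).
by rewrite ix (le_trans xk kmi).
Qed.

End Partition.

Section Pieces.
Context {R : realType} {n : nat} (M : riemannianManifold R n).
Variables (gamma : R -> M) (a b C : R) (N : nat) (mu : nat -> R).
Hypothesis part : is_partition a b N mu.
Hypothesis C0 : 0 < C.
Hypothesis good : forall i x, (i < N)%N -> x \in `[mu i, mu i.+1] -> log_good gamma C (mu i.+1) x.

Lemma mem_left i : (i < N)%N -> mu i \in `[mu i, mu i.+1].
Proof. by have [_ _ H] := part => iN; rewrite in_itv/= lexx ltW// H. Qed.

Lemma mem_right i : (i < N)%N -> mu i.+1 \in `[mu i, mu i.+1].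
Proof. by have [_ _ H] := part => iN; rewrite in_itv/= lexx andbT ltW// H. Qed.

Lemma lift_curveE i : lift_curve gamma mu i = log_curve gamma (mu i.+1). Proof. by []. Qed.

Lemma pieces_lifted : well_lifted gamma N mu.
Proof.
move=> i iN; split.
- by move=> x xi; have [h1 h2 _ _ _ _] := good iN xi.
- by move=> x xi; exact: lg_der (good iN xi).
- apply: continuous_in_subspaceT => x /set_mem xi; exact: lg_cont (good iN xi).
Qed.

Lemma lift_derivative_bound i x y : (i < N)%N -> x \in `[mu i, mu i.+1] -> y \in `[mu i, mu i.+1] ->
  tnorm (base gamma mu i) (derive1 (lift_curve gamma mu i) x - derive1 (lift_curve gamma mu i) y) <= 2 * C.
Proof.
move=> iN xi yi; rewrite (lift_curveE i) /base; apply: (le_trans (tnormB _ _ _)).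
have -> : 2 * C = C + C by ring.
exact: (lerD (lg_bound (good iN xi)) (lg_bound (good iN yi))).
Qed.

(** The supremum is finite because the derivatives are bounded by C. *)
Lemma omega_ge i x y t : (i < N)%N -> x \in `[mu i, mu i.+1] -> y \in `[mu i, mu i.+1] ->
  `|x - y| <= t ->
  tnorm (base gamma mu i) (derive1 (lift_curve gamma mu i) x - derive1 (lift_curve gamma mu i) y)
   <= omega gamma N mu t.
Proof.
move=> iN xi yi xy; apply: le_trans (le_bigmax _ _ (Ordinal iN)) => /=.
apply: ub_le_sup; last by exists x, y.
by exists (2 * C) => _ [x' [y' [h1 h2 _ ->]]]; exact: lift_derivative_bound.
Qed.

Lemma omega_le t : 0 <= t -> omega gamma N mu t <= 2 * C.
Proof.
move=> t0; apply: bigmax_le => [|i _]; first by rewrite mulr_ge0// ltW.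
apply: ge_sup.
  have iN := ltn_ord i; eexists; exists (mu i), (mu i).
  by split; [exact: mem_left|exact: mem_left|rewrite subrr normr0|reflexivity].
by move=> _ [x' [y' [h1 h2 _ ->]]]; exact: lift_derivative_bound.
Qed.

Lemma omega_ge0 t : 0 <= omega gamma N mu t.
Proof.
apply: (big_ind (fun x => 0 <= x)) => // [x y x0 y0|i _]; first by rewrite le_max x0.
set A := (X in sup X); have [hs|/sup_out-> //] := pselect (has_sup A).
have [z Az] := hs.1; apply: le_trans (sup_upper_bound hs Az).
by have [x [y [_ _ _ ->]]] := Az; exact: tnorm_ge0.
Qed.

Lemma Exp_lift i x : (i < N)%N -> x \in `[mu i, mu i.+1] ->
  Exp (base gamma mu i) (lift_curve gamma mu i x) = gamma x.
Proof.
move=> iN xi; have [xi0 [[h1 h2] _]] := lg_uniq (good iN xi).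
rewrite /lift_curve /base /Log; case: xgetP => [z _ [_ //]|/(_ xi0)].
by move=> H; exfalso; apply: H.
Qed.

Variables (vL vR : nat -> 'rV[R]_n).

Lemma piece_left i : (i < N)%N -> interpolant_piece gamma mu vL vR i (mu i) = gamma (mu i).
Proof. by move=> iN; rewrite /interpolant_piece hermite_left Exp_lift// mem_left. Qed.

Lemma piece_right i : (i < N)%N -> interpolant_piece gamma mu vL vR i (mu i.+1) = gamma (mu i.+1).
Proof.
move=> iN; have [_ _ H] := part.
by rewrite /interpolant_piece hermite_right ?H// Exp_lift// mem_right.
Qed.

Lemma pieces_concatenated : well_concatenated gamma N mu vL vR.
Proof.
move=> i x iN xi; have [kN [|[x1 x2]]] := find_piece_le part iN xi.
  by rewrite /interpolant => ->.
rewrite /interpolant; set k := find _ _ in kN x1 *.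
by rewrite {1}x1 piece_right// -x1 x2 piece_left.
Qed.

Lemma piece_close eta i x : (i < N)%N -> x \in `[mu i, mu i.+1] -> 0 <= eta ->
  velocity_data gamma N mu eta vL vR ->
  3 * mesh N mu * (omega gamma N mu (mesh N mu) + eta) <= C^-1 ->
  (rdist (gamma x) (interpolant_piece gamma mu vL vR i x)
    <= (C * (3 * mesh N mu * (omega gamma N mu (mesh N mu) + eta)))%:E)%E.
Proof.
move=> iN xi e0 vd small; have [_ _ H] := part; have [h1 h2] := vd i iN.
have hm := mesh_ge mu iN.
have h : tnorm (base gamma mu i) (hermite (mu i) (mu i.+1) (lift_curve gamma mu i (mu i))
    (lift_curve gamma mu i (mu i.+1)) (vL i) (vR i) x - lift_curve gamma mu i x)
    <= 3 * (mu i.+1 - mu i) * (omega gamma N mu (mesh N mu) + eta).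
  have HG s : mu i <= s <= mu i.+1 -> is_derive s 1 (lift_curve gamma mu i) (derive1 (lift_curve gamma mu i) s).
    move=> si; apply: derivable_is_derive1; rewrite lift_curveE; apply: lg_der; apply: (good iN).
    by rewrite in_itv.
  have HW s : mu i <= s <= mu i.+1 -> tnorm (base gamma mu i)
      (derive1 (lift_curve gamma mu i) s - derive1 (lift_curve gamma mu i) (mu i)) <= omega gamma N mu (mesh N mu).
    move=> si; apply: (omega_ge iN); [by rewrite in_itv|exact: mem_left|].
    move/andP: si => [s1 s2]; rewrite ger0_norm ?subr_ge0//; apply: le_trans hm.
    by rewrite lerD2r.
  have xi' : mu i <= x <= mu i.+1 by move: xi; rewrite in_itv.
  exact: (hermite_close (H i iN) HG HW h1 h2 xi').
have le1 : 3 * (mu i.+1 - mu i) * (omega gamma N mu (mesh N mu) + eta)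
   <= 3 * mesh N mu * (omega gamma N mu (mesh N mu) + eta).
  by rewrite ler_wpM2r ?addr_ge0 ?omega_ge0// ler_pM2l.
have {le1}h := le_trans h le1.
rewrite lift_curveE /base in h; rewrite /interpolant_piece.
apply: (le_trans (lg_dist (good iN xi) (le_trans h small))).
by rewrite lee_fin ler_pM2l.
Qed.

End Pieces.

(** The two errors are at most L1 D and L2 D. *)
Lemma front_point (R : realType) (n : nat) (M : riemannianManifold R n) (f1 f2 : M -> R) (L1 L2 D : R) x y :
  0 < L1 -> 0 < L2 -> 0 <= D -> riemannian_lipschitz L1 f1 -> riemannian_lipschitz L2 f2 ->
  (rdist x y <= D%:E)%E ->
  Num.sqrt ((f1 x - f1 y) ^+ 2 + (f2 x - f2 y) ^+ 2) <= Num.sqrt (L1 ^+ 2 + L2 ^+ 2) * D.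
Proof.
move=> l1 l2 D0 h1 h2 hD.
have H L f : 0 < L -> riemannian_lipschitz L f -> (f x - f y) ^+ 2 <= L ^+ 2 * D ^+ 2.
  move=> L0 hf; have : (`|f x - f y|%:E <= (L * D)%:E)%E.
    by apply: (le_trans (hf x y)); rewrite EFinM lee_wpmul2l// lee_fin ltW.
  rewrite lee_fin => k; rewrite -exprMn -[leLHS]real_normK ?num_real//.
  by rewrite ler_pXn2r// nnegrE ?mulr_ge0// ltW.
have {1}-> : D = Num.sqrt (D ^+ 2) by rewrite sqrtr_sqr ger0_norm.
rewrite -sqrtrM; last by rewrite addr_ge0// sqr_ge0.
by apply: ler_wsqrtr; rewrite mulrDl lerD// H.
Qed.

Theorem theorem2 (R : realType) (n : nat) (M : riemannianManifold R n)
    (f1 f2 : M -> R) (gamma : R -> M) (L1 L2 mumin mumax : R)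
    (M_compact : compact [set: M])
    (f1_C2 : C2_function f1) (f2_C2 : C2_function f2)
    (gammaP : forall mu, 0 < mu ->
       argmin (scalarization f1 f2 mu) = [set gamma mu])
    (hess_inv : forall mu, 0 < mu ->
       bijective (hessian (scalarization f1 f2 mu) (gamma mu)))
    (L1_gt0 : 0 < L1) (L2_gt0 : 0 < L2)
    (f1_lip : riemannian_lipschitz L1 f1)
    (f2_lip : riemannian_lipschitz L2 f2)
    (mumin_gt0 : 0 < mumin) (mumin_lt : mumin < mumax) :
  exists delta eta0 C : R,
    [/\ 0 < delta, 0 < eta0 & 0 < C] /\
    (forall (N : nat) (mu : nat -> R),
       is_partition mumin mumax N mu -> mesh N mu <= delta ->
       well_lifted gamma N mu /\
       forall (eta : R) (vL vR : nat -> 'rV[R]_n),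
         0 <= eta <= eta0 -> velocity_data gamma N mu eta vL vR ->
         well_concatenated gamma N mu vL vR /\
         (front_error f1 f2 gamma (interpolant gamma N mu vL vR) mumin mumax
          <= (Num.sqrt (L1 ^+ 2 + L2 ^+ 2) *
              (C * (mesh N mu * omega gamma N mu (mesh N mu)
                    + eta * mesh N mu)))%:E)%E) /\
    (forall eps : R, 0 < eps ->
       exists delta' : R, 0 < delta' /\
       forall (N : nat) (mu : nat -> R),
         is_partition mumin mumax N mu -> mesh N mu <= delta' ->
         forall (eta : R) (vL vR : nat -> 'rV[R]_n),
           0 <= eta <= eta0 -> velocity_data gamma N mu eta vL vR ->
           (front_error f1 f2 gamma (interpolant gamma N mu vL vR) mumin mumax
            <= eps%:E)%E).
Proof.
have Hg := gamma_sder M_compact f1_C2 f2_C2 gammaP hess_inv.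
have [rho [rho0 Hrho]] := log_good_uniform mumax M_compact mumin_gt0 Hg.
pose C0 := rho^-1; have C00 : 0 < C0 by rewrite invr_gt0.
pose K := 2 * C0 + 1; have K0 : 0 < K by rewrite /K; lra.
(* The first bound makes every base point and parameter of a piece close enough
   for log_good_uniform; the second one makes 3 delta K at most 1 / C0, the radius
   in which Exp is controlled, where K bounds omega + eta. *)
pose delta := Num.min (rho / 2) (3 * C0 * K)^-1.
have delta0 : 0 < delta by rewrite lt_min divr_gt0// invr_gt0 !mulr_gt0.
pose S := Num.sqrt (L1 ^+ 2 + L2 ^+ 2).
have S0 : 0 <= S by exact: sqrtr_ge0.
have good N mu : is_partition mumin mumax N mu -> mesh N mu <= delta ->
    forall i x, (i < N)%N -> x \in `[mu i, mu i.+1] -> log_good gamma C0 (mu i.+1) x.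
  move=> part hm i x iN; rewrite in_itv/= => /andP[x1 x2]; apply: Hrho; first exact: (partition_in part iN).
  have h1 := mesh_ge mu iN.
  have h2 : delta <= rho / 2 by rewrite ge_min lexx.
  rewrite ler0_norm ?subr_le0// opprB; apply: (@le_lt_trans _ _ (rho / 2)); last by lra.
  by apply: le_trans h2; apply: le_trans hm; apply: le_trans h1; rewrite lerD2l lerN2.
have total N mu eta : is_partition mumin mumax N mu -> mesh N mu <= delta -> 0 <= eta <= 1 ->
    omega gamma N mu (mesh N mu) + eta <= K.
  move=> part hm /andP[e0 e1]; rewrite /K lerD//.
  exact: (omega_le part C00 (good N mu part hm) (mesh_ge0 part)).
have front N mu eta vL vR : is_partition mumin mumax N mu -> mesh N mu <= delta -> 0 <= eta <= 1 ->
    velocity_data gamma N mu eta vL vR ->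
    (front_error f1 f2 gamma (interpolant gamma N mu vL vR) mumin mumax
      <= (S * (3 * C0 * (mesh N mu * omega gamma N mu (mesh N mu) + eta * mesh N mu)))%:E)%E.
  move=> part hm e01 vd; have /andP[e0 e1] := e01; have gd := good N mu part hm.
  have m0 := mesh_ge0 part.
  apply: ge_ereal_sup => _ [x + <-]; rewrite /= in_itv/= => xab; rewrite lee_fin.
  have [kN xk] := find_piece part mumin_lt xab.
  set k := find _ _ in kN xk.
  rewrite (pieces_concatenated part gd vL vR kN xk).
  have W0 := omega_ge0 gamma N mu (mesh N mu).
  have hK := total N mu eta part hm e01.
  set W := omega gamma N mu (mesh N mu) in W0 hK *.
  have small : 3 * mesh N mu * (W + eta) <= C0^-1.
    apply: (@le_trans _ _ (3 * delta * K)).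
      by apply: ler_pM => //; rewrite ?mulr_ge0 ?addr_ge0// ler_pM2l.
    apply: (@le_trans _ _ (3 * (3 * C0 * K)^-1 * K)).
      by rewrite ler_pM2r// ler_pM2l// ge_min lexx orbT.
    by rewrite le_eqVlt; apply/orP; left; apply/eqP; field; rewrite !gt_eqF.
  have := piece_close part C00 gd kN xk e0 vd small.
  have -> : C0 * (3 * mesh N mu * (W + eta)) = 3 * C0 * (mesh N mu * W + eta * mesh N mu) by ring.
  apply: (front_point L1_gt0 L2_gt0 _ f1_lip f2_lip).
  by rewrite !mulr_ge0 ?addr_ge0 ?mulr_ge0 ?(ltW C00).
exists delta, 1, (3 * C0); split; first by split => //; rewrite mulr_gt0.
split.
  move=> N mu part hm; have gd := good N mu part hm; split; first exact: (pieces_lifted gd).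
  move=> eta vL vR e01 vd; split; first exact: (pieces_concatenated part gd vL vR).
  exact: front.
move=> eps eps0.
have B0 : 0 < S * (3 * C0 * K) + 1 by rewrite ltr_wpDl// !mulr_ge0// ltW.
exists (Num.min delta (eps / (S * (3 * C0 * K) + 1))).
split; first by rewrite lt_min delta0 divr_gt0.
move=> N mu part; rewrite le_min => /andP[hm hm2] eta vL vR e01 vd.
apply: (le_trans (front N mu eta vL vR part hm e01 vd)); rewrite lee_fin.
have m0 := mesh_ge0 part; have hK := total N mu eta part hm e01.
have -> : S * (3 * C0 * (mesh N mu * omega gamma N mu (mesh N mu) + eta * mesh N mu)) =
  S * (3 * C0 * (omega gamma N mu (mesh N mu) + eta)) * mesh N mu by ring.
rewrite ler_pdivlMr// in hm2; apply: le_trans hm2; rewrite mulrC; apply: ler_wpM2l => //.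
apply: (@le_trans _ _ (S * (3 * C0 * K))); last by rewrite lerDl.
by rewrite ler_wpM2l// ler_pM2l ?mulr_gt0.
Qed.
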